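(* For $b\in(0,1)$ let $f(b)=\frac12\lim_{R\to\infty}\frac{e_{\rm p}(b,R)}{R^2}$, with $e_{\rm p}(b,R)$ as defined in the context. Then, as $b\to0_+$, $$f(b)=\frac{b}{2}\ln\frac{1}{\sqrt b}\,\big(1+o(1)\big).$$
   Context: Let $\mathbf A_0(x_1,x_2)=\frac12(-x_2,x_1)$ on $\mathbb{R}^2$. For $R>0$ let $K_R=(-R/2,R/2)\times(-R/2,R/2)$ and $$E_R=\{u\in H^1_{\rm loc}(\mathbb{R}^2;\mathbb{C}):\ u(x_1+R,x_2)=e^{iRx_2/2}u(x_1,x_2),\ u(x_1,x_2+R)=e^{-iRx_1/2}u(x_1,x_2)\}.$$ For $b\in(0,1)$ and $u\in E_R$, let $F_{K_R}(u)=\int_{K_R}\big(b|(\nabla-i\mathbf A_0)u|^2+\frac12(1-|u|^2)^2\big)dx$ and $e_{\rm p}(b,R)=\inf\{F_{K_R}(u):u\in E_R\}$. It is known (from prior work) that for every $b\in(0,1)$ the limit $\lim_{R\to\infty}e_{\rm p}(b,R)/R^2$ exists, so $f(b)$ is well defined.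
   Formalization: The limit R→∞ defining f(b) is taken along R with R² in 2πℕ, since for other R the two periodicity conditions force u=0, so e_p(b,R)/R²=1/2 and the limit over all R>0 does not exist for small b. *)

(* Defs.v *)
From HB Require Import structures.
From mathcomp Require Import all_boot all_order all_algebra.
From mathcomp Require Import all_classical all_reals all_analysis.
Set Implicit Arguments. Unset Strict Implicit. Unset Printing Implicit Defensive.
Import Order.TTheory GRing.Theory Num.Theory.
Import numFieldNormedType.Exports.
Local Open Scope classical_set_scope.
Local Open Scope ring_scope.

Section GL.
Variable R : realType.

Definition leb2 := ((@lebesgue_measure R) \x (@lebesgue_measure R))%E.

Definition partial1 (phi : R * R -> R) (x : R * R) : R :=
  derive1 (fun t => phi (t, x.2)) x.1.
Definition partial2 (phi : R * R -> R) (x : R * R) : R :=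
  derive1 (fun t => phi (x.1, t)) x.2.
Definition partial (j : bool) := if j then partial2 else partial1.

Definition test_fun (phi : R * R -> R) : Prop :=
  continuous phi /\
  (forall x, derivable (fun t => phi (t, x.2)) x.1 1) /\
  (forall x, derivable (fun t => phi (x.1, t)) x.2 1) /\
  continuous (partial1 phi) /\ continuous (partial2 phi) /\
  exists M : R, forall x, M < `|x.1| \/ M < `|x.2| -> phi x = 0.

Definition box (M : R) : set (R * R) := `[- M, M] `*` `[- M, M].

Definition L2loc (v : R * R -> R) : Prop :=
  measurable_fun setT v /\
  forall M : R, (\int[leb2]_(x in box M) ((v x) ^+ 2)%:E < +oo)%E.

Definition weak_deriv (j : bool) (v g : R * R -> R) : Prop :=
  forall phi, test_fun phi ->
    (\int[leb2]_x (v x * partial j phi x)%:E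
     = - \int[leb2]_x (g x * phi x)%:E)%E.

(* u = u1 + i u2 is in H^1_loc(R^2; C), with weak gradient
   g j k = d_j u_k  (j = false: x1, true: x2; k = false: u1, true: u2). *)
Definition H1loc_grad (u : bool -> R * R -> R) (g : bool -> bool -> R * R -> R)
  : Prop :=
  (forall k, L2loc (u k)) /\ (forall j k, L2loc (g j k)) /\
  (forall j k, weak_deriv j (u k) (g j k)).

Definition A0 (j : bool) (x : R * R) : R :=
  if j then x.1 / 2 else - x.2 / 2.

(* Magnetic periodicity conditions defining E_R, with u = u1 + i u2:
   u(x1+R,x2) = e^{i R x2/2} u(x1,x2), u(x1,x2+R) = e^{-i R x1/2} u(x1,x2). *)
Definition in_ER (L : R) (u : bool -> R * R -> R) : Prop :=
  (forall x : R * R, let th := L * x.2 / 2 in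
     u false (x.1 + L, x.2) = cos th * u false x - sin th * u true x /\
     u true  (x.1 + L, x.2) = sin th * u false x + cos th * u true x) /\
  (forall x : R * R, let th := - (L * x.1 / 2) in
     u false (x.1, x.2 + L) = cos th * u false x - sin th * u true x /\
     u true  (x.1, x.2 + L) = sin th * u false x + cos th * u true x).

Definition KR (L : R) : set (R * R) := `]- (L / 2), L / 2[ `*` `]- (L / 2), L / 2[.

(* Energy density: b |(nabla - i A0) u|^2 + 1/2 (1 - |u|^2)^2, where
   (d_j - i A_j)(u1 + i u2) = (d_j u1 + A_j u2) + i (d_j u2 - A_j u1). *)
Definition GL_density (b : R) (u : bool -> R * R -> R)
  (g : bool -> bool -> R * R -> R) (x : R * R) : R :=
  b * (\sum_(j : bool) ((g j false x + A0 j x * u true x) ^+ 2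
                        + (g j true x - A0 j x * u false x) ^+ 2))
  + 2^-1 * (1 - (u false x ^+ 2 + u true x ^+ 2)) ^+ 2.

Definition FKR (b L : R) u g : \bar R :=
  (\int[leb2]_(x in KR L) (GL_density b u g x)%:E)%E.

Definition ep (b L : R) : \bar R :=
  ereal_inf [set e | exists u g, H1loc_grad u g /\ in_ER L u /\ e = FKR b L u g].

(* Admissible periods: R_n = sqrt(2 pi n) (flux quantization R^2 in 2 pi N). *)
Definition Rn (n : nat) : R := Num.sqrt (2 * pi * n%:R).

Definition fGL (b : R) : R :=
  2^-1 * lim ((fun n : nat => fine (ep b (Rn n)) / (Rn n) ^+ 2) @ \oo).

End GL.

(* Main.v *)
(** Lower bound: averaging over translates of a square lattice of small mesh
    turns the energy of [u] into a discrete energy of the phase differences along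
    the edges, whose discrete curl is [2 pi d - F], with [d] the integer vortex
    charge and [F] the flux per cell.  Pairing this identity with a function [v]
    built from a truncated logarithmic kernel [K] gives a lower bound
    [4 pi sum d v - |grad v|^2] for the energy, and [v] can be chosen so that this
    is essentially [2 pi K(0)] times the total charge, which the flux prescribes.
    Such a [v] exists because the property [charge_kernel], trivial for the
    constant kernel as [|D| <= D^2] for integers, passes to sums, limits and
    random cuts, hence to [exp (- t |x - y|)] and to [K].
    Upper bound: the limit over [R] is at most the energy per area of the cell of
    flux [2 pi], tested on [f / sqrt (|f|^2 + b)] with [f] a quasi-periodic
    function having a single zero per cell. *)
From HB Require Import structures.
From mathcomp Require Import all_boot all_order all_algebra.
From mathcomp Require Import boolp classical_sets reals topology normedtype sequences realfun exp trigo derive.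
From mathcomp Require Import ring lra zify.
Import Order.TTheory GRing.Theory Num.Theory.
Import numFieldNormedType.Exports.
Local Open Scope classical_set_scope.
Local Open Scope ring_scope.
Set Implicit Arguments. Unset Strict Implicit. Unset Printing Implicit Defensive.

(** An edge pays for its phase increment like a square only while the increment is small, since the
    cosine saturates. The energy can thus be tested only against fields [g] of small size, and a
    mere lower bound for the interaction of the charges would not do: one needs a potential with
    small increments together with its dual value. This is why [charge_kernel] speaks of [Psi] and
    [s] rather than of a quadratic form. The sharp constant requires a kernel as close as possible
    to the lattice Green function, hence an isotropic one, and this forces the passage from cuts
    along lines to the Euclidean distance. Scales: the mesh is of order sqrt b and the logarithm is
    cut at a constant times [Q] mesh steps, with [Q] slightly below b to the power -1/2. The cut
    then lies below the distance of order 1 between vortices, so the uniform background flux costs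
    little, while [ln Q] is still nearly ln (1 / sqrt b). In the upper bound, dividing by the
    modulus removes its derivative, which is half of the kinetic energy near the zero; without this
    gain the constant would double. *)

Section elementary_inequalities.
Variable R : realType.

(** Each Taylor bound below is the preceding one integrated from 0, which avoids any use of the
    power series. *)
Lemma ge0_of_derive (f f' : R -> R) :
  (forall x : R, is_derive x (1 : R) f (f' x)) -> (forall x : R, 0 <= x -> 0 <= f' x) ->
  f 0 = 0 -> forall x, 0 <= x -> 0 <= f x.
Proof.
move=> df f'0 f0 x x0; rewrite -f0.
have cf : continuous f.
  by move=> y; apply/differentiable_continuous/derivable1_diffP; have [] := df y.
apply: (@ger0_derive1_ndecr _ f 0 x) => //.
- move=> y; rewrite in_itv/= => /andP[y0 _].
  by rewrite derive1E; have [_ ->] := df y; rewrite f'0// ltW.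
- exact: continuous_subspaceT.
Qed.

Lemma sin_le_id (x : R) : 0 <= x -> sin x <= x.
Proof.
move=> x0; rewrite -subr_ge0.
apply: (@ge0_of_derive (fun x => x - sin x) (fun x => 1 - cos x)) => //.
- by move=> y _; rewrite subr_ge0 cos_le1.
- by rewrite sin0 subr0.
Qed.

Lemma cos_ge1Bsqr (x : R) : 1 - x ^+ 2 / 2 <= cos x.
Proof.
wlog x0 : x / 0 <= x.
  by move=> H; have [/H//|x0] := leP 0 x; rewrite -cosN -sqrrN H//; lra.
suff : 0 <= cos x - 1 + x ^+ 2 / 2 by lra.
apply: (@ge0_of_derive (fun x => cos x - 1 + x ^+ 2 / 2) (fun x => x - sin x)) => //.
- by move=> y; apply: is_derive_eq; rewrite /GRing.scale/=; field.
- by move=> y y0; rewrite subr_ge0 sin_le_id.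
- by rewrite cos0 expr0n/= mul0r; ring.
Qed.

Lemma sin_ge_cubic (x : R) : 0 <= x -> x - x ^+ 3 / 6 <= sin x.
Proof.
move=> x0; suff : 0 <= sin x - x + x ^+ 3 / 6 by lra.
apply: (@ge0_of_derive (fun x => sin x - x + x ^+ 3 / 6) (fun x => cos x - 1 + x ^+ 2 / 2)) => //.
- by move=> y; apply: is_derive_eq; rewrite /GRing.scale/=; field.
- by move=> y y0; have := cos_ge1Bsqr y; lra.
- by rewrite sin0 expr0n/= mul0r; ring.
Qed.

Lemma cos_le_quartic (x : R) : cos x <= 1 - x ^+ 2 / 2 + x ^+ 4 / 24.
Proof.
wlog x0 : x / 0 <= x.
  move=> H; have [/H//|x0] := leP 0 x.
  have -> : x ^+ 4 = (- x) ^+ 4 by ring.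
  by rewrite -cosN -(sqrrN x) H//; lra.
suff : 0 <= 1 - x ^+ 2 / 2 + x ^+ 4 / 24 - cos x by lra.
apply: (@ge0_of_derive (fun x => 1 - x ^+ 2 / 2 + x ^+ 4 / 24 - cos x)
  (fun x => sin x - x + x ^+ 3 / 6)) => //.
- by move=> y; apply: is_derive_eq; rewrite /GRing.scale/=; field.
- by move=> y y0; have := sin_ge_cubic y0; lra.
- by rewrite cos0 !expr0n/= !mul0r; ring.
Qed.

(** Otherwise [17 / 10] would not exceed [pi / 2] and its cosine would be nonnegative, against the
    quartic bound. *)
Lemma pi_lt_34 : (pi : R) < 34 / 10.
Proof.
rewrite ltNge; apply/negP => h; have : 0 <= cos (17 / 10 : R).
  by apply: cos_ge0_pihalf; apply/andP; split; have := pi_gt0 R; lra.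
have := cos_le_quartic (17 / 10); lra.
Qed.

Lemma le_cos (x y : R) : 0 <= x -> x <= y -> y <= pi -> cos y <= cos x.
Proof.
move=> x0; rewrite le_eqVlt => /predU1P[->//|xy ypi].
by rewrite ltW// ltr_cos// in_itv/=; apply/andP; split => //; lra.
Qed.

Lemma ln_ge1BV (x : R) : 0 < x -> 1 - x^-1 <= ln x.
Proof.
move=> x0; have : ln x^-1 <= x^-1 - 1 by rewrite -[X in _ <= X - _]lnK ?posrE ?invr_gt0//; have := expR_ge1Dx (ln x^-1); lra.
by rewrite lnV ?posrE//; lra.
Qed.

Lemma ln_leB1 (x : R) : 0 < x -> ln x <= x - 1.
Proof.
by move=> x0; have := expR_ge1Dx (ln x); rewrite lnK ?posrE//; lra.
Qed.

End elementary_inequalities.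

(** * Kernels whose energy dominates the total charge, in dual form *)

Section charge_kernels.
Variable R : realType.
Implicit Type X : finType.

Definition quadf X (K : X -> X -> R) (f : X -> R) : R :=
  \sum_x \sum_y f x * f y * K x y.

Definition norm1 X (f : X -> R) : R := \sum_x `|f x|.

(** By the second clause [s] is, up to [eta], at least the value at [Psi] of the form dual to
    [quadf K]. For [f] equal to [d] the first two clauses give [m * |sum d| <= quadf K d], which is
    |D| <= D^2 for the constant kernel. The other clauses are what a test function needs: small
    increments where [K] is close to [m], a uniform bound, and an l^1 norm controlled by the number
    of charges. The slack [eta] lets the property survive uniform limits. *)
Definition charge_kernel X (K : X -> X -> R) (m : R) : Prop :=
  forall eta : R, 0 < eta -> forall d : X -> int, exists (Psi : X -> R) (s : R),
  [/\ m * `|\sum_x (d x)%:~R| <= 2 * (\sum_x (d x)%:~R * Psi x) - s,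
      forall f : X -> R,
        2 * (\sum_x f x * Psi x) - quadf K f <= s + eta * norm1 f ^+ 2,
      forall x y, `|Psi x - Psi y| <= 2 * (m - K x y) + eta,
      forall x, `|Psi x| <= m &
      forall x, `|Psi x| <= \sum_y K x y * `|(d y)%:~R| + eta].

Lemma norm1_ge0 X (f : X -> R) : 0 <= norm1 f.
Proof. exact: sumr_ge0. Qed.

(** For zero charges the first clause gives [s <= 0]; the second one, for [f] and for its opposite,
    then bounds [- quadf K f] by [eta * norm1 f ^+ 2] with [eta] arbitrary. *)
Lemma charge_kernel_psd X (K : X -> X -> R) m (f : X -> R) :
  charge_kernel K m -> 0 <= quadf K f.
Proof.
move=> gK; rewrite leNgt; apply/negP => q0.
pose eta : R := - quadf K f / (norm1 f ^+ 2 + 1) / 2.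
have n1 : 0 < norm1 f ^+ 2 + 1 by have := sqr_ge0 (norm1 f); lra.
have eta0 : 0 < eta by rewrite /eta divr_gt0// divr_gt0// oppr_gt0.
have [Psi [s [ha hb _ _ _]]] := gK _ eta0 (fun=> 0).
have s0 : s <= 0.
  move: ha; rewrite big1// [X in 2 * X]big1 => [|x _]; last by rewrite mul0r.
  by rewrite normr0; lra.
have := hb f; have := hb (fun x => - f x).
have -> : quadf K (fun x => - f x) = quadf K f.
  by apply: eq_bigr => x _; apply: eq_bigr => y _; rewrite mulrNN.
have -> : norm1 (fun x => - f x) = norm1 f.
  by apply: eq_bigr => x _; rewrite normrN.
have -> : \sum_x - f x * Psi x = - \sum_x f x * Psi x.
  by rewrite -sumrN; apply: eq_bigr => x _; rewrite mulNr.
have : eta * (norm1 f ^+ 2 + 1) * 2 = - quadf K f.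
  by rewrite /eta; field; rewrite gt_eqF.
nra.
Qed.

Lemma charge_kernel0 X : charge_kernel (fun _ _ : X => 0) 0.
Proof.
move=> eta eta0 d; exists (fun=> 0), 0; split.
- by rewrite mul0r big1 ?mulr0 ?subr0// => x _; rewrite mulr0.
- move=> f; rewrite /quadf (eq_bigr (fun=> 0)) => [|x _]; last by rewrite mulr0.
  rewrite big1// [X in _ - X]big1 => [|x _]; last by rewrite big1// => y _; rewrite mulr0.
  by rewrite mulr0 subr0 add0r mulr_ge0 ?sqr_ge0 ?ltW.
- by move=> x y; rewrite !subr0 normr0 mulr0 add0r ltW.
- by move=> x; rewrite normr0.
- by move=> x; rewrite normr0 big1 ?add0r ?ltW// => y _; rewrite mul0r.
Qed.

(** The constant potential [sgz D] reduces the first clause to [|D| <= 2 * |D| - 1] for a nonzero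
    integer [D]: in the theory of kernels this is where the integrality of the charges enters. *)
Lemma charge_kernel_sgn X : charge_kernel (fun _ _ : X => 1) 1.
Proof.
move=> eta eta0 d; set D : int := \sum_x d x.
have DE : \sum_x (d x)%:~R = D%:~R :> R by rewrite /D rmorph_sum.
have qE f : quadf (fun _ _ : X => 1) f = (\sum_x f x) ^+ 2.
  rewrite /quadf expr2 mulr_suml; apply: eq_bigr => x _.
  by rewrite mulr_sumr; apply: eq_bigr => y _; rewrite mulr1.
have SE (g : X -> R) : \sum_x g x * (sgz D)%:~R = (\sum_x g x) * (sgz D)%:~R.
  by rewrite mulr_suml.
exists (fun=> (sgz D)%:~R), ((sgz D)%:~R ^+ 2).
have sg1 : `|(sgz D)%:~R : R| <= 1 by case: (sgzP D) => _; rewrite ?normrN ?normr0 ?normr1.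
split.
- rewrite mul1r SE DE.
  have [D0|D0|->] := ltrgtP D 0; last by rewrite sgz0 normr0 mulr0 expr0n/= mulr0 subr0.
    rewrite ltr0_sgz//; have : (D%:~R : R) <= -1.
      by rewrite -[-1]/((-1)%:~R) ler_int; lia.
    by move=> h; rewrite ler0_norm; lra.
  rewrite gtr0_sgz//; have : 1 <= (D%:~R : R).
    by rewrite -[1]/((1)%:~R) ler_int; lia.
  by move=> h; rewrite ger0_norm; lra.
- move=> f; rewrite qE SE.
  have := sqr_ge0 (\sum_x f x - (sgz D)%:~R).
  have : 0 <= eta * norm1 f ^+ 2 by rewrite mulr_ge0 ?sqr_ge0 ?ltW.
  nra.
- by move=> x y; rewrite !subrr normr0 mulr0 add0r ltW.
- by [].
- move=> x; have [D0|D0] := eqVneq D 0.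
    rewrite D0 sgz0 normr0 addr_ge0 ?(ltW eta0)// sumr_ge0// => y _.
    by rewrite mul1r.
  rewrite (le_trans sg1)//.
  under eq_bigr do rewrite mul1r.
  have : `|D%:~R : R| <= \sum_y `|(d y)%:~R|.
    by rewrite -DE ler_norm_sum.
  have : 1 <= `|D%:~R : R|.
    by rewrite -intr_norm -[1]/((1)%:~R) ler_int; lia.
  lra.
Qed.

Lemma charge_kernelD X (K1 K2 : X -> X -> R) m1 m2 :
  charge_kernel K1 m1 -> charge_kernel K2 m2 ->
  charge_kernel (fun x y => K1 x y + K2 x y) (m1 + m2).
Proof.
move=> g1 g2 eta eta0 d.
have e20 : 0 < eta / 2 by lra.
have [P1 [s1 [a1 b1 c1 e1 f1]]] := g1 _ e20 d.
have [P2 [s2 [a2 b2 c2 e2 f2]]] := g2 _ e20 d.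
have SE (g : X -> R) : \sum_x g x * (P1 x + P2 x) =
    \sum_x g x * P1 x + \sum_x g x * P2 x.
  by rewrite -big_split; apply: eq_bigr => x _; rewrite mulrDr.
exists (fun x => P1 x + P2 x), (s1 + s2); split.
- by rewrite SE; lra.
- move=> f; rewrite SE.
  have -> : quadf (fun x y => K1 x y + K2 x y) f = quadf K1 f + quadf K2 f.
    rewrite /quadf -big_split; apply: eq_bigr => x _.
    by rewrite -big_split; apply: eq_bigr => y _; rewrite mulrDr.
  have := b1 f; have := b2 f; lra.
- move=> x y; have -> : P1 x + P2 x - (P1 y + P2 y) = (P1 x - P1 y) + (P2 x - P2 y) by ring.
  by rewrite (le_trans (ler_normD _ _))//; have := c1 x y; have := c2 x y; lra.
- by move=> x; rewrite (le_trans (ler_normD _ _))// lerD.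
- move=> x; rewrite (le_trans (ler_normD _ _))//.
  under eq_bigr do rewrite mulrDl.
  by rewrite big_split/=; have := f1 x; have := f2 x; lra.
Qed.

Lemma charge_kernelZ X (K : X -> X -> R) m w : 0 <= w ->
  charge_kernel K m -> charge_kernel (fun x y => w * K x y) (w * m).
Proof.
move=> w0 g eta eta0 d.
have e20 : 0 < eta / (w + 1) by rewrite divr_gt0//; lra.
have we : w * (eta / (w + 1)) <= eta.
  by rewrite mulrA ler_pdivrMr; nra.
have [P [s [a1 b1 c1 e1 f1]]] := g _ e20 d.
have SE (h : X -> R) : \sum_x h x * (w * P x) = w * \sum_x h x * P x.
  by rewrite mulr_sumr; apply: eq_bigr => x _; ring.
exists (fun x => w * P x), (w * s); split.
- by rewrite SE; have := ler_wpM2l w0 a1; lra.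
- move=> f; rewrite SE.
  have -> : quadf (fun x y => w * K x y) f = w * quadf K f.
    rewrite /quadf mulr_sumr; apply: eq_bigr => x _.
    by rewrite mulr_sumr; apply: eq_bigr => y _; ring.
  have := ler_wpM2l w0 (b1 f).
  have := ler_wpM2r (sqr_ge0 (norm1 f)) we; lra.
- move=> x y; rewrite -mulrBr normrM ger0_norm//.
  by have := ler_wpM2l w0 (c1 x y); lra.
- by move=> x; rewrite normrM ger0_norm// ler_wpM2l.
- move=> x; rewrite normrM ger0_norm//.
  under eq_bigr do rewrite -mulrA.
  by rewrite -mulr_sumr; have := ler_wpM2l w0 (f1 x); lra.
Qed.

Lemma charge_kernel_approx X (K : X -> X -> R) m :
  (forall eta : R, 0 < eta -> exists2 K', charge_kernel K' m &
     forall x y, `|K x y - K' x y| <= eta) -> charge_kernel K m.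
Proof.
move=> H eta eta0 d; pose S : R := \sum_y `|(d y)%:~R|.
have S0 : 0 <= S by apply: sumr_ge0.
(* The increment clause loses [2 * e + e] and the last clause [e * S + e]. *)
pose e := eta / (3 + S).
have e0 : 0 < e by rewrite divr_gt0//; lra.
have eE : e * (3 + S) = eta by rewrite /e mulfVK// gt_eqF//; lra.
have [K' gK' dK] := H _ e0.
have [P [s [a1 b1 c1 e1 f1]]] := gK' _ e0 d.
exists P, s; split => //.
- move=> f; have : quadf K' f - quadf K f <= e * norm1 f ^+ 2.
    rewrite /quadf -sumrB expr2 {1}/norm1 mulr_suml mulr_sumr.
    apply: ler_sum => x _; rewrite -sumrB /norm1 !mulr_sumr; apply: ler_sum => y _.
    rewrite -mulrBr (le_trans (ler_norm _))// !normrM distrC mulrC.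
    by rewrite ler_wpM2r ?mulr_ge0.
  have := b1 f; have : 2 * (e * norm1 f ^+ 2) <= eta * norm1 f ^+ 2.
    by rewrite mulrA ler_wpM2r ?sqr_ge0//; nra.
  lra.
- move=> x y; have := c1 x y; have := dK x y; rewrite ler_norml => /andP[h1 h2] h3.
  nra.
- move=> x; rewrite (le_trans (f1 x))//.
  have : \sum_y K' x y * `|(d y)%:~R| <= \sum_y K x y * `|(d y)%:~R| + e * S.
    rewrite /S mulr_sumr -big_split/=; apply: ler_sum => y _.
    rewrite -mulrDl ler_wpM2r//; have := dK x y; rewrite ler_norml => /andP[h1 h2].
    lra.
  nra.
Qed.

(** With probability [p] the set stays whole, with probability [1 - p] it is cut along [H] and the
    two sides are treated separately. The new kernel is the mean of both cases, and so is the
    potential. By the triangle inequality the charges of the two sides add up to at least the total,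
    so [m] is unchanged. *)
Lemma charge_kernel_split X (K : X -> X -> R) m (H : pred X) (p : R) : 0 <= p <= 1 ->
  charge_kernel K m ->
  charge_kernel (fun x y => K x y * (if H x == H y then 1 else p)) m.
Proof.
move=> /andP[p0 p1] g eta eta0 d.
have e20 : 0 < eta / 2 by lra.
pose r (b : bool) (h : X -> R) (x : X) : R := if H x == b then h x else 0.
pose rd (b : bool) (x : X) : int := if H x == b then d x else 0.
have [P [s [aa ab ac ae af]]] := g _ e20 d.
have [P1 [s1 [a1 b1 c1 e1 f1]]] := g _ e20 (rd true).
have [P2 [s2 [a2 b2 c2 e2 f2]]] := g _ e20 (rd false).
pose PP (x : X) : R := p * P x + (1 - p) * (if H x then P1 x else P2 x).
have SE (h : X -> R) : \sum_x h x * PP x = p * \sum_x h x * P x +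
    (1 - p) * (\sum_x r true h x * P1 x + \sum_x r false h x * P2 x).
  rewrite -big_split !mulr_sumr -big_split; apply: eq_bigr => x _ /=.
  by rewrite /r /PP; case: (H x) => /=; ring.
have rE b x : (rd b x)%:~R = r b (fun x => (d x)%:~R) x.
  by rewrite /r /rd; case: ifP.
have DE : \sum_x (d x)%:~R = \sum_x (rd true x)%:~R + \sum_x (rd false x)%:~R :> R.
  by rewrite -big_split; apply: eq_bigr => x _ /=; rewrite /r /rd; case: (H x); rewrite /= ?addr0 ?add0r.
exists PP, (p * s + (1 - p) * (s1 + s2)); split.
- rewrite SE.
  have t1 : \sum_x r true (fun x => (d x)%:~R) x * P1 x = \sum_x (rd true x)%:~R * P1 x.
    by apply: eq_bigr => x _; rewrite rE.
  have t2 : \sum_x r false (fun x => (d x)%:~R) x * P2 x = \sum_x (rd false x)%:~R * P2 x.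
    by apply: eq_bigr => x _; rewrite rE.
  have q0 : 0 <= 1 - p by lra.
  rewrite t1 t2; have := ler_wpM2l p0 aa.
  have : m * `|\sum_x (d x)%:~R| <= 2 * (\sum_x (rd true x)%:~R * P1 x) - s1 +
     (2 * (\sum_x (rd false x)%:~R * P2 x) - s2).
    (* A point of [X] gives [0 <= m]; when there is none all sums vanish and the first clauses
       suffice. *)
    have [/existsP[x _]|/existsPn n] := boolP [exists x : X, true]; last first.
      have E0 (h : X -> R) : \sum_x h x = 0 by rewrite big1// => x; have := n x.
      clear n.
      by move: a1 a2; rewrite !E0 normr0; lra.
    rewrite DE; have := ler_wpM2l (le_trans (normr_ge0 _) (ae x)) (ler_normD (\sum_x (rd true x)%:~R) (\sum_x (rd false x)%:~R)).
    lra.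
  move=> h; have := ler_wpM2l q0 h; lra.
- move=> f; rewrite SE.
  have -> : quadf (fun x y => K x y * (if H x == H y then 1 else p)) f =
    p * quadf K f + (1 - p) * (quadf K (r true f) + quadf K (r false f)).
    rewrite /quadf -big_split !mulr_sumr -big_split; apply: eq_bigr => x _ /=.
    rewrite -[in RHS]big_split !mulr_sumr -[in RHS]big_split.
    apply: eq_bigr => y _ /=.
    by rewrite /r /rd; case: (H x); case: (H y) => /=; ring.
  have nE : norm1 f = norm1 (r true f) + norm1 (r false f).
    by rewrite /norm1 -big_split; apply: eq_bigr => x _ /=; rewrite /r /rd; case: (H x); rewrite /= normr0 ?addr0 ?add0r.
  have q0 : 0 <= 1 - p by lra.
  have := ler_wpM2l p0 (ab f); have := ler_wpM2l q0 (lerD (b1 (r true f)) (b2 (r false f))).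
  have : eta / 2 * norm1 (r true f) ^+ 2 + eta / 2 * norm1 (r false f) ^+ 2 <= eta / 2 * norm1 f ^+ 2.
    rewrite -mulrDr ler_wpM2l ?(ltW e20)// nE.
    have := norm1_ge0 (r true f); have := norm1_ge0 (r false f); nra.
  have : 0 <= eta / 2 * norm1 f ^+ 2 by rewrite mulr_ge0 ?sqr_ge0 ?ltW.
  move=> h0 h1; have := ler_wpM2l q0 h1; nra.
- move=> x y; rewrite /PP.
  have q0 : 0 <= 1 - p by lra.
  have := ler_wpM2l p0 (ac x y).
  have : `|p * P x - p * P y| = p * `|P x - P y| by rewrite -mulrBr normrM ger0_norm.
  set A := p * P x - p * P y.
  (* Across the cut the two potentials are unrelated and only the bound [2 * m] for their difference
     is left, which is the increment clause for a kernel equal to 0 there. *)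
  have key (u v : R) : `|u - v| <= (2 * (m - (if H x == H y then K x y else 0))) + eta / 2 ->
    p * `|P x - P y| <= p * (2 * (m - K x y) + eta / 2) -> `|A| = p * `|P x - P y| ->
   `|p * P x + (1 - p) * u - (p * P y + (1 - p) * v)| <=
   2 * (m - K x y * (if H x == H y then 1 else p)) + eta.
    move=> uv h1 h2; have -> : p * P x + (1 - p) * u - (p * P y + (1 - p) * v) = A + (1 - p) * (u - v).
      by rewrite /A; ring.
    rewrite (le_trans (ler_normD _ _))// h2 normrM (ger0_norm q0).
    have := ler_wpM2l q0 uv; case: (H x == H y) => ?; nra.
  move=> h2 h1; apply: key => //.
  have := ler_normB (P1 x) (P2 y); have := ler_normB (P2 x) (P1 y).
  have := e1 x; have := e2 x; have := e1 y; have := e2 y; have := c1 x y; have := c2 x y.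
  by case: (H x); case: (H y) => //=; lra.
- move=> x; have q0 : 0 <= 1 - p by lra.
  rewrite /PP (le_trans (ler_normD _ _))// !normrM (ger0_norm p0) (ger0_norm q0).
  have := ler_wpM2l p0 (ae x).
  have : `|if H x then P1 x else P2 x| <= m by case: (H x).
  by move=> h; have := ler_wpM2l q0 h; lra.
- move=> x; have q0 : 0 <= 1 - p by lra.
  rewrite /PP (le_trans (ler_normD _ _))// !normrM (ger0_norm p0) (ger0_norm q0).
  have -> : \sum_y K x y * (if H x == H y then 1 else p) * `|(d y)%:~R| =
    p * \sum_y K x y * `|(d y)%:~R : R| + (1 - p) * \sum_y K x y * `|(rd (H x) y)%:~R|.
    rewrite !mulr_sumr -big_split; apply: eq_bigr => y _ /=.
    by rewrite /r /rd; case: (H x); case: (H y) => /=; rewrite ?normr0; ring.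
  have := ler_wpM2l p0 (af x).
  have : `|if H x then P1 x else P2 x| <= \sum_y K x y * `|(rd (H x) y)%:~R| + eta / 2.
    by have := f1 x; have := f2 x; case: (H x).
  by move=> h; have := ler_wpM2l q0 h; nra.
Qed.

End charge_kernels.

(** * From random cuts along lines to the exponential of the Euclidean distance *)

Section euclidean_kernel.
Variable R : realType.
Implicit Type X : finType.

Let cuts_prod (p : R) (B a b : nat) : (a <= B)%N -> (b <= B)%N ->
  \prod_(j < B) (if (j < a)%N == (j < b)%N then 1 else p) =
  p ^+ ((a - b) + (b - a)).
Proof.
elim: B a b => [|B IH] a b.
  by rewrite !leqn0 => /eqP-> /eqP->; rewrite big_ord0 expr0.
case: a => [|a] aB; case: b => [|b] bB.
- by rewrite big1// => j _.
- rewrite big_ord_recl/= (IH 0%N b)// !subn0 -exprS.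
  by rewrite !sub0n !add0n.
- rewrite big_ord_recl/= (IH a 0%N)// !subn0 -exprS.
  by rewrite !sub0n !addn0.
- rewrite big_ord_recl/= mul1r !subSS -IH//.
Qed.

(** One independent cut at every integer threshold: two points are separated by as many cuts as
    there are thresholds between their values, each at the price of a factor [p]. The exponent is a
    distance of naturals, one of the two truncated differences being 0. *)
Lemma charge_kernel_cuts X (K : X -> X -> R) m (a : X -> nat) (p : R) :
  0 <= p <= 1 -> charge_kernel K m ->
  charge_kernel (fun x y => K x y * p ^+ ((a x - a y) + (a y - a x))) m.
Proof.
move=> p01 gK; pose B := \max_x a x.
have aB x : (a x <= B)%N by apply: (leq_bigmax x).
suff : forall n, charge_kernel (fun x y => K x y *
    \prod_(j < n) (if (j < a x)%N == (j < a y)%N then 1 else p)) m.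
  move=> /(_ B); congr charge_kernel; apply/funext => x; apply/funext => y.
  by rewrite cuts_prod.
elim=> [|n IH].
  move: gK; congr charge_kernel; apply/funext => x; apply/funext => y.
  by rewrite big_ord0 mulr1.
move: (charge_kernel_split (fun x => n < a x)%N p01 IH); congr charge_kernel.
by apply/funext => x; apply/funext => y; rewrite big_ord_recr mulrA.
Qed.

Let expR_lip (s t : R) : 0 <= s -> 0 <= t -> `|expR (- s) - expR (- t)| <= `|s - t|.
Proof.
wlog st : s t / s <= t.
  move=> H s0 t0; have [|/ltW] := leP s t; first by move=> ?; exact: H.
  by move=> ?; rewrite distrC (distrC s); exact: H.
move=> s0 t0.
have e1 : expR (- t) = expR (- s) * expR (s - t) by rewrite -expRD; congr expR; ring.
have e2 : 1 + (s - t) <= expR (s - t) by exact: expR_ge1Dx.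
have e3 : expR (- s) <= 1 by rewrite -expR0 ler_expR; lra.
have e4 : 0 <= expR (- s) := expR_ge0 _.
have e5 : expR (s - t) <= 1 by rewrite -expR0 ler_expR; lra.
rewrite (distrC s) (ger0_norm (_ : 0 <= t - s)); last lra.
rewrite ger0_norm; last by rewrite e1; nra.
by rewrite e1; nra.
Qed.

(** A Poisson process of cuts in the coordinate [al], discretised with step [h];
    [p = expR (- (c * h))] is the probability that one step contains no cut. *)
Lemma charge_kernel_line X (K : X -> X -> R) m (al : X -> R) (c : R) :
  0 <= c -> charge_kernel K m ->
  charge_kernel (fun x y => K x y * expR (- (c * `|al x - al y|))) m.
Proof.
move=> c0 gK; apply: charge_kernel_approx => eta eta0.
pose S : R := \sum_x \sum_y `|K x y|.
have KS x y : `|K x y| <= S.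
  rewrite /S (bigD1 x)//= (bigD1 y)//= -addrA lerDl addr_ge0//.
    exact: sumr_ge0.
  by apply: sumr_ge0 => z _; exact: sumr_ge0.
have S0 : 0 <= S by apply: sumr_ge0 => z _; exact: sumr_ge0.
pose h := eta / ((S + 1) * (c + 1)).
have Sc : 0 < (S + 1) * (c + 1) by nra.
have h0 : 0 < h by rewrite divr_gt0.
have hE : h * ((S + 1) * (c + 1)) = eta by rewrite /h mulfVK// gt_eqF.
(* A shift that makes [al] nonnegative before it is rounded down to a natural number. *)
pose B : R := \sum_x `|al x|.
have aB x : - B <= al x.
  rewrite lerNl (le_trans (ler_norm _))// normrN /B (bigD1 x)//= lerDl.
  exact: sumr_ge0.
pose a x : nat := Num.trunc ((al x + B) / h).
have aP x : (a x)%:R <= (al x + B) / h < (a x)%:R + 1.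
  have /truncn_itv : 0 <= (al x + B) / h by rewrite divr_ge0 ?(ltW h0)//; have := aB x; lra.
  by rewrite -natr1.
pose p : R := expR (- (c * h)).
have p01 : 0 <= p <= 1.
  by rewrite expR_ge0/= -expR0 ler_expR oppr_le0 mulr_ge0// ltW.
exists (fun x y => K x y * p ^+ ((a x - a y) + (a y - a x))).
  exact: charge_kernel_cuts.
move=> x y; rewrite -mulrBr normrM.
rewrite -expRM_natl mulrN.
set n := (_ + _)%N.
have nE : (n%:R : R) = `|(a x)%:R - (a y)%:R|.
  rewrite /n; have [xy|/ltnW xy] := leqP (a x) (a y).
    rewrite (eqP xy) add0n natrB// distrC ger0_norm// subr_ge0 ler_nat//.
  by rewrite (eqP xy) addn0 natrB// ger0_norm// subr_ge0 ler_nat.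
have d1 : `| c * `|al x - al y| - n%:R * (c * h)| <= c * h.
  have -> : c * `|al x - al y| - n%:R * (c * h) = c * (`|al x - al y| - n%:R * h) by ring.
  rewrite normrM ger0_norm// ler_wpM2l//.
  have := aP x; have := aP y.
  set u := (al x + B) / h; set v := (al y + B) / h => hv hu.
  have -> : al x - al y = h * (u - v) by rewrite /u /v; field; rewrite gt_eqF.
  rewrite nE normrM (gtr0_norm h0) [X in _ - X]mulrC -mulrBr normrM (gtr0_norm h0).
  rewrite ler_piMr ?(ltW h0)// (le_trans (ler_dist_dist _ _))//.
  by rewrite ler_norml; apply/andP; split; lra.
have := expR_lip (_ : 0 <= c * `|al x - al y|) (_ : 0 <= n%:R * (c * h)).
move=> /(_ (mulr_ge0 c0 (normr_ge0 _))) /(_ (mulr_ge0 (ler0n _ _) (mulr_ge0 c0 (ltW h0)))) hh.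
rewrite (le_trans (ler_pM _ _ (KS x y) (le_trans hh d1)))//.
by rewrite -hE; nra.
Qed.

Lemma charge_kernel_lines X (n : nat) (al : 'I_n -> X -> R) (c : R) : 0 <= c ->
  charge_kernel (fun x y => expR (- (c * \sum_(i < n) `|al i x - al i y|))) 1.
Proof.
move=> c0; elim: n al => [|n IH] al.
  move: (@charge_kernel_sgn R X); congr charge_kernel.
  by apply/funext => x; apply/funext => y; rewrite big_ord0 mulr0 oppr0 expR0.
move: (charge_kernel_line (al ord_max) c0 (IH (fun i => al (widen_ord (leqnSn n) i)))).
congr charge_kernel; apply/funext => x; apply/funext => y.
by rewrite big_ord_recr/= -expRD mulrDr opprD.
Qed.

Lemma polar_coord (x y : R) : exists phi, x = Num.sqrt (x ^+ 2 + y ^+ 2) * cos phi /\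
  y = Num.sqrt (x ^+ 2 + y ^+ 2) * sin phi.
Proof.
set r : R := Num.sqrt _.
have r2 : r ^+ 2 = x ^+ 2 + y ^+ 2 by rewrite sqr_sqrtr// addr_ge0 ?sqr_ge0.
have [r0|r0] := eqVneq r 0.
  have [/eqP x0 /eqP y0] : x == 0 /\ y == 0.
    move: r2; rewrite r0 expr0n/= => /esym/eqP.
    by rewrite paddr_eq0 ?sqr_ge0// !sqrf_eq0 => /andP[].
  by exists 0; rewrite r0 !mul0r.
have rp : 0 < r by rewrite lt_neqAle eq_sym r0 sqrtr_ge0.
have xr : -1 <= x / r <= 1.
  rewrite -ler_norml normf_div (gtr0_norm rp) ler_pdivrMr// mul1r.
  by rewrite -(ger0_norm (ltW rp)) -ler_sqr ?nnegrE// !real_normK ?num_real// r2 lerDl sqr_ge0.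
have cE : cos (acos (x / r)) = x / r by rewrite acosK.
have sE : sin (acos (x / r)) = `|y| / r.
  rewrite sin_acos//.
  have -> : 1 - (x / r) ^+ 2 = (`|y| / r) ^+ 2.
    rewrite [RHS]expr_div_n real_normK ?num_real// expr_div_n.
    have -> : y ^+ 2 = r ^+ 2 - x ^+ 2 by rewrite r2; ring.
    by field.
  by rewrite sqrtr_sqr ger0_norm// divr_ge0// ltW.
have [y0|y0] := leP 0 y.
  by exists (acos (x / r)); rewrite cE sE ger0_norm// !mulrA ![r * _]mulrC !mulfK.
exists (- acos (x / r)); rewrite cosN sinN cE sE ltr0_norm//.
by rewrite mulNr opprK !mulrA ![r * _]mulrC !mulfK.
Qed.

Let cos_sum_telescope (n : nat) (phi h : R) :
  2 * sin (h / 2) * (\sum_(k < n) cos (phi - k%:R * h)) =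
  sin (phi + h / 2) - sin (phi + h / 2 - n%:R * h).
Proof.
elim: n => [|n IH]; first by rewrite big_ord0 mul0r subr0 subrr mulr0.
rewrite big_ord_recr/= mulrDr IH.
have -> : phi + h / 2 - n%:R * h = (phi - n%:R * h) + h / 2 by ring.
have -> : phi + h / 2 - n.+1%:R * h = (phi - n%:R * h) - h / 2 by rewrite -natr1; field.
by rewrite (sinD (_ - _) (h / 2)) (sinB (_ - _) (h / 2)); ring.
Qed.

(** Turning by one step permutes the directions cyclically; the one that leaves on one side returns
    on the other with the opposite sign. *)
Let abs_cos_period (n : nat) (phi : R) :
  \sum_(k < n.+1) `|cos (phi + pi / n.+1%:R - k%:R * (pi / n.+1%:R))| =
  \sum_(k < n.+1) `|cos (phi - k%:R * (pi / n.+1%:R))|.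
Proof.
set h := pi / _.
rewrite big_ord_recl [RHS]big_ord_recr/= [RHS]addrC; congr (_ + _).
  rewrite mul0r subr0.
  have -> : phi - n%:R * h = (phi + h) - pi.
    rewrite (_ : pi = n.+1%:R * h); last by rewrite /h mulrC mulfVK// pnatr_eq0.
    by rewrite -natr1; ring.
  by rewrite -[cos (_ - pi)]opprK -cosDpi subrK normrN.
apply: eq_bigr => k _; rewrite /bump/= add1n -natr1; congr (`| cos _|); ring.
Qed.

(** The mean of [|cos|] over equally spaced directions is almost independent of [phi]. After a
    rotation by multiples of the step no cosine is negative, and the sum telescopes to
    [sin (t + h / 2)]. *)
Let abs_cos_sum (n : nat) (phi : R) :
  cos (pi / n.+1%:R / 2) <=
  sin (pi / n.+1%:R / 2) * (\sum_(k < n.+1) `|cos (phi - k%:R * (pi / n.+1%:R))|) <= 1.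
Proof.
set h := pi / n.+1%:R.
have pi0 := pi_gt0 R.
have h0 : 0 < h by rewrite divr_gt0.
have hpi : n.+1%:R * h = pi by rewrite /h mulrC mulfVK// pnatr_eq0.
pose S (t : R) := \sum_(k < n.+1) `|cos (t - k%:R * h)|.
have SN (m : nat) t : S (t + m%:R * h) = S t.
  elim: m => [|m IH]; first by rewrite mul0r addr0.
  rewrite -IH /S -[RHS]abs_cos_period -/h; apply: eq_bigr => k _; rewrite -natr1; congr (`|cos _|); ring.
have SZ (m : int) t : S (t + m%:~R * h) = S t.
  case: m => m; first exact: SN.
  by rewrite NegzE -(SN m.+1 (t + _)); congr S; rewrite mulrNz; ring.
(* Brings [t] into the window [[pi / 2 - h, pi / 2]], where all the angles of the sum stay in
   [[- pi / 2, pi / 2]]. *)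
pose m := Num.floor ((phi - (pi / 2 - h)) / h).
pose t := phi - m%:~R * h.
have [t1 t2] : pi / 2 - h <= t /\ t <= pi / 2.
  have := floor_itv ((phi - (pi / 2 - h)) / h).
  rewrite -/m intrD => /andP[a b].
  have : m%:~R * h <= phi - (pi / 2 - h) by rewrite -ler_pdivlMr.
  have : phi - (pi / 2 - h) < (m%:~R + 1) * h by rewrite -ltr_pdivrMr.
  by rewrite /t; split; lra.
rewrite -/(S phi); have -> : S phi = S t by rewrite -(SZ m t) /t subrK.
have nn (k : 'I_n.+1) : 0 <= cos (t - k%:R * h).
  have kn : (k%:R : R) <= n%:R by rewrite ler_nat -ltnS.
  apply: cos_ge0_pihalf; apply/andP; split.
    move: hpi; rewrite -natr1 => hpi; nra.
  have : 0 <= (k%:R : R) * h by rewrite mulr_ge0// ltW.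
  lra.
have -> : S t = \sum_(k < n.+1) cos (t - k%:R * h).
  by apply: eq_bigr => k _; rewrite ger0_norm.
have : 2 * sin (h / 2) * (\sum_(k < n.+1) cos (t - k%:R * h)) = 2 * sin (t + h / 2).
  by rewrite cos_sum_telescope hpi -[sin (_ - pi)]opprK -sinDpi subrK; ring.
move=> E; have -> : sin (h / 2) * \sum_(k < n.+1) cos (t - k%:R * h) = sin (t + h / 2) by lra.
rewrite sin_le1 andbT.
have -> : sin (t + h / 2) = cos (t + h / 2 - pi / 2) by rewrite -sinDpihalf; congr sin; ring.
have hh : h <= pi by rewrite /h ler_piMr ?(ltW pi0)// invf_le1// ler1n.
have [u0|u0] := leP 0 (t + h / 2 - pi / 2).
  by apply: le_cos; lra.
by rewrite -[cos (t + _ - _)]cosN; apply: le_cos; lra.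
Qed.

Definition dist2 (x y : R * R) : R := Num.sqrt ((x.1 - y.1) ^+ 2 + (x.2 - y.2) ^+ 2).

(** Crofton's formula: the Euclidean distance is an average over directions of distances of
    projections, so cuts by random lines of all directions produce its exponential. Finitely many
    directions are taken and the error is removed by the uniform limit. *)
Lemma charge_kernel_dist X (p : X -> R * R) (t : R) : 0 <= t ->
  charge_kernel (fun x y => expR (- (t * dist2 (p x) (p y)))) 1.
Proof.
move=> t0; apply: charge_kernel_approx => eta eta0.
pose S : R := \sum_x \sum_y dist2 (p x) (p y).
have d0 x y : 0 <= dist2 (p x) (p y) by exact: sqrtr_ge0.
have dS x y : dist2 (p x) (p y) <= S.
  rewrite /S (bigD1 x)//= (bigD1 y)//= -addrA lerDl addr_ge0//.
    by apply: sumr_ge0 => z _.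
  by apply: sumr_ge0 => z _; apply: sumr_ge0 => w _.
have S0 : 0 <= S by apply: sumr_ge0 => z _; apply: sumr_ge0.
(* With [n.+1] directions the distance is obtained up to a factor in [[1 - h ^+ 2 / 8, 1]], where
   [h <= 4 / n.+1]. *)
pose n := Num.trunc (t * S * 16 / eta + 1).
have nP : t * S * 16 / eta + 1 <= n.+1%:R.
  have /truncn_itv : 0 <= t * S * 16 / eta + 1.
    by rewrite addr_ge0// divr_ge0 ?mulr_ge0// ltW.
  by move=> /andP[_ /ltW].
set h : R := pi / n.+1%:R.
exists (fun x y => expR (- ((t * sin (h / 2)) * \sum_(k < n.+1)
    `|(fun x => (p x).1 * cos (k%:R * h) + (p x).2 * sin (k%:R * h)) x -
      (fun x => (p x).1 * cos (k%:R * h) + (p x).2 * sin (k%:R * h)) y|))).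
  apply: (@charge_kernel_lines X n.+1 (fun (k : 'I_n.+1) x => (p x).1 * cos (k%:R * h) + (p x).2 * sin (k%:R * h))).
  rewrite mulr_ge0// sin_ge0_pi//.
  have pi0 := pi_gt0 R.
  have hh : h <= pi by rewrite /h ler_piMr ?(ltW pi0)// invf_le1// ler1n.
  have h0 : 0 < h by rewrite divr_gt0.
  lra.
move=> x y /=.
have [phi [e1 e2]] := polar_coord ((p x).1 - (p y).1) ((p x).2 - (p y).2).
rewrite -/(dist2 _ _) in e1 e2.
have -> : \sum_(k < n.+1) `|(p x).1 * cos (k%:R * h) + (p x).2 * sin (k%:R * h) -
   ((p y).1 * cos (k%:R * h) + (p y).2 * sin (k%:R * h))| =
   dist2 (p x) (p y) * \sum_(k < n.+1) `|cos (phi - k%:R * h)|.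
  rewrite mulr_sumr; apply: eq_bigr => k _.
  rewrite -[X in X * `|cos _|]ger0_norm// -normrM; congr `| _ |.
  rewrite cosB; transitivity (((p x).1 - (p y).1) * cos (k%:R * h) + ((p x).2 - (p y).2) * sin (k%:R * h)).
    by ring.
  by rewrite e1 e2; ring.
have /andP[c1 c2] := abs_cos_sum n phi; rewrite -/h in c1 c2.
set W : R := \sum_(k < n.+1) _ in c1 c2 *.
have := d0 x y; have := dS x y; set D := dist2 _ _ => DS D0.
have -> : t * sin (h / 2) * (D * W) = t * D * (sin (h / 2) * W) by ring.
set V := sin (h / 2) * W in c1 c2 *.
have V0 : 1 - (h / 2) ^+ 2 / 2 <= V by exact: le_trans (cos_ge1Bsqr _) c1.
have h4 : h <= 4 / n.+1%:R.
  by rewrite /h ler_pM2r ?invr_gt0//; have := pihalf_lt2 R; lra.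
have h0 : 0 < h by rewrite divr_gt0// pi_gt0.
have n1 : 1 <= (n.+1%:R : R) by rewrite ler1n.
have hn : h * n.+1%:R <= 4 by rewrite -ler_pdivlMr.
have tS : t * S * 16 <= eta * n.+1%:R.
  rewrite mulrC mulrC -ler_pdivrMl// mulrC; lra.
have hV : t * D * (1 - V) <= eta.
  have tD : t * D <= t * S by rewrite ler_wpM2l.
  have q : 1 - V <= h ^+ 2 / 8 by lra.
  have q2 : h ^+ 2 <= 16 / n.+1%:R.
    rewrite ler_pdivlMr// expr2; nra.
  have q3 : t * S * (16 / n.+1%:R) <= eta by rewrite mulrA ler_pdivrMr.
  have tD0 : 0 <= t * D by rewrite mulr_ge0.
  have tS0 : 0 <= t * S by rewrite mulr_ge0.
  have V10 : 0 <= 1 - V by rewrite subr_ge0.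
  rewrite (le_trans (ler_pM tD0 V10 tD q))// (le_trans _ q3)// ler_wpM2l//.
  by rewrite (le_trans _ q2)// ler_pdivrMr// ler_peMr ?sqr_ge0// ler1n.
rewrite (le_trans _ hV)//.
have V1 : 0 <= V.
  apply: le_trans c1; apply: cos_ge0_pihalf.
  have hh : h <= pi by rewrite /h ler_piMr ?invf_le1 ?(ltW (pi_gt0 R)) ?ler1n.
  lra.
have tD0 := mulr_ge0 t0 D0.
rewrite (le_trans (expR_lip tD0 (mulr_ge0 tD0 V1)))//.
have -> : t * D - t * D * V = t * D * (1 - V) by ring.
by rewrite ger0_norm// (mulr_ge0 tD0)// subr_ge0.
Qed.

End euclidean_kernel.

(** * The lattice Laplacian of a regularised logarithm *)

Section log_kernel.
Variable R : realType.
Implicit Types (P x y : R).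

Definition rad x y : R := Num.sqrt (x ^+ 2 + y ^+ 2).
(** The shift [P] removes the singularity at the origin and, from 1 on, makes the function
    subharmonic for the five-point Laplacian. The pure logarithm is not: on the axes its Laplacian
    is [ln (1 - x^-4)]. *)
Definition lnrad P x y : R := ln (rad x y + P).
Definition lap (h : R -> R -> R) x y : R :=
  h (x + 1) y + h (x - 1) y + h x (y + 1) + h x (y - 1) - 4 * h x y.

Lemma rad_ge0 x y : 0 <= rad x y. Proof. exact: sqrtr_ge0. Qed.

Lemma rad_sqr x y : rad x y ^+ 2 = x ^+ 2 + y ^+ 2.
Proof. by rewrite sqr_sqrtr// addr_ge0 ?sqr_ge0. Qed.

Lemma radN x y : rad (- x) (- y) = rad x y.
Proof. by rewrite /rad !sqrrN. Qed.

Lemma radNl x y : rad (- x) y = rad x y.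
Proof. by rewrite /rad !sqrrN. Qed.

Lemma radC x y : rad x y = rad y x.
Proof. by rewrite /rad addrC. Qed.

(** Here [c] is the squared cosine of the polar angle. The product of the distances to two opposite
    neighbours is at least [s + 1 - 2 * c] because [(s + 1) ^+ 2 - 4 * c * s] dominates the square
    of that number, and their sum is controlled through the product. *)
Let rad_pair P x y c : 1 <= P -> 1 <= x ^+ 2 + y ^+ 2 ->
  0 <= c -> c <= 1 -> x ^+ 2 = c * (x ^+ 2 + y ^+ 2) ->
  (P + Num.sqrt (x ^+ 2 + y ^+ 2 + 1 - c)) ^+ 2 - c <=
  (rad (x + 1) y + P) * (rad (x - 1) y + P).
Proof.
move=> P1 s1 c0 c1 xE; set s := x ^+ 2 + y ^+ 2 in s1 xE *.
set r1 := rad (x + 1) y; set r2 := rad (x - 1) y.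
have r10 : 0 <= r1 := rad_ge0 _ _; have r20 : 0 <= r2 := rad_ge0 _ _.
have e1 : r1 ^+ 2 = s + 1 + 2 * x by rewrite rad_sqr /s; ring.
have e2 : r2 ^+ 2 = s + 1 - 2 * x by rewrite rad_sqr /s; ring.
set u := Num.sqrt _; have u0 : 0 <= u := sqrtr_ge0 _.
have u2 : u ^+ 2 = s + 1 - c by rewrite sqr_sqrtr//; lra.
have hp : s + 1 - 2 * c <= r1 * r2.
  have h0 : 0 <= s + 1 - 2 * c by lra.
  rewrite -ler_sqr ?nnegrE// ?mulr_ge0// exprMn e1 e2.
  have -> : (s + 1 + 2 * x) * (s + 1 - 2 * x) = (s + 1) ^+ 2 - 4 * x ^+ 2 by ring.
  rewrite xE; nra.
have ha : 2 * u <= r1 + r2.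
  rewrite -ler_sqr ?nnegrE ?addr_ge0 ?mulr_ge0//.
  have -> : (r1 + r2) ^+ 2 = r1 ^+ 2 + r2 ^+ 2 + 2 * (r1 * r2) by ring.
  by rewrite exprMn e1 e2 u2; lra.
have -> : (P + u) ^+ 2 - c = P ^+ 2 + 2 * u * P + (u ^+ 2 - c) by ring.
have -> : (r1 + P) * (r2 + P) = P ^+ 2 + (r1 + r2) * P + r1 * r2 by ring.
have := ler_wpM2r (le_trans ler01 P1) ha.
by rewrite u2; lra.
Qed.

(** The terms [1 - 2 * c] of the horizontal and of the vertical pair have opposite signs and cancel
    to first order. Their product, at most 1, is paid by the cross term
    [2 * P * (al + be) * (w ^+ 2 - 1)], which is at least [2 * P]. *)
Let rad_prod P x y : 1 <= P -> 1 <= x ^+ 2 + y ^+ 2 ->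
  (rad x y + P) ^+ 4 <= (rad (x + 1) y + P) * (rad (x - 1) y + P) *
    ((rad x (y + 1) + P) * (rad x (y - 1) + P)).
Proof.
move=> P1 s1.
have P0 : 0 <= P by lra.
pose s := x ^+ 2 + y ^+ 2.
pose c := x ^+ 2 / s.
have s0 : 0 < s by rewrite /s; lra.
have c0 : 0 <= c by rewrite divr_ge0 ?sqr_ge0 ?(ltW s0).
have c1 : c <= 1 by rewrite ler_pdivrMr// mul1r /s lerDl sqr_ge0.
have cE : x ^+ 2 = c * s by rewrite /c mulfVK// gt_eqF.
have := rad_pair P1 s1 c0 c1 cE.
have s1' : 1 <= y ^+ 2 + x ^+ 2 by rewrite addrC.
have d0 : 0 <= 1 - c by lra.
have d1 : 1 - c <= 1 by lra.
have dE : y ^+ 2 = (1 - c) * (y ^+ 2 + x ^+ 2).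
  by rewrite (addrC (y ^+ 2)) -/s mulrBl mul1r -cE /s; ring.
have := rad_pair P1 s1' d0 d1 dE.
rewrite (radC (y + 1)) (radC (y - 1)) (addrC (y ^+ 2)) -/s.
have -> : s + 1 - (1 - c) = s + c by ring.
set u := Num.sqrt (s + 1 - c); set v := Num.sqrt (s + c).
set A := (rad (x + 1) y + P) * _; set B := (rad x (y + 1) + P) * _.
move=> hB hA; set r := rad x y.
have r2 : r ^+ 2 = s by rewrite rad_sqr.
have u2 : u ^+ 2 = s + 1 - c by rewrite sqr_sqrtr//; lra.
have v2 : v ^+ 2 = s + c by rewrite sqr_sqrtr//; lra.
have u0 : 0 <= u := sqrtr_ge0 _.
have v0 : 0 <= v := sqrtr_ge0 _.
have r0 : 0 <= r := rad_ge0 _ _.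
have r1 : 1 <= r by rewrite -ler_sqr ?nnegrE// r2 expr1n.
have ru : r <= u by rewrite -ler_sqr ?nnegrE// r2 u2; lra.
have rv : r <= v by rewrite -ler_sqr ?nnegrE// r2 v2; lra.
pose al := u - r; pose be := v - r.
have al0 : 0 <= al by rewrite subr_ge0.
have be0 : 0 <= be by rewrite subr_ge0.
have alE : 2 * r * al + al ^+ 2 = 1 - c.
  have : 2 * r * (u - r) + (u - r) ^+ 2 = u ^+ 2 - r ^+ 2 by ring.
  by rewrite -/al u2 r2; lra.
have beE : 2 * r * be + be ^+ 2 = c.
  have : 2 * r * (v - r) + (v - r) ^+ 2 = v ^+ 2 - r ^+ 2 by ring.
  by rewrite -/be v2 r2; lra.
set w := r + P.
have EA : (P + u) ^+ 2 - c = w ^+ 2 + 2 * P * al + (1 - 2 * c).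
  have : (P + u) ^+ 2 = w ^+ 2 + 2 * P * al + (2 * r * al + al ^+ 2) by rewrite /w /al; ring.
  by rewrite alE; lra.
have EB : (P + v) ^+ 2 - (1 - c) = w ^+ 2 + 2 * P * be - (1 - 2 * c).
  have : (P + v) ^+ 2 = w ^+ 2 + 2 * P * be + (2 * r * be + be ^+ 2) by rewrite /w /be; ring.
  by rewrite beE; lra.
rewrite EA in hA; rewrite EB in hB.
have w1 : 1 <= w ^+ 2.
  by rewrite expr_ge1// /w; lra.
have Pal : 0 <= 2 * P * al by rewrite !mulr_ge0.
have Pbe : 0 <= 2 * P * be by rewrite !mulr_ge0.
have hA0 : 0 <= w ^+ 2 + 2 * P * al + (1 - 2 * c) by lra.
have hB0 : 0 <= w ^+ 2 + 2 * P * be - (1 - 2 * c) by lra.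
apply: le_trans (ler_pM hA0 hB0 hA hB).
(* The sum of the equations for [al] and [be] is [2 * r * (al + be) + al ^+ 2 + be ^+ 2 = 1], and
   both numbers are at most 1. *)
have ab : 1 <= (al + be) * (2 * r + 1).
  have al1 : al <= 1 by nra.
  have be1 : be <= 1 by nra.
  have h1 : 2 * r * (al + be) + al ^+ 2 + be ^+ 2 = 1 by lra.
  have q1 : 0 <= al * (1 - al) by rewrite mulr_ge0// subr_ge0.
  have q2 : 0 <= be * (1 - be) by rewrite mulr_ge0// subr_ge0.
  lra.
have wr : 2 * r + 1 <= w ^+ 2 - 1.
  have h : (r + 1) ^+ 2 <= w ^+ 2 by rewrite ler_sqr ?nnegrE /w; lra.
  have e : (r + 1) ^+ 2 = r ^+ 2 + 2 * r + 1 by ring.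
  have : 1 <= r ^+ 2 by rewrite expr_ge1.
  lra.
have key : 1 <= (al + be) * (w ^+ 2 - 1).
  by rewrite (le_trans ab)// ler_wpM2l// addr_ge0.
have m1 : (1 - 2 * c) ^+ 2 <= 1.
  have : 0 <= c * (1 - c) by rewrite mulr_ge0.
  lra.
have mm : - (al + be) <= (1 - 2 * c) * (be - al).
  have : 0 <= al * c by rewrite mulr_ge0.
  have : 0 <= be * (1 - c) by rewrite mulr_ge0.
  lra.
have Pmm := ler_wpM2l P0 mm.
have pk := ler_wpM2l P0 key.
have PP : 0 <= 4 * P ^+ 2 * (al * be) by rewrite !mulr_ge0.
have -> : (w ^+ 2 + 2 * P * al + (1 - 2 * c)) * (w ^+ 2 + 2 * P * be - (1 - 2 * c)) =
  w ^+ 4 + 2 * (P * ((al + be) * (w ^+ 2 - 1))) + 2 * P * (al + be) +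
  4 * P ^+ 2 * (al * be) + 2 * (P * ((1 - 2 * c) * (be - al))) - (1 - 2 * c) ^+ 2 by ring.
lra.
Qed.

Let lnrad_arg P x y : 1 <= P -> 0 < rad x y + P.
Proof. by move=> P1; have := rad_ge0 x y; lra. Qed.

(** The origin minimises [rad]; elsewhere this is the logarithm of the product estimate. *)
Lemma lap_lnrad_ge0 P x y : 1 <= P -> (x == 0) && (y == 0) || (1 <= x ^+ 2 + y ^+ 2) ->
  0 <= lap (lnrad P) x y.
Proof.
move=> P1 /orP[/andP[/eqP-> /eqP->]|s1].
  rewrite /lap /lnrad.
  have h a b : ln (rad 0 0 + P) <= ln (rad a b + P) :> R.
    by rewrite ler_ln ?posrE ?lnrad_arg// lerD2r {1}/rad expr0n addr0 sqrtr0 rad_ge0.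
  have := h (0 + 1) 0; have := h (0 - 1) 0; have := h 0 (0 + 1); have := h 0 (0 - 1).
  lra.
rewrite /lap /lnrad -!lnM ?posrE ?mulr_gt0 ?lnrad_arg//.
have -> : 4 * ln (rad x y + P) = ln ((rad x y + P) ^+ 4).
  by rewrite lnXn ?lnrad_arg// mulr_natl.
rewrite subr_ge0 ler_ln ?posrE ?exprn_gt0 ?mulr_gt0 ?lnrad_arg//.
by rewrite -mulrA; exact: rad_prod.
Qed.

Lemma lapN P x y : lap (lnrad P) (- x) (- y) = lap (lnrad P) x y.
Proof.
have E (a b : R) : lnrad P (- a) (- b) = lnrad P a b by rewrite /lnrad radN.
rewrite /lap (_ : - x + 1 = - (x - 1)); last ring.
rewrite (_ : - x - 1 = - (x + 1)); last ring.
rewrite (_ : - y + 1 = - (y - 1)); last ring.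
rewrite (_ : - y - 1 = - (y + 1)); last ring.
by rewrite !E; lra.
Qed.

(** From [r' ^+ 2 - r ^+ 2 = 2 * T + 1] and by dropping [P] in the denominator; up to the half step
    the bound is the normal derivative of the logarithm on the side of a square. *)
Let flux_term P (T y : R) : 1 <= P -> 1 <= T ->
  lnrad P (T + 1) y - lnrad P T y <= (T + 2^-1) / (T ^+ 2 + y ^+ 2).
Proof.
move=> P1 T1; rewrite /lnrad -ln_div ?posrE ?lnrad_arg//.
rewrite (le_trans (ln_leB1 _)) ?divr_gt0 ?lnrad_arg//.
set r := rad T y; set r' := rad (T + 1) y.
have r2 : r ^+ 2 = T ^+ 2 + y ^+ 2 := rad_sqr _ _.
have r'2 : r' ^+ 2 = r ^+ 2 + 2 * T + 1 by rewrite r2 rad_sqr; ring.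
have r0 : 0 <= r := rad_ge0 _ _; have r'0 : 0 <= r' := rad_ge0 _ _.
have rp : 0 < r ^+ 2 by rewrite r2; have := sqr_ge0 y; nra.
have r1 : 0 < r by rewrite lt_neqAle r0 andbT eq_sym -sqrf_eq0 gt_eqF.
rewrite -r2 -[X in _ - X](@divff _ (r + P)) ?gt_eqF ?lnrad_arg// -mulrBl.
have -> : r' + P - (r + P) = r' - r by ring.
have rr : r <= r' by rewrite -ler_sqr ?nnegrE// r'2; lra.
have h : (r' - r) * (2 * r) <= 2 * T + 1.
  have : (r' - r) * (r' + r) = r' ^+ 2 - r ^+ 2 by ring.
  rewrite r'2; nra.
rewrite ler_pdivrMr; last by rewrite /r; exact: lnrad_arg.
rewrite (@le_trans _ _ ((T + 2^-1) / r ^+ 2 * r))//; last first.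
  by rewrite ler_wpM2l ?divr_ge0 ?ltW//; lra.
rewrite expr2 invfM mulrA mulfVK ?gt_eqF// ler_pdivlMr//; lra.
Qed.

Let atan_step (T y : R) : 0 < T -> 0 <= y ->
  T / (T ^+ 2 + (y + 1) ^+ 2) <= atan ((y + 1) / T) - atan (y / T).
Proof.
move=> T0 y0.
have yT : y / T < (y + 1) / T by rewrite ltr_pM2r ?invr_gt0//; lra.
have [|c + ->] := @MVT _ atan (fun x => (1 + x ^+ 2)^-1) _ _ yT.
  by apply: continuous_subspaceT => x; exact: continuous_atan.
rewrite in_itv/= => /andP[c1 c2].
have -> : (y + 1) / T - y / T = T^-1 by field; rewrite gt_eqF.
have c0 : 0 <= c by rewrite (le_trans _ (ltW c1))// divr_ge0// ltW.
have cT : c * T <= y + 1 by rewrite -ler_pdivlMr// ltW.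
have cT2 : (c * T) ^+ 2 <= (y + 1) ^+ 2 by rewrite ler_sqr ?nnegrE ?mulr_ge0 ?(ltW T0)//; lra.
have c21 : 0 < 1 + c ^+ 2 by have := sqr_ge0 c; lra.
have X0 : 0 < T ^+ 2 + (y + 1) ^+ 2 by have := sqr_ge0 (y + 1); nra.
rewrite ler_pdivlMr// -[leRHS]div1r ler_pdivlMr//.
have -> : T / (T ^+ 2 + (y + 1) ^+ 2) * T * (1 + c ^+ 2) =
  (T ^+ 2 + (c * T) ^+ 2) / (T ^+ 2 + (y + 1) ^+ 2) by field; rewrite gt_eqF.
by rewrite ler_pdivrMr// mul1r lerD2l.
Qed.

(** A lower Riemann sum for the angle under which a piece of the side is seen from the centre; for
    [n = T] this angle is [pi / 4]. *)
Let atan_sum (n : nat) (T : R) : 0 < T ->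
  \sum_(i < n) T / (T ^+ 2 + (i.+1%:R) ^+ 2) <= atan (n%:R / T).
Proof.
move=> T0; elim: n => [|n IH]; first by rewrite big_ord0 mul0r atan0.
rewrite big_ord_recr/=; have := @atan_step T n%:R T0 (ler0n _ _).
by rewrite natr1; lra.
Qed.

(* Integer translates are handled through real coordinates [k - T]. *)
Definition box_sum (T : nat) (F : R -> R -> R) : R :=
  \sum_(k < (2 * T).+1) \sum_(l < (2 * T).+1) F (k%:R - T%:R) (l%:R - T%:R).

Let sym_sum (n : nat) (F : R -> R) : (forall t, F (- t) = F t) ->
  \sum_(l < (2 * n).+1) F (l%:R - n%:R) = F 0 + 2 * \sum_(i < n) F i.+1%:R.
Proof.
move=> FN; have -> : (2 * n).+1 = (n + n.+1)%N by lia.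
rewrite big_split_ord/= big_ord_recl/= addn0 subrr.
have -> : \sum_(i < n) F ((n + lift ord0 i)%:R - n%:R) = \sum_(i < n) F i.+1%:R.
  by apply: eq_bigr => i _; rewrite natrD addrAC subrr add0r.
have -> : \sum_(i < n) F (i%:R - n%:R) = \sum_(i < n) F i.+1%:R.
  rewrite (reindex_inj rev_ord_inj)/=; apply: eq_bigr => i _.
  by rewrite -FN opprB natrB// opprB addrC addrNK.
ring.
Qed.

(** Two half sides are seen under [pi / 4] each; the middle row and the half step of [flux_term]
    make up the [4 / T]. *)
Let flux_side P (T : nat) : 1 <= P -> (0 < T)%N ->
  \sum_(l < (2 * T).+1) (lnrad P (T%:R + 1) (l%:R - T%:R) - lnrad P T%:R (l%:R - T%:R))
  <= pi / 2 + 4 / T%:R.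
Proof.
move=> P1 T0; have T1 : 1 <= (T%:R : R) by rewrite ler1n.
pose F y := (T%:R + 2^-1) / (T%:R ^+ 2 + y ^+ 2) : R.
rewrite (@le_trans _ _ (\sum_(l < (2 * T).+1) F (l%:R - T%:R)))//.
  by apply: ler_sum => l _; exact: flux_term.
rewrite sym_sum; last by move=> t; rewrite /F sqrrN.
have -> : \sum_(i < T) F i.+1%:R = (T%:R + 2^-1) / T%:R * \sum_(i < T) (T%:R / (T%:R ^+ 2 + i.+1%:R ^+ 2)).
  rewrite mulr_sumr; apply: eq_bigr => i _; rewrite /F; field.
  by rewrite !gt_eqF//; have := sqr_ge0 (i.+1%:R : R); nra.
have := @atan_sum T T%:R; rewrite divff ?gt_eqF// ?atan1; last lra.
have T0R : 0 < (T%:R : R) by lra.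
move=> /(_ T0R); set S := \sum_(i < T) _ => hS.
have ti : (T%:R : R)^-1 <= 1 by rewrite invf_le1.
have ti0 : 0 < (T%:R : R)^-1 by rewrite invr_gt0.
have -> : F 0 = T%:R^-1 + 2^-1 * (T%:R^-1 * T%:R^-1) by rewrite /F expr0n/= addr0; field; rewrite gt_eqF.
have -> : (T%:R + 2^-1) / T%:R = 1 + 2^-1 / T%:R :> R by field; rewrite gt_eqF.
have := pi_lt_34 R; have := pi_gt0 R.
set t := (T%:R)^-1 in ti ti0 *.
have ht : t * S <= t * (pi / 4) by rewrite ler_wpM2l// ltW.
nra.
Qed.

(** The discrete divergence theorem; by the symmetries of [h] the flux through all four sides is the
    same. *)
Let box_lap (T : nat) (h : R -> R -> R) :
  (forall x y, h (- x) y = h x y) -> (forall x y, h x y = h y x) ->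
  box_sum T (lap h) =
  4 * \sum_(l < (2 * T).+1) (h (T%:R + 1) (l%:R - T%:R) - h T%:R (l%:R - T%:R)).
Proof.
move=> hN hC.
pose D y := \sum_(k < (2 * T).+1) (h (k%:R - T%:R + 1) y + h (k%:R - T%:R - 1) y - 2 * h (k%:R - T%:R) y).
have tele y n : \sum_(k < n) (h (k%:R - T%:R + 1) y + h (k%:R - T%:R - 1) y - 2 * h (k%:R - T%:R) y)
   = (h (n%:R - T%:R) y - h (n%:R - T%:R - 1) y) - (h (- T%:R) y - h (- T%:R - 1) y).
  elim: n => [|n IH]; first by rewrite big_ord0 !sub0r !subrr.
  rewrite big_ord_recr/= IH -[n.+1%:R]natr1.
  have -> : n%:R + 1 - T%:R - 1 = n%:R - T%:R :> R by ring.
  have -> : n%:R + 1 - T%:R = n%:R - T%:R + 1 :> R by ring.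
  ring.
have DE y : D y = 2 * (h (T%:R + 1) y - h T%:R y).
  rewrite /D tele (_ : (2 * T).+1%:R = 2%:R * T%:R + 1); last by rewrite -natr1 natrM.
  have -> : 2%:R * T%:R + 1 - T%:R - 1 = T%:R :> R by ring.
  have -> : 2%:R * T%:R + 1 - T%:R = T%:R + 1 :> R by ring.
  have -> : h (- T%:R - 1) y = h (T%:R + 1) y by rewrite -(hN (T%:R + 1)); congr h; ring.
  rewrite hN; ring.
have E : box_sum T (lap h) = \sum_(l < (2 * T).+1) D (l%:R - T%:R) + \sum_(l < (2 * T).+1) D (l%:R - T%:R).
  rewrite /box_sum {1}/D [X in _ = X + _]exchange_big/= -big_split/=; apply: eq_bigr => k _.
  rewrite /D -big_split/=; apply: eq_bigr => l _.
  rewrite /lap !(hC (k%:R - T%:R)) [h (l%:R - T%:R) _]hC; rewrite !(hC (l%:R - T%:R + 1)) !(hC (l%:R - T%:R - 1)).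
  lra.
rewrite E -big_split/= mulr_sumr; apply: eq_bigr => l _; rewrite DE; ring.
Qed.

Let box_le (T T' : nat) (F : R -> R -> R) : (T <= T')%N ->
  (forall i j : int, 0 <= F i%:~R j%:~R) -> box_sum T F <= box_sum T' F.
Proof.
move=> TT F0.
have intE (k : nat) : k%:R - T'%:R = (k%:Z - T'%:Z)%:~R :> R by rewrite intrD mulrNz.
have key (G : R -> R) : (forall i : int, 0 <= G i%:~R) ->
    \sum_(k < (2 * T).+1) G (k%:R - T%:R) <= \sum_(k < (2 * T').+1) G (k%:R - T'%:R).
  move=> G0; have e : (2 * T').+1 = ((T' - T) + ((2 * T).+1 + (T' - T)))%N by lia.
  rewrite e !big_split_ord/= addrA.
  have -> : \sum_(i < (2 * T).+1) G ((T' - T + i)%:R - T'%:R) = \sum_(k < (2 * T).+1) G (k%:R - T%:R).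
    by apply: eq_bigr => i _; congr G; rewrite natrD natrB//; ring.
  have s1 : 0 <= \sum_(i < T' - T) G (i%:R - T'%:R) by apply: sumr_ge0 => i _; rewrite intE G0.
  have s2 : 0 <= \sum_(i < T' - T) G ((T' - T + ((2 * T).+1 + i))%:R - T'%:R) by apply: sumr_ge0 => i _; rewrite intE G0.
  lra.
rewrite /box_sum (le_trans _ (key (fun x => \sum_(l < (2 * T').+1) F x (l%:R - T'%:R)) _))//.
  apply: ler_sum => k _; apply: (key (F (k%:R - T%:R))) => i.
  by have -> : k%:R - T%:R = (k%:Z - T%:Z)%:~R :> R; [rewrite intrD mulrNz | exact: F0].
by move=> i; apply: sumr_ge0 => l _; rewrite intE.
Qed.

Lemma lap_lnrad_int_ge0 P (i j : int) : 1 <= P -> 0 <= lap (lnrad P) i%:~R j%:~R.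
Proof.
move=> P1; apply: lap_lnrad_ge0 => //; rewrite !intr_eq0.
have sq (k : int) : k != 0 -> 1 <= k ^+ 2 by rewrite expr2; case: (ltgtP k 0) => // *; nia.
have sq0 (k : int) : 0 <= k ^+ 2 by exact: sqr_ge0.
case: (eqVneq i 0) (eqVneq j 0) => [->|i0] [->|j0] //=;
  rewrite -!rmorphXn -intrD -[1]/(1%:~R) ler_int.
- by rewrite expr0n add0r sq.
- by rewrite expr0n addr0 sq.
- by rewrite (le_trans (sq _ i0))// lerDl.
Qed.

(** Box sums of a nonnegative function increase with the box, and for large boxes they are at most
    [2 * pi + 16 / T']. This mass fixes the constant of the lower bound. *)
Lemma box_lap_lnrad P (T : nat) : 1 <= P -> box_sum T (lap (lnrad P)) <= 2 * pi.
Proof.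
move=> P1; rewrite leNgt; apply/negP => h.
pose e := box_sum T (lap (lnrad P)) - 2 * pi.
have e0 : 0 < e by rewrite /e subr_gt0.
pose n := Num.trunc (16 / e).
have nP : 16 / e < n.+1%:R.
  by have /truncn_itv/andP[_] : 0 <= 16 / e by rewrite divr_ge0// ltW.
pose T' := (T + n.+1)%N.
have := @box_le T T' (lap (lnrad P)) (leq_addr _ _) (fun i j => lap_lnrad_int_ge0 i j P1).
rewrite (@box_lap T') => [|x y|x y]; first last.
- by rewrite /lnrad radC.
- by rewrite /lnrad radNl.
have := flux_side P1 (_ : (0 < T')%N); rewrite {1}/T' addnS => /(_ isT).
have h2 : 4 / T'%:R < e / 4.
  rewrite ltr_pdivrMr ?ltr0n /T' ?addnS//.
  have : (n.+1%:R : R) <= (T + n).+1%:R by rewrite ler_nat ltnS leq_addl.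
  move: nP; rewrite ltr_pdivrMr//; nra.
rewrite /e in h2; set S := \sum_(l < _) _; lra.
Qed.

End log_kernel.

(** * Summation by parts on a square and comparison of the logarithm with the Green function *)

Section lattice_green.
Variable R : realType.
Implicit Types (M : nat) (v w p : nat -> nat -> R) (G : R -> R -> R).

Definition neglap v i j : R :=
  4 * v i j - v i.+1 j - v i.-1 j - v i j.+1 - v i j.-1.
Definition d1 v i j : R := v i.+1 j - v i j.
Definition d2 v i j : R := v i j.+1 - v i j.
Definition dirichlet M v : R :=
  \sum_(i < M) \sum_(j < M) (d1 v i j ^+ 2 + d2 v i j ^+ 2).
Definition conv M G p i j : R :=
  \sum_(k < M) \sum_(l < M) G (i%:R - k%:R) (j%:R - l%:R) * p k l.
(** The neighbours of the support stay in the index range, so that the predecessor of 0, which is 0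
    again, and the row [M] only meet zero values. *)
Definition inner_support M v := forall i j, v i j != 0 ->
  (0 < i)%N && (i.+1 < M)%N && (0 < j)%N && (j.+1 < M)%N.

Let sum_shift M (F : nat -> R) : F 0%N = F M ->
  \sum_(i < M) F i.+1 = \sum_(i < M) F i.
Proof.
move=> E; have e : \sum_(i < M.+1) F i = F 0%N + \sum_(i < M) F i.+1 by rewrite big_ord_recl.
by move: e; rewrite big_ord_recr/= E addrC => /addrI->.
Qed.

Let supp0 M v i j : inner_support M v ->
  ~~ ((0 < i)%N && (i.+1 < M)%N && (0 < j)%N && (j.+1 < M)%N) -> v i j = 0.
Proof. by move=> sv; apply: contraNeq => /sv. Qed.

Let sum1p M v (g : R -> R) j : inner_support M v ->
  \sum_(i < M) g i%:R * v i.+1 j = \sum_(i < M) g (i%:R - 1) * v i j.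
Proof.
move=> sv; rewrite -(@sum_shift M (fun i => g (i%:R - 1) * v i j)).
  by apply: eq_bigr => i _; rewrite -natr1 addrK.
by rewrite (supp0 sv) ?[v M _](supp0 sv) ?mulr0//; lia.
Qed.

Let sum1m M v (g : R -> R) j : inner_support M v ->
  \sum_(i < M) g i%:R * v i.-1 j = \sum_(i < M) g (i%:R + 1) * v i j.
Proof.
move=> sv; rewrite -(@sum_shift M (fun i => g i%:R * v i.-1 j)).
  by apply: eq_bigr => i _; rewrite -natr1.
by rewrite (supp0 sv) ?[v M.-1 _](supp0 sv) ?mulr0//; lia.
Qed.

Let transp M v : inner_support M v -> inner_support M (fun i j => v j i).
Proof. by move=> sv i j /sv /andP[/andP[/andP[-> ->] ->] ->]. Qed.

(** The four shifts are moved from [v] to the kernel by reindexing; nothing crosses the border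
    because of the support condition. *)
Let conv_neglap M G v i j : inner_support M v ->
  conv M G (neglap v) i j = - conv M (lap G) v i j.
Proof.
move=> sv.
pose S (F : nat -> nat -> R) := \sum_(k < M) \sum_(l < M) F k l.
have SX F : S F = \sum_(l < M) \sum_(k < M) F k l by rewrite /S exchange_big.
have SB F1 F2 : S (fun k l => F1 k l - F2 k l) = S F1 - S F2.
  by rewrite /S -sumrB; apply: eq_bigr => k _; rewrite -sumrB.
pose g (k l : nat) (a b : R) := G (i%:R - k%:R + a) (j%:R - l%:R + b).
have e1 : S (fun k l => G (i%:R - k%:R) (j%:R - l%:R) * v k.+1 l) =
          S (fun k l => G (i%:R - k%:R + 1) (j%:R - l%:R) * v k l).
  rewrite !SX; apply: eq_bigr => l _.
  rewrite (sum1p (fun t => G (i%:R - t) (j%:R - l%:R)) l sv).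
  by apply: eq_bigr => k _; congr (G _ _ * _); ring.
have e2 : S (fun k l => G (i%:R - k%:R) (j%:R - l%:R) * v k.-1 l) =
          S (fun k l => G (i%:R - k%:R - 1) (j%:R - l%:R) * v k l).
  rewrite !SX; apply: eq_bigr => l _.
  rewrite (sum1m (fun t => G (i%:R - t) (j%:R - l%:R)) l sv).
  by apply: eq_bigr => k _; congr (G _ _ * _); ring.
have e3 : S (fun k l => G (i%:R - k%:R) (j%:R - l%:R) * v k l.+1) =
          S (fun k l => G (i%:R - k%:R) (j%:R - l%:R + 1) * v k l).
  apply: eq_bigr => k _.
  rewrite (sum1p (fun t => G (i%:R - k%:R) (j%:R - t)) k (transp sv)).
  by apply: eq_bigr => l _; congr (G _ _ * _); ring.
have e4 : S (fun k l => G (i%:R - k%:R) (j%:R - l%:R) * v k l.-1) =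
          S (fun k l => G (i%:R - k%:R) (j%:R - l%:R - 1) * v k l).
  apply: eq_bigr => k _.
  rewrite (sum1m (fun t => G (i%:R - k%:R) (j%:R - t)) k (transp sv)).
  by apply: eq_bigr => l _; congr (G _ _ * _); ring.
transitivity (S (fun k l => G (i%:R - k%:R) (j%:R - l%:R) * (4 * v k l)) -
  S (fun k l => G (i%:R - k%:R) (j%:R - l%:R) * v k.+1 l) -
  S (fun k l => G (i%:R - k%:R) (j%:R - l%:R) * v k.-1 l) -
  S (fun k l => G (i%:R - k%:R) (j%:R - l%:R) * v k l.+1) -
  S (fun k l => G (i%:R - k%:R) (j%:R - l%:R) * v k l.-1)).
  rewrite -!SB; apply: eq_bigr => k _; apply: eq_bigr => l _.
  by rewrite /neglap; ring.
rewrite e1 e2 e3 e4 -!SB /conv /S -sumrN; apply: eq_bigr => k _.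
by rewrite -sumrN; apply: eq_bigr => l _; rewrite /lap; ring.
Qed.

Let conv_d1 M G v i j : inner_support M v -> d1 (conv M G v) i j = conv M G (d1 v) i j.
Proof.
move=> sv; rewrite /d1 /conv.
under [in RHS]eq_bigr do (under eq_bigr do rewrite mulrBr; rewrite sumrB).
rewrite sumrB; congr (_ - _); rewrite exchange_big [RHS]exchange_big/=.
apply: eq_bigr => l _; rewrite (sum1p (fun t => G (i%:R - t) (j%:R - l%:R)) l sv).
by apply: eq_bigr => k _; congr (G _ _ * _); rewrite -natr1; ring.
Qed.

Let conv_d2 M G v i j : inner_support M v -> d2 (conv M G v) i j = conv M G (d2 v) i j.
Proof.
move=> sv; rewrite /d2 /conv.
under [in RHS]eq_bigr do (under eq_bigr do rewrite mulrBr; rewrite sumrB).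
rewrite sumrB; congr (_ - _).
apply: eq_bigr => k _; rewrite (sum1p (fun t => G (i%:R - k%:R) (j%:R - t)) k (transp sv)).
by apply: eq_bigr => l _; congr (G _ _ * _); rewrite -natr1; ring.
Qed.

Let by_parts1 M (v w : nat -> R) : v 0%N = 0 -> v M = 0 -> v M.-1 = 0 ->
  \sum_(i < M) (2 * v i - v i.+1 - v i.-1) * w i =
  \sum_(i < M) (v i.+1 - v i) * (w i.+1 - w i).
Proof.
move=> v0 vM vM1.
have e1 : \sum_(i < M) v i.+1 * w i.+1 = \sum_(i < M) v i * w i.
  by apply: (@sum_shift M (fun i => v i * w i)); rewrite v0 vM !mul0r.
have e2 : \sum_(i < M) v i * w i.+1 = \sum_(i < M) v i.-1 * w i.
  by apply: (@sum_shift M (fun i => v i.-1 * w i)); rewrite v0 vM1 !mul0r.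
have -> : \sum_(i < M) (v i.+1 - v i) * (w i.+1 - w i) =
  \sum_(i < M) v i.+1 * w i.+1 - \sum_(i < M) v i.+1 * w i -
  \sum_(i < M) v i * w i.+1 + \sum_(i < M) v i * w i.
  by rewrite -!sumrB -big_split/=; apply: eq_bigr => i _; ring.
rewrite e1 e2 -!sumrB -big_split/=; apply: eq_bigr => i _; ring.
Qed.

Lemma lattice_by_parts M v w : inner_support M v ->
  \sum_(i < M) \sum_(j < M) neglap v i j * w i j =
  \sum_(i < M) \sum_(j < M) (d1 v i j * d1 w i j + d2 v i j * d2 w i j).
Proof.
move=> sv.
have b j : v 0%N j = 0 /\ v M j = 0 /\ v M.-1 j = 0.
  by split; [|split]; apply: (supp0 sv); lia.
have b' j : v j 0%N = 0 /\ v j M = 0 /\ v j M.-1 = 0.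
  by split; [|split]; apply: (supp0 sv); lia.
transitivity (\sum_(i < M) \sum_(j < M) (2 * v i j - v i.+1 j - v i.-1 j) * w i j +
  \sum_(i < M) \sum_(j < M) (2 * v i j - v i j.+1 - v i j.-1) * w i j).
  rewrite -big_split/=; apply: eq_bigr => i _; rewrite -big_split/=; apply: eq_bigr => j _.
  by rewrite /neglap; ring.
transitivity (\sum_(i < M) \sum_(j < M) d1 v i j * d1 w i j +
  \sum_(i < M) \sum_(j < M) d2 v i j * d2 w i j); last first.
  by rewrite -big_split/=; apply: eq_bigr => i _; rewrite -big_split.
congr (_ + _).
  rewrite exchange_big [RHS]exchange_big/=; apply: eq_bigr => j _.
  have [b1 [b2 b3]] := b j.
  exact: (@by_parts1 M (fun i => v i j) (fun i => w i j)).
apply: eq_bigr => i _; have [b1 [b2 b3]] := b' i.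
exact: (@by_parts1 M (fun j => v i j) (fun j => w i j)).
Qed.

Let sum_window M (i : 'I_M) (F : R -> R) : (forall k : int, 0 <= F k%:~R) ->
  \sum_(k < M) F (i%:R - k%:R) <= \sum_(k < (2 * M).+1) F (k%:R - M%:R).
Proof.
move=> F0.
pose phi (k : 'I_M) : 'I_(2 * M).+1 := inord (M + i - k).
have phiE (k : 'I_M) : phi k = (M + i - k)%N :> nat.
  by rewrite /phi inordK//; have := ltn_ord i; lia.
have phi_inj : injective phi.
  move=> a b /(congr1 (@nat_of_ord _)); rewrite !phiE => h; apply/val_inj => /=.
  by have := ltn_ord a; have := ltn_ord b; lia.
have -> : \sum_(k < M) F (i%:R - k%:R) = \sum_(k in phi @: 'I_M) F (k%:R - M%:R).
  rewrite big_imset/=; last by move=> a b _ _; exact: phi_inj.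
  apply: eq_big => [k|k _]; first by rewrite inE.
  by rewrite phiE natrB ?natrD; [congr F; ring | have := ltn_ord k; lia].
rewrite [leRHS](bigID (mem (phi @: 'I_M)))/= lerDl sumr_ge0// => k _.
by have -> : k%:R - M%:R = (k%:Z - M%:Z)%:~R :> R; [rewrite intrD mulrNz | exact: F0].
Qed.

(** Schur's test: [2 * a * b <= a ^+ 2 + b ^+ 2] for a nonnegative symmetric kernel whose row sums
    are at most [box_sum M G]. *)
Let conv_young M G p : (forall i j : int, 0 <= G i%:~R j%:~R) ->
  (forall x y : R, G (- x) (- y) = G x y) ->
  \sum_(i < M) \sum_(j < M) p i j * conv M G p i j <=
  box_sum M G * \sum_(i < M) \sum_(j < M) p i j ^+ 2.
Proof.
move=> G0 GN.
have Gint (i j k l : nat) : 0 <= G (i%:R - k%:R) (j%:R - l%:R).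
  have e (a b : nat) : a%:R - b%:R = (a%:Z - b%:Z)%:~R :> R by rewrite intrD mulrNz.
  by rewrite !e G0.
have window (i j : 'I_M) : \sum_(k < M) \sum_(l < M) G (i%:R - k%:R) (j%:R - l%:R) <= box_sum M G.
  rewrite (le_trans (@sum_window M i (fun t => \sum_(l < M) G t (j%:R - l%:R)) _))//.
    move=> k; apply: sumr_ge0 => l _.
    by have -> : j%:R - l%:R = (j%:Z - l%:Z)%:~R :> R; [rewrite intrD mulrNz | exact: G0].
  apply: ler_sum => k _; apply: (@sum_window M j (fun t => G (k%:R - M%:R) t)) => l.
  by have -> : k%:R - M%:R = (k%:Z - M%:Z)%:~R :> R; [rewrite intrD mulrNz | exact: G0].
pose Q (i j k l : nat) := G (i%:R - k%:R) (j%:R - l%:R).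
have QC i j k l : Q i j k l = Q k l i j.
  by rewrite /Q -GN !opprB.
pose T := \sum_(i < M) \sum_(j < M) \sum_(k < M) \sum_(l < M) Q i j k l * (p i j ^+ 2).
have T1 : T <= box_sum M G * \sum_(i < M) \sum_(j < M) p i j ^+ 2.
  rewrite /T mulr_sumr; apply: ler_sum => i _; rewrite mulr_sumr; apply: ler_sum => j _.
  under eq_bigr do rewrite -mulr_suml.
  by rewrite -mulr_suml ler_wpM2r ?sqr_ge0// window.
have T2 : T = \sum_(i < M) \sum_(j < M) \sum_(k < M) \sum_(l < M) Q i j k l * (p k l ^+ 2).
  have X4 (F : nat -> nat -> nat -> nat -> R) :
    \sum_(i < M) \sum_(j < M) \sum_(k < M) \sum_(l < M) F i j k l =
    \sum_(k < M) \sum_(l < M) \sum_(i < M) \sum_(j < M) F i j k l.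
    rewrite (pair_bigA _ (fun i j : 'I_M => \sum_(k < M) \sum_(l < M) F i j k l))/=.
    rewrite (pair_bigA _ (fun k l : 'I_M => \sum_(i < M) \sum_(j < M) F i j k l))/=.
    under eq_bigr => q _ do rewrite (pair_bigA _ (fun k l : 'I_M => F q.1 q.2 k l))/=.
    rewrite exchange_big/=; apply: eq_bigr => q _.
    by rewrite (pair_bigA _ (fun i j : 'I_M => F i j q.1 q.2)).
  rewrite /T (X4 (fun i j k l => Q i j k l * p i j ^+ 2)); apply: eq_bigr => i _; apply: eq_bigr => j _; apply: eq_bigr => k _; apply: eq_bigr => l _.
  by rewrite QC.
suff : 2 * (\sum_(i < M) \sum_(j < M) p i j * conv M G p i j) <= T + T by lra.
rewrite [X in _ <= _ + X]T2 -big_split mulr_sumr; apply: ler_sum => i _ /=.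
rewrite -big_split mulr_sumr; apply: ler_sum => j _ /=.
rewrite -big_split /conv !mulr_sumr; apply: ler_sum => k _ /=.
rewrite -big_split !mulr_sumr; apply: ler_sum => l _ /=.
have := Gint i j k l; have := sqr_ge0 (p i j - p k l); rewrite -/(Q i j k l).
move=> s q; have : 0 <= Q i j k l * (p i j - p k l) ^+ 2 by rewrite mulr_ge0.
lra.
Qed.

(** One Laplacian goes onto the logarithm, and half of the other one onto each factor; what remains
    is a convolution with the nonnegative kernel [lap (lnrad P)] of mass at most [2 * pi]. As a form
    on Laplacians, minus the regularised logarithm is at most [2 * pi] times the Green function. *)
Lemma neglap_lnrad_le (P : R) M v : 1 <= P -> inner_support M v ->
  \sum_(i < M) \sum_(j < M) \sum_(k < M) \sum_(l < M)
    neglap v i j * neglap v k l * - lnrad P (i%:R - k%:R) (j%:R - l%:R) <=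
  2 * pi * dirichlet M v.
Proof.
move=> P1 sv; set A := lap (lnrad P).
have A0 (i j : int) : 0 <= A i%:~R j%:~R by exact: lap_lnrad_int_ge0.
have AN x y : A (- x) (- y) = A x y by exact: lapN.
have -> : \sum_(i < M) \sum_(j < M) \sum_(k < M) \sum_(l < M)
    neglap v i j * neglap v k l * - lnrad P (i%:R - k%:R) (j%:R - l%:R) =
  \sum_(i < M) \sum_(j < M) neglap v i j * conv M A v i j.
  apply: eq_bigr => i _; apply: eq_bigr => j _.
  rewrite -[conv M A v i j]opprK -conv_neglap// mulrN /conv mulr_sumr -sumrN.
  apply: eq_bigr => k _; rewrite mulr_sumr -sumrN; apply: eq_bigr => l _.
  ring.
rewrite lattice_by_parts//.
under eq_bigr do under eq_bigr do rewrite conv_d1// conv_d2//.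
under eq_bigr do rewrite big_split/=.
rewrite big_split/=.
rewrite (le_trans (lerD (@conv_young M A (d1 v) A0 AN) (@conv_young M A (d2 v) A0 AN)))//.
rewrite -mulrDr -big_split/=.
have -> : \sum_(i < M) (\sum_(j < M) d1 v i j ^+ 2 + \sum_(j < M) d2 v i j ^+ 2) = dirichlet M v.
  by apply: eq_bigr => i _; rewrite -big_split.
rewrite ler_wpM2r ?box_lap_lnrad//.
by apply: sumr_ge0 => i _; apply: sumr_ge0 => j _; rewrite addr_ge0 ?sqr_ge0.
Qed.

End lattice_green.

(** * The truncated logarithm as a positive combination of exponentials *)

Section truncated_kernel.
Variable R : realType.
Implicit Types (M n J : nat) (h P r s x : R).

Definition grid_pt M (x : 'I_M * 'I_M) : R * R := (x.1%:R, x.2%:R).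
Definition grid_dist M (x y : 'I_M * 'I_M) : R := dist2 (grid_pt x) (grid_pt y).

(** A window of the series of [- ln (1 - expR (- (h * (r + P))))], which for small [h] is close to
    [- ln (r + P) - ln h]. Dropping the terms before [j0] cuts the logarithm at distances of order
    [1 / (j0 * h)]; dropping those from [j0 + n] on flattens it at distances below
    [1 / ((j0 + n) * h)]. Positive coefficients keep the kernel within reach of the [charge_kernel]
    calculus. *)
Definition kap h P j0 n r : R :=
  \sum_(i < n) (j0 + i)%:R^-1 * expR (- ((j0 + i)%:R * h * (r + P))).

Lemma grid_distE M (x y : 'I_M * 'I_M) :
  grid_dist x y = rad (x.1%:R - y.1%:R) (x.2%:R - y.2%:R).
Proof. by []. Qed.

Lemma grid_dist_ge0 M (x y : 'I_M * 'I_M) : 0 <= grid_dist x y.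
Proof. exact: sqrtr_ge0. Qed.

Lemma grid_dist_le M (x y : 'I_M * 'I_M) : grid_dist x y <= 2 * M%:R.
Proof.
have b (i k : 'I_M) : ((i%:R : R) - k%:R) ^+ 2 <= M%:R ^+ 2.
  have hi : (i%:R : R) <= M%:R by rewrite ler_nat ltnW.
  have hk : (k%:R : R) <= M%:R by rewrite ler_nat ltnW.
  have i0 : 0 <= (i%:R : R) := ler0n _ _.
  have k0 : 0 <= (k%:R : R) := ler0n _ _.
  nra.
rewrite -ler_sqr ?nnegrE ?grid_dist_ge0 ?mulr_ge0// sqr_sqrtr ?addr_ge0 ?sqr_ge0//=.
have := b x.1 y.1; have := b x.2 y.2; have := sqr_ge0 (M%:R : R).
rewrite exprMn; lra.
Qed.

Let charge_kernel_dist_sum M h P (m n : nat) : 0 <= h ->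
  charge_kernel (fun x y : 'I_M * 'I_M => \sum_(i < n) (m + i)%:R^-1 *
      expR (- ((m + i)%:R * h * (grid_dist x y + P))))
    (\sum_(i < n) (m + i)%:R^-1 * expR (- ((m + i)%:R * h * P))).
Proof.
move=> h0; elim: n => [|n IH].
  rewrite big_ord0; move: (@charge_kernel0 R ('I_M * 'I_M)%type); congr charge_kernel.
  by apply/funext => x; apply/funext => y; rewrite big_ord0.
rewrite big_ord_recr/=.
have w0 : 0 <= (m + n)%:R^-1 * expR (- ((m + n)%:R * h * P)).
  by rewrite mulr_ge0 ?invr_ge0 ?expR_ge0.
have t0 : 0 <= (m + n)%:R * h by rewrite mulr_ge0.
have := charge_kernelD IH (charge_kernelZ w0 (charge_kernel_dist (@grid_pt M) t0)).
rewrite mulr1; congr charge_kernel; apply/funext => x; apply/funext => y.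
rewrite [RHS]big_ord_recr/=; congr (_ + _).
rewrite -[LHS]mulrA; congr (_ * _); rewrite -[LHS]expRD; congr expR.
by rewrite /grid_dist; ring.
Qed.

Lemma charge_kernel_kap M h P j0 n : 0 <= h ->
  charge_kernel (fun x y : 'I_M * 'I_M => kap h P j0 n (grid_dist x y)) (kap h P j0 n 0).
Proof.
move=> h0; have := @charge_kernel_dist_sum M h P j0 n h0; congr charge_kernel.
by rewrite /kap; apply: eq_bigr => i _; rewrite add0r.
Qed.

Lemma kap_ge0 h P j0 n r : 0 <= kap h P j0 n r.
Proof. by apply: sumr_ge0 => i _; rewrite mulr_ge0 ?invr_ge0 ?expR_ge0. Qed.

(** Every term has slope at most [h]: the factor that differentiation brings down cancels the
    coefficient. *)
Lemma kap_slope h P j0 n r : 0 <= h -> 0 <= P -> 0 <= r <= 1 ->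
  kap h P j0 n 0 - kap h P j0 n r <= n%:R * h.
Proof.
move=> h0 P0 /andP[r0 r1]; rewrite /kap -sumrB.
rewrite (@le_trans _ _ (\sum_(i < n) h))//; last by rewrite sumr_const card_ord -[leLHS]mulr_natl.
apply: ler_sum => i _; rewrite -mulrBr add0r.
set j : R := (j0 + i)%:R; have j_0 : 0 <= j := ler0n _ _.
have -> : expR (- (j * h * (r + P))) = expR (- (j * h * P)) * expR (- (j * h * r)).
  by rewrite -expRD; congr expR; ring.
rewrite -{1}[expR (- (j * h * P))]mulr1 -mulrBr.
have e1 : expR (- (j * h * P)) <= 1 by rewrite -expR0 ler_expR oppr_le0 !mulr_ge0.
have e0 : 0 <= expR (- (j * h * P)) := expR_ge0 _.
have e2 : 1 - expR (- (j * h * r)) <= j * h.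
  have := expR_ge1Dx (- (j * h * r)); have : j * h * r <= j * h by rewrite ler_piMr ?mulr_ge0.
  lra.
have e3 : 0 <= 1 - expR (- (j * h * r)) by rewrite subr_ge0 -expR0 ler_expR oppr_le0 !mulr_ge0.
have e4 : expR (- (j * h * P)) * (1 - expR (- (j * h * r))) <= j * h by nra.
have [->|jn] := eqVneq j 0; first by rewrite invr0 mul0r.
have jp : 0 < j by rewrite lt_neqAle eq_sym jn.
by rewrite -ler_pdivlMl ?invr_gt0// invrK.
Qed.

Let ln_ratio (k : nat) : (0 < k)%N -> ln (k.+1%:R / k%:R) <= (k%:R : R)^-1.
Proof.
move=> k0; have kp : 0 < (k%:R : R) by rewrite ltr0n.
rewrite (le_trans (ln_leB1 _)) ?divr_gt0// -natr1 mulrDl divff ?gt_eqF// mul1r; lra.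
Qed.

Let ratio_mul (a b c : R) : a != 0 -> b != 0 -> c / a = b / a * (c / b).
Proof. by move=> a0 b0; field; rewrite a0 b0. Qed.

Let harmonic_ge j0 n : (0 < j0)%N ->
  ln ((j0 + n)%:R / j0%:R) <= \sum_(i < n) ((j0 + i)%:R : R)^-1.
Proof.
move=> j00; have jp : 0 < (j0%:R : R) by rewrite ltr0n.
elim: n => [|n IH]; first by rewrite big_ord0 addn0 divff ?gt_eqF// ln1.
rewrite big_ord_recr/=; have jn : (0 < j0 + n)%N by rewrite addn_gt0 j00.
have jnp : 0 < ((j0 + n)%:R : R) by rewrite ltr0n.
have -> : ((j0 + n.+1)%:R / j0%:R : R) = ((j0 + n)%:R / j0%:R) * ((j0 + n).+1%:R / (j0 + n)%:R).
  by rewrite addnS; apply: ratio_mul; rewrite gt_eqF.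
rewrite lnM ?posrE ?divr_gt0// ?ltr0n//.
exact: lerD IH (ln_ratio jn).
Qed.

Let harmonic_le j0 n : (0 < j0)%N ->
  \sum_(i < n) ((j0 + i)%:R : R)^-1 <= 1 + ln ((j0 + n)%:R / j0%:R).
Proof.
move=> j00; have jp : 0 < (j0%:R : R) by rewrite ltr0n.
have j1 : (j0%:R : R)^-1 <= 1 by rewrite invf_le1// ler1n.
elim: n => [|n IH]; first by rewrite big_ord0 addn0 divff ?gt_eqF// ln1; lra.
suff : \sum_(i < n.+1) ((j0 + i)%:R : R)^-1 <= (j0%:R)^-1 + ln ((j0 + n)%:R / j0%:R).
  move=> /le_trans; apply.
  have : ln ((j0 + n)%:R / j0%:R) <= ln ((j0 + n.+1)%:R / j0%:R) :> R.
    rewrite ler_ln ?posrE ?divr_gt0 ?ltr0n ?addn_gt0 ?j00// ler_pM2r ?invr_gt0//.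
    by rewrite ler_nat addnS leqnSn.
  lra.
elim: n {IH} => [|n IH].
  by rewrite big_ord_recr big_ord0/= addn0 divff ?gt_eqF// ln1 add0r addr0.
rewrite big_ord_recr/=; have jn : (0 < j0 + n)%N by rewrite addn_gt0 j00.
have jnp : 0 < ((j0 + n)%:R : R) by rewrite ltr0n.
have jnp1 : 0 < ((j0 + n.+1)%:R : R) by rewrite ltr0n addnS.
have -> : ((j0 + n.+1)%:R / j0%:R : R) = ((j0 + n)%:R / j0%:R) * ((j0 + n.+1)%:R / (j0 + n)%:R).
  by apply: ratio_mul; rewrite gt_eqF.
rewrite lnM ?posrE ?divr_gt0//.
have : ((j0 + n.+1)%:R : R)^-1 <= ln ((j0 + n.+1)%:R / (j0 + n)%:R).
  apply: le_trans (ln_ge1BV _); last by rewrite divr_gt0.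
  rewrite invf_div.
  have -> : (j0 + n)%:R = (j0 + n.+1)%:R - 1 :> R by rewrite addnS -natr1 addrK.
  by rewrite mulrBl divff ?gt_eqF// mul1r; lra.
lra.
Qed.

Lemma kap0_ge h P j0 n : 0 <= h -> 0 <= P -> (0 < j0)%N ->
  expR (- ((j0 + n)%:R * h * P)) * ln ((j0 + n)%:R / j0%:R) <= kap h P j0 n 0.
Proof.
move=> h0 P0 j00; rewrite (@le_trans _ _ (expR (- ((j0 + n)%:R * h * P)) *
   \sum_(i < n) ((j0 + i)%:R)^-1))//; first by rewrite ler_wpM2l ?expR_ge0// harmonic_ge.
rewrite mulr_sumr; apply: ler_sum => i _; rewrite mulrC ler_wpM2l ?invr_ge0//.
rewrite ler_expR lerN2 add0r -!mulrA ler_wpM2r ?mulr_ge0// ler_nat leq_add2l ltnW//.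
Qed.

Lemma kap0_le h P j0 n : 0 <= h -> 0 <= P -> (0 < j0)%N ->
  kap h P j0 n 0 <= 1 + ln ((j0 + n)%:R / j0%:R).
Proof.
move=> h0 P0 j00; apply: le_trans (harmonic_le n j00).
apply: ler_sum => i _; rewrite ler_piMr ?invr_ge0//.
by rewrite -[leRHS]expR0 ler_expR oppr_le0 add0r !mulr_ge0.
Qed.

Let geo_id (q : R) (n : nat) : (\sum_(i < n) q ^+ i) * (1 - q) = 1 - q ^+ n.
Proof.
rewrite -[in RHS](expr1n R n) subrXX mulrC; congr (_ * _).
by apply: eq_bigr => i _; rewrite expr1n mul1r.
Qed.

Let geo_sum (q : R) (n : nat) : 0 <= q < 1 -> \sum_(i < n) q ^+ i <= (1 - q)^-1.
Proof.
move=> /andP[q0 q1]; have d : 0 < 1 - q by rewrite subr_gt0.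
rewrite -[leRHS]mul1r ler_pdivlMr//.
rewrite geo_id.
by rewrite lerBlDr lerDl exprn_ge0.
Qed.

Let exp_abs_sum M (a : R) (i : 'I_M) : 0 < a <= 1 ->
  \sum_(k < M) expR (- (a * `|i%:R - k%:R|)) <= 4 / a.
Proof.
move=> /andP[a0 a1].
pose q := expR (- a).
have q01 : 0 <= q < 1 by rewrite expR_ge0/= -expR0 ltr_expR oppr_lt0.
have qle : (1 - q)^-1 <= 2 / a.
  rewrite -[leRHS]invrK invf_div lef_pV2 ?posrE ?subr_gt0 ?divr_gt0//; last by case/andP: q01.
  have : expR a * q = 1 by rewrite /q -expRD subrr expR0.
  have := expR_ge1Dx a; case/andP: q01 => q0 q1 h1 h2.
  nra.
have b (k : 'I_M) : expR (- (a * `|i%:R - k%:R|)) <= q ^+ (i - k) * (k <= i)%:R + q ^+ (k - i) * (i <= k)%:R.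
  have e (m : nat) : expR (- (a * m%:R)) = q ^+ m by rewrite /q -expRM_natl; congr expR; ring.
  have [ki|ik] := leqP k i.
    rewrite ger0_norm ?subr_ge0 ?ler_nat// -natrB// e mulr1 lerDl mulr_ge0 ?exprn_ge0//.
    by case/andP: q01.
  rewrite ltr0_norm ?subr_lt0 ?ltr_nat// opprB -natrB ?(ltnW ik)// e mulr0 add0r.
  by rewrite mulr1.
rewrite (le_trans (ler_sum _ (fun k _ => b k)))// big_split/=.
have s1 : \sum_(k < M) q ^+ (i - k) * (k <= i)%:R <= (1 - q)^-1.
  apply: le_trans (geo_sum i.+1 q01).
  have -> : \sum_(k < M) q ^+ (i - k) * (k <= i)%:R = \sum_(k < i.+1) q ^+ (i - k).
    rewrite (big_ord_widen M (fun k => q ^+ (i - k)) (ltn_ord i)) [RHS]big_mkcond/=.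
    by apply: eq_bigr => k _; rewrite ltnS; case: ifP => _; rewrite ?mulr1 ?mulr0.
  rewrite (reindex_inj rev_ord_inj)/=; apply: ler_sum => k _.
  by rewrite subSS subKn// -ltnS.
have s2 : \sum_(k < M) q ^+ (k - i) * (i <= k)%:R <= (1 - q)^-1.
  apply: le_trans (geo_sum (M - i) q01).
  have -> : \sum_(k < M) q ^+ (k - i) * (i <= k)%:R = \sum_(i <= k < M) q ^+ (k - i).
    rewrite (@big_nat_widenl _ _ _ i 0%N)// big_mkord [RHS]big_mkcond/=; apply: eq_bigr => k _.
    by case: ifP => _; rewrite ?mulr1 ?mulr0.
  by rewrite -{1}[nat_of_ord i]add0n big_addn big_mkord; apply: ler_sum => k _; rewrite addnK.
lra.
Qed.

(** All terms decay at least like [expR (- (j0%:R * h * r))]. The distance dominates half the sum of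
    the coordinate differences, so the sum over the lattice is at most a product of two geometric
    sums. *)
Lemma kap_sum_le M h P j0 n (x : 'I_M * 'I_M) : 0 < h -> 0 <= P -> (0 < j0)%N ->
  j0%:R * h <= 1 ->
  \sum_y kap h P j0 n (grid_dist x y) <= kap h P j0 n 0 * (64 / (j0%:R * h) ^+ 2).
Proof.
move=> h0 P0 j00 t1; set t := j0%:R * h.
have jp : 0 < (j0%:R : R) by rewrite ltr0n.
have t0 : 0 < t by rewrite mulr_gt0.
have kb r : 0 <= r -> kap h P j0 n r <= kap h P j0 n 0 * expR (- (t * r)).
  move=> r0; rewrite /kap mulr_suml; apply: ler_sum => i _.
  rewrite -[leRHS]mulrA ler_wpM2l ?invr_ge0// -expRD ler_expR add0r.
  have : t * r <= (j0 + i)%:R * h * r.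
    by rewrite /t !ler_wpM2r ?(ltW h0)// ler_nat leq_addr.
  lra.
rewrite (le_trans (ler_sum _ (fun y _ => kb _ (grid_dist_ge0 x y))))// -mulr_sumr.
rewrite ler_wpM2l ?kap_ge0//.
have b (y : 'I_M * 'I_M) : expR (- (t * grid_dist x y)) <=
   expR (- (t / 2 * `|x.1%:R - y.1%:R|)) * expR (- (t / 2 * `|x.2%:R - y.2%:R|)).
  rewrite -expRD ler_expR -opprD lerN2 -mulrDr -mulrA ler_pM2l// .
  rewrite grid_distE; set a := _ - _; set c := _ - _.
  have : `|a| <= rad a c.
    by rewrite -ler_sqr ?nnegrE ?rad_ge0// rad_sqr real_normK ?num_real// lerDl sqr_ge0.
  have : `|c| <= rad a c.
    by rewrite -ler_sqr ?nnegrE ?rad_ge0// rad_sqr real_normK ?num_real// lerDr sqr_ge0.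
  lra.
rewrite (le_trans (ler_sum _ (fun y _ => b y)))//.
rewrite -(pair_bigA _ (fun i k : 'I_M => expR (- (t / 2 * `|x.1%:R - i%:R|)) * expR (- (t / 2 * `|x.2%:R - k%:R|))))/=.
under eq_bigr do rewrite -mulr_sumr.
rewrite -mulr_suml.
have t2 : 0 < t / 2 <= 1 by apply/andP; split; rewrite /t in t0 *; lra.
have -> : 64 / t ^+ 2 = (4 / (t / 2)) * (4 / (t / 2)) by field; rewrite gt_eqF.
by apply: ler_pM (exp_abs_sum x.1 t2) (exp_abs_sum x.2 t2); apply: sumr_ge0 => k _; exact: expR_ge0.
Qed.

(** The difference vanishes at 0 and has derivative [x ^+ J / (1 - x)]; the mean value theorem does
    the rest. *)
Let log_series J (q : R) : 0 < q < 1 ->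
  0 <= - ln (1 - q) - \sum_(j < J) q ^+ j.+1 / j.+1%:R <= q ^+ J.+1 / (1 - q).
Proof.
move=> /andP[q0 q1].
pose F (x : R) := - ln (1 - x) - \sum_(j < J) x ^+ j.+1 / j.+1%:R.
have d1mx (x : R) : is_derive x (1 : R) (fun x : R => 1 - x) (-1).
  apply: is_derive_eq.
  ring.
have dX (x : R) n : is_derive x (1 : R) (fun y : R => y ^+ n.+1 / n.+1%:R) (x ^+ n).
  have := is_deriveM (is_deriveX n.+1 (@is_derive_id R R x 1)) (@is_derive_cst R R R (n.+1%:R^-1) x 1).
  rewrite functions.mulrfctE functions.exprfctE.
  move=> H; apply: (is_derive_eq H); rewrite /GRing.scale/=.
  by rewrite mulr0 add0r mulr1 mulrA mulVf ?mul1r// pnatr_eq0.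
have dS (x : R) n : is_derive x (1 : R) (fun x : R => \sum_(j < n) x ^+ j.+1 / j.+1%:R) (\sum_(j < n) x ^+ j).
  elim: n => [|n IH].
    rewrite big_ord0; apply: (@is_derive_eq _ _ _ _ _ _ 0) => //.
    under eq_fun do rewrite big_ord0; exact: is_derive_cst.
  under eq_fun do rewrite big_ord_recr/=.
  rewrite big_ord_recr/=; apply: is_deriveD.
have dF (x : R) : x < 1 -> is_derive x (1 : R) F (x ^+ J / (1 - x)).
  move=> x1; have h1 : 0 < 1 - x by rewrite subr_gt0.
  have dl : is_derive (1 - x) (1 : R) (@ln R) (1 - x)^-1 by exact: is_derive1_ln.
  have := dS x J => dSx.
  have dl2 : is_derive x (1 : R) (fun x : R => ln (1 - x)) (- (1 - x)^-1).
    have := @is_derive1_comp R (@ln R) (fun x => 1 - x) x _ _ dl (_ : is_derive x (1 : R) (fun x : R => 1 - x) (-1)).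
    move=> H; apply: (@is_derive_eq _ _ _ _ _ _ _ _ (H _)); last by rewrite mulrN1.
  apply: is_derive_eq.
  have -> : \sum_(j < J) x ^+ j = (1 - x ^+ J) / (1 - x).
    by rewrite -geo_id mulfK ?gt_eqF.
  by rewrite opprK; field; rewrite gt_eqF.
have [||c] := @MVT _ F (fun x => x ^+ J / (1 - x)) 0 q q0.
  by move=> x; rewrite in_itv/= => /andP[_ xq]; apply: dF; lra.
  apply: derivable_within_continuous => x; rewrite in_itv/= => /andP[_ xq].
  by have [] : is_derive x (1 : R) F (x ^+ J / (1 - x)) by apply: dF; lra.
rewrite in_itv/= => /andP[c0 cq].
have -> : F 0 = 0.
  by rewrite /F subr0 ln1 oppr0 sub0r big1 ?oppr0// => j _; rewrite expr0n mul0r.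
rewrite !subr0 -/(F q) => ->.
have cc : 0 < 1 - c by lra.
have qq : 0 < 1 - q by lra.
apply/andP; split; first by rewrite !mulr_ge0 ?invr_ge0 ?exprn_ge0 ?(ltW c0) ?(ltW cc) ?(ltW q0).
have -> : q ^+ J.+1 / (1 - q) = q ^+ J / (1 - q) * q by rewrite exprSr mulrAC.
rewrite ler_pM2r// ler_pM ?exprn_ge0 ?invr_ge0 ?(ltW c0) ?(ltW cc)//.
  by rewrite lerXn2r ?nnegrE ?(ltW c0) ?(ltW q0) ?(ltW cq).
by rewrite lef_pV2 ?posrE//; lra.
Qed.

Let ln_1mexp s : 0 < s -> 0 <= ln s - ln (1 - expR (- s)) <= s.
Proof.
move=> s0; have e1 : expR (- s) < 1 by rewrite -expR0 ltr_expR oppr_lt0.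
have d : 0 < 1 - expR (- s) by rewrite subr_gt0.
have h1 : 1 - expR (- s) <= s by have := expR_ge1Dx (- s); lra.
have h2 : s * expR (- s) <= 1 - expR (- s).
  have : expR s * expR (- s) = 1 by rewrite -expRD subrr expR0.
  have := expR_ge1Dx s; have := expR_gt0 (- s); nra.
apply/andP; split; first by rewrite subr_ge0 ler_ln ?posrE.
have : ln (s * expR (- s)) <= ln (1 - expR (- s)) by rewrite ler_ln ?posrE ?mulr_gt0 ?expR_gt0.
rewrite lnM ?posrE ?expR_gt0// expRK; lra.
Qed.

Let full_sum h P J r : 0 < h -> 0 < P -> 0 <= r ->
  `|\sum_(j < J) j.+1%:R^-1 * expR (- (j.+1%:R * h * (r + P))) - (- ln (r + P) - ln h)|
  <= h * (r + P) + expR (- (h * P)) ^+ J.+1 / (1 - expR (- (h * P))).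
Proof.
move=> h0 P0 r0; pose s := h * (r + P).
have s0 : 0 < s by rewrite mulr_gt0// ltr_wpDl.
have q01 : 0 < expR (- s) < 1 by rewrite expR_gt0 -expR0 ltr_expR oppr_lt0.
have := log_series J q01; set q := expR (- s) in q01 *.
have -> : \sum_(j < J) q ^+ j.+1 / j.+1%:R = \sum_(j < J) j.+1%:R^-1 * expR (- (j.+1%:R * h * (r + P))).
  by apply: eq_bigr => j _; rewrite mulrC /q -expRM_natl; congr (_ * expR _); rewrite /s; ring.
set S := \sum_(j < J) _; move=> /andP[a1 a2].
have := ln_1mexp s0; rewrite -/q => /andP[b1 b2].
have ls : ln s = ln h + ln (r + P) by rewrite /s lnM ?posrE// ltr_wpDl.
have hP : 0 < h * P by rewrite mulr_gt0.
have qq : q <= expR (- (h * P)) by rewrite /q ler_expR lerN2 /s ler_wpM2l ?(ltW h0)// lerDr.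
have e1 : expR (- (h * P)) < 1 by rewrite -expR0 ltr_expR oppr_lt0.
have c : q ^+ J.+1 / (1 - q) <= expR (- (h * P)) ^+ J.+1 / (1 - expR (- (h * P))).
  case/andP: q01 => q0 q1.
  rewrite ler_pM ?exprn_ge0 ?invr_ge0 ?expR_ge0 ?subr_ge0 ?(ltW q1)//.
    by rewrite lerXn2r ?nnegrE ?expR_ge0.
  by rewrite lef_pV2 ?posrE; lra.
rewrite -/s ler_norml; apply/andP; split; lra.
Qed.

Definition grid_neglap M (v : nat -> nat -> R) (x : 'I_M * 'I_M) : R := neglap v x.1 x.2.

(** The terms missing from the window form positive semidefinite kernels, so the window is smaller
    as a form than a long partial sum of the series. On the square that sum is uniformly close to
    [- ln (r + P) - ln h], and the constant [- ln h], large as it is, disappears because a Laplacian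
    has zero sum. *)
Lemma quadf_kap_le M (P eta : R) : 1 <= P -> 0 < eta -> exists2 h0 : R, 0 < h0 &
  forall h j0 n (v : nat -> nat -> R), 0 < h < h0 -> (0 < j0)%N -> inner_support M v ->
  quadf (fun x y : 'I_M * 'I_M => kap h P j0 n (grid_dist x y)) (@grid_neglap M v) <=
  2 * pi * dirichlet M v + eta * norm1 (@grid_neglap M v) ^+ 2.
Proof.
move=> P1 eta0; have P0 : 0 < P by lra.
have B0 : 0 < 2 * M%:R + P by rewrite ltr_wpDl// mulr_ge0.
exists (eta / 2 / (2 * M%:R + P)); first by rewrite !divr_gt0.
move=> h j0 n v /andP[h0 hh] j00 sv; set f := @grid_neglap M v.
pose q := expR (- (h * P)).
have hP : 0 < h * P by rewrite mulr_gt0.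
have q1 : 0 < 1 - q by rewrite subr_gt0 -expR0 ltr_expR oppr_lt0.
(* Long enough for the tail of the series to be at most [eta / 2], by
   [(1 + x) * expR (- x) <= 1]. *)
pose J0 := Num.trunc (2 / (eta * (1 - q)) / (h * P)).
pose J := (J0 + (j0 + n))%N.
have Jb : q ^+ J.+1 / (1 - q) <= eta / 2.
  have eq0 : 0 < eta * (1 - q) by rewrite mulr_gt0.
  have JP : 2 / (eta * (1 - q)) <= 1 + J.+1%:R * (h * P).
    have /truncn_itv/andP[_] : 0 <= 2 / (eta * (1 - q)) / (h * P) by rewrite !divr_ge0// ltW.
    rewrite -/J0 ltr_pdivrMr// => lt1.
    have : (J0.+1%:R : R) <= J.+1%:R by rewrite ler_nat ltnS leq_addr.
    move=> /(ler_wpM2r (ltW hP)); lra.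
  have qJ : q ^+ J.+1 * (1 + J.+1%:R * (h * P)) <= 1.
    have -> : q ^+ J.+1 = expR (- (J.+1%:R * (h * P))).
      by rewrite /q -expRM_natl; congr expR; ring.
    have := expR_ge1Dx (J.+1%:R * (h * P)); have := expR_ge0 (- (J.+1%:R * (h * P))).
    have : expR (J.+1%:R * (h * P)) * expR (- (J.+1%:R * (h * P))) = 1 by rewrite -expRD subrr expR0.
    nra.
  rewrite ler_pdivrMr//.
  have qJ0 : 0 <= q ^+ J.+1 by rewrite exprn_ge0 ?expR_ge0.
  have : q ^+ J.+1 * (2 / (eta * (1 - q))) <= 1 by rewrite (le_trans _ qJ)// ler_wpM2l.
  rewrite mulrA ler_pdivrMr//; lra.
pose K1 (x y : 'I_M * 'I_M) := \sum_(j < J) j.+1%:R^-1 * expR (- (j.+1%:R * h * (grid_dist x y + P))).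
pose e (x y : 'I_M * 'I_M) (j : nat) : R := j%:R^-1 * expR (- (j%:R * h * (grid_dist x y + P))).
have quadfD (K K' : 'I_M * 'I_M -> 'I_M * 'I_M -> R) :
    quadf (fun x y : ('I_M * 'I_M)%type => K x y + K' x y) f = quadf K f + quadf K' f.
  by rewrite /quadf -big_split; apply: eq_bigr => x _; rewrite -big_split; apply: eq_bigr => y _; rewrite mulrDr.
have psd_e (a b : nat) : 0 <= quadf (fun x y : ('I_M * 'I_M)%type => \sum_(i < b) e x y (a + i)%N) f.
  exact: charge_kernel_psd (@charge_kernel_dist_sum M h P a b (ltW h0)).
have [J2 JE] : exists J2, J = (j0.-1 + n + J2)%N.
  by exists (J - (j0.-1 + n))%N; rewrite subnKC// /J addnA leq_add2r (leq_trans (leq_pred _))// leq_addl.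
have step1 : quadf (fun x y : ('I_M * 'I_M)%type => kap h P j0 n (grid_dist x y)) f <= quadf K1 f.
  have -> : K1 = (fun x y : ('I_M * 'I_M)%type => (\sum_(i < j0.-1) e x y (1 + i)%N + kap h P j0 n (grid_dist x y)) +
      \sum_(i < J2) e x y ((j0 + n) + i)%N).
    apply/funext => x; apply/funext => y; rewrite /K1.
    have -> : \sum_(j < J) j.+1%:R^-1 * expR (- (j.+1%:R * h * (grid_dist x y + P))) = \sum_(j < J) e x y j.+1 by [].
    rewrite JE.
    rewrite !big_split_ord/=; congr (_ + _ + _).
      apply: eq_bigr => i _; rewrite /e.
      by rewrite -addSn prednK.
    apply: eq_bigr => i _; congr (e _ _ _); clear -j00; lia.
  rewrite !quadfD; have a := psd_e 1%N j0.-1; have b := psd_e (j0 + n)%N J2; clear -a b; lra.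
apply: le_trans step1 _.
(* Summation by parts against the constant 1. *)
have sum0 : \sum_x f x = 0.
  have := lattice_by_parts (fun _ _ => 1) sv.
  rewrite [RHS]big1 => [|i _]; last by rewrite big1// => j _; rewrite /d1 /d2 !subrr !mulr0 addr0.
  move=> H; rewrite -[RHS]H (pair_bigA _ (fun i j : 'I_M => neglap v i j * 1))/=.
  by apply: eq_bigr => i _; rewrite mulr1.
pose K2 (x y : 'I_M * 'I_M) := - ln (grid_dist x y + P) - ln h.
have step2 : quadf K1 f <= quadf K2 f + eta * norm1 f ^+ 2.
  rewrite -lerBlDl /quadf -sumrB expr2 {1}/norm1 mulr_suml mulr_sumr.
  apply: ler_sum => x _; rewrite -sumrB /norm1 !mulr_sumr; apply: ler_sum => y _.
  rewrite -mulrBr (le_trans (ler_norm _))// !normrM mulrC ler_wpM2r ?mulr_ge0//.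
  rewrite (le_trans (full_sum J h0 P0 (grid_dist_ge0 x y)))//.
  have := grid_dist_le x y => gd.
  have : h * (grid_dist x y + P) <= h * (2 * M%:R + P) by rewrite ler_wpM2l ?(ltW h0)// lerD2r.
  move: hh; rewrite ltr_pdivlMr// => hh; rewrite -/q; lra.
apply: le_trans step2 _; rewrite lerD2r.
have -> : quadf K2 f = \sum_(i < M) \sum_(j < M) \sum_(k < M) \sum_(l < M)
    neglap v i j * neglap v k l * - lnrad P (i%:R - k%:R) (j%:R - l%:R).
  have -> : quadf K2 f = quadf (fun x y : ('I_M * 'I_M)%type => - ln (grid_dist x y + P)) f + quadf (fun _ _ : ('I_M * 'I_M)%type => - ln h) f.
    by rewrite -quadfD.
  have -> : quadf (fun _ _ : ('I_M * 'I_M)%type => - ln h) f = 0.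
    rewrite /quadf big1// => x _.
    by rewrite -mulr_suml -mulr_sumr sum0 mulr0 mul0r.
  rewrite addr0 /quadf (pair_bigA _ (fun i j : 'I_M => \sum_(k < M) \sum_(l < M)
    neglap v i j * neglap v k l * - lnrad P (i%:R - k%:R) (j%:R - l%:R)))/=.
  by apply: eq_bigr => x _; rewrite (pair_bigA _ (fun k l : 'I_M =>
    neglap v x.1 x.2 * neglap v k l * - lnrad P (x.1%:R - k%:R) (x.2%:R - l%:R))).
exact: neglap_lnrad_le.
Qed.

End truncated_kernel.

(** * Lower bounds for the energy of a single edge *)

Section edge_energy.
Variable R : realType.
Implicit Types (th g r eta beta kap : R).

(** The left factor is a tangent to the square, [2 * th * g - g ^+ 2 <= th ^+ 2], and
    [2 * (1 - cos th)] loses at most the fraction [th ^+ 2 / 12] of [th ^+ 2]. Up to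
    [th ^+ 2 = 12 * eta] the factor [1 - eta] covers the loss. Beyond, [|th| <= pi] leaves
    [th ^+ 2 / 30], and this suffices since [beta ^+ 2 <= eta / 300] makes [60 * |g|] smaller than
    [|th|]. *)
Lemma one_sub_cos_ge th g eta beta : 0 < eta -> 0 <= beta -> beta ^+ 2 <= eta / 300 ->
  `|th| <= pi -> `|g| <= beta ->
  (1 - eta) * (2 * th * g - g ^+ 2) <= 2 * (1 - cos th) \/ 2 * th * g - g ^+ 2 < 0.
Proof.
move=> eta0 b0 be thpi gb.
have [neg|pos] := ltP (2 * th * g - g ^+ 2) 0; [by right|left].
have q := cos_le_quartic th.
have th2 : th ^+ 2 <= 116 / 10.
  have : th ^+ 2 <= pi ^+ 2.
    by rewrite -[th ^+ 2]real_normK ?num_real// ler_sqr ?nnegrE ?pi_ge0.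
  have := pi_lt_34 R; have := pi_gt0 R; nra.
have t4 : th ^+ 4 = th ^+ 2 * th ^+ 2 by ring.
set T := th ^+ 2 in th2 t4 q; have T0 : 0 <= T := sqr_ge0 _.
have low : T * (1 - T / 12) <= 2 * (1 - cos th) by rewrite t4 in q; lra.
have tg : 2 * th * g - g ^+ 2 <= T by have := sqr_ge0 (th - g); rewrite /T; lra.
have [h|h] := leP T (12 * eta).
  have : T * (1 - eta) <= T * (1 - T / 12) by rewrite ler_wpM2l//; lra.
  have : eta * (2 * th * g - g ^+ 2) >= 0 by rewrite mulr_ge0// ltW.
  have [e1|e1] := leP eta 1.
    have : (1 - eta) * (2 * th * g - g ^+ 2) <= (1 - eta) * T by rewrite ler_wpM2l//; lra.
    lra.
  have : (1 - eta) * (2 * th * g - g ^+ 2) <= 0 by rewrite mulr_le0_ge0//; lra.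
  have := cos_le1 th; lra.
have low2 : T * (1 / 30) <= 2 * (1 - cos th).
  by rewrite (le_trans _ low)// ler_wpM2l//; lra.
have g2 : g ^+ 2 <= beta ^+ 2.
  by rewrite -[g ^+ 2]real_normK ?num_real// ler_sqr ?nnegrE.
have thg : 2 * th * g <= T * (1 / 30).
  have := sqr_ge0 (th - 60 * g); rewrite /T in h *; lra.
have : (1 - eta) * (2 * th * g - g ^+ 2) <= 2 * th * g - g ^+ 2.
  have := mulr_ge0 (ltW eta0) pos; lra.
have := sqr_ge0 g; lra.
Qed.

(** If the square of a modulus is below [1 - eta], the well alone gives 1, which the left side does
    not exceed. Otherwise the product of the moduli is at least [1 - eta], and the two losses
    combine to [(1 - eta) ^+ 2]. *)
Lemma edge_bound th g r r' eta beta kap : 0 < eta <= 1 / 4 -> 0 <= beta ->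
  beta ^+ 2 <= eta / 300 -> 1 <= kap * eta ^+ 2 ->
  `|th| <= pi -> `|g| <= beta -> 0 <= r -> 0 <= r' ->
  (1 - 2 * eta) * (2 * th * g - g ^+ 2) <=
  (r' - r) ^+ 2 + 2 * r * r' * (1 - cos th) +
  kap * ((1 - r ^+ 2) ^+ 2 + (1 - r' ^+ 2) ^+ 2).
Proof.
move=> /andP[eta0 eta1] b0 be ke thpi gb r0 r'0.
have kap0 : 0 <= kap.
  rewrite leNgt; apply/negP => k; have := sqr_ge0 eta; nra.
have c0 : 0 <= 1 - cos th by rewrite subr_ge0 cos_le1.
have V0 : 0 <= kap * ((1 - r ^+ 2) ^+ 2 + (1 - r' ^+ 2) ^+ 2).
  by rewrite mulr_ge0// addr_ge0 ?sqr_ge0.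
have A0 : 0 <= (r' - r) ^+ 2 + 2 * r * r' * (1 - cos th).
  by rewrite addr_ge0 ?sqr_ge0// !mulr_ge0.
case: (one_sub_cos_ge eta0 b0 be thpi gb) => [h|neg]; last first.
  have : (1 - 2 * eta) * (2 * th * g - g ^+ 2) <= 0 by rewrite mulr_ge0_le0 ?(ltW neg)//; lra.
  lra.
have [pos|neg] := leP 0 (2 * th * g - g ^+ 2); last first.
  have : (1 - 2 * eta) * (2 * th * g - g ^+ 2) <= 0 by rewrite mulr_ge0_le0 ?(ltW neg)//; lra.
  lra.
have small : 2 * th * g <= 1.
  have b1 : beta <= 1 / 20.
    rewrite -ler_sqr ?nnegrE//; [|lra]; rewrite (le_trans be)//; lra.
  rewrite (le_trans (ler_norm _))// !normrM (ger0_norm (_ : 0 <= 2))//.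
  have := pi_lt_34 R; have : `|th| * `|g| <= pi * beta by rewrite ler_pM.
  have := pi_gt0 R; nra.
have bad x : x ^+ 2 < 1 - eta -> 1 <= kap * (1 - x ^+ 2) ^+ 2.
  move=> xs; rewrite (le_trans ke)// ler_wpM2l// ler_sqr ?nnegrE; lra.
have le1 : (1 - 2 * eta) * (2 * th * g - g ^+ 2) <= 1.
  have : 2 * eta * (2 * th * g - g ^+ 2) >= 0 by rewrite !mulr_ge0// ltW.
  have := sqr_ge0 g; lra.
have [g1|b1] := leP (1 - eta) (r ^+ 2); last first.
  have := bad _ b1; have : 0 <= kap * (1 - r' ^+ 2) ^+ 2 by rewrite mulr_ge0 ?sqr_ge0.
  lra.
have [g2|b2] := leP (1 - eta) (r' ^+ 2); last first.
  have := bad _ b2; have : 0 <= kap * (1 - r ^+ 2) ^+ 2 by rewrite mulr_ge0 ?sqr_ge0.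
  lra.
have rr : 1 - eta <= r * r'.
  rewrite -ler_sqr ?nnegrE ?mulr_ge0//; [|lra].
  by rewrite exprMn expr2 ler_pM//; lra.
have : (1 - eta) * (1 - cos th) <= r * r' * (1 - cos th) by rewrite ler_wpM2r.
have : (1 - eta) * ((1 - eta) * (2 * th * g - g ^+ 2)) <= (1 - eta) * (2 * (1 - cos th)).
  by rewrite ler_wpM2l//; lra.
have : eta ^+ 2 * (2 * th * g - g ^+ 2) >= 0 by rewrite mulr_ge0 ?sqr_ge0.
have := sqr_ge0 (r' - r).
lra.
Qed.

(** A large increment has a fixed price, whatever the moduli; this is what bounds the number of
    charges by the energy. *)
Lemma edge_large th r r' eta kap : 0 < eta <= 1 / 4 -> 1 <= kap * eta ^+ 2 ->
  `|th| <= pi -> 1 <= `|th| -> 0 <= r -> 0 <= r' ->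
  1 / 50 <= (r' - r) ^+ 2 + 2 * r * r' * (1 - cos th) +
  kap * ((1 - r ^+ 2) ^+ 2 + (1 - r' ^+ 2) ^+ 2).
Proof.
move=> eta01 ke thpi th1 r0 r'0; case/andP: (eta01) => eta0 eta1.
have kap0 : 0 <= kap.
  rewrite leNgt; apply/negP => k; have := sqr_ge0 eta; nra.
have c0 : 0 <= 1 - cos th by rewrite subr_ge0 cos_le1.
have A0 : 0 <= (r' - r) ^+ 2 + 2 * r * r' * (1 - cos th).
  by rewrite addr_ge0 ?sqr_ge0// !mulr_ge0.
have bad x : x ^+ 2 < 1 - eta -> 1 <= kap * (1 - x ^+ 2) ^+ 2.
  move=> xs; rewrite (le_trans ke)// ler_wpM2l// ler_sqr ?nnegrE; lra.
have [g1|b1] := leP (1 - eta) (r ^+ 2); last first.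
  have := bad _ b1; have : 0 <= kap * (1 - r' ^+ 2) ^+ 2 by rewrite mulr_ge0 ?sqr_ge0.
  lra.
have [g2|b2] := leP (1 - eta) (r' ^+ 2); last first.
  have := bad _ b2; have : 0 <= kap * (1 - r ^+ 2) ^+ 2 by rewrite mulr_ge0 ?sqr_ge0.
  lra.
have rr : 1 - eta <= r * r'.
  rewrite -ler_sqr ?nnegrE ?mulr_ge0//; [|lra].
  by rewrite exprMn expr2 ler_pM//; lra.
have q := cos_le_quartic th.
have th2 : th ^+ 2 <= 116 / 10.
  have : th ^+ 2 <= pi ^+ 2.
    by rewrite -[th ^+ 2]real_normK ?num_real// ler_sqr ?nnegrE ?pi_ge0.
  have := pi_lt_34 R; have := pi_gt0 R; nra.
have T1 : 1 <= th ^+ 2 by rewrite -[th ^+ 2]real_normK ?num_real// expr_ge1.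
have t4 : th ^+ 4 = th ^+ 2 * th ^+ 2 by ring.
set T := th ^+ 2 in th2 t4 T1 q.
have low : 33 / 1000 <= 2 * (1 - cos th).
  have : T * (33 / 1000) <= T * (1 - T / 12) by rewrite ler_wpM2l//; lra.
  rewrite t4 in q; lra.
have : (1 - eta) * (1 - cos th) <= r * r' * (1 - cos th) by rewrite ler_wpM2r.
have : 3 / 4 * (1 - cos th) <= (1 - eta) * (1 - cos th) by rewrite ler_wpM2r//; lra.
have : 0 <= kap * ((1 - r ^+ 2) ^+ 2 + (1 - r' ^+ 2) ^+ 2).
  by rewrite mulr_ge0// addr_ge0 ?sqr_ge0.
have := sqr_ge0 (r' - r).
lra.
Qed.

End edge_energy.

(** * The test function attached to a configuration of charges *)

Section test_function.
Variable R : realType.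
Implicit Types (v : nat -> nat -> R) (N : nat).

(** The cell [(i, j)] sits at the index [(i.+1, j.+1)], which leaves room for a frame of zeros
    around the cells. *)
Definition inner N i j := [&& (0 < i)%N, (i <= N)%N, (0 < j)%N & (j <= N)%N].

Lemma innerE N i j :
  inner N i j = (0 < i)%N && (i.+1 < N.+2)%N && (0 < j)%N && (j.+1 < N.+2)%N.
Proof. by rewrite /inner !ltnS -!andbA. Qed.

Lemma sum_inner N (f : nat -> nat -> R) : (forall i j, ~~ inner N i j -> f i j = 0) ->
  \sum_(x : 'I_N.+2 * 'I_N.+2) f x.1 x.2 = \sum_(i < N) \sum_(j < N) f i.+1 j.+1.
Proof.
move=> f0; rewrite -(pair_bigA _ (fun i j : 'I_N.+2 => f i j))/=.
have one (g : nat -> R) : g 0%N = 0 -> g N.+1 = 0 -> \sum_(i < N.+2) g i = \sum_(i < N) g i.+1.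
  by move=> g0 gN; rewrite big_ord_recr big_ord_recl/= g0 gN add0r addr0.
rewrite (one (fun i => \sum_(j < N.+2) f i j)).
- by apply: eq_bigr => i _; rewrite one// f0// /inner; lia.
- by rewrite big1// => j _; rewrite f0// /inner; lia.
- by rewrite big1// => j _; rewrite f0// /inner; lia.
Qed.

Lemma sum_outer N : \sum_(x : 'I_N.+2 * 'I_N.+2) (~~ inner N x.1 x.2)%:R <= 4 * N.+2%:R :> R.
Proof.
have one (n k : nat) : \sum_(i < n) ((i : nat) == k)%:R <= 1 :> R.
  elim: n => [|n IH]; first by rewrite big_ord0.
  rewrite big_ord_recr/=; case: eqP => [E|_]; last by rewrite addr0.
  rewrite big1 ?add0r// => i _; case: eqP => // e.
  by have := ltn_ord i; rewrite e E ltnn.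
have row (k : nat) : \sum_(x : 'I_N.+2 * 'I_N.+2) ((x.1 : nat) == k)%:R <= N.+2%:R :> R.
  rewrite -(pair_bigA _ (fun i j : 'I_N.+2 => ((i : nat) == k)%:R))/=.
  rewrite exchange_big/= (le_trans (ler_sum _ (fun j _ => one N.+2 k)))//.
  by rewrite sumr_const card_ord.
have col (k : nat) : \sum_(x : 'I_N.+2 * 'I_N.+2) ((x.2 : nat) == k)%:R <= N.+2%:R :> R.
  rewrite -(pair_bigA _ (fun i j : 'I_N.+2 => ((j : nat) == k)%:R))/=.
  rewrite (le_trans (ler_sum _ (fun j _ => one N.+2 k)))//.
  by rewrite sumr_const card_ord.
have := row 0%N; have := row N.+1; have := col 0%N; have := col N.+1.
move=> c1 c2 c3 c4; apply: le_trans (_ : \sum_(x : 'I_N.+2 * 'I_N.+2)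
  (((x.1 : nat) == 0%N)%:R + ((x.1 : nat) == N.+1)%:R + ((x.2 : nat) == 0%N)%:R + ((x.2 : nat) == N.+1)%:R) <= _).
  apply: ler_sum => -[i j] _ /=; rewrite -!natrD ler_nat /inner.
  have := ltn_ord i; have := ltn_ord j; lia.
by rewrite !big_split/=; lra.
Qed.

(** The potential [Psi] of the charges for the truncated logarithm, set to 0 on the frame. Since the
    kernel is at most [2 * pi] times the Green function, testing the dual clause with a multiple of
    [neglap v] bounds [dirichlet v] by [2 * pi * s], up to the frame, where [v] and [Psi] differ. *)
Lemma test_function N Q (beta : R) (d : nat -> nat -> int) : (1 < Q)%N -> 0 < beta <= 1 ->
  exists (m : R) (v : nat -> nat -> R),
  [/\ expR (- (beta / 4)) * ln Q%:R <= m <= 1 + ln Q%:R,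
      forall i j, (~~ inner N i j -> v i j = 0) /\ `|v i j| <= m,
      forall i j, (inner N i j -> inner N i.+1 j -> `|v i.+1 j - v i j| <= beta) /\
                  (inner N i j -> inner N i j.+1 -> `|v i j.+1 - v i j| <= beta),
      2 * pi * m * `|\sum_(i < N) \sum_(j < N) (d i j)%:~R| <=
        4 * pi * (\sum_(i < N) \sum_(j < N) (d i j)%:~R * v i.+1 j.+1) - dirichlet N.+2 v +
        100 * (1 + ln Q%:R) ^+ 2 * N.+2%:R &
      \sum_(i < N) \sum_(j < N) `|v i.+1 j.+1| <=
        2000 * (1 + ln Q%:R) * Q%:R ^+ 2 / beta ^+ 2 * (\sum_(i < N) \sum_(j < N) `|(d i j)%:~R|) + 1].
Proof.
move=> Q1 /andP[beta0 beta1].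
have Qp : 0 < (Q%:R : R) by rewrite ltr0n ltnW.
have Q1R : 1 <= (Q%:R : R) by rewrite ler1n ltnW.
have lnQ : 0 <= ln (Q%:R : R) by rewrite ln_ge0.
pose U : R := 1 + ln Q%:R; have U1 : 1 <= U by rewrite /U; lra.
(* The logarithm is cut at distance [1 / tau] and flattened at distance [4 / beta]. The ratio is
   [Q], so the value at 0 is about [ln Q], and the slope [beta / 4] yields increments of at most
   [beta]. *)
pose tau := beta / (4 * Q%:R).
have tau0 : 0 < tau by rewrite divr_gt0// mulr_gt0.
have tauQ : tau * Q%:R = beta / 4 by rewrite /tau; field; rewrite gt_eqF.
have tau1 : tau <= 1 by rewrite ler_pdivrMr ?mulr_gt0//; nra.
pose M := N.+2.
have M1 : 1 <= (M%:R : R) by rewrite ler1n.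
have M0 : 0 < (M%:R : R) by lra.
pose nrm := 8 * U * M%:R ^+ 2.
have MM : 1 <= (M%:R : R) ^+ 2 by rewrite expr_ge1.
have nrmM : 8 * M%:R ^+ 2 <= nrm by rewrite /nrm ler_wpM2r//; lra.
have nrm1 : 1 <= nrm by lra.
(* [nrm] bounds the l^1 norm of [neglap v], so the slack costs at most 1 in the dual clause; the
   other entry is the share of the increments. *)
pose e0 := Num.min (beta / 2) (1 / nrm ^+ 2).
have e0p : 0 < e0 by rewrite lt_min !divr_gt0// exprn_gt0//; lra.
have e0n : e0 * nrm ^+ 2 <= 1.
  rewrite -ler_pdivlMr; last by rewrite exprn_gt0//; lra.
  by rewrite ge_min lexx orbT.
have e0b : e0 <= beta / 2 by rewrite ge_min lexx.
have [h0 h0p hK] := @quadf_kap_le R M 1 e0 (lexx 1) e0p.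
(* Brings [h = tau / j0] below [h0] while the cut [j0 * h = tau] stays in place. *)
pose j0 := (Num.trunc (tau / h0)).+1.
have j0p : (0 < j0)%N by [].
have j0R : 0 < (j0%:R : R) by rewrite ltr0n.
pose h := tau / j0%:R.
have hp : 0 < h by rewrite divr_gt0.
have hh0 : h < h0.
  rewrite /h ltr_pdivrMr// -ltr_pdivrMl// mulrC.
  by have /truncn_itv/andP[] : 0 <= tau / h0 by rewrite divr_ge0 ?ltW.
have jh : j0%:R * h = tau by rewrite /h mulrC divfK ?gt_eqF.
pose n := (j0 * Q.-1)%N.
have jn : (j0 + n)%N = (j0 * Q)%N.
  by rewrite /n -{1}[j0]muln1 -mulnDr add1n prednK// ltnW.
have jnR : ((j0 + n)%:R : R) = j0%:R * Q%:R by rewrite jn natrM.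
have jnh : (j0 + n)%:R * h = beta / 4 by rewrite jnR mulrAC jh tauQ.
have nh : n%:R * h <= beta / 4.
  by rewrite -jnh natrD ler_wpM2r ?(ltW hp)// lerDr.
have jQ : ((j0 + n)%:R : R) / j0%:R = Q%:R by rewrite jnR mulrAC divff ?gt_eqF// mul1r.
pose K (x y : 'I_M * 'I_M) := kap h 1 j0 n (grid_dist R x y).
pose m := kap h 1 j0 n (0 : R).
have m_le : m <= U by have := @kap0_le R h 1 j0 n (ltW hp) ler01 j0p; rewrite jQ.
have m_ge : expR (- (beta / 4)) * ln Q%:R <= m.
  by have := @kap0_ge R h 1 j0 n (ltW hp) ler01 j0p; rewrite jQ jnh mulr1.
have m0 : 0 <= m by exact: kap_ge0.
pose dh (x : 'I_M * 'I_M) : int := if inner N x.1 x.2 then d x.1.-1 x.2.-1 else 0.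
have [Psi [s [k1 k2 k3 k4 k5]]] := @charge_kernel_kap R M h 1 j0 n (ltW hp) e0 e0p dh.
pose v (i j : nat) : R := if inner N i j then Psi (inord i, inord j) else 0.
have vE (x : 'I_M * 'I_M) : inner N x.1 x.2 -> v x.1 x.2 = Psi x.
  by move=> ix; rewrite /v ix !inord_val; case: x {ix}.
have v0 i j : ~~ inner N i j -> v i j = 0 by rewrite /v => /negbTE->.
have vm i j : `|v i j| <= m by rewrite /v; case: ifP => _; [exact: k4|rewrite normr0].
have sv : inner_support M v.
  move=> i j; apply: contraNT => o; by rewrite v0// innerE.
have dist1 (i j i' j' : nat) : inner N i j -> inner N i' j' ->
    ((i = i' /\ j' = j.+1) \/ (j = j' /\ i' = i.+1))%N -> `|v i' j' - v i j| <= beta.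
  move=> ii ii' adj; rewrite /v ii ii'; apply: le_trans (k3 _ _) _.
  suff : grid_dist R ((inord i', inord j') : 'I_M * 'I_M) (inord i, inord j) <= (1 : R).
    set r := grid_dist _ _ _ => gd; have r01 : 0 <= r <= 1 by rewrite grid_dist_ge0.
    have := @kap_slope R h 1 j0 n r (ltW hp) ler01 r01; rewrite -/m.
    by clear -nh e0b; lra.
  move: ii ii'; rewrite /inner => /and4P[? ? ? ?] /and4P[? ? ? ?].
  rewrite grid_distE /rad /= !inordK ?ltnS ?leqW//.
  case: adj => -[-> ->]; rewrite -?[_.+1%:R]natr1 ?subrr expr0n ?add0r ?addr0.
    by rewrite addrAC subrr add0r expr1n sqrtr1.
  by rewrite addrAC subrr add0r expr1n sqrtr1.
have nl i j : `|neglap v i j| <= 8 * m.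
  rewrite /neglap; have := vm i j; have := vm i.+1 j; have := vm i.-1 j; have := vm i j.+1; have := vm i j.-1.
  rewrite !ler_norml => /andP[a1 b1] /andP[a2 b2] /andP[a3 b3] /andP[a4 b4] /andP[a5 b5].
  by apply/andP; clear -a1 b1 a2 b2 a3 b3 a4 b4 a5 b5; split; lra.
have n1 : norm1 (@grid_neglap R M v) <= nrm.
  rewrite /norm1 (@le_trans _ _ (\sum_(x : 'I_M * 'I_M) 8 * m))//.
    by apply: ler_sum => x _; exact: nl.
  rewrite sumr_const card_prod card_ord -[leLHS]mulr_natr natrM /nrm -expr2 ler_wpM2r ?sqr_ge0//; clear -m_le; lra.
have n1n : norm1 (@grid_neglap R M v) ^+ 2 <= nrm ^+ 2.
  by rewrite lerXn2r// nnegrE ?sumr_ge0// (le_trans ler01).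
have dirE : dirichlet M v = \sum_(x : 'I_M * 'I_M) neglap v x.1 x.2 * v x.1 x.2.
  rewrite -(pair_bigA _ (fun i j : 'I_M => neglap v i j * v i j))/= lattice_by_parts//.
have outer : `|\sum_(x : 'I_M * 'I_M) neglap v x.1 x.2 * (Psi x - v x.1 x.2)| <= 32 * U ^+ 2 * M%:R.
  rewrite (le_trans (ler_norm_sum _ _ _))//.
  apply: le_trans (_ : \sum_(x : 'I_M * 'I_M) 8 * m ^+ 2 * (~~ inner N x.1 x.2)%:R <= _).
    apply: ler_sum => x _; case: (boolP (inner N x.1 x.2)) => ix /=.
      by rewrite vE// subrr mulr0 normr0 mulr0.
    by rewrite v0// subr0 normrM mulr1 expr2 mulrA ler_pM.
  rewrite -mulr_sumr; have := sum_outer N; rewrite -/M => so.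
  have mU : m ^+ 2 <= U ^+ 2 by rewrite lerXn2r// nnegrE (le_trans ler01).
  have : 8 * m ^+ 2 * (\sum_(x : 'I_M * 'I_M) (~~ inner N x.1 x.2)%:R) <= 8 * m ^+ 2 * (4 * M%:R).
    by rewrite ler_wpM2l// mulr_ge0// sqr_ge0.
  have mUM : m ^+ 2 * M%:R <= U ^+ 2 * M%:R by rewrite ler_wpM2r// ltW.
  by move=> H; clear -mUM H; lra.
have pi0 := pi_gt0 R; have pi2 := pi_ge2 R.
have dir : dirichlet M v <= 2 * pi * s + 70 * U ^+ 2 * M%:R.
  (* With this factor [2 * (sum f Psi) - quadf K f] is at least [dirichlet v / (2 * pi)], up to the
     frame and the slack. *)
  pose f x := (2 * pi)^-1 * @grid_neglap R M v x.
  have := k2 f.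
  have -> : \sum_x f x * Psi x = (2 * pi)^-1 * (dirichlet M v +
      \sum_(x : 'I_M * 'I_M) neglap v x.1 x.2 * (Psi x - v x.1 x.2)).
    rewrite dirE -big_split mulr_sumr; apply: eq_bigr => x _ /=.
    by rewrite /f /grid_neglap; ring.
  have -> : quadf (fun x y => kap h 1 j0 n (grid_dist R x y)) f = (2 * pi)^-1 ^+ 2 *
      quadf (fun x y => kap h 1 j0 n (grid_dist R x y)) (@grid_neglap R M v).
    rewrite /quadf mulr_sumr; apply: eq_bigr => x _; rewrite mulr_sumr; apply: eq_bigr => y _.
    by rewrite /f; ring.
  have -> : norm1 f = (2 * pi)^-1 * norm1 (@grid_neglap R M v).
    rewrite /norm1 mulr_sumr; apply: eq_bigr => x _.
    by rewrite /f normrM ger0_norm// invr_ge0 mulr_ge0// ltW.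
  have := hK h j0 n v; rewrite hp hh0 j0p => /(_ isT isT sv).
  move: outer; set q := quadf _ _; set D := dirichlet M v; set S := \sum_x _; set L := norm1 _.
  rewrite ler_norml => /andP[o1 o2] hq k2'.
  have e0L : e0 * L ^+ 2 <= 1 by apply: le_trans e0n; rewrite ler_wpM2l ?(ltW e0p).
  have UM : 1 <= U ^+ 2 * M%:R by rewrite mulr_ege1// expr_ge1// (le_trans ler01).
  have p2 : 0 < 2 * pi :> R by rewrite mulr_gt0.
  have k3' : 2 * (D + S) - (2 * pi)^-1 * q <= 2 * pi * s + (2 * pi)^-1 * (e0 * L ^+ 2).
    rewrite -(ler_pM2l (_ : 0 < (2 * pi)^-1)) ?invr_gt0//.
    rewrite [in leRHS]mulrDr mulKf ?gt_eqF//.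
    by move: k2'; rewrite exprMn; set w := (2 * pi)^-1 => k2'; clear -k2'; lra.
  have iq : (2 * pi)^-1 * q <= D + (2 * pi)^-1 * (e0 * L ^+ 2).
    by rewrite -[D](mulKf (lt0r_neq0 p2)) -mulrDr ler_pM2l ?invr_gt0.
  have i1 : (2 * pi)^-1 * (e0 * L ^+ 2) <= 1.
    by rewrite ler_pdivrMl// mulr1; clear -e0L pi2; lra.
  by clear -k3' iq i1 o1 UM; lra.
exists m, v; split.
- by rewrite m_ge.
- by move=> i j; split; [exact: v0|exact: vm].
- by move=> i j; split=> ii ii'; apply: dist1 => //; [right|left].
- move: k1; rewrite -/m.
  have -> : \sum_(x : 'I_M * 'I_M) (dh x)%:~R = \sum_(i < N) \sum_(j < N) (d i j)%:~R :> R.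
    rewrite (@sum_inner N (fun i j => (if inner N i j then d i.-1 j.-1 else 0)%:~R)).
      by apply: eq_bigr => i _; apply: eq_bigr => j _; rewrite /inner /= !ltn_ord.
    by move=> i j /negbTE->.
  have -> : \sum_(x : 'I_M * 'I_M) (dh x)%:~R * Psi x =
      \sum_(i < N) \sum_(j < N) (d i j)%:~R * v i.+1 j.+1.
    transitivity (\sum_(x : 'I_M * 'I_M) (if inner N x.1 x.2 then d x.1.-1 x.2.-1 else 0)%:~R * v x.1 x.2).
      apply: eq_bigr => x _; rewrite /dh; case: ifP => ix; last by rewrite !mul0r.
      by rewrite vE.
    rewrite (@sum_inner N (fun i j => (if inner N i j then d i.-1 j.-1 else 0)%:~R * v i j)).
      by apply: eq_bigr => i _; apply: eq_bigr => j _; rewrite /inner /= !ltn_ord.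
    by move=> i j /negbTE->; rewrite mul0r.
  set A := `| _ |; set B := \sum_(i < N) _; rewrite -/U -/M => k1.
  have mA : pi * (m * A) <= pi * (2 * B - s) by rewrite ler_wpM2l// ltW.
  have UM : 0 <= U ^+ 2 * M%:R by rewrite mulr_ge0 ?sqr_ge0// ltW.
  by clear -mA UM dir; lra.
- have -> : \sum_(i < N) \sum_(j < N) `|v i.+1 j.+1| = \sum_(x : 'I_M * 'I_M) `|v x.1 x.2|.
    by rewrite (@sum_inner N (fun i j => `|v i j|))// => i j /v0->; rewrite normr0.
  have -> : \sum_(i < N) \sum_(j < N) `|(d i j)%:~R| = \sum_(x : 'I_M * 'I_M) `|(dh x)%:~R : R|.
    rewrite (@sum_inner N (fun i j => `|(if inner N i j then d i.-1 j.-1 else 0)%:~R : R|)).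
      by apply: eq_bigr => i _; apply: eq_bigr => j _; rewrite /inner /= !ltn_ord.
    by move=> i j /negbTE->; rewrite normr0.
  apply: le_trans (_ : \sum_x (\sum_y K x y * `|(dh y)%:~R| + e0) <= _).
    apply: ler_sum => x _; case: (boolP (inner N x.1 x.2)) => ix; first by rewrite vE//; exact: k5.
    rewrite v0// normr0 addr_ge0 ?(ltW e0p)//; apply: sumr_ge0 => y _; rewrite mulr_ge0//; exact: kap_ge0.
  rewrite big_split/=; apply: lerD; last first.
    rewrite sumr_const card_prod card_ord -[leLHS]mulr_natr natrM -expr2.
    apply: le_trans e0n; rewrite ler_wpM2l ?(ltW e0p)//.
    have nn : nrm <= nrm ^+ 2 by rewrite expr2 ler_peMr// (le_trans ler01).
    by apply: le_trans nn; clear -nrmM MM; lra.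
  rewrite exchange_big/= mulr_sumr; apply: ler_sum => y _.
  rewrite -mulr_suml ler_wpM2r//.
  have -> : \sum_(x : 'I_M * 'I_M) K x y = \sum_(x : 'I_M * 'I_M) K y x.
    apply: eq_bigr => x _; rewrite /K /grid_dist /dist2; congr (kap _ _ _ _ (Num.sqrt _)); ring.
  have := @kap_sum_le R M h 1 j0 n y hp ler01 j0p; rewrite jh => /(_ tau1) H.
  apply: le_trans H _; rewrite -/m -/U.
  have -> : 64 / tau ^+ 2 = 1024 * Q%:R ^+ 2 / beta ^+ 2.
    by rewrite /tau; field; rewrite !gt_eqF.
  have X0 : 0 <= Q%:R ^+ 2 / beta ^+ 2 :> R by rewrite divr_ge0// sqr_ge0.
  have mU : m * (Q%:R ^+ 2 / beta ^+ 2) <= U * (Q%:R ^+ 2 / beta ^+ 2) by rewrite ler_wpM2r.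
  have UX : 0 <= U * (Q%:R ^+ 2 / beta ^+ 2) by rewrite mulr_ge0// (le_trans ler01).
  by clear -mU UX; lra.
Qed.

End test_function.

(** * Lower bound for the energy of a configuration on a finite grid *)

Section discrete_lower_bound.
Variable R : realType.
Implicit Types (zr zi : nat -> nat -> R) (a b : nat -> R).

(** This is [|z' - e^(i al) z|^2] for [z = x + i y] and [z' = x' + i y']. *)
Definition hop (x y x' y' al : R) : R :=
  (x' - (cos al * x - sin al * y)) ^+ 2 + (y' - (sin al * x + cos al * y)) ^+ 2.
Definition hop1 zr zi a i j : R := hop (zr i j) (zi i j) (zr i.+1 j) (zi i.+1 j) (a j).
Definition hop2 zr zi b i j : R := hop (zr i j) (zi i j) (zr i j.+1) (zi i j.+1) (b i).
Definition well zr zi i j : R := (1 - (zr i j ^+ 2 + zi i j ^+ 2)) ^+ 2.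

(* GL energy of a configuration on the (N+1) x (N+1) vertices of a grid, the
   gauge potential being a j on horizontal and b i on vertical edges. *)
Definition grid_energy (N : nat) (kap : R) zr zi a b : R :=
  \sum_(i < N) \sum_(j < N.+1) hop1 zr zi a i j +
  \sum_(i < N.+1) \sum_(j < N) hop2 zr zi b i j +
  4 * kap * \sum_(i < N.+1) \sum_(j < N.+1) well zr zi i j.

Let hop_polar r p r' p' al : hop (r * cos p) (r * sin p) (r' * cos p') (r' * sin p') al =
  (r' - r) ^+ 2 + 2 * r * r' * (1 - cos (p' - p - al)).
Proof.
have -> : cos (p' - p - al) = cos p' * cos (p + al) + sin p' * sin (p + al).
  by rewrite -cosB; congr cos; ring.
rewrite /hop cosD sinD.
have e1 := cos2Dsin2 p; have e2 := cos2Dsin2 p'; have e3 := cos2Dsin2 al.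
transitivity (r' ^+ 2 * (cos p' ^+ 2 + sin p' ^+ 2) + r ^+ 2 * ((cos p ^+ 2 + sin p ^+ 2) * (cos al ^+ 2 + sin al ^+ 2))
  - 2 * r * r' * (cos p' * (cos p * cos al - sin p * sin al) + sin p' * (sin p * cos al + cos p * sin al))).
  ring.
by rewrite e1 e2 e3; ring.
Qed.

Let reduce_angle (t : R) : exists n : int, `|t - 2 * pi * n%:~R| <= pi.
Proof.
have pi0 := pi_gt0 R; pose n := Num.floor ((t + pi) / (2 * pi)).
exists n; have := floor_itv ((t + pi) / (2 * pi)); rewrite -/n intrD => /andP[h1 h2].
have p2 : 0 < 2 * pi :> R by lra.
move: h1 h2; rewrite ler_pdivlMr// ltr_pdivrMr// => h1 h2.
by rewrite ler_norml; apply/andP; split; lra.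
Qed.

(** Discrete Green formula: the curl tested with [W] is the edge field tested with the rotated
    gradient of [W]; no boundary terms appear as [W] vanishes on the frame. *)
Let cell_sum (N : nat) (th tv : nat -> nat -> R) (W : nat -> nat -> R) :
  (forall j, W 0%N j = 0) -> (forall j, W N.+1 j = 0) ->
  (forall i, W i 0%N = 0) -> (forall i, W i N.+1 = 0) ->
  \sum_(i < N) \sum_(j < N) W i.+1 j.+1 * (th i j + tv i.+1 j - th i j.+1 - tv i j) =
  \sum_(i < N) \sum_(j < N.+1) th i j * (W i.+1 j.+1 - W i.+1 j) +
  \sum_(i < N.+1) \sum_(j < N) tv i j * (W i j.+1 - W i.+1 j.+1).
Proof.
move=> W0 WN Wl Wr.
have key (n : nat) (t w : nat -> R) : w 0%N = 0 -> w n.+1 = 0 ->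
    \sum_(j < n) w j.+1 * (t j - t j.+1) = \sum_(j < n.+1) t j * (w j.+1 - w j).
  move=> w0 wn.
  have -> : \sum_(j < n.+1) t j * (w j.+1 - w j) = \sum_(j < n.+1) t j * w j.+1 - \sum_(j < n.+1) t j * w j.
    by rewrite -sumrB; apply: eq_bigr => j _; rewrite mulrBr.
  rewrite big_ord_recr/= wn mulr0 addr0 [X in _ - X]big_ord_recl/= w0 mulr0 add0r -sumrB.
  by apply: eq_bigr => j _; rewrite /bump/= add1n; ring.
transitivity (\sum_(i < N) \sum_(j < N) W i.+1 j.+1 * (th i j - th i j.+1) +
   \sum_(j < N) \sum_(i < N) W i.+1 j.+1 * (tv i.+1 j - tv i j)).
  rewrite [X in _ + X]exchange_big -big_split/=; apply: eq_bigr => i _.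
  by rewrite -big_split/=; apply: eq_bigr => j _; ring.
congr (_ + _).
  by apply: eq_bigr => i _; rewrite (key N (th i) (W i.+1)).
rewrite [RHS]exchange_big/=; apply: eq_bigr => j _.
have := key N (fun i => tv i j) (fun i => W i j.+1) (W0 _) (WN _).
move=> E; transitivity (- \sum_(i < N) W i.+1 j.+1 * (tv i j - tv i.+1 j)).
  by rewrite -sumrN; apply: eq_bigr => i _; ring.
by rewrite E -sumrN; apply: eq_bigr => i _; ring.
Qed.

(** The curl sums up to its boundary, [4 * n] increments of size at most [p], and 14 exceeds
    [4 * pi]. *)
Let charge_flux (n f d ad s1 s2 p : R) : p < 34 / 10 -> 2 <= p -> 0 <= n -> d <= ad ->
  `|s1| <= 2 * p * n -> `|s2| <= 2 * p * n -> 2 * p * d = n ^+ 2 * f - s1 + s2 ->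
  n ^+ 2 * f - 14 * n <= 2 * p * ad.
Proof.
move=> p1 p2 n0 dd; rewrite !ler_norml => /andP[_ h1] /andP[h2 _] e.
have : p * n <= 34 / 10 * n by rewrite ler_wpM2r// ltW.
have : p * d <= p * ad by rewrite ler_wpM2l//; lra.
lra.
Qed.

Let edges_arith (a b c e A B X : R) : e <= B -> a <= B -> b <= A -> c <= A -> A + B <= X ->
  150 * (c + e + b + a) <= 300 * X.
Proof. lra. Qed.

(** [W] is the curl tested with [v], [G] the sum of the squared increments of [v], [DV] the pairing
    of charges and [v], while [SV] and [SD] are the l^1 norms of [v] and of the charges. The
    products are isolated first, so that the rest is linear. *)
Let kernel_arith (c m1 m U n F X E D SV SD W G dir DV p : R) :
  0 <= c -> c <= 1 -> 0 <= m1 -> m1 <= m -> 1 <= U -> m <= U -> 0 <= n -> 0 < F -> F <= 1 ->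
  0 <= X -> 0 <= E -> 0 <= SV ->
  n ^+ 2 * F - 14 * n <= 2 * p * D ->
  2 * p * m * D <= 4 * p * DV - dir + 100 * U ^+ 2 * (n + 2) ->
  G <= dir -> 2 * p * DV - F * SV <= W -> SV <= X * SD + 1 -> SD <= 300 * E ->
  c * (2 * W - G) <= E + 48 * n ->
  c * m1 * (n ^+ 2 * F) <= E * (1 + 2 * F * X * 600) + 200 * U ^+ 2 * (n + 2).
Proof.
move=> c0 c1 m10 mm U1 mU n0 F0 F1 X0 E0 SV0 H5 vC GD H4 vS H6 H9.
have UU : U <= U ^+ 2 by rewrite expr2 ler_peMr//; lra.
have UN : n * U <= n * U ^+ 2 by rewrite ler_wpM2l.
have UN1 : n <= n * U ^+ 2 by rewrite ler_peMr//; lra.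
have m0 : 0 <= m by lra.
have mn : n * m <= n * U by rewrite ler_wpM2l.
have H7 : m * (n ^+ 2 * F) <= 2 * p * m * D + 14 * (n * U).
  have : m * (n ^+ 2 * F - 14 * n) <= m * (2 * p * D) by rewrite ler_wpM2l.
  lra.
have XS : X * SD <= X * (300 * E) by rewrite ler_wpM2l.
have H8 : F * SV <= F * (X * (300 * E)) + 1.
  have : F * SV <= F * (X * (300 * E) + 1) by rewrite ler_wpM2l ?(ltW F0)//; lra.
  lra.
have nU0 : 0 <= n * U by rewrite mulr_ge0//; lra.
have nU2 : 0 <= n * U ^+ 2 by lra.
have FS : 0 <= F * SV by rewrite mulr_ge0// ltW.
pose Y := 100 * U ^+ 2 * (n + 2) + 2 * (F * SV) + 14 * (n * U).
have Y0 : 0 <= Y by rewrite /Y; lra.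
have cY : c * Y <= Y by rewrite ler_piMl.
have K : c * (m * (n ^+ 2 * F)) <= c * (2 * W - G + Y) by rewrite ler_wpM2l// /Y; lra.
have K1 : c * m1 * (n ^+ 2 * F) <= c * (m * (n ^+ 2 * F)).
  by rewrite -mulrA ler_wpM2l// ler_wpM2r// mulr_ge0 ?sqr_ge0// ltW.
rewrite mulrDr in K; apply: le_trans K1 (le_trans K _).
apply: le_trans (_ : E + 48 * n + Y <= _); first by rewrite lerD.
rewrite /Y; lra.
Qed.

Section configuration.
Variables (N : nat) (zr zi : nat -> nat -> R) (a b : nat -> R) (F kap eta beta : R).
Hypothesis N0 : (0 < N)%N.
Hypothesis eta01 : 0 < eta <= 1 / 4.
Hypothesis kapeta : 1 <= kap * eta ^+ 2.
Hypothesis beta0 : 0 < beta.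
Hypothesis betaeta : beta ^+ 2 <= eta / 300.
Hypothesis F01 : 0 < F <= 1.
Hypothesis flux : forall i j, a j - a j.+1 + b i.+1 - b i = F.

Let E := grid_energy N kap zr zi a b.
Let V := well zr zi.
Let e1 i j := hop1 zr zi a i j + kap * (V i j + V i.+1 j).
Let e2 i j := hop2 zr zi b i j + kap * (V i j + V i j.+1).

Let kap0 : 0 <= kap.
Proof.
rewrite leNgt; apply/negP => k; have := sqr_ge0 eta => h.
by move: kapeta; rewrite leNgt => /negP; apply; nra.
Qed.

Let V_ge0 i j : 0 <= V i j. Proof. exact: sqr_ge0. Qed.

Let e1_ge0 i j : 0 <= e1 i j.
Proof. by rewrite addr_ge0// ?mulr_ge0// addr_ge0// sqr_ge0. Qed.

Let e2_ge0 i j : 0 <= e2 i j.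
Proof. by rewrite addr_ge0// ?mulr_ge0// addr_ge0// sqr_ge0. Qed.

(** A vertex lies on at most four edges, and each edge takes [kap] times the well at both ends;
    hence the 4 in [grid_energy]. *)
Let e_le : \sum_(i < N) \sum_(j < N.+1) e1 i j + \sum_(i < N.+1) \sum_(j < N) e2 i j <= E.
Proof.
pose S := \sum_(i < N.+1) \sum_(j < N.+1) V i j.
have w0 (f : nat -> R) : (forall i, 0 <= f i) -> \sum_(i < N) f i <= \sum_(i < N.+1) f i.
  by move=> f0; rewrite big_ord_recr/= lerDl.
have w1 (f : nat -> R) : (forall i, 0 <= f i) -> \sum_(i < N) f i.+1 <= \sum_(i < N.+1) f i.
  by move=> f0; rewrite big_ord_recl/= lerDr.
have s1 : \sum_(i < N) \sum_(j < N.+1) V i j <= S.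
  by apply: (w0 (fun i => \sum_(j < N.+1) V i j)) => i; apply: sumr_ge0.
have s2 : \sum_(i < N) \sum_(j < N.+1) V i.+1 j <= S.
  by apply: (w1 (fun i => \sum_(j < N.+1) V i j)) => i; apply: sumr_ge0.
have s3 : \sum_(i < N.+1) \sum_(j < N) V i j <= S.
  by apply: ler_sum => i _; apply: (w0 (V i)).
have s4 : \sum_(i < N.+1) \sum_(j < N) V i j.+1 <= S.
  by apply: ler_sum => i _; apply: (w1 (V i)).
have -> : \sum_(i < N) \sum_(j < N.+1) e1 i j = \sum_(i < N) \sum_(j < N.+1) hop1 zr zi a i j +
    kap * (\sum_(i < N) \sum_(j < N.+1) V i j + \sum_(i < N) \sum_(j < N.+1) V i.+1 j).
  rewrite -big_split mulr_sumr -big_split; apply: eq_bigr => i _ /=.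
  rewrite -big_split mulr_sumr -big_split; apply: eq_bigr => j _ /=.
  by rewrite /e1.
have -> : \sum_(i < N.+1) \sum_(j < N) e2 i j = \sum_(i < N.+1) \sum_(j < N) hop2 zr zi b i j +
    kap * (\sum_(i < N.+1) \sum_(j < N) V i j + \sum_(i < N.+1) \sum_(j < N) V i j.+1).
  rewrite -big_split mulr_sumr -big_split; apply: eq_bigr => i _ /=.
  rewrite -big_split mulr_sumr -big_split; apply: eq_bigr => j _ /=.
  by rewrite /e2.
have : kap * (\sum_(i < N) \sum_(j < N.+1) V i j + \sum_(i < N) \sum_(j < N.+1) V i.+1 j +
  (\sum_(i < N.+1) \sum_(j < N) V i j + \sum_(i < N.+1) \sum_(j < N) V i j.+1)) <= kap * (4 * S).
  rewrite ler_wpM2l//; lra.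
rewrite /E /grid_energy -/V -/S; lra.
Qed.

(* Phases of the vertices, edge increments reduced to [-pi, pi], and the
   integer charges of the cells; no condition on the moduli is needed. *)
Let phases : exists (phi : nat -> nat -> R) (n1 n2 : nat -> nat -> int),
  [/\ forall i j, zr i j = Num.sqrt (zr i j ^+ 2 + zi i j ^+ 2) * cos (phi i j),
      forall i j, zi i j = Num.sqrt (zr i j ^+ 2 + zi i j ^+ 2) * sin (phi i j),
      forall i j, `|phi i.+1 j - phi i j - a j - 2 * pi * (n1 i j)%:~R| <= pi &
      forall i j, `|phi i j.+1 - phi i j - b i - 2 * pi * (n2 i j)%:~R| <= pi].
Proof.
have [phi hphi] := choice (fun p : nat * nat => polar_coord (zr p.1 p.2) (zi p.1 p.2)).
have [n1 hn1] := choice (fun p : nat * nat =>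
  reduce_angle (phi (p.1.+1, p.2) - phi p - a p.2)).
have [n2 hn2] := choice (fun p : nat * nat =>
  reduce_angle (phi (p.1, p.2.+1) - phi p - b p.1)).
exists (fun i j => phi (i, j)), (fun i j => n1 (i, j)), (fun i j => n2 (i, j)).
split=> i j; first exact: (hphi (i, j)).1.
- exact: (hphi (i, j)).2.
- exact: (hn1 (i, j)).
- exact: (hn2 (i, j)).
Qed.

(** The multiples of [2 * pi] taken off the increments reappear as the charge of the cell. In a
    charged cell some increment is at least 1 in modulus, and its edge costs [1 / 50]; as
    [|d| <= 3], this explains the 150. *)
Lemma grid_energy_edges : exists (th tv : nat -> nat -> R) (d : nat -> nat -> int),
  [/\ forall i j, th i j + tv i.+1 j - th i j.+1 - tv i j = 2 * pi * (d i j)%:~R - F,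
      forall i j, `|th i j| <= pi /\ `|tv i j| <= pi,
      forall i j g, `|g| <= beta ->
        (1 - 2 * eta) * (2 * th i j * g - g ^+ 2) <= e1 i j /\
        (1 - 2 * eta) * (2 * tv i j * g - g ^+ 2) <= e2 i j &
      forall i j, `|(d i j)%:~R : R| <= 150 * (e1 i j + e2 i.+1 j + e1 i j.+1 + e2 i j)].
Proof.
have [phi [n1 [n2 [p1 p2 q1 q2]]]] := phases.
pose th i j := phi i.+1 j - phi i j - a j - 2 * pi * (n1 i j)%:~R.
pose tv i j := phi i j.+1 - phi i j - b i - 2 * pi * (n2 i j)%:~R.
pose d i j : int := - (n1 i j + n2 i.+1 j - n1 i j.+1 - n2 i j).
pose r i j := Num.sqrt (zr i j ^+ 2 + zi i j ^+ 2).
have r0 i j : 0 <= r i j by exact: sqrtr_ge0.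
have P1 i j : zr i j = r i j * cos (phi i j) by exact: p1.
have P2 i j : zi i j = r i j * sin (phi i j) by exact: p2.
have cosn (t : R) (n : int) : cos (t - 2 * pi * n%:~R) = cos t.
  have cn (m : nat) s : cos (s + 2 * pi * m%:R) = cos s :> R.
    elim: m s => [|m IH] s; first by rewrite mulr0 addr0.
    rewrite -(IH s) (_ : s + 2 * pi * m.+1%:R = s + 2 * pi * m%:R + pi *+ 2) ?cosD2pi//.
    by rewrite -[m.+1%:R]natr1 mulr2n; ring.
  case: n => n; last by rewrite NegzE -[RHS](cn n.+1); congr cos; rewrite mulrNz; ring.
  by rewrite -(cn n (t - _)); congr cos; rewrite -pmulrn; ring.
have V_E i j : V i j = (1 - r i j ^+ 2) ^+ 2.
  by rewrite /V /well sqr_sqrtr// addr_ge0 ?sqr_ge0.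
have e1E i j : e1 i j = (r i.+1 j - r i j) ^+ 2 + 2 * r i j * r i.+1 j * (1 - cos (th i j)) +
    kap * ((1 - r i j ^+ 2) ^+ 2 + (1 - r i.+1 j ^+ 2) ^+ 2).
  rewrite /e1 !V_E /hop1 !P1 !P2.
  by rewrite hop_polar cosn.
have e2E i j : e2 i j = (r i j.+1 - r i j) ^+ 2 + 2 * r i j * r i j.+1 * (1 - cos (tv i j)) +
    kap * ((1 - r i j ^+ 2) ^+ 2 + (1 - r i j.+1 ^+ 2) ^+ 2).
  rewrite /e2 !V_E /hop2 !P1 !P2.
  by rewrite hop_polar cosn.
have curl i j : th i j + tv i.+1 j - th i j.+1 - tv i j = 2 * pi * (d i j)%:~R - F.
  by rewrite /th /tv /d -(flux i j) !(rmorphN, rmorphB, rmorphD)/=; ring.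
exists th, tv, d; split => //.
- by move=> i j; split; [exact: q1|exact: q2].
- move=> i j g gb; rewrite e1E e2E; split.
    exact: (edge_bound eta01 (ltW beta0) betaeta kapeta (q1 i j) gb).
  exact: (edge_bound eta01 (ltW beta0) betaeta kapeta (q2 i j) gb).
- move=> i j.
  have [D0|D0] := eqVneq (d i j) 0.
    by rewrite D0 normr0 mulr_ge0// addr_ge0 ?e2_ge0// addr_ge0 ?e1_ge0// addr_ge0 ?e1_ge0 ?e2_ge0.
  have pi3 := pi_lt_34 R; have pi2 := pi_ge2 R.
  (* Four increments below 1 and a flux of at most 1 must not add up to [2 * pi]. *)
  have pi52 : 5 / 2 < pi :> R.
    have := cos_ge1Bsqr (pi / 2 : R); rewrite cos_pihalf; nra.
  case/andP: F01 => F0 F1.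
  have dpos : 1 <= `|(d i j)%:~R : R| by rewrite -intr_norm -[1]/(1%:~R) ler_int -gtz0_ge1 normr_gt0.
  have dE : 2 * pi * `|(d i j)%:~R| = `|th i j + tv i.+1 j - th i j.+1 - tv i j + F|.
    rewrite curl subrK normrM ger0_norm//; lra.
  have tri : 2 * pi * `|(d i j)%:~R| <= `|th i j| + `|tv i.+1 j| + `|th i j.+1| + `|tv i j| + 1.
    rewrite dE (le_trans (ler_normD _ _))// lerD ?(ger0_norm (ltW F0))//.
    rewrite (le_trans (ler_normB _ _))// lerD//.
    by rewrite (le_trans (ler_normB _ _))// lerD// ler_normD.
  have d3 : `|(d i j)%:~R : R| <= 3.
    have := q1 i j; have := q1 i j.+1; have := q2 i j; have := q2 i.+1 j.
    rewrite -/(th i j) -/(th i j.+1) -/(tv i j) -/(tv i.+1 j) => *; nra.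
  suff : 1 / 50 <= e1 i j + e2 i.+1 j + e1 i j.+1 + e2 i j by lra.
  have large : 1 <= `|th i j| \/ 1 <= `|tv i.+1 j| \/ 1 <= `|th i j.+1| \/ 1 <= `|tv i j|.
    have [?|h1] := leP 1 `|th i j|; [by left|right].
    have [?|h2] := leP 1 `|tv i.+1 j|; [by left|right].
    have [?|h3] := leP 1 `|th i j.+1|; [by left|right].
    rewrite leNgt; apply/negP => h4; have : 2 * pi <= 2 * pi * `|(d i j)%:~R : R| by rewrite ler_peMr//; lra.
    lra.
  have := e1_ge0 i j; have := e1_ge0 i j.+1; have := e2_ge0 i j; have := e2_ge0 i.+1 j.
  case: large => [h|[h|[h|h]]].
  + have := edge_large eta01 kapeta (q1 i j) h (r0 i j) (r0 i.+1 j); rewrite -e1E; lra.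
  + have := edge_large eta01 kapeta (q2 i.+1 j) h (r0 i.+1 j) (r0 i.+1 j.+1); rewrite -e2E; lra.
  + have := edge_large eta01 kapeta (q1 i j.+1) h (r0 i j.+1) (r0 i.+1 j.+1); rewrite -e1E; lra.
  + have := edge_large eta01 kapeta (q2 i j) h (r0 i j) (r0 i j.+1); rewrite -e2E; lra.
Qed.

(* Duality: the kernel's test function is tested against the curl of the edge
   increments, whose sum is the total charge up to the flux and the boundary. *)
Let etaW : 0 <= 1 - 2 * eta /\ 1 - 2 * eta <= 1.
Proof. by move: eta01 => /andP[? ?]; lra. Qed.

(** [2 * t * g - g ^+ 2 <= t ^+ 2 <= pi ^+ 2] holds for every [g]; it serves along the frame, where
    [v] may jump. *)
Let edge_triv (t g e x : R) : 0 <= e -> `|t| <= pi -> 1 <= x ->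
  (1 - 2 * eta) * (2 * t * g - g ^+ 2) <= e + 12 * x.
Proof.
move=> e_0 tp x1; have [c0 c1] := etaW.
have p12 : pi ^+ 2 <= 12 :> R.
  by have := pi_lt_34 R; have := pi_ge2 R; rewrite expr2; nra.
have tg : 2 * t * g - g ^+ 2 <= 12.
  have : t ^+ 2 <= pi ^+ 2 by rewrite -[t ^+ 2]real_normK ?num_real// lerXn2r// nnegrE ?(pi_ge0 R).
  by have := sqr_ge0 (t - g); lra.
apply: le_trans (ler_wpM2l c0 tg) _; apply: le_trans (ler_wpM2r _ c1) _ => //.
by rewrite mul1r; lra.
Qed.

Let flux_term (z t y : R) : 0 <= F -> z <= y -> 2 * pi * (t * z) - F * y <= z * (2 * pi * t - F).
Proof. by move=> Fge0 /(ler_wpM2l Fge0); lra. Qed.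

(** The background flux enters with the wrong sign, as [F] times the l^1 norm of [v]. By the last
    clause of [charge_kernel] that norm is bounded by the number of charges, hence by the energy;
    this is the origin of the factor behind [E]. *)
Lemma grid_energy_kernel (Q : nat) : (1 < Q)%N -> beta <= 1 ->
  (1 - 2 * eta) * (expR (- (beta / 4)) * ln Q%:R) * (N%:R ^+ 2 * F) <=
  E * (1 + 2 * F * (2000 * (1 + ln Q%:R) * Q%:R ^+ 2 / beta ^+ 2) * 600) +
  200 * (1 + ln Q%:R) ^+ 2 * N.+2%:R.
Proof.
move=> Q1 beta1.
have [th [tv [d [curl thpi eb de]]]] := grid_energy_edges.
have [F0 F1] := andP F01; have [et0 et1] := andP eta01.
have lnQ : 0 <= ln (Q%:R : R) by rewrite ln_ge0// ler1n ltnW.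
have := @test_function R N Q beta d Q1; rewrite beta0 beta1 => /(_ isT).
set U := 1 + ln _; set X := 2000 * _ * _ / _.
have U1 : 1 <= U by rewrite /U; lra.
have X0 : 0 <= X by rewrite /X !mulr_ge0 ?invr_ge0 ?sqr_ge0//; lra.
move=> [m [v [/andP[m1 m2] vP vD vC vS]]].
have v0 i j : ~~ inner N i j -> v i j = 0 := (vP i j).1.
pose g1 i j := v i.+1 j.+1 - v i.+1 j; pose g2 i j := v i j.+1 - v i.+1 j.+1.
have pi3 := pi_lt_34 R; have pi2 := pi_ge2 R.
(* Marks the edges across which [v] passes to the frame: two per line at the price 12, hence
   [24 * N] in each direction. *)
pose B (j : nat) : R := (j == 0%N)%:R + (j == N)%:R.
have B0 j : 0 <= B j by rewrite addr_ge0.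
have [c0 c1] := etaW.
have edge (t g e : R) j : 0 <= e -> `|t| <= pi -> 1 <= B j -> (1 - 2 * eta) * (2 * t * g - g ^+ 2) <= e + 12 * B j.
  by move=> e_0 tp Bj; apply: edge_triv.
have Bj j : (j < N.+1)%N -> ~~ ((0 < j) && (j < N))%N -> 1 <= B j.
  move=> jN; rewrite negb_and -leqNgt leqn0 -leqNgt /B => /orP[->|Nj]; first by rewrite lerDl.
  by rewrite (_ : (j == N) = true) ?lerDr// eqn_leq Nj -ltnS jN.
have h1 i j : (i < N)%N -> (j < N.+1)%N ->
    (1 - 2 * eta) * (2 * th i j * g1 i j - g1 i j ^+ 2) <= e1 i j + 12 * B j.
  move=> iN jN; case: (boolP ((0 < j) && (j < N))%N) => [/andP[j0 j1]|/(Bj _ jN)]; last first.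
    by move=> b1; apply: (edge _ _ _ _ (e1_ge0 i j) (thpi i j).1 b1).
  have gb : `|g1 i j| <= beta by apply: (vD i.+1 j).2; rewrite /inner /= iN ?j0 ?j1 ?(ltnW j1)//= ltnW.
  by apply: le_trans (eb i j _ gb).1 _; rewrite lerDl mulr_ge0.
have h2 i j : (i < N.+1)%N -> (j < N)%N ->
    (1 - 2 * eta) * (2 * tv i j * g2 i j - g2 i j ^+ 2) <= e2 i j + 12 * B i.
  move=> iN jN; case: (boolP ((0 < i) && (i < N))%N) => [/andP[j0 j1]|/(Bj _ iN)]; last first.
    by move=> b1; apply: (edge _ _ _ _ (e2_ge0 i j) (thpi i j).2 b1).
  have gb : `|g2 i j| <= beta by rewrite /g2 distrC; apply: (vD i j.+1).1; rewrite /inner /= jN ?j0 ?j1 ?(ltnW j1)//= ltnW.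
  by apply: le_trans (eb i j _ gb).2 _; rewrite lerDl mulr_ge0.
have sB : \sum_(j < N.+1) B j <= 2.
  have one (n k : nat) : \sum_(i < n) ((i : nat) == k)%:R <= 1 :> R.
    elim: n => [|n IH]; first by rewrite big_ord0.
    rewrite big_ord_recr/=; case: eqP => [En|_]; last by rewrite addr0.
    rewrite big1 ?add0r// => i _; case: eqP => // e.
    by have := ltn_ord i; rewrite e En ltnn.
  by rewrite big_split/=; exact: lerD (one N.+1 0%N) (one N.+1 N).
have w0 (f : nat -> R) n : (forall i, 0 <= f i) -> \sum_(i < n) f i <= \sum_(i < n.+1) f i.
  by move=> f0; rewrite big_ord_recr/= lerDl.
have w1 (f : nat -> R) n : (forall i, 0 <= f i) -> \sum_(i < n) f i.+1 <= \sum_(i < n.+1) f i.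
  by move=> f0; rewrite big_ord_recl/= lerDr.
have H1 : \sum_(i < N) \sum_(j < N.+1) (1 - 2 * eta) * (2 * th i j * g1 i j - g1 i j ^+ 2) <=
    \sum_(i < N) \sum_(j < N.+1) e1 i j + 24 * N%:R.
  rewrite (_ : 24 * N%:R = \sum_(i < N) (24 : R)); last by rewrite sumr_const card_ord mulr_natr.
  rewrite -big_split; apply: ler_sum => i _ /=.
  rewrite (@le_trans _ _ (\sum_(j < N.+1) (e1 i j + 12 * B j)))//.
    by apply: ler_sum => j _; apply: h1.
  by rewrite big_split/= lerD2l -mulr_sumr; apply: le_trans (ler_wpM2l _ sB) _; rewrite // -natrM.
have H2 : \sum_(i < N.+1) \sum_(j < N) (1 - 2 * eta) * (2 * tv i j * g2 i j - g2 i j ^+ 2) <=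
    \sum_(i < N.+1) \sum_(j < N) e2 i j + 24 * N%:R.
  rewrite exchange_big/= [X in _ <= X + _]exchange_big/=.
  rewrite (_ : 24 * N%:R = \sum_(i < N) (24 : R)); last by rewrite sumr_const card_ord mulr_natr.
  rewrite -big_split; apply: ler_sum => j _ /=.
  rewrite (@le_trans _ _ (\sum_(i < N.+1) (e2 i j + 12 * B i)))//.
    by apply: ler_sum => i _; apply: h2.
  by rewrite big_split/= lerD2l -mulr_sumr; apply: le_trans (ler_wpM2l _ sB) _; rewrite // -natrM.
pose G : R := \sum_(i < N) \sum_(j < N.+1) g1 i j ^+ 2 + \sum_(i < N.+1) \sum_(j < N) g2 i j ^+ 2.
have GD : G <= dirichlet N.+2 v.
  have -> : dirichlet N.+2 v = \sum_(i < N.+2) \sum_(j < N.+2) d2 v i j ^+ 2 +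
      \sum_(i < N.+2) \sum_(j < N.+2) d1 v i j ^+ 2.
    rewrite /dirichlet -big_split; apply: eq_bigr => i _; rewrite -big_split.
    by apply: eq_bigr => j _; rewrite /= addrC.
  apply: lerD.
    apply: le_trans (_ : \sum_(i < N) \sum_(j < N.+2) d2 v i.+1 j ^+ 2 <= _).
      by apply: ler_sum => i _; apply: (w0 (fun j => d2 v i.+1 j ^+ 2)) => j; apply: sqr_ge0.
    apply: le_trans (w1 (fun i => \sum_(j < N.+2) d2 v i j ^+ 2) _ _) _.
      by move=> i; apply: sumr_ge0 => j _; apply: sqr_ge0.
    by apply: (w0 (fun i => \sum_(j < N.+2) d2 v i j ^+ 2)) => i; apply: sumr_ge0 => j _; apply: sqr_ge0.
  apply: le_trans (_ : \sum_(i < N.+1) \sum_(j < N.+2) d1 v i j ^+ 2 <= _).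
    apply: ler_sum => i _; apply: le_trans (_ : \sum_(j < N) d1 v i j.+1 ^+ 2 <= _).
      by apply: ler_sum => j _; rewrite /g2 /d1 -sqrrN opprB.
    apply: le_trans (w1 (fun j => d1 v i j ^+ 2) _ _) _; first by move=> j; apply: sqr_ge0.
    by apply: (w0 (fun j => d1 v i j ^+ 2)) => j; apply: sqr_ge0.
  by apply: (w0 (fun i => \sum_(j < N.+2) d1 v i j ^+ 2)) => i; apply: sumr_ge0 => j _; apply: sqr_ge0.
pose D := \sum_(i < N) \sum_(j < N) (d i j)%:~R : R.
pose DV : R := \sum_(i < N) \sum_(j < N) (d i j)%:~R * v i.+1 j.+1.
pose SV : R := \sum_(i < N) \sum_(j < N) `|v i.+1 j.+1|.
have H3 : \sum_(i < N) \sum_(j < N.+1) (1 - 2 * eta) * (2 * th i j * g1 i j - g1 i j ^+ 2) +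
    \sum_(i < N.+1) \sum_(j < N) (1 - 2 * eta) * (2 * tv i j * g2 i j - g2 i j ^+ 2) =
    (1 - 2 * eta) * (2 * (\sum_(i < N) \sum_(j < N) v i.+1 j.+1 * (2 * pi * (d i j)%:~R - F)) - G).
  have -> : \sum_(i < N) \sum_(j < N) v i.+1 j.+1 * (2 * pi * (d i j)%:~R - F) =
      \sum_(i < N) \sum_(j < N.+1) th i j * g1 i j + \sum_(i < N.+1) \sum_(j < N) tv i j * g2 i j.
    rewrite -cell_sum; first by apply: eq_bigr => i _; apply: eq_bigr => j _; rewrite curl.
    - by move=> j; rewrite v0// /inner /= ?ltnn ?andbF.
    - by move=> j; rewrite v0// /inner /= ?ltnn ?andbF.
    - by move=> j; rewrite v0// /inner /= ?ltnn ?andbF.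
    - by move=> j; rewrite v0// /inner /= ?ltnn ?andbF.
  have dist (n k : nat) (t g : nat -> nat -> R) :
      \sum_(i < n) \sum_(j < k) (1 - 2 * eta) * (2 * t i j * g i j - g i j ^+ 2) =
      (1 - 2 * eta) * (2 * (\sum_(i < n) \sum_(j < k) t i j * g i j) - \sum_(i < n) \sum_(j < k) g i j ^+ 2).
    rewrite !mulr_sumr -sumrB mulr_sumr; apply: eq_bigr => i _.
    by rewrite !mulr_sumr -sumrB mulr_sumr; apply: eq_bigr => j _; ring.
  by rewrite !dist /G; ring.
have H4 : 2 * pi * DV - F * SV <= \sum_(i < N) \sum_(j < N) v i.+1 j.+1 * (2 * pi * (d i j)%:~R - F).
  rewrite !mulr_sumr -sumrB; apply: ler_sum => i _; rewrite !mulr_sumr -sumrB; apply: ler_sum => j _.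
  by apply: flux_term; [exact: ltW|exact: ler_norm].
have H5 : N%:R ^+ 2 * F - 14 * N%:R <= 2 * pi * `|D|.
  have tele (t : nat -> nat -> R) : (forall i j, `|t i j| <= pi) ->
      `|\sum_(i < N) \sum_(j < N) (t i j.+1 - t i j)| <= 2 * pi * N%:R.
    move=> tp; rewrite (le_trans (ler_norm_sum _ _ _))//.
    rewrite mulr_natr -[N in _ *+ N]card_ord -sumr_const; apply: ler_sum => i _.
    rewrite -(big_mkord xpredT (fun j => t i j.+1 - t i j)) telescope_sumr//.
    by rewrite (le_trans (ler_normB _ _))// (_ : 2 * pi = pi + pi) ?lerD//; ring.
  have t1 := tele th (fun i j => (thpi i j).1).
  have t2 := tele (fun j i => tv i j) (fun i j => (thpi j i).2).
  apply: (charge_flux pi3 pi2 _ (ler_norm D) t1 t2) => //.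
  rewrite [X in _ + X]exchange_big/=.
  have -> : N%:R ^+ 2 * F = \sum_(i < N) \sum_(j < N) F.
    by rewrite !sumr_const card_ord -mulrnA -[RHS]mulr_natl natrM expr2.
  rewrite -sumrB -big_split mulr_sumr; apply: eq_bigr => i _ /=.
  rewrite -sumrB -big_split mulr_sumr; apply: eq_bigr => j _ /=.
  move: (curl i j) => /(congr1 (fun t => t + F)); rewrite subrK => <-; ring.
have H6 : \sum_(i < N) \sum_(j < N) `|(d i j)%:~R| <= 300 * E.
  apply: le_trans (_ : \sum_(i < N) \sum_(j < N) 150 * (e1 i j + e2 i.+1 j + e1 i j.+1 + e2 i j) <= _).
    by apply: ler_sum => i _; apply: ler_sum => j _.
  have -> : \sum_(i < N) \sum_(j < N) 150 * (e1 i j + e2 i.+1 j + e1 i j.+1 + e2 i j) =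
     150 * (\sum_(i < N) \sum_(j < N) e1 i j + \sum_(i < N) \sum_(j < N) e2 i.+1 j +
     \sum_(i < N) \sum_(j < N) e1 i j.+1 + \sum_(i < N) \sum_(j < N) e2 i j).
    rewrite -!big_split mulr_sumr; apply: eq_bigr => i _; rewrite -!big_split mulr_sumr.
    by apply: eq_bigr => j _.
  have : \sum_(i < N) \sum_(j < N) e1 i j <= \sum_(i < N) \sum_(j < N.+1) e1 i j.
    by apply: ler_sum => i _; apply: (w0 (e1 i)) => j; apply: e1_ge0.
  have : \sum_(i < N) \sum_(j < N) e1 i j.+1 <= \sum_(i < N) \sum_(j < N.+1) e1 i j.
    by apply: ler_sum => i _; apply: (w1 (e1 i)) => j; apply: e1_ge0.
  have : \sum_(i < N) \sum_(j < N) e2 i j <= \sum_(i < N.+1) \sum_(j < N) e2 i j.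
    by apply: (w0 (fun i => \sum_(j < N) e2 i j)) => i; apply: sumr_ge0 => j _; apply: e2_ge0.
  have : \sum_(i < N) \sum_(j < N) e2 i.+1 j <= \sum_(i < N.+1) \sum_(j < N) e2 i j.
    by apply: (w1 (fun i => \sum_(j < N) e2 i j)) => i; apply: sumr_ge0 => j _; apply: e2_ge0.
  by move=> a1 a2 a3 a4; apply: edges_arith a1 a2 a3 a4 e_le.
have E_ge0 : 0 <= E.
  by apply: le_trans e_le; rewrite addr_ge0//; apply: sumr_ge0 => i _; apply: sumr_ge0 => j _; [apply: e1_ge0|apply: e2_ge0].
have H9 : (1 - 2 * eta) * (2 * (\sum_(i < N) \sum_(j < N) v i.+1 j.+1 * (2 * pi * (d i j)%:~R - F)) - G)
   <= E + 48 * N%:R.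
  rewrite -H3; apply: le_trans (lerD H1 H2) _; rewrite addrACA lerD ?e_le// -mulrDl.
  by rewrite ler_wpM2r//; rewrite -natrD.
have -> : (N.+2%:R : R) = N%:R + 2 by rewrite -addn2 natrD.
apply: (kernel_arith c0 c1 _ m1 U1 m2 _ F0 F1 X0 E_ge0 _ H5 _ GD H4 vS H6 H9) => //.
- by rewrite mulr_ge0 ?expR_ge0.
- by apply: sumr_ge0 => i _; apply: sumr_ge0.
- by move: vC; rewrite (_ : (N.+2%:R : R) = N%:R + 2) // -addn2 natrD.
Qed.

End configuration.

End discrete_lower_bound.


From mathcomp Require Import all_classical all_reals all_analysis measurable_realfun.
Require Import Defs.


(** * Measurability, translation invariance and local integrability in the plane *)

Section plane_measure.
Variable R : realType.
Local Notation mu2 := (@leb2 R).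
Local Notation T1 := (measurableTypeR R).
Local Notation T2 := (T1 * T1)%type.
Implicit Types (f h : R * R -> R) (v g : R * R -> R).

(** Rational squares form a countable base and are measurable; this ties the topology of the plane
    to the product sigma-algebra. *)
Lemma open_measurable2 (A : set (R * R)) : open A -> measurable A.
Proof.
move=> oA; pose B (p : rat * rat * rat) : set (R * R) :=
  `]ratr p.1.1 - ratr p.2, ratr p.1.1 + ratr p.2[ `*` `]ratr p.1.2 - ratr p.2, ratr p.1.2 + ratr p.2[.
have mB p : measurable (B p) by apply: measurableX; apply: measurable_itv.
suff -> : A = \bigcup_(p in [set p | B p `<=` A]) B p.
  rewrite bigcup_mkcond; apply: countable_bigcupT_measurable => [|p].
    exact: countableP.
  by case: ifPn.
apply/seteqP; split => [x Ax|x [p pA Bx]]; last exact: pA.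
have [e /= e0 eA] : nbhs_ball x A by apply/nbhs_ballP; apply: open_nbhs_nbhs.
have [r] : exists r : rat, 0 < (ratr r : R) /\ ratr r < e / 2.
  have [r /=] := @rat_in_itvoo R 0 (e / 2) ltac:(lra).
  by rewrite in_itv/= => /andP[r0 r1]; exists r.
move=> [r0 r1].
have q_ (t : R) : exists q : rat, t - ratr r < ratr q < t + ratr r.
  have [q /=] := @rat_in_itvoo R (t - ratr r) (t + ratr r) ltac:(lra).
  by rewrite in_itv/= => h; exists q.
have [q1 h1] := q_ x.1; have [q2 h2] := q_ x.2.
exists ((q1, q2), r).
  move=> y [/=]; rewrite !in_itv/= => y1 y2; apply: eA; split; rewrite /= /ball/= ltr_distl; apply/andP; split; lra.
by split; rewrite /= in_itv/=; lra.
Qed.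

Lemma continuous_measurable2 f : continuous f -> measurable_fun setT f.
Proof.
move=> /continuousP cf; apply: (measurability _ (RGenOpens.measurableE R)).
move=> _ [_ [a [b ->] <-]]; rewrite setTI; apply: open_measurable2.
exact/cf/interval_open.
Qed.

Definition shift2 (a x : R * R) : R * R := (x.1 + a.1, x.2 + a.2).

Lemma measurable_shift2 a : measurable_fun setT (shift2 a : T2 -> T2).
Proof.
apply/measurable_fun_pairP; split.
  by apply: measurable_funD => //; exact: measurable_fst.
by apply: measurable_funD => //; exact: measurable_snd.
Qed.

Lemma lebesgue_shift (a : R) (A : set R) : measurable A ->
  pushforward lebesgue_measure ((fun x => x + a) : R -> measurableTypeR R) A = lebesgue_measure A.
Proof.
have mf : measurable_fun setT ((fun x => x + a) : R -> measurableTypeR R).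
  exact: measurable_funD.
move=> mA; apply/esym/lebesgue_measure_unique => //= _ [[c b]] _ <-.
rewrite /pushforward (_ : _ @^-1` _ = `]c - a, b - a]%classic); last first.
  by apply/seteqP; split => x /=; rewrite !in_itv/= ltrBlDr lerBrDr.
by rewrite !lebesgue_measure_itv/= !lte_fin ltrD2r -EFinB -EFinB opprB addrA subrK.
Qed.

(** Both measures agree on rectangles, and these determine a product measure. *)
Lemma leb2_shift a (A : set T2) : measurable A ->
  pushforward (@leb2 R) (shift2 a : T2 -> T2) A = mu2 A.
Proof.
move=> mA; rewrite /leb2; apply/esym/product_measure_unique => //=; first exact: measurable_shift2.
move=> _ B C mB mC; rewrite /pushforward.
rewrite (_ : _ @^-1` _ = ((fun x => x + a.1) @^-1` B) `*` ((fun x => x + a.2) @^-1` C))//.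
have mp (c : R) (D : set R) : measurable D -> measurable ((fun x => x + c) @^-1` D).
  by move=> mD; rewrite -[X in measurable X]setTI; apply: measurable_funD.
rewrite product_measure1E; [|exact: mp|exact: mp].
by congr (_ * _)%E; [rewrite -(lebesgue_shift a.1 mB)|rewrite -(lebesgue_shift a.2 mC)].
Qed.

Lemma ge0_integral_shift2 a (f : T2 -> \bar R) : measurable_fun setT f ->
  (forall x, 0 <= f x)%E ->
  (\int[mu2]_x f (shift2 a x) = \int[mu2]_x f x)%E.
Proof.
move=> mf f0.
have := @ge0_integral_pushforward _ _ _ _ R _ (measurable_shift2 a)
  (@leb2 R : {measure set T2 -> \bar R}) setT f measurableT mf (fun x _ => f0 x).
rewrite preimage_setT => <-.
apply: eq_measure_integral => [|? A mA _]; first exact: measurable_shift2.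
exact: leb2_shift.
Qed.

Lemma integral_shift2 a (f : T2 -> \bar R) : measurable_fun setT f ->
  (\int[mu2]_x f (shift2 a x) = \int[mu2]_x f x)%E.
Proof.
move=> mf; rewrite [LHS]integralE [RHS]integralE; congr (_ - _)%E.
  transitivity (\int[mu2]_x (f^\+ (shift2 a x)))%E; first by apply: eq_integral => x _; rewrite !funeposE.
  by apply: ge0_integral_shift2 => //; exact: measurable_funepos.
transitivity (\int[mu2]_x (f^\- (shift2 a x)))%E; first by apply: eq_integral => x _; rewrite !funenegE.
by apply: ge0_integral_shift2 => //; exact: measurable_funeneg.
Qed.

Lemma measurable_box (M : R) : measurable (box M : set T2).
Proof. by apply: measurableX; exact: measurable_itv. Qed.

Lemma compact_box (M : R) : compact (box M).
Proof. by apply: compact_setX; exact: segment_compact. Qed.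

Definition L1loc v := measurable_fun setT v /\
  forall M : R, (\int[mu2]_(x in box M) (`|v x|)%:E < +oo)%E.

Lemma leb2_box (M : R) : (mu2 (box M) < +oo)%E.
Proof.
rewrite /leb2 /box product_measure1E; [|exact: measurable_itv|exact: measurable_itv].
have e : lebesgue_measure (`[- M, M] : set R) \is a fin_num.
  by rewrite lebesgue_measure_itv/= lte_fin; case: ifP => _; rewrite -?EFinB.
by apply: lte_mul_pinfty => //; rewrite ltey_eq; apply/orP; left; exact: e.
Qed.

(** [|v| <= 1 + v ^+ 2], and boxes have finite measure. *)
Lemma L2loc_L1loc v : L2loc v -> L1loc v.
Proof.
move=> [mv hv]; split=> // M.
have mB := measurable_box M.
have m2 : measurable_fun (box M : set T2) (fun x => ((v x) ^+ 2)%:E).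
  by apply/measurable_EFinP; apply: measurable_funX; exact: measurable_funTS.
apply: le_lt_trans (_ : \int[mu2]_(x in box M) (1%:E + ((v x) ^+ 2)%:E) < +oo)%E; last first.
  rewrite ge0_integralD//; last by move=> x _; rewrite lee_fin sqr_ge0.
  by rewrite integral_cst// mul1e lte_add_pinfty// leb2_box.
apply: ge0_le_integral => //.
- apply/measurable_EFinP; apply: measurableT_comp => //; exact: measurable_funTS.
- by apply: emeasurable_funD.
- move=> x _; rewrite -EFinD lee_fin -real_normK ?num_real//.
  have := sqr_ge0 (`|v x| - 1 / 2); lra.
Qed.

Definition compact_support f := exists M : R, forall x, M < `|x.1| \/ M < `|x.2| -> f x = 0.

Lemma boxP (M : R) x : box M x <-> `|x.1| <= M /\ `|x.2| <= M.
Proof. by rewrite /box /= !in_itv/= !ler_norml; split=> [[-> ->]|[-> ->]]. Qed.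

Lemma continuous_bounded f (M : R) : continuous f -> exists2 B : R, 0 <= B & forall x, box M x -> `|f x| <= B.
Proof.
move=> cf; have : compact (f @` box M).
  by apply: continuous_compact; [exact: continuous_subspaceT|exact: compact_box].
move/compact_bounded => [B [_ hB]]; exists (`|B| + 1) => [|x bx]; first exact: addr_ge0.
apply: (hB (`|B| + 1)); last by exists x.
by rewrite (le_lt_trans (ler_norm _))// ltrDl.
Qed.

Lemma integrable_test v f : L1loc v -> continuous f -> compact_support f ->
  mu2.-integrable setT (fun x => (v x * f x)%:E).
Proof.
move=> [mv hv] cf [M fM]; have [B B0 hB] := continuous_bounded M cf.
have mf := continuous_measurable2 cf.
have mB := measurable_box M.
have mvB : measurable_fun (box M : set T2) (fun x => (`|v x|)%:E).
  by apply/measurable_EFinP; apply: measurableT_comp => //; exact: measurable_funTS.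
have mvf : measurable_fun [set: T2] (fun x => (v x * f x)%:E).
  by apply/measurable_EFinP; exact: measurable_funM.
apply/integrableP; split => //.
apply: le_lt_trans (_ : \int[mu2]_(x in box M) (B%:E * (`|v x|)%:E) < +oo)%E.
  rewrite [leRHS]integral_mkcond; apply: ge0_le_integral => //.
  - by apply: measurableT_comp.
  - by apply/(measurable_restrictT _ mB); apply: emeasurable_funM.
  - move=> x _; rewrite patchE; case: ifPn => [/[!inE] bx|/negP].
      by rewrite -EFinM lee_fin normrM mulrC ler_wpM2r//; exact: hB.
    rewrite inE boxP => nb; rewrite fM ?mulr0 /= ?normr0//.
    by apply: contrapT => /not_orP[/negP h1 /negP h2]; apply: nb; rewrite !leNgt.
by rewrite ge0_integralZl// lte_mul_pinfty.
Qed.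

End plane_measure.

(** * Calculus of functions with continuous partial derivatives *)

Section smooth_functions.
Variable R : realType.
Local Notation mu2 := (@leb2 R).
Local Notation T1 := (measurableTypeR R).
Local Notation T2 := (T1 * T1)%type.
Implicit Types (c f v g phi : R * R -> R) (d e : bool -> R * R -> R).

(** The partial derivatives belong to the data, so that sums, products and compositions come with
    explicit derivatives. *)
Definition C1 c d := [/\ continuous c, forall j, continuous (d j),
  forall x, is_derive x.1 (1 : R) (fun t => c (t, x.2)) (d false x) &
  forall x, is_derive x.2 (1 : R) (fun t => c (x.1, t)) (d true x)].

Lemma C1_partial c d j : C1 c d -> partial j c = d j.
Proof.
move=> [_ _ d1 d2]; apply/funext => x; case: j; rewrite /partial /partial1 /partial2 derive1E.
  by have [_ <-] := d2 x.
by have [_ <-] := d1 x.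
Qed.

Lemma test_C1 c d : C1 c d -> compact_support c -> test_fun c.
Proof.
move=> cd sc; have [cc ce d1 d2] := cd; split => //.
split; first by move=> x; have [] := d1 x.
split; first by move=> x; have [] := d2 x.
rewrite -[partial1 c]/(partial false c) -[partial2 c]/(partial true c).
by rewrite !(C1_partial _ cd); do !split; try exact: ce.
Qed.

Lemma C1_test c : test_fun c -> C1 c (fun j => partial j c) /\ compact_support c.
Proof.
move=> [cc [d1 [d2 [c1 [c2 sc]]]]]; split; last exact: sc.
split; [exact: cc|by case|..].
- move=> x; have := d1 x => h; split => //; by rewrite /partial /partial1 derive1E.
- move=> x; have := d2 x => h; split => //; by rewrite /partial /partial2 derive1E.
Qed.

Lemma C1_ext c d e : C1 c d -> (forall j x, d j x = e j x) -> C1 c e.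
Proof. by move=> cd de; have -> : e = d by apply/funext => j; apply/funext => x. Qed.

Lemma C1_cst (k : R) : C1 (fun=> k) (fun _ _ => 0).
Proof.
split => [|j|x|x]; try exact: cst_continuous; exact: is_derive_cst.
Qed.

Lemma C1_proj (k : bool) : C1 (fun x => if k then x.2 else x.1) (fun j _ => (j == k)%:R).
Proof.
split.
- by case: k => x; [exact: cvg_snd|exact: cvg_fst].
- move=> j; exact: cst_continuous.
- by case: k => x /=; [exact: is_derive_cst|exact: is_derive_id].
- by case: k => x /=; [exact: is_derive_id|exact: is_derive_cst].
Qed.

Lemma C1D c1 d1 c2 d2 : C1 c1 d1 -> C1 c2 d2 -> C1 (fun x => c1 x + c2 x) (fun j x => d1 j x + d2 j x).
Proof.
move=> [a1 a2 a3 a4] [b1 b2 b3 b4]; split.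
- by move=> x; apply: cvgD; [exact: a1|exact: b1].
- by move=> j x; apply: cvgD; [exact: a2|exact: b2].
- by move=> x; apply: is_deriveD.
- by move=> x; apply: is_deriveD.
Qed.

Lemma C1M c1 d1 c2 d2 : C1 c1 d1 -> C1 c2 d2 ->
  C1 (fun x => c1 x * c2 x) (fun j x => c1 x * d2 j x + d1 j x * c2 x).
Proof.
move=> [a1 a2 a3 a4] [b1 b2 b3 b4]; split.
- by move=> x; apply: cvgM; [exact: a1|exact: b1].
- move=> j x; apply: cvgD; apply: cvgM; [exact: a1|exact: b2|exact: a2|exact: b1].
- move=> x; have := a3 x; have := b3 x => h1 h2; apply: is_derive_eq.
  by rewrite /GRing.scale/= -!surjective_pairing [X in _ + X]mulrC.
- move=> x; have := a4 x; have := b4 x => h1 h2; apply: is_derive_eq.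
  by rewrite /GRing.scale/= -!surjective_pairing [X in _ + X]mulrC.
Qed.

Lemma C1_comp (h h' : R -> R) c d : (forall t : R, is_derive t (1 : R) h (h' t)) -> continuous h' ->
  C1 c d -> C1 (fun x => h (c x)) (fun j x => h' (c x) * d j x).
Proof.
move=> hh ch' [a1 a2 a3 a4].
have ch : continuous h.
  by move=> t; apply: differentiable_continuous; apply/derivable1_diffP; have [] := hh t.
split.
- by move=> x; apply: continuous_comp; [exact: a1|exact: ch].
- move=> j x; apply: cvgM; last exact: a2.
  by apply: continuous_comp; [exact: a1|exact: ch'].
- move=> x; have := a3 x; case: x => x1 x2 /= h1.
  exact: (@is_derive1_comp R h (fun t => c (t, x2)) x1).
- move=> x; have := a4 x; case: x => x1 x2 /= h1.
  exact: (@is_derive1_comp R h (fun t => c (x1, t)) x2).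
Qed.

Lemma continuous_shift2 a : continuous (shift2 a : R * R -> R * R).
Proof.
move=> x.
have h1 : (fun y : R * R => y.1 + a.1) @ x --> x.1 + a.1.
  by apply: cvgD; [exact: cvg_fst|exact: cvg_cst].
have h2 : (fun y : R * R => y.2 + a.2) @ x --> x.2 + a.2.
  by apply: cvgD; [exact: cvg_snd|exact: cvg_cst].
exact: (cvg_pair h1 h2).
Qed.

Lemma C1_shift a c d : C1 c d -> C1 (fun x => c (shift2 a x)) (fun j x => d j (shift2 a x)).
Proof.
move=> [a1 a2 a3 a4]; split.
- by move=> x; apply: continuous_comp; [exact: continuous_shift2|exact: a1].
- by move=> j x; apply: continuous_comp; [exact: continuous_shift2|exact: a2].
- move=> x; have := a3 (shift2 a x) => h; rewrite -[d false _]mulr1.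
  apply: (@is_derive1_comp R (fun t => c (t, x.2 + a.2)) (fun t => t + a.1)).
  by apply: is_derive_eq; rewrite addr0.
- move=> x; have := a4 (shift2 a x) => h; rewrite -[d true _]mulr1.
  apply: (@is_derive1_comp R (fun t => c (x.1 + a.1, t)) (fun t => t + a.2)).
  by apply: is_derive_eq; rewrite addr0.
Qed.

(** Along the line of differentiation the function vanishes identically if the fixed coordinate is
    large, and near the point if the moving one is. *)
Lemma C1_support c d j : C1 c d -> compact_support c -> compact_support (d j).
Proof.
move=> cd [M cM]; exists M => x xM; rewrite -(C1_partial j cd).
have nr (t : R) : M < `|t| -> \forall s \near t, M < `|s|.
  have ct : (fun s : R => `|s|) @ t --> `|t| by exact: norm_continuous.
  by move: ct => /cvgr_gt ct h; exact: ct.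
case: j; rewrite /partial /partial1 /partial2 derive1E.
  rewrite -[RHS](derive_cst (0 : R) x.2 (1 : R)); apply: near_eq_derive.
  case: xM => xM; first by apply/nbhs_ballP; exists 1 => //= t _; rewrite cM//; left.
  by apply: filterS (nr _ xM) => t tM; rewrite cM//; right.
rewrite -[RHS](derive_cst (0 : R) x.1 (1 : R)); apply: near_eq_derive.
case: xM => xM; last by apply/nbhs_ballP; exists 1 => //= t _; rewrite cM//; right.
by apply: filterS (nr _ xM) => t tM; rewrite cM//; left.
Qed.

Lemma compact_supportMl c f : compact_support f -> compact_support (fun x => c x * f x).
Proof. by move=> [M fM]; exists M => x xM; rewrite fM// mulr0. Qed.

Lemma compact_support_shift a f : compact_support f -> compact_support (fun x => f (shift2 a x)).
Proof.
move=> [M fM]; exists (M + `|a.1| + `|a.2|) => x xM; apply: fM => /=.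
have := ler_normB (x.1 + a.1) a.1; have := ler_normB (x.2 + a.2) a.2.
rewrite !addrK; have := normr_ge0 a.1; have := normr_ge0 a.2 => h1 h2 h3 h4.
by case: xM => h; [left|right]; lra.
Qed.

End smooth_functions.

(** * Rules for weak derivatives *)

Section weak_derivatives.
Variable R : realType.
Local Notation mu2 := (@leb2 R).
Local Notation T1 := (measurableTypeR R).
Local Notation T2 := (T1 * T1)%type.
Implicit Types (c f v g phi : R * R -> R) (d e : bool -> R * R -> R).

Definition J f : R := \int[mu2]_x f x.
Definition integ f := mu2.-integrable [set: T2] (EFin \o f).

Lemma J_EFin f : integ f -> (\int[mu2]_x (f x)%:E = (J f)%:E)%E.
Proof. by move=> hf; rewrite /J /Rintegral fineK// integrable_fin_num. Qed.

Lemma JD f g : integ f -> integ g -> J (fun x => f x + g x) = J f + J g.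
Proof. by move=> hf hg; rewrite /J RintegralD. Qed.

Lemma JB f g : integ f -> integ g -> J (fun x => f x - g x) = J f - J g.
Proof. by move=> hf hg; rewrite /J RintegralB. Qed.

Lemma JZ (k : R) f : integ f -> J (fun x => k * f x) = k * J f.
Proof. by move=> hf; rewrite /J RintegralZl. Qed.

Lemma eq_J f g : f =1 g -> J f = J g.
Proof. by move=> fg; congr J; apply/funext. Qed.

Lemma integ_test v f : L1loc v -> continuous f -> compact_support f -> integ (fun x => v x * f x).
Proof. exact: integrable_test. Qed.

Lemma integD f g : integ f -> integ g -> integ (fun x => f x + g x).
Proof. by move=> hf hg; have := integrableD measurableT hf hg. Qed.

Lemma J_shift a f : measurable_fun [set: T2] f -> J (fun x => f (shift2 a x)) = J f.
Proof.
move=> mf; rewrite /J /Rintegral.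
rewrite -[in RHS](@integral_shift2 R a (fun x => (f x)%:E))//.
exact/measurable_EFinP.
Qed.

(** For locally integrable data the extended integrals are finite, so the defining identity can be
    handled in [R]. *)
Lemma weak_derivP j v g : L1loc v -> L1loc g ->
  weak_deriv j v g <-> forall phi d, C1 phi d -> compact_support phi ->
    J (fun x => v x * d j x) = - J (fun x => g x * phi x).
Proof.
move=> hv hg; have key phi d : C1 phi d -> compact_support phi ->
    (\int[mu2]_x (v x * d j x)%:E = - \int[mu2]_x (g x * phi x)%:E)%E <->
    J (fun x => v x * d j x) = - J (fun x => g x * phi x).
  move=> hphi sp; have [cp cd _ _] := hphi.
  rewrite (J_EFin (integ_test hv (cd j) (C1_support j hphi sp))) (J_EFin (integ_test hg cp sp)).
  by rewrite -EFinN; split=> [[]|->].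
split=> [w phi d hphi sp|w phi tphi].
  by apply/key => //; have := w phi (test_C1 hphi sp); rewrite (C1_partial j hphi).
by have [hphi sp] := C1_test tphi; exact: ((key _ _ hphi sp).2 (w _ _ hphi sp)).
Qed.

Lemma L1locD v g : L1loc v -> L1loc g -> L1loc (fun x => v x + g x).
Proof.
move=> [mv hv] [mg hg]; split=> [|M]; first exact: measurable_funD.
have mB := @measurable_box R M.
have m f : measurable_fun [set: T2] f -> measurable_fun (box M : set T2) (fun x => (`|f x|)%:E).
  by move=> mf; apply/measurable_EFinP; apply: measurableT_comp => //; exact: measurable_funTS.
apply: le_lt_trans (_ : \int[mu2]_(x in box M) ((`|v x|)%:E + (`|g x|)%:E) < +oo)%E; last first.
  by rewrite ge0_integralD//; [exact: lte_add_pinfty|exact: m|exact: m].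
apply: ge0_le_integral => //.
- by apply: m; exact: measurable_funD.
- by apply: emeasurable_funD; exact: m.
- by move=> x _; rewrite -EFinD lee_fin ler_normD.
Qed.

Lemma L1locM c v : continuous c -> L1loc v -> L1loc (fun x => c x * v x).
Proof.
move=> cc [mv hv]; split=> [|M]; first by apply: measurable_funM => //; exact: continuous_measurable2.
have mB := @measurable_box R M; have [B B0 cB] := continuous_bounded M cc.
have m f : measurable_fun [set: T2] f -> measurable_fun (box M : set T2) (fun x => (`|f x|)%:E).
  by move=> mf; apply/measurable_EFinP; apply: measurableT_comp => //; exact: measurable_funTS.
apply: le_lt_trans (_ : \int[mu2]_(x in box M) (B%:E * (`|v x|)%:E) < +oo)%E; last first.
  by rewrite ge0_integralZl//; [exact: lte_mul_pinfty|exact: m].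
apply: ge0_le_integral => //.
- by apply: m; apply: measurable_funM => //; exact: continuous_measurable2.
- by apply: emeasurable_funM => //; exact: m.
- by move=> x bx; rewrite -EFinM lee_fin normrM ler_wpM2r//; exact: cB.
Qed.

Lemma L2locD v g : L2loc v -> L2loc g -> L2loc (fun x => v x + g x).
Proof.
move=> [mv hv] [mg hg]; split=> [|M]; first exact: measurable_funD.
have mB := @measurable_box R M.
have m f : measurable_fun [set: T2] f -> measurable_fun (box M : set T2) (fun x => (f x ^+ 2)%:E).
  by move=> mf; apply/measurable_EFinP; apply: measurable_funX; exact: measurable_funTS.
apply: le_lt_trans (_ : \int[mu2]_(x in box M) (2%:E * (v x ^+ 2)%:E + 2%:E * (g x ^+ 2)%:E) < +oo)%E; last first.
  rewrite ge0_integralD//; last first.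
  - by apply: emeasurable_funM => //; exact: m.
  - by move=> x _; rewrite -EFinM lee_fin mulr_ge0// sqr_ge0.
  - by apply: emeasurable_funM => //; exact: m.
  - by move=> x _; rewrite -EFinM lee_fin mulr_ge0// sqr_ge0.
  have s f x : (box M : set T2) x -> (0 <= (f x ^+ 2)%:E)%E by move=> _; rewrite lee_fin sqr_ge0.
  rewrite !ge0_integralZl//; try by [exact: m|exact: s].
  by rewrite lte_add_pinfty// lte_mul_pinfty.
apply: ge0_le_integral => //.
- by move=> x _; rewrite lee_fin sqr_ge0.
- by apply: m; exact: measurable_funD.
- by apply: emeasurable_funD; apply: emeasurable_funM => //; exact: m.
- move=> x _; rewrite -!EFinM -EFinD lee_fin; have := sqr_ge0 (v x - g x); lra.
Qed.

Lemma L2locM c v : continuous c -> L2loc v -> L2loc (fun x => c x * v x).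
Proof.
move=> cc [mv hv]; split=> [|M]; first by apply: measurable_funM => //; exact: continuous_measurable2.
have mB := @measurable_box R M; have [B B0 cB] := continuous_bounded M cc.
have m f : measurable_fun [set: T2] f -> measurable_fun (box M : set T2) (fun x => (f x ^+ 2)%:E).
  by move=> mf; apply/measurable_EFinP; apply: measurable_funX; exact: measurable_funTS.
have s f x : (box M : set T2) x -> (0 <= (f x ^+ 2)%:E)%E by move=> _; rewrite lee_fin sqr_ge0.
apply: le_lt_trans (_ : \int[mu2]_(x in box M) ((B ^+ 2)%:E * (v x ^+ 2)%:E) < +oo)%E; last first.
  rewrite ge0_integralZl//; [|exact: m|exact: s|by rewrite lee_fin sqr_ge0].
  by rewrite lte_mul_pinfty// lee_fin sqr_ge0.
apply: ge0_le_integral => //.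
- by move=> x _; rewrite lee_fin sqr_ge0.
- by apply: m; apply: measurable_funM => //; exact: continuous_measurable2.
- by apply: emeasurable_funM => //; exact: m.
- move=> x bx; rewrite -EFinM lee_fin exprMn ler_wpM2r ?sqr_ge0//.
  by rewrite -[c x ^+ 2]real_normK ?num_real// lerXn2r// ?nnegrE//; exact: cB.
Qed.

Lemma weak_derivD j v1 g1 v2 g2 : L1loc v1 -> L1loc g1 -> L1loc v2 -> L1loc g2 ->
  weak_deriv j v1 g1 -> weak_deriv j v2 g2 ->
  weak_deriv j (fun x => v1 x + v2 x) (fun x => g1 x + g2 x).
Proof.
move=> a1 b1 a2 b2 /(weak_derivP _ a1 b1) w1 /(weak_derivP _ a2 b2) w2.
apply/weak_derivP; [exact: L1locD|exact: L1locD|] => phi d hphi sp.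
have [cp cd _ _] := hphi; have sd := C1_support j hphi sp.
rewrite (@eq_J _ (fun x => v1 x * d j x + v2 x * d j x)); last by move=> x; rewrite mulrDl.
rewrite [in RHS](@eq_J _ (fun x => g1 x * phi x + g2 x * phi x)); last by move=> x; rewrite mulrDl.
rewrite !JD; try by [exact: integ_test].
by rewrite (w1 _ _ hphi sp) (w2 _ _ hphi sp) opprD.
Qed.

(** The Leibniz rule, by testing the weak derivative of [v] with [c * phi]. *)
Lemma weak_derivM j c d v g : C1 c d -> L1loc v -> L1loc g ->
  weak_deriv j v g -> weak_deriv j (fun x => c x * v x) (fun x => c x * g x + d j x * v x).
Proof.
move=> hc a b /(weak_derivP _ a b) w; have [cc cd _ _] := hc.
apply/weak_derivP; [exact: L1locM|by apply: L1locD; exact: L1locM|] => phi e hphi sp.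
have [cp ce _ _] := hphi; have se := C1_support j hphi sp.
have := w _ _ (C1M hc hphi) (compact_supportMl c sp) => /=.
have cM (f h : R * R -> R) : continuous f -> continuous h -> continuous (fun x => f x * h x).
  by move=> cf ch x; apply: cvgM; [exact: cf|exact: ch].
rewrite (@eq_J _ (fun x => v x * (c x * e j x) + v x * (d j x * phi x))); last by move=> x; rewrite mulrDr.
rewrite JD; last 2 first.
- by apply: integ_test => //; [exact: cM|exact: compact_supportMl].
- by apply: integ_test => //; [exact: cM|exact: compact_supportMl].
move=> E.
rewrite [in RHS](@eq_J _ (fun x => g x * (c x * phi x) + v x * (d j x * phi x))); last by move=> x; ring.
rewrite JD; last 2 first.
- by apply: integ_test => //; [exact: cM|exact: compact_supportMl].
- by apply: integ_test => //; [exact: cM|exact: compact_supportMl].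
rewrite opprD -E (@eq_J _ (fun x => v x * (c x * e j x))); last by move=> x; ring.
by rewrite addrK.
Qed.

Lemma L1loc_shift a v : L1loc v -> L1loc (fun x => v (shift2 a x)).
Proof.
move=> [mv hv]; split=> [|M]; first by apply: (measurableT_comp mv); exact: measurable_shift2.
pose M' := M + `|a.1| + `|a.2|.
have mB' := @measurable_box R M'; have mB := @measurable_box R M.
have mav : measurable_fun [set: T2] (fun x => (`|v x|)%:E).
  by apply/measurable_EFinP; apply: measurableT_comp.
have mr : measurable_fun [set: T2] ((fun x => (`|v x|)%:E) \_ (box M' : set T2)).
  by apply/(measurable_restrictT _ mB'); exact: measurable_funTS.
apply: le_lt_trans (hv M').
rewrite [leRHS]integral_mkcond -[leRHS](ge0_integral_shift2 a mr); last first.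
  by move=> x; rewrite patchE; case: ifP.
rewrite [leLHS]integral_mkcond; apply: ge0_le_integral => //.
- by move=> x _; rewrite patchE; case: ifP.
- apply/(measurable_restrictT _ mB); apply: measurable_funTS.
  by apply: (measurableT_comp mav); exact: measurable_shift2.
- by apply: (measurableT_comp mr); exact: measurable_shift2.
- move=> x _; rewrite !patchE; have [|nb] := pselect (box M x); last first.
    by rewrite memNset//; case: ifP => //= _; rewrite lee_fin.
  move=> bx; have /boxP[h1 h2] := bx; rewrite mem_set// mem_set//; apply/boxP; rewrite /shift2/= /M'.
  have := ler_normD x.1 a.1; have := ler_normD x.2 a.2.
  by have := normr_ge0 a.1; have := normr_ge0 a.2; split; lra.
Qed.

Lemma L2loc_shift a v : L2loc v -> L2loc (fun x => v (shift2 a x)).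
Proof.
move=> [mv hv]; split=> [|M]; first by apply: (measurableT_comp mv); exact: measurable_shift2.
have : L1loc (fun x => v x ^+ 2).
  split=> [|N]; first exact: measurable_funX.
  by under eq_integral => x _ do rewrite ger0_norm ?sqr_ge0//; exact: hv.
move/(L1loc_shift a) => [_ /(_ M)].
by under eq_integral => x _ do rewrite ger0_norm ?sqr_ge0//.
Qed.

Definition opp2 (a : R * R) : R * R := (- a.1, - a.2).

Lemma shift2K a x : shift2 a (shift2 (opp2 a) x) = x.
Proof. by case: x => x1 x2; rewrite /shift2 /opp2/= !subrK. Qed.

Lemma weak_deriv_shift a j v g : L1loc v -> L1loc g ->
  weak_deriv j v g -> weak_deriv j (fun x => v (shift2 a x)) (fun x => g (shift2 a x)).
Proof.
move=> hv hg /(weak_derivP _ hv hg) w.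
apply/weak_derivP; [exact: L1loc_shift|exact: L1loc_shift|] => phi d hphi sp.
have [cp cd _ _] := hphi.
have := w _ _ (C1_shift (opp2 a) hphi) (compact_support_shift (opp2 a) sp) => /=.
have m v' f : L1loc v' -> continuous f -> measurable_fun [set: T2] (fun x => v' (shift2 a x) * f x).
  move=> [mv' _] cf; apply: measurable_funM; last exact: continuous_measurable2.
  by apply: (measurableT_comp mv'); exact: measurable_shift2.
rewrite -(J_shift (opp2 a) (m _ _ hv (cd j))) -(J_shift (opp2 a) (m _ _ hg cp)).
move=> E; rewrite (@eq_J _ (fun x => v x * d j (shift2 (opp2 a) x))); last by move=> x; rewrite shift2K.
by rewrite E; congr (- _); apply: eq_J => x; rewrite shift2K.
Qed.

(** A test function only sees a box that contains its support and that of its derivative. *)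
Lemma weak_deriv_local j v g : L1loc v -> L1loc g ->
  (forall M : R, exists v' g', [/\ L1loc v', L1loc g', weak_deriv j v' g',
     forall x, box M x -> v x = v' x & forall x, box M x -> g x = g' x]) ->
  weak_deriv j v g.
Proof.
move=> hv hg loc; apply/weak_derivP => // phi d hphi sp.
have [M sM] := sp; have [N sN] := C1_support j hphi sp.
have [v' [g' [hv' hg' /(weak_derivP _ hv' hg') w ev eg]]] := loc (Num.max M N).
have off x : ~ box (Num.max M N) x -> phi x = 0 /\ d j x = 0.
  move=> nb; have : Num.max M N < `|x.1| \/ Num.max M N < `|x.2|.
    by apply: contrapT => /not_orP[/negP h1 /negP h2]; apply: nb; rewrite boxP !leNgt.
  rewrite !gt_max => h; split; [apply: sM|apply: sN]; by case: h => /andP[? ?]; [left|right].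
rewrite (@eq_J _ (fun x => v' x * d j x)); last first.
  by move=> x; have [/ev->//|/off[_ ->]] := pselect (box (Num.max M N) x); rewrite !mulr0.
rewrite (w _ _ hphi sp); congr (- _); apply: eq_J => x.
by have [/eg->//|/off[-> _]] := pselect (box (Num.max M N) x); rewrite !mulr0.
Qed.

End weak_derivatives.

(** * Vanishing of integrals on a generated sigma-algebra *)

Section pi_system.
Local Open Scope ereal_scope.
Context d (T : measurableType d) (R : realType) (mu : {measure set T -> \bar R}).

(** The sets with vanishing integral form a Dynkin system, integrability of [h] taking care of
    countable disjoint unions. The map [p] allows the argument to be run coordinate by
    coordinate. *)
Lemma integral_pi_system (S : Type) (p : T -> S) (G : set (set S)) (D : set T) (h : T -> \bar R) :
  measurable D -> mu.-integrable D h -> setI_closed G ->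
  (forall A, <<s G >> A -> measurable (D `&` p @^-1` A)) ->
  \int[mu]_(x in D) h x = 0 ->
  (forall A, G A -> \int[mu]_(x in D `&` p @^-1` A) h x = 0) ->
  forall A, <<s G >> A -> \int[mu]_(x in D `&` p @^-1` A) h x = 0.
Proof.
move=> mD ih GI mp h0 hG.
pose L := [set A | <<s G >> A /\ \int[mu]_(x in D `&` p @^-1` A) h x = 0].
suff GL : <<s G >> `<=` L by move=> A /GL[].
have [sG0 sGC sGU] := smallest_sigma_algebra setT G.
rewrite -setI_closed_g_dynkin_g_sigma_algebra//; apply: smallest_sub; last first.
  by move=> A GA; split; [exact: sub_sigma_algebra|exact: hG].
split.
- split; last by rewrite preimage_setT setIT.
  by have := sGC _ sG0; rewrite setD0.
- move=> A [sA iA]; have sC : <<s G >> (~` A) by rewrite -setTD; exact: sGC.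
  split => //; have := h0.
  have {1}-> : D = (D `&` p @^-1` A) `|` (D `&` p @^-1` (~` A)).
    by rewrite -setIUr preimage_setC setUv setIT.
  rewrite integral_setU; [by rewrite iA add0e|exact: mp|exact: mp|..].
    by rewrite -setIUr preimage_setC setUv setIT; exact: measurable_int ih.
  by apply/disj_setPS => x [[_ /= Ax] [_ /=]].
- move=> F tF hF; split; first by apply: sGU => n; have [] := hF n.
  rewrite preimage_bigcup setI_bigcupr integral_bigcup.
  + by apply: eseries0 => i _ _; have [] := hF i.
  + apply/trivIsetP => i j _ _ ij; apply/seteqP; split=> x // -[[_ Fi] [_ Fj]].
    by move/trivIsetP : tF => /(_ i j I I ij)/seteqP[+ _] => /(_ (p x)); exact.
  + by move=> k; apply: mp; have [] := hF k.
  + rewrite -setI_bigcupr -preimage_bigcup; apply: (integrableS mD) => //.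
    by apply: mp; apply: sGU => n; have [] := hF n.
Qed.

End pi_system.

(** * Continuously differentiable approximations of the indicator of an interval *)

Section bumps.
Variable R : realType.
Implicit Types (a b t : R).

(** The square of the positive part, in a form that is differentiated without cases. *)
Definition sqp t : R := (t ^+ 2 + t * `|t|) / 2.
Definition sqp' t : R := t + `|t|.

Let is_derive_abs t : is_derive t (1 : R) (fun t => t * `|t| : R) (2 * `|t|).
Proof.
have [->|t0] := eqVneq t 0.
  rewrite normr0 mulr0.
  have cv : (fun h : R => h^-1 *: (((h *: (1 : R) + 0 : R) * `|h *: (1 : R) + 0 : R|) - 0 * `|0 : R|)) @ 0^' --> (0 : R).
    have E : {near 0^', (fun h : R => `|h|) =1 (fun h : R => h^-1 *: (((h *: (1 : R) + 0 : R) * `|h *: (1 : R) + 0 : R|) - 0 * `|0 : R|))}.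
      near=> h; rewrite /GRing.scale/= mulr1 addr0 mul0r subr0 mulrA mulVf ?mul1r//.
      near: h; exact: nbhs_dnbhs_neq.
    have n0 : (fun h : R => `|h|) @ (0 : R) --> `|0 : R| by exact: norm_continuous.
    rewrite normr0 in n0; apply: cvg_trans (near_eq_cvg E) _.
    exact: cvg_within_filter n0.
  split; first by apply/cvg_ex; exists 0.
  by apply/cvg_lim.
have cn : (fun s : R => `|s|) @ t --> `|t| by exact: norm_continuous.
have [tp|tn] := ltP 0 t.
  apply: (@near_eq_is_derive _ _ _ (fun s : R => s ^+ 2)).
    near=> s; rewrite ger0_norm ?expr2//; near: s; apply: filterS (lt_nbhsr tp) => s; exact: ltW.
  by apply: is_derive_eq; rewrite /GRing.scale/= (ger0_norm (ltW tp)); ring.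
have tn' : t < 0 by rewrite lt_neqAle t0.
apply: (@near_eq_is_derive _ _ _ (fun s : R => - s ^+ 2)).
  near=> s; rewrite ler0_norm ?expr2 ?mulrN//; near: s; apply: filterS (lt_nbhsl tn') => s; exact: ltW.
by apply: is_derive_eq; rewrite /GRing.scale/= (ltr0_norm tn'); ring.
Unshelve. all: by end_near. Qed.

Lemma is_derive_sqp t : is_derive t (1 : R) sqp (sqp' t).
Proof.
rewrite /sqp; have := is_derive_abs t => h; apply: is_derive_eq.
by rewrite /GRing.scale/= /sqp'; field.
Qed.

Lemma continuous_sqp' : continuous sqp'.
Proof. by move=> t; apply: cvgD; [exact: cvg_id|exact: norm_continuous]. Qed.

Definition C1_bump (al al' : R -> R) := [/\ continuous al',
  forall t, is_derive t (1 : R) al (al' t) & exists M : R, forall t, M < `|t| -> al t = 0].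

Let P a b t := sqp (t - a) * sqp (b - t).

Let sqp_ge0 t : 0 <= sqp t.
Proof.
rewrite /sqp; have [h|h] := ltP 0 t; first by rewrite gtr0_norm// divr_ge0// addr_ge0// ?sqr_ge0// mulr_ge0 ?ltW.
by rewrite ler0_norm// mulrN -expr2 subrr mul0r.
Qed.

Let sqp_gt0 t : (0 < sqp t) = (0 < t).
Proof.
rewrite /sqp; have [h|h] := ltP 0 t.
  by rewrite gtr0_norm// divr_gt0// addr_gt0// mulr_gt0.
by rewrite ler0_norm// mulrN -expr2 subrr mul0r ltxx.
Qed.

Let P_ge0 a b t : 0 <= P a b t. Proof. by rewrite mulr_ge0. Qed.

Let P_gt0 a b t : (0 < P a b t) = (a < t < b).
Proof.
have [h|h] := ltP 0 (sqp (t - a)).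
  by rewrite /P pmulr_rgt0// sqp_gt0 subr_gt0; move: h; rewrite sqp_gt0 subr_gt0 => ->.
have -> : P a b t = 0 by rewrite /P (_ : sqp (t - a) = 0) ?mul0r//; apply/eqP; rewrite eq_le h sqp_ge0.
by rewrite ltxx; move: h; rewrite leNgt sqp_gt0 subr_gt0 => /negbTE->.
Qed.

(** [P a b] is positive exactly on []a, b[]; hence [w] is 1 off the interval and smaller than 1 on
    it, and [1 - w t ^+ n] has the required limits. *)
Lemma bump_approx (a b : R) : exists al al' : nat -> R -> R, [/\ forall n, C1_bump (al n) (al' n),
   forall n t, 0 <= al n t <= 1, forall n t, ~~ (a < t < b) -> al n t = 0 &
   forall t, a < t < b -> al ^~ t @ \oo --> (1 : R)].
Proof.
pose w t : R := (1 + P a b t)^-1.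
have w0 t : 0 < w t <= 1.
  have := P_ge0 a b t => h; rewrite invr_gt0 invf_le1; lra.
pose P' t : R := sqp' (t - a) * sqp (b - t) - sqp (t - a) * sqp' (b - t).
have dP t : is_derive t (1 : R) (P a b) (P' t).
  have h1 : is_derive t (1 : R) (fun t => sqp (t - a)) (sqp' (t - a)).
    have h3 : is_derive t (1 : R) (fun t : R => t - a) 1 by apply: is_derive_eq; rewrite subr0.
    by rewrite -[sqp' _]mulr1; exact: (@is_derive1_comp R sqp (fun t => t - a) t _ _ (is_derive_sqp _) h3).
  have h2 : is_derive t (1 : R) (fun t => sqp (b - t)) (- sqp' (b - t)).
    have h3 : is_derive t (1 : R) (fun t : R => b - t) (- 1) by apply: is_derive_eq; ring.
    by rewrite -mulrN1; exact: (@is_derive1_comp R sqp (fun t => b - t) t _ _ (is_derive_sqp _) h3).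
  by rewrite /P; apply: is_derive_eq; rewrite /GRing.scale/= /P'; ring.
have csq : continuous sqp.
  by move=> t; apply: differentiable_continuous; apply/derivable1_diffP; have [] := is_derive_sqp t.
have cshift (f : R -> R) : continuous f -> continuous (fun t => f (t - a)).
  move=> cf t; apply: continuous_comp; last exact: cf.
  by apply: cvgB; [exact: cvg_id|exact: cvg_cst].
have crefl (f : R -> R) : continuous f -> continuous (fun t => f (b - t)).
  move=> cf t; apply: continuous_comp; last exact: cf.
  by apply: cvgB; [exact: cvg_cst|exact: cvg_id].
have cP' : continuous P'.
  move=> t; exact: (cvgB (cvgM (cshift _ continuous_sqp' t) (crefl _ csq t))
    (cvgM (cshift _ csq t) (crefl _ continuous_sqp' t))).
have dw t : is_derive t (1 : R) w (- (w t ^+ 2 * P' t)).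
  have := dP t => h; have p0 := P_ge0 a b t.
  have nz : 1 + P a b t != 0 by rewrite gt_eqF//; lra.
  have h1 : is_derive t (1 : R) (fun t => 1 + P a b t) (P' t).
    by have := is_deriveD (is_derive_cst (1 : R) t (1 : R)) h; rewrite add0r.
  have h2 := @is_deriveV R (fun t => 1 + P a b t) t (P' t) 1 nz h1.
  apply: (is_derive_eq h2); rewrite /GRing.scale/= /w.
  by rewrite exprVn; ring.
have cw : continuous w.
  by move=> t; apply: differentiable_continuous; apply/derivable1_diffP; have [] := dw t.
have cwn n : continuous (fun t => w t ^+ n).
  elim: n => [|n IH] t; first exact: cvg_cst.
  have -> : (fun t => w t ^+ n.+1) = (fun t => w t * w t ^+ n) by apply/funext => s; rewrite exprS.
  exact: (cvgM (cw t) (IH t)).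
exists (fun n t => 1 - w t ^+ n), (fun n t => n%:R * w t ^+ n.-1 * (w t ^+ 2 * P' t)).
split.
- move=> n; split.
  + move=> t; exact: (cvgM (cvgM (cvg_cst _) (cwn _ t)) (cvgM (cwn 2%N t) (cP' t))).
  + move=> t; have h2 := is_deriveB (is_derive_cst (1 : R) t (1 : R)) (is_deriveX n (dw t)).
    have -> : (fun t => 1 - w t ^+ n) = cst 1 - w ^+ n by apply/funext => s; rewrite fctE exprfctE.
    by apply: (is_derive_eq h2); rewrite /GRing.scale/=; ring.
  + exists (`|a| + `|b|) => t ht; apply/eqP; rewrite subr_eq0 eq_sym; apply/eqP.
    suff -> : w t = 1 by rewrite expr1n.
    rewrite /w (_ : P a b t = 0) ?addr0 ?invr1//.
    apply/eqP; rewrite eq_le P_ge0 andbT leNgt P_gt0; apply/negP => /andP[h1 h2].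
    move: ht; rewrite ltNge ler_norml; have := ler_norm a; have := ler_norm b.
    have := ler_norm (- a); have := ler_norm (- b); rewrite !normrN => n1 n2 n3 n4.
    by move/negP; apply; apply/andP; split; lra.
- move=> n t; have /andP[h1 h2] := w0 t.
  by rewrite subr_ge0 gerBl exprn_ge0 ?exprn_ile1// ltW.
- move=> n t; rewrite -P_gt0 -leNgt => h.
  rewrite /w (_ : P a b t = 0) ?addr0 ?invr1 ?expr1n ?subrr//.
  by apply/eqP; rewrite eq_le h P_ge0.
- move=> t; rewrite -P_gt0 => h; rewrite -[X in _ --> X]subr0.
  apply: cvgB; first exact: cvg_cst.
  apply: cvg_expr; rewrite gtr0_norm; last by case/andP: (w0 t).
  by rewrite /w invf_lt1; lra.
Qed.

End bumps.

(** * The fundamental lemma of the calculus of variations and uniqueness of weak derivatives *)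

Section fundamental_lemma.
Variable R : realType.
Local Notation mu2 := (@leb2 R).
Local Notation T1 := (measurableTypeR R).
Local Notation T2 := (T1 * T1)%type.
Implicit Types (h : R * R -> R).

Lemma C1_bump_prod (al al' be be' : R -> R) : C1_bump al al' -> C1_bump be be' ->
  C1 (fun x => al x.1 * be x.2) (fun j x => if j then al x.1 * be' x.2 else al' x.1 * be x.2) /\
  compact_support (fun x => al x.1 * be x.2).
Proof.
move=> [ca da [M sa]] [cb db [N sb]]; split.
  apply: C1_ext (C1M (C1_comp da ca (C1_proj R false)) (C1_comp db cb (C1_proj R true))) _.
  by move=> [] x /=; rewrite mulr1 mulr0 ?mul0r ?mulr0 ?addr0 ?add0r.
exists (`|M| + `|N|) => x; have := ler_norm M; have := ler_norm N.
have := normr_ge0 M; have := normr_ge0 N => h1 h2 h3 h4 [h|h].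
  by rewrite sa ?mul0r//; lra.
by rewrite sb ?mulr0//; lra.
Qed.

Let rect (a b c d : R) : set T2 := `]a, b[ `*` `]c, d[.

Let measurable_rect a b c d : measurable (rect a b c d).
Proof. by apply: measurableX; exact: measurable_itv. Qed.

Section vanishing.
Variable h : R * R -> R.
Hypothesis hh : L1loc h.
Hypothesis h0 : forall al al' be be' : R -> R, C1_bump al al' -> C1_bump be be' ->
  J (fun x => h x * (al x.1 * be x.2)) = 0.

Let integ_box M : mu2.-integrable (box M : set T2) (EFin \o h).
Proof.
case: hh => mh hM; apply/integrableP; split; first by apply/measurable_EFinP; exact: measurable_funTS.
exact: hM.
Qed.

(** Products of bumps tend to the indicator of the open rectangle, dominated by [|h|] on a box. *)
Let rect0 a b c d : (\int[mu2]_(x in rect a b c d) (h x)%:E = 0)%E.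
Proof.
have [al [al' [ba a01 a0 a1]]] := bump_approx a b.
have [be [be' [bb b01 b0 b1]]] := bump_approx c d.
have mR := measurable_rect a b c d; have [mh _] := hh.
pose f_ (n : nat) (x : T2) := (h x * (al n x.1 * be n x.2))%:E.
pose M := `|a| + `|b| + `|c| + `|d|.
have rectM x : rect a b c d x -> box M x.
  rewrite /rect/= !in_itv/= => -[/andP[x1 x2] /andP[x3 x4]]; apply/boxP; rewrite /M.
  have [A1 A2 A3 A4] := And4 (ler_norm a) (ler_norm b) (ler_norm c) (ler_norm d).
  have [B1 B2 B3 B4] := And4 (ler_norm (- a)) (ler_norm (- b)) (ler_norm (- c)) (ler_norm (- d)).
  have [C1 C2 C3 C4] := And4 (normr_ge0 a) (normr_ge0 b) (normr_ge0 c) (normr_ge0 d).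
  by rewrite !normrN in B1 B2 B3 B4; rewrite !ler_norml; split; apply/andP; split; lra.
have off n x : ~ rect a b c d x -> al n x.1 * be n x.2 = 0.
  move=> nr; have [x1|/negP x1] := boolP (a < x.1 < b); last by rewrite a0 ?mul0r//; apply/negP.
  have [x2|/negP x2] := boolP (c < x.2 < d); last by rewrite b0 ?mulr0//; apply/negP.
  by exfalso; apply: nr; rewrite /rect/= !in_itv/= x1 x2.
have cp n : continuous (fun x : R * R => al n x.1 * be n x.2).
  by have [[]] := C1_bump_prod (ba n) (bb n).
have mf n : measurable_fun [set: T2] (f_ n).
  by apply/measurable_EFinP; apply: measurable_funM => //; exact: continuous_measurable2.
pose f := (EFin \o h) \_ (rect a b c d).
have mfl : measurable_fun [set: T2] f.
  by apply/(measurable_restrictT _ mR); apply/measurable_EFinP; exact: measurable_funTS.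
have mB := @measurable_box R M.
pose g : T2 -> \bar R := (abse \o (EFin \o h)) \_ (box M).
have ig : mu2.-integrable [set: T2] g.
  by apply/(integrable_restrict _ mB measurableT); rewrite setTI; exact: integrable_abse.
have cv x : f_ ^~ x @ \oo --> f x.
  rewrite /f patchE; have [rx|nr] := pselect (rect a b c d x).
    rewrite mem_set//= -[h x]mulr1; apply: cvg_EFin; first by apply: nearW.
    apply: cvgM; first exact: cvg_cst.
    rewrite -[X in _ --> X](mulr1 1); move: rx; rewrite /rect/= !in_itv/= => -[r1 r2].
    by apply: cvgM; [exact: a1|exact: b1].
  rewrite memNset//; apply: cvg_near_cst; apply: nearW => n.
  by rewrite /f_ off// mulr0.
have dom x n : (`|f_ n x| <= g x)%E.
  rewrite /f_ /g patchE; have [rx|nr] := pselect (rect a b c d x).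
    rewrite mem_set; last exact: rectM.
    rewrite /= lee_fin normrM ler_piMr//.
    have /andP[? ?] := a01 n x.1; have /andP[? ?] := b01 n x.2.
    by rewrite ger0_norm ?mulr_ge0// mulr_ile1.
  by rewrite off// mulr0 /= normr0; case: ifP => // _; rewrite lee_fin.
have [_ _] := dominated_convergence measurableT mf mfl (aeW _ (fun x _ => cv x)) ig
  (aeW _ (fun x n _ => dom x n)).
have -> : [sequence (\int[mu2]_(x in [set: T2]) f_ n x)%E]_n = fun=> 0%E.
  apply/funext => n /=; have := h0 (ba n) (bb n).
  have [_ sp] := C1_bump_prod (ba n) (bb n).
  move=> E; transitivity ((J (fun x => h x * (al n x.1 * be n x.2)))%:E); last by rewrite E.
  exact: (J_EFin (integ_test hh (cp n) sp)).
move=> /(cvg_lim (@ereal_hausdorff R)); rewrite lim_cst// => E.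
by rewrite -[LHS]/(\int[mu2]_(x in rect a b c d) (EFin \o h) x)%E integral_mkcond -/f -E.
Qed.

(** The maximum keeps the intersection with a half-plane among the rectangles, possibly as an empty
    one. *)
Let rectI (M a c : R) : rect (- M) M (Num.max c (- M)) M `&` fst @^-1` `]a, +oo[ =
  rect (Num.max a (- M)) M (Num.max c (- M)) M.
Proof.
apply/seteqP; split => -[x y]; rewrite /rect/= !in_itv/= !gt_max andbT.
  by move=> [[/andP[-> ->] ->] ->].
by move=> [/andP[/andP[-> ->] ->] ->].
Qed.

Let rectI2 (M c : R) : rect (- M) M (Num.max c (- M)) M = rect (- M) M (- M) M `&` snd @^-1` `]c, +oo[.
Proof.
apply/seteqP; split => -[x y]; rewrite /rect/= !in_itv/= !gt_max andbT.
  by move=> [-> /andP[/andP[-> ->] ->]].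
by move=> [[-> /andP[-> ->]] ->].
Qed.

Let measurableG : measurable = <<s RGenOInfty.G (R:=R) >> :> set (set T1).
Proof. exact: RGenOInfty.measurableE. Qed.

Let GI : setI_closed (RGenOInfty.G (R:=R)).
Proof.
move=> _ _ [a ->] [b ->]; exists (Num.max a b).
apply/seteqP; split => x /=; rewrite !in_itv/= !andbT gt_max; first by move=> [-> ->].
by move=> /andP[].
Qed.

Let preimage_fst (A : set T1) : measurable A -> measurable (fst @^-1` A : set T2).
Proof. by move=> mA; rewrite -[X in measurable X]setTI; exact: measurable_fst. Qed.

Let preimage_snd (A : set T1) : measurable A -> measurable (snd @^-1` A : set T2).
Proof. by move=> mA; rewrite -[X in measurable X]setTI; exact: measurable_snd. Qed.

Let integ_rect M a b c d : rect a b c d `<=` box M -> mu2.-integrable (rect a b c d) (EFin \o h).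
Proof. by move=> s; apply: integrableS (integ_box M) => //; exact: measurable_box. Qed.

Let sub_box M c : rect (- M) M (Num.max c (- M)) M `<=` box M.
Proof.
move=> -[x y]; rewrite /rect /box /= !in_itv/= gt_max => -[/andP[x1 x2] /andP[/andP[_ y1] y2]].
by split; apply/andP; split; exact: ltW.
Qed.

Let maxMM (M : R) : Num.max (- M) (- M) = - M. Proof. exact: maxxx. Qed.

(** [integral_pi_system] is applied three times: in the first coordinate, in the second, and for
    products of measurable sets. *)
Let square0 M (E : set T2) : measurable E ->
  (\int[mu2]_(x in rect (- M) M (- M) M `&` E) (h x)%:E = 0)%E.
Proof.
pose Sq (c : R) : set T2 := rect (- M) M (Num.max c (- M)) M.
have st1 (c : R) (A : set T1) : measurable A ->
    (\int[mu2]_(x in (Sq c `&` fst @^-1` A : set T2)) (h x)%:E = 0)%E.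
  rewrite measurableG; apply: (@integral_pi_system _ T2 R mu2 T1 fst _ _ (EFin \o h)).
  - exact: measurable_rect.
  - exact: integ_rect (@sub_box M c).
  - exact: GI.
  - by move=> B; rewrite -measurableG => mB; apply: measurableI; [exact: measurable_rect|exact: preimage_fst].
  - exact: rect0.
  - by move=> _ [a ->]; rewrite rectI; exact: rect0.
have mD := measurable_rect (- M) M (- M) M.
have iD : mu2.-integrable (rect (- M) M (- M) M) (EFin \o h).
  by apply: (@integ_rect M); rewrite -{2}maxMM; exact: sub_box.
pose S0 : set T2 := rect (- M) M (- M) M.
have st2 (A B : set T1) : measurable A -> measurable B ->
    (\int[mu2]_(x in ((S0 `&` fst @^-1` A) `&` snd @^-1` B : set T2)) (h x)%:E = 0)%E.
  move=> mA; rewrite measurableG.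
  have mDA : measurable (rect (- M) M (- M) M `&` fst @^-1` A : set T2).
    by apply: measurableI => //; exact: preimage_fst.
  apply: (@integral_pi_system _ T2 R mu2 T1 snd _ _ (EFin \o h)).
  - exact: mDA.
  - by apply: integrableS iD => //; exact: subIsetl.
  - exact: GI.
  - by move=> C; rewrite -measurableG => mC; apply: measurableI => //; exact: preimage_snd.
  - by have := st1 (- M) A mA; rewrite /Sq maxMM.
  - by move=> _ [c ->]; rewrite setIAC -rectI2; exact: st1.
rewrite measurable_prod_measurableType.
apply: (@integral_pi_system _ T2 R mu2 T2 id _ _ (EFin \o h)).
- exact: mD.
- exact: iD.
- move=> _ _ [A1 mA1 [B1 mB1 <-]] [A2 mA2 [B2 mB2 <-]]; rewrite -setXI.
  by exists (A1 `&` A2); [exact: measurableI|exists (B1 `&` B2) => //; exact: measurableI].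
- by move=> A; rewrite -measurable_prod_measurableType => mA; exact: measurableI.
- exact: rect0.
- move=> _ [A mA [B mB <-]]; rewrite preimage_id.
  rewrite (_ : A `*` B = fst @^-1` A `&` snd @^-1` B) ?setIA; first exact: st2.
  by apply/seteqP; split.
Qed.

Lemma fundamental_lemma : {ae mu2, forall x : T2, h x = 0}.
Proof.
have [mh _] := hh.
have step (n : nat) : {ae mu2, forall x : T2, rect (- n%:R) n%:R (- n%:R) n%:R x -> h x = 0}.
  have : ae_eq mu2 (rect (- n%:R) n%:R (- n%:R) n%:R) (EFin \o h) (cst 0%E).
    apply: integral_ae_eq => //.
    - by apply: (@integ_rect n%:R); rewrite -{2}maxMM; exact: sub_box.
    - by move=> E ED mE; rewrite integral_cst// mul0e -(setIidr ED); exact: square0.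
  by apply: filterS => x /= hx rx; have := hx rx => -[].
have := ae_foralln step; apply: filterS => x hx.
pose n := (Num.trunc (`|x.1| + `|x.2|)).+1.
have nx : `|x.1| + `|x.2| < n%:R.
  by have /truncn_itv/andP[] : 0 <= `|x.1| + `|x.2| by rewrite addr_ge0.
apply: (hx n); rewrite /rect/= !in_itv/= -!ltr_norml.
by have := normr_ge0 x.1; have := normr_ge0 x.2; split; lra.
Qed.

End vanishing.

Lemma weak_deriv_unique j (v g1 g2 : R * R -> R) : L1loc v -> L1loc g1 -> L1loc g2 ->
  weak_deriv j v g1 -> weak_deriv j v g2 -> {ae mu2, forall x : T2, g1 x = g2 x}.
Proof.
move=> hv h1 h2 /(weak_derivP _ hv h1) w1 /(weak_derivP _ hv h2) w2.
have hN : L1loc (fun x => -1 * g2 x) by apply: L1locM => //; exact: cst_continuous.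
have : {ae mu2, forall x : T2, g1 x + -1 * g2 x = 0}.
  apply: fundamental_lemma; first exact: L1locD.
  move=> al al' be be' ba bb; have [c1 sc] := C1_bump_prod ba bb; have [cc _ _ _] := c1.
  rewrite (@eq_J _ _ (fun x => g1 x * (al x.1 * be x.2) + -1 * (g2 x * (al x.1 * be x.2)))); last by move=> x; ring.
  have i1 := integ_test h1 cc sc; have i2 := integ_test h2 cc sc.
  have i3 : integ (fun x => -1 * (g2 x * (al x.1 * be x.2))) by have := integrableZl measurableT (-1) i2.
  rewrite JD// JZ//.
  have := w1 _ _ c1 sc; have := w2 _ _ c1 sc => -> /eqP; rewrite eqr_opp => /eqP ->; ring.
by apply: filterS => x; lra.
Qed.

End fundamental_lemma.

(** * Fubini and Tonelli for the plane times a line of parameters *)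

Section slab.
Variable R : realType.
Local Notation T1 := (measurableTypeR R).
Local Notation T2 := (T1 * T1)%type.
Local Notation mu2 := (@leb2 R).
Local Notation mu1 := (@lebesgue_measure R).

Lemma sigma_finite_leb2 : sigma_finite [set: T2] mu2.
Proof.
exists (fun n => box n%:R).
  apply/seteqP; split => // -[x y] _; exists (Num.trunc (`|x| + `|y|)).+1 => //.
  have h : `|x| + `|y| < (Num.trunc (`|x| + `|y|)).+1%:R.
    by have /truncn_itv/andP[] : 0 <= `|x| + `|y| by rewrite addr_ge0.
  by apply/boxP; split => /=; apply: ltW; apply: le_lt_trans h; [rewrite lerDl|rewrite lerDr].
by move=> n; split; [exact: measurable_box|exact: leb2_box].
Qed.

(* A copy of [leb2], to carry the sigma-finite structure needed by Fubini. *)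
Definition sf2 : set T2 -> \bar R := mu2.
HB.instance Definition _ := Measure.copy sf2 mu2.
HB.instance Definition _ := Measure_isSigmaFinite.Build _ _ _ sf2 sigma_finite_leb2.
Local Notation sf1 := mu1.

Definition slab (F : T2 * T1 -> R) := (sf2 \x sf1)%E.-integrable setT (EFin \o F).

Lemma integral_sf2 (D : set T2) (f : T2 -> \bar R) : (\int[sf2]_(x in D) f x = \int[mu2]_(x in D) f x)%E.
Proof. by apply: eq_measure_integral. Qed.

Lemma slabP (F : T2 * T1 -> R) : measurable_fun setT F ->
  (\int[mu1]_t \int[mu2]_x (`|F (x, t)|)%:E < +oo)%E -> slab F.
Proof.
move=> mF h; apply: (integrable21ltyP sf2 sf1 _).2; first exact/measurable_EFinP.
by under eq_integral do rewrite integral_sf2.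
Qed.

Lemma slab_lty (F : T2 * T1 -> R) : slab F -> (\int[mu2]_x \int[mu1]_t (`|F (x, t)|)%:E < +oo)%E.
Proof.
move=> iF; rewrite -integral_sf2.
exact: ((integrable12ltyP sf2 sf1 (measurable_int _ iF)).1 iF).
Qed.

Lemma slab_fubini (F : T2 * T1 -> R) : slab F ->
  (\int[mu2]_x \int[mu1]_t (F (x, t))%:E = \int[mu1]_t \int[mu2]_x (F (x, t))%:E)%E.
Proof.
move=> iF; rewrite -integral_sf2; under [RHS]eq_integral do rewrite -integral_sf2.
exact: (@Fubini _ _ T2 T1 R sf2 sf1 (EFin \o F) iF).
Qed.

Lemma slab_measurable (F : T2 * T1 -> R) : slab F ->
  measurable_fun [set: T2] (fun x => \int[mu1]_t (F (x, t))%:E)%E.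
Proof. move=> iF; exact: (@measurable_fubini_F _ _ T2 T1 R sf2 sf1 (EFin \o F) iF). Qed.

Lemma slab_ae (F : T2 * T1 -> R) : slab F ->
  {ae mu2, forall x : T2, mu1.-integrable setT (fun t => (F (x, t))%:E)}.
Proof.
move=> iF; have [A [mA A0 sA]] := @ae_integrable1 _ _ T2 T1 R sf2 sf1 (EFin \o F) iF.
by exists A.
Qed.

Lemma slab_tonelli (F : T2 * T1 -> \bar R) : measurable_fun setT F -> (forall p, 0 <= F p)%E ->
  (\int[mu2]_x \int[mu1]_t F (x, t) = \int[mu1]_t \int[mu2]_x F (x, t))%E.
Proof.
move=> mF F0; rewrite -integral_sf2; under [RHS]eq_integral do rewrite -integral_sf2.
exact: (@fubini_tonelli _ _ T2 T1 R sf2 sf1 F mF F0).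
Qed.

Lemma measurable_slab_x (F : T2 * T1 -> \bar R) : measurable_fun setT F -> (forall p, 0 <= F p)%E ->
  measurable_fun [set: T2] (fun x => \int[mu1]_t F (x, t))%E.
Proof. move=> mF F0; exact: (@measurable_fun_fubini_tonelli_F _ _ T2 T1 R sf1 F mF F0). Qed.

Lemma measurable_slab_t (F : T2 * T1 -> \bar R) : measurable_fun setT F -> (forall p, 0 <= F p)%E ->
  measurable_fun [set: T1] (fun t => \int[mu2]_x F (x, t))%E.
Proof.
move=> mF F0; under eq_fun do rewrite -integral_sf2.
exact: (@measurable_fun_fubini_tonelli_G _ _ T2 T1 R sf2 F mF F0).
Qed.

Lemma leb2_tonelli (F : T2 -> \bar R) : measurable_fun setT F -> (forall p, 0 <= F p)%E ->
  (\int[mu2]_x F x = \int[mu1]_s \int[mu1]_t F (s, t))%E.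
Proof. move=> mF F0; exact: (@fubini_tonelli1 _ _ T1 T1 R sf1 sf1 F mF F0). Qed.

End slab.

(** * Differences of a function as line integrals of its weak derivative *)

Section difference_quotient.
Variable R : realType.
Local Notation mu2 := (@leb2 R).
Local Notation mu1 := (@lebesgue_measure R).
Local Notation T1 := (measurableTypeR R).
Local Notation T2 := (T1 * T1)%type.

Lemma integral_indicM (f : R -> R) (D : set T1) :
  (\int[mu1]_(t in D) (f t)%:E = \int[mu1]_t (f t * \1_D t)%:E)%E.
Proof.
rewrite integral_mkcond; apply: eq_integral => t _; rewrite patchE indicE.
by case: ifP => _; rewrite ?mulr1 ?mulr0.
Qed.

Lemma integrable_itv (f : R -> R) a b : continuous f ->
  mu1.-integrable setT (fun t => (f t * \1_(`[a, b] : set R) t)%:E).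
Proof.
move=> cf; have mD : measurable (`[a, b]%classic : set T1) by exact: measurable_itv.
have -> : (fun t => (f t * \1_(`[a, b] : set R) t)%:E) = (EFin \o f) \_ (`[a, b]%classic : set T1).
  by apply/funext => t; rewrite patchE indicE; case: ifP => _; rewrite /= ?mulr1 ?mulr0.
apply: (@integrable_restrict _ T1 R mu1 _ mD setT measurableT (EFin \o f)).1; rewrite setTI.
by apply: continuous_compact_integrable; [exact: segment_compact|exact: continuous_subspaceT].
Qed.

Lemma continuous_of_is_derive (f f' : R -> R) : (forall t, is_derive t (1 : R) f (f' t)) -> continuous f.
Proof.
by move=> h t; apply: differentiable_continuous; apply/derivable1_diffP; have [] := h t.
Qed.

Lemma integral_is_derive (F f : R -> R) a b : a < b -> continuous f ->
  (forall t, is_derive t (1 : R) F (f t)) -> (\int[mu1]_(t in `[a, b]) (f t)%:E = (F b - F a)%:E)%E.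
Proof.
move=> ab cf dF; have cF := continuous_of_is_derive dF.
rewrite (@continuous_FTC2 R f F a b)//.
- exact: continuous_subspaceT.
- split; first by move=> x _; have [] := dF x.
  + by apply: cvg_at_right_filter; exact: cF.
  + by apply: cvg_at_left_filter; exact: cF.
- by move=> x _; rewrite derive1E; have [_ ->] := dF x.
Qed.

Lemma antiderivative (al : R -> R) : continuous al -> (exists M : R, forall t, M < `|t| -> al t = 0) ->
  exists A : R -> R, forall t, is_derive t (1 : R) A (al t).
Proof.
move=> ca [M aM].
have ial : mu1.-integrable setT (EFin \o al).
  have -> : EFin \o al = (fun t => (al t * \1_(`[- M, M] : set R) t)%:E).
    apply/funext => t; rewrite /= indicE; case: (boolP (t \in _)) => [_|/negP]; first by rewrite mulr1.
    by rewrite inE/= in_itv/= -ler_norml => h; rewrite aM ?mul0r// ltNge; apply/negP.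
  exact: integrable_itv.
exists (fun x => \int[mu1]_(t in `]-oo, x]) al t) => x.
have i1 : mu1.-integrable `]-oo, x + 1] (EFin \o al) by apply: integrableS ial => //; exact: measurable_itv.
have x1 : x < x + 1 by rewrite ltrDl.
have [] := continuous_FTC1 x1 i1 (ltNyr x) (ca x).
by rewrite derive1E => d e; split.
Qed.

Variable delta : R.
Hypothesis delta0 : 0 < delta.
Let chi (t : R) : R := \1_(`[0, delta] : set R) t.

Let chi01 t : 0 <= chi t <= 1.
Proof. by rewrite /chi indicE; case: (_ \in _); rewrite ?lexx ?ler01. Qed.

Let chi_in t : chi t != 0 -> 0 <= t <= delta.
Proof.
by rewrite /chi indicE; case: (boolP (t \in _)) => [|_]; rewrite ?inE/= ?in_itv//= eqxx.
Qed.

Let measurable_chi : measurable_fun [set: T1] chi.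
Proof. by apply: measurable_indic; exact: measurable_itv. Qed.

(** The integral of the translates of a bump by [[0, delta]] is a difference of values of its
    primitive. It is again a bump, with a difference of two translates of [al] as derivative. *)
Lemma bump_difference (al al' : R -> R) : C1_bump al al' -> exists A : R -> R,
  [/\ C1_bump (fun s => A s - A (s - delta)) (fun s => al s - al (s - delta)),
      forall s, mu1.-integrable setT (fun t => (al (s - t) * chi t)%:E) &
      forall s, (\int[mu1]_t (al (s - t) * chi t)%:E = (A s - A (s - delta))%:E)%E].
Proof.
move=> [ca' da sa]; have ca := continuous_of_is_derive da.
have [A dA] := antiderivative ca sa.
have dcomp (f f' : R -> R) (c k t : R) : (forall t, is_derive t (1 : R) f (f' t)) ->
    is_derive t (1 : R) (fun t => f (c + k * t)) (k * f' (c + k * t)).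
  move=> df; have h : is_derive t (1 : R) (fun t : R => c + k * t) k.
    by apply: is_derive_eq; rewrite /GRing.scale/=; ring.
  rewrite mulrC; exact: (@is_derive1_comp R f (fun t => c + k * t) t _ _ (df _) h).
have crefl s : continuous (fun t => al (s - t)).
  move=> t; apply: (@continuous_comp _ _ _ (fun t => s - t) al); last exact: ca.
  by apply: cvgB; [exact: cvg_cst|exact: cvg_id].
have FTC s : (\int[mu1]_t (al (s - t) * chi t)%:E = (A s - A (s - delta))%:E)%E.
  rewrite -integral_indicM.
  have -> : (A s - A (s - delta)) = (fun t => - A (s + -1 * t)) delta - (fun t => - A (s + -1 * t)) 0.
    by rewrite /= mulr0 addr0 mulN1r opprK addrC.
  apply: (@integral_is_derive (fun t => - A (s + -1 * t)) (fun t => al (s - t)) _ _ delta0).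
    exact: crefl.
  move=> t; have := is_deriveN (dcomp _ _ s (-1) t dA).
  by rewrite mulN1r opprK mulN1r.
exists A; split => //.
- split.
  + move=> t; apply: cvgB; first exact: ca.
    apply: (@continuous_comp _ _ _ (fun t => t - delta) al); last exact: ca.
    by apply: cvgB; [exact: cvg_id|exact: cvg_cst].
  + move=> t; have h2 := dcomp _ _ (- delta) 1 t dA.
    have := is_deriveB (dA t) h2; rewrite !mul1r [- delta + t]addrC.
    congr is_derive; apply/funext => r; rewrite fctE; congr (_ - A _); ring.
  + have [M aM] := sa; exists (M + delta) => s hs.
    suff : (\int[mu1]_t (al (s - t) * chi t)%:E = 0)%E by rewrite FTC => -[].
    apply: integral0_eq => t _; have [->|/chi_in/andP[t0 t1]] := eqVneq (chi t) 0.
      by rewrite mulr0.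
    rewrite aM ?mul0r//; have := ler_normB (s - t) (- t); rewrite opprK subrK normrN (ger0_norm t0); lra.
- move=> s; exact: (integrable_itv _ _ (crefl s)).
Qed.

Definition ev (j : bool) (t : R) : R * R := if j then (0, t) else (t, 0).

Lemma measurable_sweep j (f : T2 -> R) (k : R) : measurable_fun setT f ->
  measurable_fun [set: T2 * T1] (fun p => f (shift2 (ev j (k * p.2)) p.1)).
Proof.
move=> mf; apply: (measurableT_comp mf).
have m2 : measurable_fun [set: T2 * T1] (fun p => k * p.2).
  by apply: measurable_funM => //; exact: measurable_snd.
have m11 : measurable_fun [set: T2 * T1] (fun p => p.1.1).
  exact: (measurableT_comp measurable_fst measurable_fst).
have m12 : measurable_fun [set: T2 * T1] (fun p => p.1.2).
  exact: (measurableT_comp measurable_snd measurable_fst).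
by rewrite /shift2 /ev; case: j; apply: measurable_fun_pair; apply: measurable_funD.
Qed.

Definition sweep j (g : R * R -> R) (x : R * R) : R :=
  \int[mu1]_t (g (shift2 (ev j t) x) * chi t).

Section sweep.
Variables (j : bool) (g : R * R -> R).
Hypothesis hg : L1loc g.
Let mg := hg.1.

Let K (p : T2 * T1) : R := g (shift2 (ev j p.2) p.1) * chi p.2.

Let mK : measurable_fun setT K.
Proof.
apply: measurable_funM; last by apply: (measurableT_comp measurable_chi); exact: measurable_snd.
by have := measurable_sweep j 1 mg; under eq_fun do rewrite mul1r.
Qed.

Let inbox (M : R) (x : T2) : R := \1_(box M : set T2) x.

(** For [t] in [[0, delta]] a translated box stays in the box enlarged by [delta], so the bound is
    uniform in [t]. *)
Let sweep_bound M : exists2 C : R, 0 <= C &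
  forall t, (\int[mu2]_x (inbox M x * `|K (x, t)|)%:E <= (C * chi t)%:E)%E.
Proof.
have [_ gM] := hg; pose C := fine (\int[mu2]_(x in box (M + delta)) (`|g x|)%:E)%E.
have CE : (\int[mu2]_(x in box (M + delta)) (`|g x|)%:E = C%:E)%E.
  by rewrite fineK// ge0_fin_numE//; apply: integral_ge0.
exists C; first by apply: fine_ge0; apply: integral_ge0.
move=> t; have [t0|/chi_in tD] := eqVneq (chi t) 0.
  rewrite t0 mulr0 integral0_eq// => x _; by rewrite /K t0 mulr0 normr0 mulr0.
have c1 : chi t = 1.
  by rewrite /chi indicE mem_set//= in_itv.
have mB := @measurable_box R (M + delta).
have mg' : measurable_fun [set: T2] (fun x => (`|g x|)%:E).
  by apply/measurable_EFinP; exact: measurableT_comp.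
have mr : measurable_fun [set: T2] ((fun x => (`|g x|)%:E) \_ (box (M + delta) : set T2)).
  by apply/(measurable_restrictT _ mB); exact: measurable_funTS.
rewrite c1 mulr1 -CE [leRHS]integral_mkcond -[leRHS](ge0_integral_shift2 (ev j t) mr); last first.
  by move=> x; rewrite patchE; case: ifP.
apply: ge0_le_integral => //.
- by move=> x _; rewrite lee_fin mulr_ge0.
- apply/measurable_EFinP; apply: measurable_funM; first by apply: measurable_indic; exact: measurable_box.
  by apply: measurableT_comp => //; exact: (measurableT_comp mK (measurable_pair2 t)).
- exact: (measurableT_comp mr (measurable_shift2 _)).
- move=> x _; rewrite patchE /K /= c1 mulr1 /inbox indicE.
  case: (boolP (x \in _)) => [/set_mem/boxP[x1 x2]|_]; last by rewrite mul0r; case: ifP => // _; rewrite lee_fin.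
  rewrite mul1r mem_set//; apply/boxP; rewrite /shift2 /ev; case/andP: tD => t0 t1.
  have := ler_normD x.1 t; have := ler_normD x.2 t; rewrite (ger0_norm t0).
  by case: (j) => /=; rewrite addr0 => *; split; lra.
Qed.

Let chi_int : (\int[mu1]_t (chi t)%:E = delta%:E)%E.
Proof.
rewrite -[RHS]mul1e (_ : delta%:E = mu1 (`[0, delta]%classic : set T1)); last first.
  by have := @lebesgue_measure_itv R `[0, delta]; rewrite /= lte_fin delta0 sube0.
rewrite -integral_cst; last exact: measurable_itv.
have E := integral_indicM (fun=> 1) (`[0, delta]%classic : set T1).
by apply/esym; apply: (etrans E); apply: eq_integral => t _; rewrite mul1r.
Qed.

Let integ_slab (F : T2 * T1 -> R) C : 0 <= C -> measurable_fun setT F ->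
  (forall t, \int[mu2]_x (`|F (x, t)|)%:E <= (C * chi t)%:E)%E -> slab F.
Proof.
move=> C0 mF bF; apply: slabP => //.
apply: le_lt_trans (_ : \int[mu1]_t (C * chi t)%:E < +oo)%E.
  apply: ge0_le_integral => //.
  - by move=> t _; apply: integral_ge0.
  - apply: (measurable_slab_t (F := fun p => (`|F p|)%:E)) => //.
    by apply/measurable_EFinP; exact: measurableT_comp.
  - by apply/measurable_EFinP; exact: measurable_funM.
rewrite (eq_integral (fun t : T1 => (C%:E * (chi t)%:E)%E)); last by move=> t _; rewrite EFinM.
rewrite ge0_integralZl//.
- by rewrite chi_int -EFinM ltry.
- exact/measurable_EFinP.
- by move=> t _; rewrite lee_fin; case/andP: (chi01 t).
Qed.

Let inboxK M : slab (fun p => inbox M p.1 * K p).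
Proof.
have [C C0 bC] := sweep_bound M; apply: (integ_slab C0).
  apply: measurable_funM => //; apply: measurableT_comp; last exact: measurable_fst.
  by apply: measurable_indic; exact: measurable_box.
move=> t; apply: le_trans (bC t); rewrite le_eqVlt; apply/orP; left; apply/eqP.
by apply: eq_integral => x _; rewrite normrM ger0_norm.
Qed.

Lemma measurable_sweep_fun : measurable_fun [set: T2] (sweep j g).
Proof.
(* Each part is measurable in [x] by Tonelli, before anything is known about integrability. *)
have -> : sweep j g = fine \o (fun x => \int[mu1]_t (EFin \o K)^\+ (x, t) - \int[mu1]_t (EFin \o K)^\- (x, t))%E.
  apply/funext => x; rewrite /sweep /Rintegral /= integralE; congr (fine (_ - _)).
    by apply: eq_integral => t _; rewrite !funeposE.
  by apply: eq_integral => t _; rewrite !funenegE.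
have mEK : measurable_fun [set: T2 * T1] (EFin \o K) by exact/measurable_EFinP.
apply: measurableT_comp; first exact: fine_measurable.
apply: emeasurable_funB.
- apply: measurable_slab_x => //; exact: measurable_funepos.
- apply: measurable_slab_x => //; exact: measurable_funeneg.
Qed.

Lemma L1loc_sweep : L1loc (sweep j g).
Proof.
split=> [|M]; first exact: measurable_sweep_fun.
have mEK := measurable_int _ (inboxK M).
apply: le_lt_trans (slab_lty (inboxK M)).
rewrite integral_mkcond; apply: ge0_le_integral => //.
- by move=> x _; rewrite patchE; case: ifP.
- apply/(measurable_restrictT _ (@measurable_box R M)); apply: measurable_funTS.
  by apply/measurable_EFinP; apply: measurableT_comp => //; exact: measurable_sweep_fun.
- apply: (measurable_slab_x (F := fun p => (`|inbox M p.1 * K p|)%:E)) => //.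
  by apply/measurable_EFinP; apply: measurableT_comp => //; exact/measurable_EFinP.
- move=> x _; rewrite patchE; case: ifPn => [xB|_]; last exact: integral_ge0.
  rewrite (eq_integral (fun t : T1 => `|(K (x, t))%:E|%E)); last first.
    by move=> t _; rewrite /inbox /= indicE xB mul1r.
  have mKx : measurable_fun [set: T1] (fun t => (K (x, t))%:E).
    by apply/measurable_EFinP; exact: (measurableT_comp mK (measurable_pair1 x)).
  apply: le_trans (le_abse_integral mu1 measurableT mKx).
  rewrite /sweep /Rintegral -/(K (x, _)).
  by case: (\int[mu1]_t (K (x, t))%:E)%E => [r| |] //=; rewrite normr0 leey.
Qed.

(* Fubini on the slab R^2 x [0, delta], translating x by t e_j in between. *)
Lemma J_sweep phi psi : continuous phi -> compact_support phi ->
  continuous psi -> compact_support psi ->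
  (forall x, mu1.-integrable setT (fun t => (phi (shift2 (ev j (- t)) x) * chi t)%:E)) ->
  (forall x, \int[mu1]_t (phi (shift2 (ev j (- t)) x) * chi t)%:E = (psi x)%:E)%E ->
  J (fun x => sweep j g x * phi x) = J (fun x => g x * psi x).
Proof.
move=> cphi sphi cpsi spsi iphi ephi; have [M phiM] := sphi.
have mphi := continuous_measurable2 cphi.
have [B B0 hB] := continuous_bounded M cphi.
have [C C0 bC] := sweep_bound M.
pose H (p : T2 * T1) := K p * phi p.1.
pose H' (p : T2 * T1) := g p.1 * (phi (shift2 (ev j (- p.2)) p.1) * chi p.2).
have mH : measurable_fun setT H.
  by apply: measurable_funM => //; apply: measurableT_comp; [exact: mphi|exact: measurable_fst].
have mphis : measurable_fun [set: T2 * T1] (fun p => phi (shift2 (ev j (- p.2)) p.1)).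
  by have := measurable_sweep j (-1) mphi; under eq_fun do rewrite mulN1r.
have mH' : measurable_fun setT H'.
  apply: measurable_funM; first by apply: measurableT_comp; [exact: mg|exact: measurable_fst].
  by apply: measurable_funM => //; apply: measurableT_comp; [exact: measurable_chi|exact: measurable_snd].
have HH' (t : T1) (x : T2) : H' (x, t) = H (shift2 (ev j (- t)) x, t).
  rewrite /H' /H /K /= mulrAC -mulrA; congr (_ * _); congr (g _).
  by rewrite /shift2 /ev; case: x => x1 x2; case: (j) => /=; rewrite ?addr0 subrK.
have bH t : (\int[mu2]_x (`|H (x, t)|)%:E <= (B * C * chi t)%:E)%E.
  apply: le_trans (_ : \int[mu2]_x (B%:E * (inbox M x * `|K (x, t)|)%:E) <= _)%E.
    apply: ge0_le_integral => //.
    - apply/measurable_EFinP; apply: measurableT_comp => //.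
      exact: (measurableT_comp mH (measurable_pair2 t)).
    - apply: emeasurable_funM => //; apply/measurable_EFinP; apply: measurable_funM.
        by apply: measurable_indic; exact: measurable_box.
      by apply: measurableT_comp => //; exact: (measurableT_comp mK (measurable_pair2 t)).
    - move=> x _; rewrite -EFinM lee_fin /H /inbox indicE normrM /=.
      have [bx|nb] := pselect (box M x).
        by rewrite mem_set// mul1r mulrC ler_wpM2r//; exact: hB.
      rewrite phiM ?normr0 ?mulr0 ?memNset//; first by rewrite mul0r mulr0.
      by apply: contrapT => /not_orP[/negP h1 /negP h2]; apply: nb; rewrite boxP !leNgt.
  rewrite ge0_integralZl//.
  - by rewrite -mulrA [in leRHS]EFinM lee_wpmul2l// lee_fin.
  - apply/measurable_EFinP; apply: measurable_funM.
      by apply: measurable_indic; exact: measurable_box.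
    by apply: measurableT_comp => //; exact: (measurableT_comp mK (measurable_pair2 t)).
  - by move=> x _; rewrite lee_fin mulr_ge0// /inbox indicE.
have BC0 : 0 <= B * C by rewrite mulr_ge0.
have iH := integ_slab BC0 mH bH.
have iH' : slab H'.
  apply: (integ_slab BC0 mH') => t; apply: le_trans (bH t).
  rewrite (eq_integral (fun x : T2 => (`|H (shift2 (ev j (- t)) x, t)|)%:E)); last by move=> x _; rewrite HH'.
  rewrite (ge0_integral_shift2 (ev j (- t)) (f := fun x : T2 => (`|H (x, t)|)%:E))//.
  apply/measurable_EFinP; apply: measurableT_comp => //.
  exact: (measurableT_comp mH (measurable_pair2 t)).
have E1 : (\int[mu2]_x \int[mu1]_t (H (x, t))%:E = \int[mu2]_x \int[mu1]_t (H' (x, t))%:E)%E.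
  rewrite (slab_fubini iH) (slab_fubini iH'); apply: eq_integral => t _ /=.
  rewrite [RHS](eq_integral (fun x : T2 => (H (shift2 (ev j (- t)) x, t))%:E)); last by move=> x _; rewrite HH'.
  rewrite (integral_shift2 (ev j (- t)) (f := fun x : T2 => (H (x, t))%:E))//.
  by apply/measurable_EFinP; exact: (measurableT_comp mH (measurable_pair2 t)).
have E2 : (\int[mu2]_x \int[mu1]_t (H' (x, t))%:E = (J (fun x => g x * psi x))%:E)%E.
  rewrite -(J_EFin (integ_test hg cpsi spsi)); apply: eq_integral => x _.
  rewrite (eq_integral (fun t : T1 => (g x)%:E * (phi (shift2 (ev j (- t)) x) * chi t)%:E)%E); last first.
    by move=> t _; rewrite -EFinM.
  by rewrite integralZl// ephi -EFinM.
have E3 : (\int[mu2]_x \int[mu1]_t (H (x, t))%:E = (J (fun x => sweep j g x * phi x))%:E)%E.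
  rewrite -(J_EFin (integ_test L1loc_sweep cphi sphi)).
  apply: ae_eq_integral => //.
  - exact: slab_measurable iH.
  - apply/measurable_EFinP; apply: measurable_funM => //; exact: measurable_sweep_fun.
  have := slab_ae iH; apply: filterS => x ix _.
  have [p0|p0] := eqVneq (phi x) 0.
    by rewrite p0 mulr0 integral0_eq// => t _; rewrite /H /= p0 mulr0.
  have iK : mu1.-integrable setT (fun t => (K (x, t))%:E).
    have := integrableZl measurableT (phi x)^-1 ix.
    congr (mu1.-integrable _ _); apply/funext => t.
    by rewrite /= /H -EFinM mulrC mulfK.
  rewrite (eq_integral (fun t : T1 => (K (x, t))%:E * (phi x)%:E)%E); last by move=> t _; rewrite -EFinM.
  rewrite integralZr// EFinM /sweep /Rintegral fineK//.
  exact: (integrable_fin_num measurableT iK).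
by apply: EFin_inj; rewrite -E3 E1 E2.
Qed.

End sweep.

(** For a product of bumps [phi], the difference of [phi] and its translate by [delta] is the [j]-th
    derivative of [psi], which is [phi] swept backwards. The weak derivative is tested with [psi],
    and the sweep is then moved from [phi] to [g]. *)
Lemma weak_deriv_difference j (v g : R * R -> R) : L1loc v -> L1loc g -> weak_deriv j v g ->
  {ae mu2, forall x : T2, v (shift2 (ev j delta) x) - v x = sweep j g x}.
Proof.
move=> hv hg /(weak_derivP _ hv hg) w.
have hvs : L1loc (fun x => v (shift2 (ev j delta) x)) by exact: L1loc_shift.
have cc : continuous (fun _ : R * R => -1 : R) by exact: cst_continuous.
have hvN := L1locM cc hv; have hsN := L1locM cc (L1loc_sweep j hg).
have : {ae mu2, forall x : T2, v (shift2 (ev j delta) x) + -1 * v x + -1 * sweep j g x = 0}.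
  apply: fundamental_lemma; first by apply: L1locD => //; exact: L1locD.
  move=> al al' be be' ba bb; have [c1 sc] := C1_bump_prod ba bb; have [cphi cd _ _] := c1.
  set phi := fun x : R * R => al x.1 * be x.2 in c1 sc cphi *.
  have [psi [e [h1 h2 h3 h4 h5]]] : exists psi e, [/\ C1 psi e, compact_support psi,
     forall x, e j x = phi x - phi (shift2 (ev j (- delta)) x),
     forall x, mu1.-integrable setT (fun t => (phi (shift2 (ev j (- t)) x) * chi t)%:E) &
     forall x, (\int[mu1]_t (phi (shift2 (ev j (- t)) x) * chi t)%:E = (psi x)%:E)%E].
    case: (j).
    - have [A [A1 A2 A3]] := bump_difference bb; have [C1A sA] := C1_bump_prod ba A1.
      do 2 eexists; split; [exact: C1A|exact: sA|..].
      + by move=> x; rewrite /phi /shift2 /ev/= addr0; ring.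
      + move=> x; have := integrableZl measurableT (al x.1) (A2 x.2).
        by congr (mu1.-integrable _ _); apply/funext => t; rewrite /phi /shift2 /ev/= addr0 -EFinM; congr (_%:E); ring.
      + move=> x; rewrite EFinM -A3 -integralZl//.
        by apply: eq_integral => t _; rewrite /phi /shift2 /ev/= addr0 -EFinM; congr (_%:E); ring.
    - have [A [A1 A2 A3]] := bump_difference ba; have [C1A sA] := C1_bump_prod A1 bb.
      do 2 eexists; split; [exact: C1A|exact: sA|..].
      + by move=> x; rewrite /phi /shift2 /ev/= addr0; ring.
      + move=> x; have := integrableZl measurableT (be x.2) (A2 x.1).
        by congr (mu1.-integrable _ _); apply/funext => t; rewrite /phi /shift2 /ev/= addr0 -EFinM; congr (_%:E); ring.
      + move=> x; rewrite EFinM muleC -A3 -integralZl//.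
        by apply: eq_integral => t _; rewrite /phi /shift2 /ev/= addr0 -EFinM; congr (_%:E); ring.
  have [cpsi ce _ _] := h1.
  have is1 := integ_test hvs cphi sc; have is2 := integ_test hv cphi sc.
  have is3 := integ_test (L1loc_sweep j hg) cphi sc.
  have isN (f : R * R -> R) : integ f -> integ (fun x => -1 * f x) by move=> fi; have := integrableZl measurableT (-1) fi.
  rewrite (@eq_J _ _ (fun x => (v (shift2 (ev j delta) x) * phi x + -1 * (v x * phi x)) + -1 * (sweep j g x * phi x))); last first.
    by move=> x; rewrite /phi; ring.
  rewrite JD; [|exact: (integD is1 (isN _ is2))|exact: isN].
  rewrite JD; [|exact: is1|exact: isN].
  rewrite !JZ//; rewrite (J_sweep hg cphi sc cpsi h2 h4 h5).
  have := w _ _ h1 h2.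
  have is4 : integ (fun x => v x * phi (shift2 (ev j (- delta)) x)).
    apply: integ_test => //; last exact: compact_support_shift.
    by move=> x; apply: continuous_comp; [exact: continuous_shift2|exact: cphi].
  rewrite (@eq_J _ _ (fun x => v x * phi x - v x * phi (shift2 (ev j (- delta)) x))); last first.
    by move=> x; rewrite h3 mulrBr.
  rewrite JB// => E.
  have -> : J (fun x => v (shift2 (ev j delta) x) * phi x) = J (fun x => v x * phi (shift2 (ev j (- delta)) x)).
    rewrite -(J_shift (ev j (- delta))); last first.
      by apply: measurable_funM; [exact: (proj1 hvs)|exact: continuous_measurable2].
    apply: eq_J => x; congr (v _ * _); rewrite /shift2 /ev; case: x => x1 x2.
    by case: (j) => /=; rewrite ?addr0 subrK.
  move: E; lra.
by apply: filterS => x; lra.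
Qed.

End difference_quotient.

(** * Averaging discrete edge energies over translates of the grid *)

Section averaging.
Variable R : realType.
Local Notation mu2 := (@leb2 R).
Local Notation mu1 := (@lebesgue_measure R).
Local Notation T1 := (measurableTypeR R).
Local Notation T2 := (T1 * T1)%type.

Variable delta : R.
Hypothesis delta0 : 0 < delta.
Let chi (t : R) : R := \1_(`[0, delta] : set R) t.

Let chi01 t : 0 <= chi t <= 1.
Proof. by rewrite /chi indicE; case: (_ \in _); rewrite ?lexx ?ler01. Qed.

Let measurable_chi : measurable_fun [set: T1] chi.
Proof. by apply: measurable_indic; exact: measurable_itv. Qed.

Let integrable_chi : mu1.-integrable setT (EFin \o chi).
Proof.
have := @integrable_itv R (fun=> 1) 0 delta (@cst_continuous _ _ _).
by congr (mu1.-integrable _ _); apply/funext => t; rewrite mul1r.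
Qed.

Let chi_int : \int[mu1]_t chi t = delta.
Proof.
have := @integral_is_derive R id (fun=> 1) 0 delta delta0 (@cst_continuous _ _ _) (fun t => is_derive_id _ _).
rewrite integral_indicM subr0 /Rintegral => E.
by rewrite (eq_integral (fun t : T1 => (1 * chi t)%:E)) ?E// => t _; rewrite mul1r.
Qed.

(** Cauchy-Schwarz, from the nonnegative integral of [(f t - m) ^+ 2] with [m] the mean value; an
    infinite right side is trivial. *)
Lemma sqr_integral_le (f : R -> R) : measurable_fun [set: T1] f ->
  (((\int[mu1]_t (f t * chi t)) ^+ 2)%:E <= delta%:E * \int[mu1]_t (f t ^+ 2 * chi t)%:E)%E.
Proof.
move=> mf.
have mfc : measurable_fun [set: T1] (fun t => f t * chi t) by exact: measurable_funM.
have mf2 : measurable_fun [set: T1] (fun t => f t ^+ 2 * chi t).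
  by apply: measurable_funM => //; exact: measurable_funX.
have f20 t : 0 <= f t ^+ 2 * chi t by rewrite mulr_ge0 ?sqr_ge0//; case/andP: (chi01 t).
have [fin|] := ltP (\int[mu1]_t (f t ^+ 2 * chi t)%:E)%E +oo%E; last first.
  by rewrite leye_eq => /eqP ->; rewrite gt0_muley ?lte_fin// leey.
have i2 : mu1.-integrable setT (EFin \o (fun t => f t ^+ 2 * chi t)).
  apply/integrableP; split; first exact/measurable_EFinP.
  by under eq_integral do rewrite /= ger0_norm//.
have i1 : mu1.-integrable setT (EFin \o (fun t => f t * chi t)).
  apply: (@le_integrable _ _ _ mu1 setT measurableT _ (EFin \o (fun t => chi t + f t ^+ 2 * chi t))).
  - exact/measurable_EFinP.
  - move=> t _; rewrite /= lee_fin; have /andP[c0 _] := chi01 t.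
    rewrite normrM (ger0_norm c0) [leRHS]ger0_norm ?addr_ge0// -[X in X + _]mul1r -mulrDl ler_wpM2r//.
    rewrite -[f t ^+ 2]real_normK ?num_real//; have := sqr_ge0 (`|f t| - 1 / 2); lra.
  - exact: (integrableD measurableT integrable_chi i2).
pose I := \int[mu1]_t (f t * chi t); pose S := \int[mu1]_t (f t ^+ 2 * chi t).
have SE : (\int[mu1]_t (f t ^+ 2 * chi t)%:E = S%:E)%E by rewrite /S /Rintegral fineK// integrable_fin_num.
rewrite SE -EFinM lee_fin -/I.
pose m := I / delta.
have iZ (k : R) (h : R -> R) : mu1.-integrable setT (EFin \o h) -> mu1.-integrable setT (EFin \o (fun t => k * h t)).
  by move=> ih; exact: (integrableZl measurableT k ih).
have : 0 <= \int[mu1]_t (f t ^+ 2 * chi t + ((- 2 * m) * (f t * chi t) + m ^+ 2 * chi t)).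
  apply: Rintegral_ge0 => t _; have /andP[c0 _] := chi01 t.
  rewrite (_ : _ + _ = (f t - m) ^+ 2 * chi t); first by rewrite mulr_ge0 ?sqr_ge0.
  by ring.
rewrite RintegralD//; last exact: (integrableD measurableT (iZ _ _ i1) (iZ _ _ integrable_chi)).
rewrite RintegralD//; [|exact: iZ|exact: iZ].
rewrite RintegralZl// RintegralZl// chi_int -/S -/I /m => h.
have : 0 <= delta * (S + (- 2 * (I / delta) * I + (I / delta) ^+ 2 * delta)) by rewrite mulr_ge0// ltW.
rewrite (_ : delta * _ = delta * S - I ^+ 2); first by rewrite subr_ge0.
by field; rewrite gt_eqF.
Qed.

Lemma indic_telescope (n : nat) (y : R) :
  \sum_(i < n) (\1_(`[0, delta[ : set R) (y - i%:R * delta) : R) = \1_(`[0, n%:R * delta[ : set R) y.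
Proof.
elim: n => [|n IH].
  rewrite big_ord0 mul0r indicE memNset//= in_itv/= => /andP[h1 h2].
  by move: (le_lt_trans h1 h2); rewrite ltxx.
rewrite big_ord_recr/= IH !indicE -[n.+1%:R]natr1.
have n0 : 0 <= n%:R * delta by rewrite mulr_ge0// ltW.
have mE (P : set R) z : (z \in P) = `[< P z >] by apply/idP/asboolP => [/set_mem|/mem_set].
rewrite !mE /= !in_itv/= !asboolb; have [y0|y0] := leP 0 y => /=.
  have [h|h] := ltP y (n%:R * delta).
    by rewrite subr_ge0 leNgt h/= addr0 (lt_trans h)// mulrDl mul1r ltrDl.
  rewrite subr_ge0 h/= add0r ltrBlDl; congr ((_ : bool)%:R).
  by rewrite mulrDl mul1r.
by rewrite add0r subr_ge0 leNgt (lt_le_trans y0 n0).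
Qed.

Definition cell : set T2 := `[0, delta[ `*` `[0, delta[.
Definition block (a : R * R) (n m : nat) : set T2 :=
  `[a.1, a.1 + n%:R * delta[ `*` `[a.2, a.2 + m%:R * delta[.
Definition node (a : R * R) (i j : nat) : R * R := (a.1 + i%:R * delta, a.2 + j%:R * delta).

Let measurable_cell : measurable cell.
Proof. by apply: measurableX; exact: measurable_itv. Qed.

Lemma measurable_block a n m : measurable (block a n m).
Proof. by apply: measurableX; exact: measurable_itv. Qed.

Let indicX (A B : set R) (x : R * R) : \1_(A `*` B) x = \1_A x.1 * \1_B x.2 :> R.
Proof. by rewrite !indicE in_setX -natrM mulnb. Qed.

(** The translates of the half-open cell by the nodes tile the block exactly. *)
Lemma integral_cells (h : R * R -> R) a n m : measurable_fun [set: T2] h -> (forall x, 0 <= h x) ->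
  (\int[mu2]_s (\1_cell s * \sum_(i < n) \sum_(j < m) h (shift2 (node a i j) s))%:E =
   \int[mu2]_x (\1_(block a n m) x * h x)%:E)%E.
Proof.
move=> mh h0.
have i0 (A : set T2) x : 0 <= \1_A x :> R by rewrite indicE.
have mi (A : set T2) : measurable A -> measurable_fun [set: T2] (\1_A : T2 -> R) by move=> mA; exact: measurable_indic.
pose F i j (x : T2) : R := \1_cell (shift2 (opp2 (node a i j)) x) * h x.
have mF i j : measurable_fun [set: T2] (F i j).
  apply: measurable_funM => //; apply: (measurableT_comp (mi _ measurable_cell)).
  exact: measurable_shift2.
have F0 i j x : 0 <= F i j x by rewrite mulr_ge0.
have FE i j s : F i j (shift2 (node a i j) s) = \1_cell s * h (shift2 (node a i j) s).
  rewrite /F; congr (\1_cell _ * _); case: s => s1 s2.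
  by rewrite /shift2 /opp2/= !addrK.
transitivity (\sum_(i < n) \sum_(j < m) \int[mu2]_s (F i j (shift2 (node a i j) s))%:E)%E.
  rewrite (eq_integral (fun s : T2 => \sum_(i < n) \sum_(j < m) (F i j (shift2 (node a i j) s))%:E))%E; last first.
    move=> s _; rewrite mulr_sumr -sumEFin; apply: eq_bigr => i _.
    by rewrite mulr_sumr -sumEFin; apply: eq_bigr => j _; rewrite FE.
  have mFs i j : measurable_fun [set: T2] (fun s => (F i j (shift2 (node a i j) s))%:E).
    by apply/measurable_EFinP; apply: (measurableT_comp (mF i j)); exact: measurable_shift2.
  rewrite ge0_integral_sum//.
  - by apply: eq_bigr => i _; rewrite ge0_integral_sum// => j s _; rewrite lee_fin.
  - by move=> i; apply: emeasurable_sum.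
  - by move=> i s _; apply: sume_ge0 => j _; rewrite lee_fin.
rewrite (eq_bigr (fun i : 'I_n => \sum_(j < m) \int[mu2]_x (F i j x)%:E)%E); last first.
  move=> i _; apply: eq_bigr => j _.
  rewrite (ge0_integral_shift2 (node a i j) (f := fun x : T2 => (F i j x)%:E))//; first exact/measurable_EFinP.
  by move=> x; rewrite lee_fin.
transitivity (\int[mu2]_x \sum_(i < n) \sum_(j < m) (F i j x)%:E)%E.
  rewrite ge0_integral_sum//.
  - apply: eq_bigr => i _; rewrite ge0_integral_sum//; first by move=> j; exact/measurable_EFinP.
    by move=> j s _; rewrite lee_fin.
  - by move=> i; apply: emeasurable_sum => j; exact/measurable_EFinP.
  - by move=> i s _; apply: sume_ge0 => j _; rewrite lee_fin.
apply: eq_integral => x _; under eq_bigr do rewrite sumEFin; rewrite sumEFin; congr (_%:E).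
rewrite /F; under eq_bigr do rewrite -mulr_suml; rewrite -mulr_suml; congr (_ * _).
rewrite /cell /block !indicX.
have e (c y k : R) : \1_(`[c, c + k[ : set R) y = \1_(`[0, k[ : set R) (y - c) :> R.
  rewrite !indicE; congr ((_ : bool)%:R); apply/idP/idP => /set_mem; rewrite /= in_itv/= => /andP[h1 h2];
    apply/mem_set; rewrite /= in_itv/=; apply/andP; split; lra.
rewrite !e -!indic_telescope mulr_suml; apply: eq_bigr => i _; rewrite mulr_sumr; apply: eq_bigr => j _.
by rewrite indicX /shift2 /opp2 /node /= !opprD !addrA.
Qed.

Variables (u : bool -> R * R -> R) (g : bool -> bool -> R * R -> R).
Hypothesis ug : H1loc_grad u g.

Let L1u k : L1loc (u k). Proof. by case: ug => h _; exact: L2loc_L1loc. Qed.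
Let L1g j k : L1loc (g j k). Proof. by case: ug => _ [h _]; exact: L2loc_L1loc. Qed.

(* |D_j u|^2 for the magnetic derivative D_j = d_j - i A_j *)
Definition cov2 j (x : R * R) : R :=
  (g j false x + A0 j x * u true x) ^+ 2 + (g j true x - A0 j x * u false x) ^+ 2.

(** [A0 j] is constant in the direction [j], so [delta * A0 j x] is exactly the integral of the
    potential along the edge. *)
Definition hop_at j (x : R * R) : R :=
  let y := shift2 (ev j delta) x in
  hop (u false x) (u true x) (u false y) (u true y) (delta * A0 j x).

Lemma continuous_A0 j : continuous (@A0 R j).
Proof.
have [c0 _ _ _] := C1_proj R false; have [c1 _ _ _] := C1_proj R true.
case: j => x; rewrite /A0.
  by apply: cvgM; [exact: c0|exact: cvg_cst].
by apply: cvgM; [apply: cvgN; exact: c1|exact: cvg_cst].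
Qed.

Lemma measurable_cov2 j : measurable_fun [set: T2] (cov2 j).
Proof.
have mA := continuous_measurable2 (@continuous_A0 j).
have mu k := proj1 (L1u k); have mg k := proj1 (L1g j k).
apply: measurable_funD; apply: measurable_funX.
  exact: (measurable_funD (mg false) (measurable_funM mA (mu true))).
exact: (measurable_funB (mg true) (measurable_funM mA (mu false))).
Qed.

Lemma measurable_hop_at j : measurable_fun [set: T2] (hop_at j).
Proof.
have cA : continuous (fun x => delta * A0 j x).
  by move=> x; apply: cvgM; [exact: cvg_cst|exact: continuous_A0].
have mc : measurable_fun [set: T2] (fun x => cos (delta * A0 j x)).
  apply: continuous_measurable2 => x; apply: continuous_comp; [exact: cA|exact: continuous_cos].
have ms : measurable_fun [set: T2] (fun x => sin (delta * A0 j x)).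
  apply: continuous_measurable2 => x; apply: continuous_comp; [exact: cA|exact: continuous_sin].
have mu k := proj1 (L1u k).
have mv k : measurable_fun [set: T2] (fun x => u k (shift2 (ev j delta) x)).
  by apply: (measurableT_comp (mu k)); exact: measurable_shift2.
rewrite /hop_at /hop; apply: measurable_funD; apply: measurable_funX.
  exact: (measurable_funB (mv false) (measurable_funB (measurable_funM mc (mu false)) (measurable_funM ms (mu true)))).
exact: (measurable_funB (mv true) (measurable_funD (measurable_funM ms (mu false)) (measurable_funM mc (mu true)))).
Qed.

Let sg (j : bool) : R := if j then - 2^-1 else 2^-1.
Let th j (x : R * R) : R := sg j * (x.1 * x.2).

Let C1_th j : C1 (th j) (fun i x => sg j * (if i then x.1 else x.2)).
Proof.
apply: C1_ext (C1M (C1_cst (sg j)) (C1M (C1_proj R false) (C1_proj R true))) _.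
by move=> [] x /=; ring.
Qed.

Let comb j c dc s ds : C1 c dc -> C1 s ds ->
  let w x := c x * u false x + s x * u true x in
  let dw x := c x * g j false x + dc j x * u false x + (s x * g j true x + ds j x * u true x) in
  [/\ L1loc w, L1loc dw & weak_deriv j w dw].
Proof.
move=> hc hs /=; have [cc cdc _ _] := hc; have [cs cds _ _] := hs; have [_ [_ wd]] := ug.
have l1 := L1locM cc (L1u false); have l2 := L1locM cs (L1u true).
have l3 := L1locD (L1locM cc (L1g j false)) (L1locM (cdc j) (L1u false)).
have l4 := L1locD (L1locM cs (L1g j true)) (L1locM (cds j) (L1u true)).
split; [exact: L1locD|exact: L1locD|apply: weak_derivD => //].
  exact: (weak_derivM hc (L1u false) (L1g j false) (wd j false)).
exact: (weak_derivM hs (L1u true) (L1g j true) (wd j true)).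
Qed.

(* In the gauge e^{i theta_j}, theta_j = +-x1 x2 / 2, the derivative D_j is d_j. *)
Lemma hop_at_le j : {ae mu2, forall x : T2,
  ((hop_at j x)%:E <= delta%:E * \int[mu1]_t (cov2 j (shift2 (ev j t) x) * chi t)%:E)%E}.
Proof.
pose c x := cos (th j x); pose s x := sin (th j x); pose s' x := -1 * s x.
have csin (t : R) : {for t, continuous (fun t => - sin t)} by apply: cvgN; exact: continuous_sin.
have hc : C1 c (fun i x => - sin (th j x) * (sg j * (if i then x.1 else x.2))).
  exact: (@C1_comp R cos (fun t => - sin t) _ _ (@is_derive_cos R) csin (C1_th j)).
have hs : C1 s (fun i x => cos (th j x) * (sg j * (if i then x.1 else x.2))).
  exact: (@C1_comp R sin cos _ _ (@is_derive_sin R) (@continuous_cos R) (C1_th j)).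
have hs' : C1 s' (fun i x => -1 * (cos (th j x) * (sg j * (if i then x.1 else x.2)))).
  by apply: C1_ext (C1M (C1_cst (-1)) hs) _ => i x /=; ring.
have sgA x : sg j * (if j then x.1 else x.2) = - A0 j x by rewrite /sg /A0; case: (j) => /=; field.
have [a1 a2 a3] := comb j hc hs'; have [b1 b2 b3] := comb j hs hc.
pose p x := g j false x + A0 j x * u true x; pose q x := g j true x - A0 j x * u false x.
have := weak_deriv_difference delta0 a1 a2 a3; have := weak_deriv_difference delta0 b1 b2 b3.
pose v1 x := c x * p x - s x * q x; pose v2 x := s x * p x + c x * q x.
rewrite [X in sweep _ _ X](_ : _ = v2); last first.
  by apply/funext => x; rewrite sgA /v2 /c /s /p /q; ring.
move=> H2; rewrite [X in sweep _ _ X](_ : _ = v1); last first.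
  by apply/funext => x; rewrite sgA /v1 /c /s' /s /p /q; ring.
move: H2; apply: filterS2 => x H2 H1.
have mp : measurable_fun [set: T2] p.
  apply: (measurable_funD (proj1 (L1g j false))); apply: (measurable_funM _ (proj1 (L1u true))).
  by apply: continuous_measurable2; exact: continuous_A0.
have mq : measurable_fun [set: T2] q.
  apply: (measurable_funB (proj1 (L1g j true))); apply: (measurable_funM _ (proj1 (L1u false))).
  by apply: continuous_measurable2; exact: continuous_A0.
have mc := continuous_measurable2 (let: And4 cc _ _ _ := hc in cc).
have ms := continuous_measurable2 (let: And4 cc _ _ _ := hs in cc).
have mline (f : T2 -> R) : measurable_fun setT f -> measurable_fun [set: T1] (fun t => f (shift2 (ev j t) x)).
  move=> mf; have := measurableT_comp (measurable_sweep j 1 mf) (measurable_pair1 x).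
  by under eq_fun do rewrite /= mul1r.
have mv1 := mline _ (measurable_funB (measurable_funM mc mp) (measurable_funM ms mq)).
have mv2 := mline _ (measurable_funD (measurable_funM ms mp) (measurable_funM mc mq)).
have -> : hop_at j x = sweep delta j v1 x ^+ 2 + sweep delta j v2 x ^+ 2.
  rewrite -H1 -H2 /hop_at /hop; set y := shift2 _ _.
  (* The gauge phases at the two ends differ by the edge potential, which is why a plain difference
     becomes a [hop]. *)
  have e : th j x = th j y + delta * A0 j x.
    by rewrite /th /y /shift2 /ev /A0 /sg; case: (j); case: (x) => x1 x2 /=; field.
  rewrite /s' /c /s e cosD sinD.
  set C := cos (th j y); set S := sin (th j y); have CS : C ^+ 2 + S ^+ 2 = 1 := cos2Dsin2 _.
  set al := delta * _; set ux := u false x; set vx := u true x; set uy := u false y; set vy := u true y.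
  transitivity ((C ^+ 2 + S ^+ 2) * ((uy - (cos al * ux - sin al * vx)) ^+ 2 +
    (vy - (sin al * ux + cos al * vx)) ^+ 2)); first by rewrite CS mul1r.
  ring.
rewrite EFinD; apply: le_trans (leeD (sqr_integral_le mv1) (sqr_integral_le mv2)) _.
have m2 (f : R -> R) : measurable_fun [set: T1] f -> measurable_fun [set: T1] (fun t => (f t ^+ 2 * chi t)%:E).
  by move=> mf; apply/measurable_EFinP; apply: measurable_funM => //; exact: measurable_funX.
have p2 (f : R -> R) t : (0 <= (f t ^+ 2 * chi t)%:E)%E.
  by rewrite lee_fin mulr_ge0 ?sqr_ge0//; case/andP: (chi01 t).
rewrite -ge0_muleDr; [|by apply: integral_ge0 => t _; exact: (p2 (fun t => v1 (shift2 (ev j t) x)))|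
  by apply: integral_ge0 => t _; exact: (p2 (fun t => v2 (shift2 (ev j t) x)))].
rewrite -ge0_integralD//; last 4 first.
- by move=> t _; exact: (p2 (fun t => v1 (shift2 (ev j t) x))).
- exact: (m2 _ mv1).
- by move=> t _; exact: (p2 (fun t => v2 (shift2 (ev j t) x))).
- exact: (m2 _ mv2).
rewrite le_eqVlt; apply/orP; left; apply/eqP; congr (_ * _)%E; apply: eq_integral => t _.
rewrite -EFinD -mulrDl; congr ((_ * _)%:E); rewrite /v1 /v2 /cov2 -/(p _) -/(q _).
set y := shift2 _ _; have CS : c y ^+ 2 + s y ^+ 2 = 1 := cos2Dsin2 _.
transitivity ((c y * p y - s y * q y) ^+ 2 + (s y * p y + c y * q y) ^+ 2); first by [].
transitivity ((c y ^+ 2 + s y ^+ 2) * (p y ^+ 2 + q y ^+ 2)); first by ring.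
by rewrite CS mul1r.
Qed.

Let cov2_ge0 j x : 0 <= cov2 j x. Proof. by rewrite addr_ge0 ?sqr_ge0. Qed.
Let hop_at_ge0 j x : 0 <= hop_at j x. Proof. by rewrite addr_ge0 ?sqr_ge0. Qed.
Let i0 (A : set T2) x : 0 <= \1_A x :> R. Proof. by rewrite indicE. Qed.

(** After exchanging the integrals each [t] in [[0, delta]] contributes at most the integral over
    [K]; one factor [delta] comes from this and one from Cauchy-Schwarz. *)
Lemma integral_hop_at_le j (P K : set T2) : measurable P -> measurable K ->
  (forall x t, P x -> 0 <= t <= delta -> K (shift2 (ev j t) x)) ->
  (\int[mu2]_x (\1_P x * hop_at j x)%:E <=
   (delta ^+ 2)%:E * \int[mu2]_(x in K) (cov2 j x)%:E)%E.
Proof.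
move=> mP mK PK.
have mhop := measurable_hop_at j; have mcov := measurable_cov2 j.
have mi (A : set T2) : measurable A -> measurable_fun [set: T2] (\1_A : T2 -> R) by move=> mA; exact: measurable_indic.
pose S (p : T2 * T1) : R := cov2 j (shift2 (ev j p.2) p.1) * chi p.2.
have mS : measurable_fun [set: T2 * T1] S.
  apply: measurable_funM; last by apply: (measurableT_comp measurable_chi); exact: measurable_snd.
  by have := measurable_sweep j 1 mcov; under eq_fun do rewrite mul1r.
have S0 p : 0 <= S p by rewrite mulr_ge0//; case/andP: (chi01 p.2).
pose S1 (p : T2 * T1) : R := \1_P p.1 * S p.
have mS1 : measurable_fun [set: T2 * T1] S1.
  by apply: measurable_funM => //; apply: (measurableT_comp (mi _ mP)); exact: measurable_fst.
have S10 p : 0 <= S1 p by rewrite mulr_ge0.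
apply: le_trans (_ : \int[mu2]_x (delta%:E * \int[mu1]_t (S1 (x, t))%:E) <= _)%E.
  apply: ae_ge0_le_integral => //.
  - by move=> x _; rewrite lee_fin mulr_ge0.
  - by apply/measurable_EFinP; apply: measurable_funM => //; exact: mi.
  - by move=> x _; apply: mule_ge0; [rewrite lee_fin ltW|apply: integral_ge0 => t _; rewrite lee_fin].
  - apply: emeasurable_funM => //; apply: (measurable_slab_x (F := fun p => (S1 p)%:E)) => //.
    exact/measurable_EFinP.
  have := hop_at_le j; apply: filterS => x hx _.
  rewrite (eq_integral (fun t : T1 => ((\1_P x)%:E * (S (x, t))%:E)%E)); last by move=> t _; rewrite -EFinM.
  rewrite ge0_integralZl//; last 2 first.
  - by apply/measurable_EFinP; exact: (measurableT_comp mS (measurable_pair1 x)).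
  - by move=> t _; rewrite lee_fin.
  by rewrite EFinM muleCA lee_wpmul2l.
rewrite ge0_integralZl//; last 3 first.
- by apply: (measurable_slab_x (F := fun p => (S1 p)%:E)) => //; exact/measurable_EFinP.
- by move=> x _; apply: integral_ge0 => t _; rewrite lee_fin.
- by rewrite lee_fin ltW.
rewrite expr2 EFinM -muleA lee_wpmul2l ?lee_fin ?(ltW delta0)//.
rewrite (slab_tonelli (F := fun p => (S1 p)%:E))//; last exact/measurable_EFinP.
pose CK := (\int[mu2]_(x in K) (cov2 j x)%:E)%E.
have CK0 : (0 <= CK)%E by apply: integral_ge0 => x _; rewrite lee_fin.
apply: le_trans (_ : \int[mu1]_t ((chi t)%:E * CK) <= _)%E; last first.
  rewrite ge0_integralZr//; first last.
  - by move=> t _; rewrite lee_fin; case/andP: (chi01 t).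
  - exact/measurable_EFinP.
  - rewrite (_ : \int[mu1]_t (chi t)%:E = delta%:E)%E//.
    by rewrite -chi_int /Rintegral fineK// (integrable_fin_num measurableT integrable_chi).
apply: ge0_le_integral => //.
- by move=> t _; apply: integral_ge0 => x _; rewrite lee_fin.
- by apply: (measurable_slab_t (F := fun p => (S1 p)%:E)) => //; exact/measurable_EFinP.
- by apply: emeasurable_funM => //; exact/measurable_EFinP.
move=> t _; have [c0|cn] := eqVneq (chi t) 0.
  by rewrite c0 mul0e integral0_eq// => x _; rewrite /S1 /S c0 !mulr0.
have /andP[t0 t1] : 0 <= t <= delta.
  by move: cn; rewrite /chi indicE; case: (boolP (t \in _)) => [|_]; rewrite ?inE/= ?in_itv//= eqxx.
have c1 : chi t = 1 by rewrite /chi indicE mem_set//= in_itv/= t0 t1.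
rewrite c1 mul1e /CK [leRHS]integral_mkcond.
have mr : measurable_fun [set: T2] ((fun x => (cov2 j x)%:E) \_ K).
  by apply/(measurable_restrictT _ mK); apply: measurable_funTS; exact/measurable_EFinP.
rewrite -[leRHS](ge0_integral_shift2 (ev j t) mr); last first.
  by move=> x; rewrite patchE; case: ifP => // _; rewrite lee_fin.
apply: ge0_le_integral => //.
- by move=> x _; rewrite lee_fin.
- by apply/measurable_EFinP; exact: (measurableT_comp mS1 (measurable_pair2 t)).
- by apply: (measurableT_comp mr); exact: measurable_shift2.
move=> x _; rewrite /S1 /S /= c1 mulr1 indicE.
have [Px|nP] := pselect (P x).
  by rewrite mem_set// mul1r patchE mem_set//; apply: PK => //; rewrite t0.
by rewrite memNset// mul0r patchE; case: ifP => // _; rewrite lee_fin.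
Qed.

End averaging.

(** * From the grid inequality to the continuous energy *)

Section lower_bound.
Variable R : realType.
Local Notation mu2 := (@leb2 R).
Local Notation mu1 := (@lebesgue_measure R).
Local Notation T1 := (measurableTypeR R).
Local Notation T2 := (T1 * T1)%type.

Lemma measurable_KR (L : R) : measurable (KR L : set T2).
Proof. by apply: measurableX; exact: measurable_itv. Qed.

Lemma GL_density_cov2 (b : R) u g x : GL_density b u g x =
  b * cov2 u g true x + (b * cov2 u g false x + 2^-1 * (1 - (u false x ^+ 2 + u true x ^+ 2)) ^+ 2).
Proof. by rewrite /GL_density /cov2 big_bool/=; ring. Qed.

Lemma GL_density_ge0 (b : R) u g x : 0 <= b -> 0 <= GL_density b u g x.
Proof.
move=> b0; rewrite GL_density_cov2.
have c0 j : 0 <= b * cov2 u g j x by rewrite mulr_ge0// addr_ge0 ?sqr_ge0.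
by apply: addr_ge0 => //; apply: addr_ge0 => //; rewrite mulr_ge0 ?sqr_ge0 ?invr_ge0.
Qed.

Lemma integral_cell_cst (delta c : R) : 0 < delta -> 0 <= c ->
  (\int[mu2]_s (\1_(cell delta : set T2) s * c)%:E = (c * delta ^+ 2)%:E)%E.
Proof.
move=> d0 c0; have mC : measurable (cell delta : set T2) by apply: measurableX; exact: measurable_itv.
rewrite (eq_integral (fun s : T2 => c%:E * (\1_(cell delta) s)%:E)%E); last by move=> s _; rewrite -EFinM mulrC.
rewrite ge0_integralZl//; [|by apply/measurable_EFinP; exact: measurable_indic].
have E : mu2 (cell delta) = (delta ^+ 2)%:E.
  rewrite /leb2 /cell product_measure1E; [|exact: measurable_itv|exact: measurable_itv].
  have e : lebesgue_measure (`[0, delta[ : set R) = delta%:E.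
    by rewrite lebesgue_measure_itv/= lte_fin d0 oppr0 adde0.
  by transitivity (delta%:E * delta%:E)%E; [congr (_ * _)%E; exact: e|rewrite -EFinM expr2].
by transitivity (c%:E * mu2 (cell delta))%E; [congr (_ * _)%E; rewrite integral_indic// setIT|rewrite E -EFinM].
Qed.

Section fixed.
Variables (b L delta : R) (N : nat) (u : bool -> R * R -> R) (g : bool -> bool -> R * R -> R).
Hypothesis ug : H1loc_grad u g.
Hypothesis b0 : 0 < b.
Hypothesis delta0 : 0 < delta.
Hypothesis NL : N.+1%:R * delta < L.

(** The grid has [N] cells per side but is centred as if it had [N.+1]: the additional one is the
    room for the translates by [s]. *)
Let c0 : R := - (N.+1%:R * delta / 2).
Let p i j := node delta (c0, c0) i j.
(** Then [4 * kap] is [2^-1] times [delta ^+ 2 / b], and the mean of [Gs] has the weights of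
    [GL_density]. *)
Let kap := delta ^+ 2 / (8 * b).
Let wel (x : R * R) : R := (1 - (u false x ^+ 2 + u true x ^+ 2)) ^+ 2.
Let Gs (s : R * R) := grid_energy N kap (fun i j => u false (shift2 (p i j) s))
  (fun i j => u true (shift2 (p i j) s)) (fun j => delta * A0 false (shift2 (p 0 j) s))
  (fun i => delta * A0 true (shift2 (p i 0) s)).

Let GsE s : Gs s = (\sum_(i < N) \sum_(j < N.+1) hop_at delta u false (shift2 (p i j) s) +
  \sum_(i < N.+1) \sum_(j < N) hop_at delta u true (shift2 (p i j) s)) +
  4 * kap * \sum_(i < N.+1) \sum_(j < N.+1) wel (shift2 (p i j) s).
Proof.
rewrite /Gs /grid_energy; congr (_ + _ + _).
  apply: eq_bigr => i _; apply: eq_bigr => j _; rewrite /hop1 /hop_at.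
  have -> : shift2 (p i.+1 j) s = shift2 (ev false delta) (shift2 (p i j) s).
    by rewrite /shift2 /p /node /ev /= -natr1; congr (_, _); ring.
  by [].
apply: eq_bigr => i _; apply: eq_bigr => j _; rewrite /hop2 /hop_at.
have -> : shift2 (p i j.+1) s = shift2 (ev true delta) (shift2 (p i j) s).
  by rewrite /shift2 /p /node /ev /= -natr1; congr (_, _); ring.
by [].
Qed.

Let mwel : measurable_fun [set: T2] wel.
Proof.
have [h _] := ug; have mu k : measurable_fun [set: T2] (u k) := proj1 (h k).
apply: measurable_funX; apply: measurable_funB; first exact: measurable_cst.
by apply: measurable_funD; exact: measurable_funX.
Qed.
Let wel0 x : 0 <= wel x. Proof. exact: sqr_ge0. Qed.
Let hop0 j x : 0 <= hop_at delta u j x. Proof. by rewrite addr_ge0 ?sqr_ge0. Qed.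
Let i0 (A : set T2) x : 0 <= \1_A x :> R. Proof. by rewrite indicE. Qed.
Let mi (A : set T2) : measurable A -> measurable_fun [set: T2] (\1_A : T2 -> R).
Proof. by move=> mA; exact: measurable_indic. Qed.
Let mcell : measurable (cell delta : set T2).
Proof. by apply: measurableX; exact: measurable_itv. Qed.

Let hop_block j n m : (n <= if j then N.+1 else N)%N -> (m <= if j then N else N.+1)%N ->
  (\int[mu2]_x (\1_(block delta (c0, c0) n m) x * hop_at delta u j x)%:E <=
  (delta ^+ 2)%:E * \int[mu2]_(x in KR L) (cov2 u g j x)%:E)%E.
Proof.
move=> hn hm; apply: integral_hop_at_le => //; [exact: measurable_block|exact: measurable_KR|].
move=> [x1 x2] t [] /=; rewrite !in_itv/= => /andP[a1 a2] /andP[a3 a4] /andP[t0 t1].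
have q k l : (k <= l)%N -> k%:R * delta <= l%:R * delta.
  by move=> kl; rewrite ler_wpM2r ?ler_nat// ltW.
rewrite /KR /shift2 /ev /=; move: a1 a2 a3 a4 NL (q _ _ hn) (q _ _ hm); rewrite /c0 -natr1 mulrDl mul1r.
case: (j) hn hm => _ _; rewrite /= -[N.+1%:R]natr1 (mulrDl _ _ delta) mul1r !in_itv/= => *; split; lra.
Qed.

Let well_block :
  (\int[mu2]_x (\1_(block delta (c0, c0) N.+1 N.+1) x * wel x)%:E <= \int[mu2]_(x in KR L) (wel x)%:E)%E.
Proof.
have mK := measurable_KR L.
rewrite [leRHS]integral_mkcond; apply: ge0_le_integral => //.
- by move=> x _; rewrite lee_fin mulr_ge0.
- by apply/measurable_EFinP; apply: measurable_funM => //; apply: mi; exact: measurable_block.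
- by apply/(measurable_restrictT _ mK); apply: measurable_funTS; exact/measurable_EFinP.
move=> x _; rewrite indicE patchE; case: (boolP (x \in block _ _ _ _)) => [|_]; last first.
  by rewrite mul0r; case: ifP => _ //; rewrite lee_fin.
rewrite inE mul1r => -[] /=; rewrite !in_itv/= => /andP[a1 a2] /andP[a3 a4]; rewrite mem_set//.
by move: NL a1 a2 a3 a4; rewrite /KR /= /c0 !in_itv/= => *; split; lra.
Qed.

Let integral_Gs : (\int[mu2]_s (\1_(cell delta) s * Gs s)%:E <= (delta ^+ 2 / b)%:E * FKR b L u g)%E.
Proof.
have kap0 : 0 <= 4 * kap by rewrite /kap mulr_ge0// divr_ge0 ?sqr_ge0// mulr_ge0// ltW.
have mh j := measurable_hop_at delta ug j; have mcov j := measurable_cov2 ug j.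
have msh (h : T2 -> R) i j : measurable_fun setT h -> measurable_fun setT (fun s : T2 => h (shift2 (p i j) s)).
  by move=> mh'; apply: (measurableT_comp mh'); exact: measurable_shift2.
have ms (h : T2 -> R) n m : measurable_fun setT h -> measurable_fun setT
    (fun s : T2 => (\1_(cell delta) s * \sum_(i < n) \sum_(j < m) h (shift2 (p i j) s))%:E).
  move=> mh'; apply/measurable_EFinP; apply: measurable_funM; first exact: mi.
  by apply: measurable_sum => i; apply: measurable_sum => j; exact: msh.
have ps (h : T2 -> R) n m : (forall x, 0 <= h x) -> forall s : T2,
    (0 <= (\1_(cell delta) s * \sum_(i < n) \sum_(j < m) h (shift2 (p i j) s))%:E)%E.
  by move=> h0 s; rewrite lee_fin mulr_ge0//; apply: sumr_ge0 => i _; apply: sumr_ge0.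
rewrite (eq_integral (fun s : T2 =>
  ((\1_(cell delta) s * \sum_(i < N) \sum_(j < N.+1) hop_at delta u false (shift2 (p i j) s))%:E +
   (\1_(cell delta) s * \sum_(i < N.+1) \sum_(j < N) hop_at delta u true (shift2 (p i j) s))%:E) +
  (4 * kap)%:E * (\1_(cell delta) s * \sum_(i < N.+1) \sum_(j < N.+1) wel (shift2 (p i j) s))%:E))%E; last first.
  by move=> s _; rewrite GsE -EFinM -!EFinD; congr (_%:E); ring.
rewrite ge0_integralD//; last 4 first.
- by move=> s _; apply: adde_ge0; exact: ps.
- by apply: emeasurable_funD; exact: ms.
- by move=> s _; apply: mule_ge0; [rewrite lee_fin|exact: ps].
- by apply: emeasurable_funM => //; exact: ms.
rewrite ge0_integralD//; last 4 first.
- by move=> s _; exact: ps.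
- exact: ms.
- by move=> s _; exact: ps.
- exact: ms.
rewrite ge0_integralZl//; last 2 first.
- exact: ms.
- by move=> s _; exact: ps.
rewrite !integral_cells//.
apply: (@le_trans _ _ ((delta ^+ 2)%:E * (\int[mu2]_(x in KR L) (cov2 u g false x)%:E) +
   (delta ^+ 2)%:E * (\int[mu2]_(x in KR L) (cov2 u g true x)%:E) +
   (4 * kap)%:E * (\int[mu2]_(x in KR L) (wel x)%:E)))%E.
  apply: leeD; first by apply: leeD; exact: hop_block.
  by apply: lee_wpmul2l; [rewrite lee_fin|exact: well_block].
have mK := measurable_KR L.
have mr (h : T2 -> R) : measurable_fun setT h -> measurable_fun (KR L : set T2) (fun x => (h x)%:E).
  by move=> ?; apply: measurable_funTS; exact/measurable_EFinP.
have cov0 j x : 0 <= cov2 u g j x by rewrite addr_ge0 ?sqr_ge0.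
have mrc j : measurable_fun (KR L : set T2) (fun x => (b%:E * (cov2 u g j x)%:E)%E).
  by apply: emeasurable_funM => //; exact: mr.
have b0' : (0 <= b%:E)%E by rewrite lee_fin ltW.
have -> : FKR b L u g = (b%:E * \int[mu2]_(x in KR L) (cov2 u g true x)%:E +
   (b%:E * (\int[mu2]_(x in KR L) (cov2 u g false x)%:E) + (2^-1)%:E * \int[mu2]_(x in KR L) (wel x)%:E))%E.
  rewrite /FKR -!ge0_integralZl//; try by [exact: mr|move=> x _; rewrite lee_fin].
  have mw : measurable_fun (KR L : set T2) (fun x => ((2^-1)%:E * (wel x)%:E)%E).
    by apply: emeasurable_funM => //; exact: mr.
  have pc j (x : T2) : KR L x -> (0 <= b%:E * (cov2 u g j x)%:E)%E by move=> _; rewrite mule_ge0 ?lee_fin.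
  have pw (x : T2) : KR L x -> (0 <= (2^-1)%:E * (wel x)%:E)%E by move=> _; rewrite mule_ge0 ?lee_fin ?invr_ge0.
  rewrite -[X in (_ + X)%E]ge0_integralD//; try by [exact: pc|exact: pw].
  rewrite -ge0_integralD//; try by [exact: pc|move=> x Kx; rewrite adde_ge0 ?pc ?pw|exact: emeasurable_funD].
  by apply: eq_integral => x _; rewrite -!EFinM -!EFinD GL_density_cov2.
set c1 := (\int[mu2]_(x in _) (cov2 u g true x)%:E)%E.
set c2 := (\int[mu2]_(x in _) (cov2 u g false x)%:E)%E.
set c3 := (\int[mu2]_(x in _) (wel x)%:E)%E.
have C1 : (0 <= c1)%E by apply: integral_ge0 => x _; rewrite lee_fin.
have C2 : (0 <= c2)%E by apply: integral_ge0 => x _; rewrite lee_fin.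
have C3 : (0 <= c3)%E by apply: integral_ge0 => x _; rewrite lee_fin.
have b2 : (0 <= (2^-1 : R)%:E)%E by rewrite lee_fin invr_ge0.
have M1 := mule_ge0 b0' C1; have M2 := mule_ge0 b0' C2; have M3 := mule_ge0 b2 C3.
rewrite (ge0_muleDr _ M1 (adde_ge0 M2 M3)) (ge0_muleDr _ M2 M3).
rewrite !muleA -!EFinM divfK ?gt_eqF// [X in (X <= _)%E](addeAC) -addeA addeC -addeA.
rewrite (_ : 4 * kap = delta ^+ 2 / b * 2^-1) ?addeA; last by rewrite /kap; field; rewrite gt_eqF.
by rewrite le_eqVlt; apply/orP; left; apply/eqP; rewrite -addeA addeC.
Qed.

(** The grid inequality holds for every shift [s], always with flux [delta ^+ 2] per cell. It is
    integrated over the cell, whose area then cancels the factor [delta ^+ 2] in front of the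
    energy. *)
Lemma FKR_ge (eta beta : R) (Q : nat) : 0 < eta <= 1 / 4 ->
  1 <= delta ^+ 2 / (8 * b) * eta ^+ 2 -> 0 < beta <= 1 -> beta ^+ 2 <= eta / 300 ->
  delta <= 1 -> (1 < Q)%N ->
  (((1 - 2 * eta) * (expR (- (beta / 4)) * ln Q%:R) * (N%:R ^+ 2 * delta ^+ 2)
    - 200 * (1 + ln Q%:R) ^+ 2 * N.+2%:R)%:E <=
   ((1 + 2 * delta ^+ 2 * (2000 * (1 + ln Q%:R) * Q%:R ^+ 2 / beta ^+ 2) * 600) / b)%:E * FKR b L u g)%E.
Proof.
move=> eta01 kapeta /andP[beta0 beta1] betaeta delta1 Q1.
have F01 : 0 < delta ^+ 2 <= 1 by rewrite exprn_gt0// expr_le1// ltW.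
have lnQ : 0 <= ln (Q%:R : R) by rewrite ln_ge0// ler1n ltnW.
set B := 200 * _ * _; set C := 1 + 2 * delta ^+ 2 * _ * 600; set A := _ * (_ * _ ^+ 2).
have C0 : 0 < C.
  apply: ltr_pwDl; first exact: ltr01.
  apply: mulr_ge0; last exact: ler0n.
  apply: mulr_ge0; first by apply: mulr_ge0; [exact: ler0n|exact: sqr_ge0].
  apply: mulr_ge0; last by rewrite invr_ge0 sqr_ge0.
  apply: mulr_ge0; last exact: sqr_ge0.
  by apply: mulr_ge0; [exact: ler0n|exact: (addr_ge0 ler01 lnQ)].
have key s : A - B <= C * Gs s.
  rewrite lerBlDr [C * _]mulrC /A /B /C /Gs; apply: grid_energy_kernel => //.
  by move=> i j; rewrite /A0 /shift2 /p /node /= -!natr1; field.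
clearbody A B C; have [AB|AB] := leP (A - B) 0.
  apply: le_trans (_ : 0 <= _)%E; first by rewrite lee_fin.
  apply: mule_ge0; first by rewrite lee_fin divr_ge0// ltW.
  by apply: integral_ge0 => x _; rewrite lee_fin GL_density_ge0// ltW.
have d20 : 0 < delta ^+ 2 by rewrite exprn_gt0.
suff : ((A - B)%:E * (delta ^+ 2)%:E <= (C / b)%:E * FKR b L u g * (delta ^+ 2)%:E)%E.
  by rewrite lee_pmul2r.
rewrite -EFinM -(integral_cell_cst delta0 (ltW AB)).
have mG : measurable_fun [set: T2] Gs.
  have msh (h : T2 -> R) i j : measurable_fun setT h -> measurable_fun setT (fun s : T2 => h (shift2 (p i j) s)).
    by move=> mh'; apply: (measurableT_comp mh'); exact: measurable_shift2.
  have mh j := measurable_hop_at delta ug j.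
  rewrite (_ : Gs = fun s => (\sum_(i < N) \sum_(j < N.+1) hop_at delta u false (shift2 (p i j) s) +
  \sum_(i < N.+1) \sum_(j < N) hop_at delta u true (shift2 (p i j) s)) +
  4 * kap * \sum_(i < N.+1) \sum_(j < N.+1) wel (shift2 (p i j) s)); last by apply/funext => s; exact: GsE.
  apply: measurable_funD; [apply: measurable_funD|apply: measurable_funM => //];
    by apply: measurable_sum => i; apply: measurable_sum => j; exact: msh.
have kap0 : 0 <= 4 * kap by rewrite /kap mulr_ge0// divr_ge0 ?sqr_ge0// mulr_ge0// ltW.
have G0 s : 0 <= Gs s.
  by rewrite GsE; apply: addr_ge0; [apply: addr_ge0|apply: mulr_ge0 => //]; apply: sumr_ge0 => i _; apply: sumr_ge0.
apply: le_trans (_ : \int[mu2]_s (C%:E * (\1_(cell delta) s * Gs s)%:E) <= _)%E.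
  apply: ge0_le_integral => //.
  - by move=> s _; rewrite lee_fin mulr_ge0// ltW.
  - by apply/measurable_EFinP; apply: measurable_funM => //; exact: mi.
  - by apply: emeasurable_funM => //; apply/measurable_EFinP; apply: measurable_funM => //; exact: mi.
  - by move=> s _; rewrite -EFinM lee_fin mulrCA ler_wpM2l.
rewrite ge0_integralZl//; last 3 first.
- by apply/measurable_EFinP; apply: measurable_funM => //; exact: mi.
- by move=> s _; rewrite lee_fin mulr_ge0.
- by rewrite lee_fin ltW.
apply: le_trans (lee_wpmul2l _ integral_Gs) _; first by rewrite lee_fin ltW.
by rewrite muleAC muleA -!EFinM mulrA (mulrAC C) .
Qed.

End fixed.
End lower_bound.

(** * Magnetic translations and the invariance of the energy density *)

Section magnetic_translations.
Variable R : realType.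
Local Notation mu2 := (@leb2 R).
Local Notation T1 := (measurableTypeR R).
Local Notation T2 := (T1 * T1)%type.
Implicit Types (u w : bool -> R * R -> R) (g gw : bool -> bool -> R * R -> R) (a : R * R).

Lemma eq_H1loc_grad u u' g g' : (forall k, u k =1 u' k) -> (forall j k, g j k =1 g' j k) ->
  H1loc_grad u g -> H1loc_grad u' g'.
Proof.
move=> uu gg; have -> : u' = u by apply/funext => k; apply/funext => x; rewrite uu.
by have -> : g' = g by apply/funext => j; apply/funext => k; apply/funext => x; rewrite gg.
Qed.

Lemma L2loc0 : L2loc (fun=> 0 : R).
Proof.
split=> // M; rewrite integral0_eq// => x _; by rewrite expr0n.
Qed.

Lemma H1loc0 : H1loc_grad (fun _ _ => 0 : R) (fun _ _ _ => 0).
Proof.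
split; [|split] => *; try exact: L2loc0.
by move=> phi _; rewrite !integral0_eq ?oppe0// => x _; rewrite mul0r.
Qed.

Lemma H1locD u g u' g' : H1loc_grad u g -> H1loc_grad u' g' ->
  H1loc_grad (fun k x => u k x + u' k x) (fun j k x => g j k x + g' j k x).
Proof.
move=> [a1 [a2 a3]] [b1 [b2 b3]]; split; first by move=> k; exact: L2locD.
split=> j k; first exact: L2locD.
by apply: weak_derivD => //; exact: L2loc_L1loc.
Qed.

Lemma H1loc_sum n (u : nat -> bool -> R * R -> R) (g : nat -> bool -> bool -> R * R -> R) :
  (forall i, H1loc_grad (u i) (g i)) ->
  H1loc_grad (fun k x => \sum_(i < n) u i k x) (fun j k x => \sum_(i < n) g i j k x).
Proof.
move=> h; elim: n => [|n IH].
  by apply: eq_H1loc_grad H1loc0 => [k x|j k x]; rewrite big_ord0.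
by apply: eq_H1loc_grad (H1locD IH (h n)) => [k x|j k x]; rewrite big_ord_recr.
Qed.

Lemma L2loc_local (v : R * R -> R) :
  (forall M : R, exists2 v', L2loc v' & forall x, box M x -> v x = v' x) -> L2loc v.
Proof.
move=> loc; split=> [|M].
  have -> : [set: T2] = \bigcup_n (box n%:R : set T2).
    apply/seteqP; split=> // -[x1 x2] _; exists (Num.trunc (`|x1| + `|x2|)).+1 => //.
    have h := ltW (truncnS_gt (`|x1| + `|x2|)); apply/boxP.
    by split; apply: le_trans h; rewrite ?lerDl ?lerDr.
  apply/measurable_fun_bigcup => [n|n]; first exact: measurable_box.
  have [v' [mv' _] e] := loc n%:R.
  apply: (eq_measurable_fun v'); last exact: measurable_funTS.
  by move=> x /set_mem bx; rewrite e.
have [v' [_ h] e] := loc M.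
by rewrite (eq_integral (fun x : T2 => (v' x ^+ 2)%:E)) // => x /set_mem bx; rewrite e.
Qed.

(** All conditions are tested on boxes, so a function may be assembled from local pieces. *)
Lemma H1loc_local u g :
  (forall M : R, exists u' g', [/\ H1loc_grad u' g', forall k x, box M x -> u k x = u' k x &
     forall j k x, box M x -> g j k x = g' j k x]) -> H1loc_grad u g.
Proof.
move=> loc.
have hu k : L2loc (u k).
  by apply: L2loc_local => M; have [u' [g' [[h _] e _]]] := loc M; exists (u' k) => // x bx; exact: e.
have hg j k : L2loc (g j k).
  by apply: L2loc_local => M; have [u' [g' [[_ [h _]] _ e]]] := loc M; exists (g' j k) => // x bx; exact: e.
split=> //; split=> // j k; apply: weak_deriv_local; try exact: L2loc_L1loc.
move=> M; have [u' [g' [[h1 [h2 h3]] e1 e2]]] := loc M; exists (u' k), (g' j k).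
split=> //; [exact: L2loc_L1loc|exact: L2loc_L1loc|exact: e1|exact: e2].
Qed.

(* e^{i ph a x} u (x - a): the translation commuting with nabla - i A0. *)
Definition ph a (x : R * R) : R := (a.1 * x.2 - a.2 * x.1) / 2.
Definition mt a u (k : bool) (x : R * R) : R :=
  let y := shift2 (opp2 a) x in
  if k then sin (ph a x) * u false y + cos (ph a x) * u true y
  else cos (ph a x) * u false y - sin (ph a x) * u true y.
(** The second summand stems from the phase, whose [j]-th derivative is the constant [A0 j a]. *)
Definition mtg a u g (j k : bool) (x : R * R) : R :=
  mt a (g j) k x + A0 j a * (if k then mt a u false x else - mt a u true x).

Lemma mt_sqr a u x : mt a u false x ^+ 2 + mt a u true x ^+ 2 =
  u false (shift2 (opp2 a) x) ^+ 2 + u true (shift2 (opp2 a) x) ^+ 2.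
Proof.
rewrite /mt /=; set y := shift2 _ _; have CS : cos (ph a x) ^+ 2 + sin (ph a x) ^+ 2 = 1 := cos2Dsin2 _.
transitivity ((cos (ph a x) ^+ 2 + sin (ph a x) ^+ 2) * (u false y ^+ 2 + u true y ^+ 2)); first by ring.
by rewrite CS mul1r.
Qed.

(** The gradient of the phase compensates the change of the potential, as [A0] is linear. *)
Lemma mt_cov2 a u g j x : cov2 (mt a u) (mtg a u g) j x = cov2 u g j (shift2 (opp2 a) x).
Proof.
pose v (k : bool) y := if k then g j true y - A0 j y * u false y else g j false y + A0 j y * u true y.
have := mt_sqr a v x; rewrite /v /= -/(cov2 _ _ _ _) => <-; rewrite /cov2 /mtg; congr (_ ^+ 2 + _ ^+ 2).
  by rewrite /mt /shift2 /opp2 /A0 /=; case: j {v} => /=; ring.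
by rewrite /mt /shift2 /opp2 /A0 /=; case: j {v} => /=; ring.
Qed.

Lemma mt_GL_density b a u g x :
  GL_density b (mt a u) (mtg a u g) x = GL_density b u g (shift2 (opp2 a) x).
Proof. by rewrite !GL_density_cov2 !mt_cov2 mt_sqr. Qed.

Let csin (t : R) : {for t, continuous (fun t => - sin t)}.
Proof. by apply: cvgN; exact: continuous_sin. Qed.

Let C1_ph a : C1 (ph a) (fun j _ => A0 j a).
Proof.
apply: (@C1_ext R _ (fun j x => a.1 / 2 * (j == true)%:R + 0 * x.2 + (- a.2 / 2 * (j == false)%:R + 0 * x.1))); last first.
  by case=> x /=; rewrite /A0; ring.
have -> : ph a = fun x => a.1 / 2 * x.2 + - a.2 / 2 * x.1 by apply/funext => x; rewrite /ph; ring.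
by have := C1D (C1M (C1_cst (a.1 / 2)) (C1_proj R true)) (C1M (C1_cst (- a.2 / 2)) (C1_proj R false)).
Qed.

Lemma H1loc_mt a u g : H1loc_grad u g -> H1loc_grad (mt a u) (mtg a u g).
Proof.
move=> [hu [hg wd]].
pose C x := cos (ph a x); pose S x := sin (ph a x); pose S' x := -1 * S x.
have hC : C1 C (fun j x => - sin (ph a x) * A0 j a).
  exact: (@C1_comp R cos (fun t => - sin t) _ _ (@is_derive_cos R) csin (C1_ph a)).
have hS : C1 S (fun j x => cos (ph a x) * A0 j a).
  exact: (@C1_comp R sin cos _ _ (@is_derive_sin R) (@continuous_cos R) (C1_ph a)).
have hS' : C1 S' (fun j x => -1 * (cos (ph a x) * A0 j a)).
  by apply: C1_ext (C1M (C1_cst (-1)) hS) _ => i x /=; ring.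
have cont c d : C1 c d -> continuous c by case.
have su v : L2loc v -> L2loc (fun x => v (shift2 (opp2 a) x)) by exact: L2loc_shift.
pose p := fun c c' : R * R -> R => fun v (x : R * R) =>
  c x * v false (shift2 (opp2 a) x) + c' x * v true (shift2 (opp2 a) x).
have Lp c d c' d' v : C1 c d -> C1 c' d' -> (forall k, L2loc (v k)) -> L2loc (p c c' v).
  by move=> h h' hv; apply: L2locD; apply: L2locM; [exact: cont h|exact: su|exact: cont h'|exact: su].
have mtE v : (mt a v false = p C S' v) * (mt a v true = p S C v).
  by split; apply/funext => x; rewrite /mt /p /C /S' /S /=; ring.
have Lmt v k : (forall k, L2loc (v k)) -> L2loc (mt a v k).
  by move=> hv; case: k; rewrite mtE; [exact: (Lp _ _ _ _ _ hS hC)|exact: (Lp _ _ _ _ _ hC hS')].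
have cA j : continuous (fun _ : R * R => A0 j a) by exact: cst_continuous.
split; first by move=> k; exact: Lmt.
split=> j k.
  rewrite /mtg; apply: L2locD; first exact: Lmt.
  apply: L2locM => //; case: k; first exact: Lmt.
  have -> : (fun x => - mt a u true x) = fun x => -1 * mt a u true x by apply/funext => x; ring.
  by apply: L2locM; [exact: cst_continuous|exact: Lmt].
have wp c d c' d' : C1 c d -> C1 c' d' -> weak_deriv j (p c c' u)
    (fun x => (c x * g j false (shift2 (opp2 a) x) + d j x * u false (shift2 (opp2 a) x)) +
              (c' x * g j true (shift2 (opp2 a) x) + d' j x * u true (shift2 (opp2 a) x))).
  move=> h h'; have [_ cd _ _] := h; have [_ cd' _ _] := h'.
  have lu k' := L2loc_L1loc (su _ (hu k')); have lg k' := L2loc_L1loc (su _ (hg j k')).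
  have ws k' := weak_deriv_shift (opp2 a) (L2loc_L1loc (hu k')) (L2loc_L1loc (hg j k')) (wd j k').
  apply: weak_derivD.
  - by apply: L1locM => //; exact: cont h.
  - by apply: L1locD; apply: L1locM => //; exact: cont h.
  - by apply: L1locM => //; exact: cont h'.
  - by apply: L1locD; apply: L1locM => //; exact: cont h'.
  - exact: weak_derivM.
  - exact: weak_derivM.
case: k; rewrite mtE.
  have := wp _ _ _ _ hS hC; congr (weak_deriv j _ _); apply/funext => x.
  by rewrite /mtg /mt /C /S /=; ring.
have := wp _ _ _ _ hC hS'; congr (weak_deriv j _ _); apply/funext => x.
by rewrite /mtg /mt /C /S' /S /=; ring.
Qed.

(** Both boundary conditions become one invariance, so that the two directions can be treated at
    once. *)
Lemma in_ERP (L : R) u : in_ER L u <-> forall j k x, mt (ev j L) u k x = u k x.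
Proof.
have s j x : shift2 (opp2 (ev j L)) (shift2 (ev j L) x) = x.
  by case: x => x1 x2; rewrite /shift2 /opp2 /= !addrK.
split=> [[h1 h2] j k [x1 x2]|h].
  rewrite /mt /shift2 /opp2 /ev; case: j => /=; rewrite oppr0 addr0.
    rewrite (_ : ph _ _ = - (L * x1 / 2)); last by rewrite /ph /=; ring.
    by have := h2 (x1, x2 - L); rewrite /= subrK => -[e1 e2]; case: k; rewrite ?e1 ?e2.
  rewrite (_ : ph _ _ = L * x2 / 2); last by rewrite /ph /=; ring.
  by have := h1 (x1 - L, x2); rewrite /= subrK => -[e1 e2]; case: k; rewrite ?e1 ?e2.
have E j x k : u k (shift2 (ev j L) x) = if k
    then sin (ph (ev j L) (shift2 (ev j L) x)) * u false x + cos (ph (ev j L) (shift2 (ev j L) x)) * u true x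
    else cos (ph (ev j L) (shift2 (ev j L) x)) * u false x - sin (ph (ev j L) (shift2 (ev j L) x)) * u true x.
  by rewrite -(h j) /mt s.
split=> x /=.
  have -> : (x.1 + L, x.2) = shift2 (ev false L) x by rewrite /shift2 /ev /= addr0.
  rewrite !E (_ : ph _ _ = L * x.2 / 2)//.
  by rewrite /ph /shift2 /ev /=; ring.
have -> : (x.1, x.2 + L) = shift2 (ev true L) x by rewrite /shift2 /ev /= addr0.
rewrite !E (_ : ph _ _ = - (L * x.1 / 2))//.
by rewrite /ph /shift2 /ev /=; ring.
Qed.

(** Only almost everywhere: the translate of [g] is another weak gradient of [u], hence agrees with
    [g] off a null set. *)
Lemma GL_density_periodic b (L : R) j u g : H1loc_grad u g -> in_ER L u ->
  {ae mu2, forall x : T2, GL_density b u g (shift2 (opp2 (ev j L)) x) = GL_density b u g x}.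
Proof.
move=> ug /in_ERP per; have [hu [hg wd]] := ug.
have [hu' [hg' wd']] := H1loc_mt (ev j L) ug.
have e k : mt (ev j L) u k = u k by apply/funext => x; exact: per.
have ae i k : {ae mu2, forall x : T2, mtg (ev j L) u g i k x = g i k x}.
  apply: (@weak_deriv_unique R i (u k)); try exact: L2loc_L1loc.
    by rewrite -(e k).
  exact: wd.
have ae2 i : {ae mu2, forall x : T2, cov2 (mt (ev j L) u) (mtg (ev j L) u g) i x = cov2 u g i x}.
  apply: filterS2 (ae i false) (ae i true) => x h1 h2.
  by rewrite /cov2 !e h1 h2.
apply: filterS2 (ae2 false) (ae2 true) => x h1 h2.
by rewrite -mt_GL_density !GL_density_cov2 h1 h2 !e.
Qed.

End magnetic_translations.

(** * Magnetically periodic continuation of a function supported in a cell *)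

Section periodic_extension.
Variable R : realType.
Implicit Types (w : bool -> R * R -> R) (g : bool -> bool -> R * R -> R) (a b : R * R).

Definition co (j : bool) (x : R * R) : R := if j then x.2 else x.1.

Lemma mt_mt a b w k x : let t := ph a x + ph b (shift2 (opp2 a) x) in
  let y := shift2 (opp2 b) (shift2 (opp2 a) x) in
  mt a (mt b w) k x = if k then sin t * w false y + cos t * w true y
    else cos t * w false y - sin t * w true y.
Proof. by move=> t y; rewrite /mt -/y /t cosD sinD; case: k; ring. Qed.

Lemma mt_parallel j (s t : R) w k x : mt (ev j s) (mt (ev j t) w) k x = mt (ev j (s + t)) w k x.
Proof.
rewrite mt_mt /mt (_ : ph _ x + _ = ph (ev j (s + t)) x).
  rewrite (_ : shift2 _ (shift2 _ _) = shift2 (opp2 (ev j (s + t))) x)//.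
  by rewrite /shift2 /opp2 /ev; case: j => /=; congr (_, _); ring.
by rewrite /ph /shift2 /opp2 /ev; case: j => /=; field.
Qed.

Lemma cos_sin_mulz (t : R) (z : int) : cos t = 1 -> cos (z%:~R * t) = 1 /\ sin (z%:~R * t) = 0.
Proof.
move=> c1; have s0 : sin t = 0.
  by apply/eqP; rewrite -sqrf_eq0; have := cos2Dsin2 t; rewrite c1 expr1n => h; apply/eqP; lra.
elim: z => [|n [c s]|n [c s]]; first by rewrite mul0r cos0 sin0.
  by rewrite intS rmorphD/= mulrDl mul1r cosD sinD c s c1 s0; split; ring.
rewrite (_ : (- n.+1%:Z)%:~R * t = (- n%:Z)%:~R * t - t); last by rewrite intS opprD rmorphD/= rmorphN/= rmorph1; ring.
by rewrite cosB sinB c s c1 s0; split; ring.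
Qed.

(** The two orders differ by the phase of the enclosed flux, an integer multiple of [L * K];
    quantisation makes it trivial. *)
Lemma mt_commute (L K : R) (z : int) j w k x : cos (L * K) = 1 ->
  mt (ev (~~ j) K) (mt (ev j (z%:~R * L)) w) k x = mt (ev j (z%:~R * L)) (mt (ev (~~ j) K) w) k x.
Proof.
move=> L1; rewrite !mt_mt.
rewrite (_ : shift2 (opp2 (ev j _)) _ = shift2 (opp2 (ev (~~ j) K)) (shift2 (opp2 (ev j (z%:~R * L))) x)); last first.
  by rewrite /shift2 /opp2 /ev; case: j => /=; congr (_, _); ring.
set s := ph _ _ + _; set t := ph _ _ + _; set y := shift2 _ _.
pose e : int := if j then 1 else -1.
have st : s = t + (e * z)%:~R * (L * K).
  by rewrite /s /t /e /ph /shift2 /opp2 /ev; case: j {s t y e} => /=; rewrite ?mul1r ?mulN1r ?rmorphN/=; field.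
have [c0 s0] := cos_sin_mulz (e * z) L1.
by rewrite st cosD sinD c0 s0 !mulr0 !mulr1 subr0 addr0.
Qed.

Section one_direction.
Variables (c L : R) (j : bool).
Hypothesis L0 : 0 < L.

Definition index_of (x : R * R) : int := Num.floor ((co j x - c + L / 2) / L).
(** The value is fetched from the strip of width [L] centred at [c]. For [w] vanishing off that
    strip this is the sum of all its magnetic translates. *)
Definition ext w k x := mt (ev j ((index_of x)%:~R * L)) w k x.
Definition extg w g i k x := mtg (ev j ((index_of x)%:~R * L)) w g i k x.
Definition in_strip w := forall k x, ~~ (c - L / 2 <= co j x < c + L / 2) -> w k x = 0.

Let index_ofP (x : R * R) (z : int) :
  c - L / 2 <= co j (shift2 (opp2 (ev j (z%:~R * L))) x) < c + L / 2 -> index_of x = z.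
Proof.
move=> h; apply: floor_def; rewrite ler_pdivlMr// ltr_pdivrMr// rmorphD/= mulrDl mul1r.
have e : co j (shift2 (opp2 (ev j (z%:~R * L))) x) = co j x - z%:~R * L.
  by rewrite /co /shift2 /opp2 /ev; case: (j).
by move: h; rewrite e => /andP[h1 h2]; apply/andP; split; lra.
Qed.

Lemma mt_strip w k x z : in_strip w -> z != index_of x -> mt (ev j (z%:~R * L)) w k x = 0.
Proof.
move=> sw zx; rewrite /mt !(sw _ (shift2 _ _)); first by rewrite !mulr0 subr0 addr0; case: k.
all: by apply: contra_neqN zx => h; rewrite (index_ofP h).
Qed.

Lemma mtg_strip w g i k x z : in_strip w -> (forall i, in_strip (g i)) -> z != index_of x ->
  mtg (ev j (z%:~R * L)) w g i k x = 0.
Proof. by move=> sw sg zx; rewrite /mtg !mt_strip// oppr0; case: k; rewrite mulr0 addr0. Qed.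

(** A box meets finitely many strips, and at each point at most one translate is nonzero; locally
    the continuation is thus a finite sum of magnetic translates. *)
Lemma H1loc_ext w g : H1loc_grad w g -> in_strip w -> (forall i, in_strip (g i)) ->
  H1loc_grad (ext w) (extg w g).
Proof.
move=> wg sw sg; apply: H1loc_local => M0; pose M := M0 + `|c|.
(* A bound for the strip numbers met in the box; indices are shifted by [P] so as to start from
   0. *)
pose P := (Num.trunc (`|M| / L)).+2.
have hP (x : R * R) : box M0 x -> exists i : 'I_(P + P), (i%:Z - P%:Z)%R = index_of x.
  move=> /boxP[b1 b2]; have hx0 : `|co j x| <= M0 by rewrite /co; case: (j).
  have hx : `|co j x - c| <= M by apply: le_trans (ler_normB _ _) _; rewrite lerD2r.
  have hM : `|M| / L + 1 < P%:R :> R.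
    by rewrite /P -[X in _ < X]natr1 ltrD2r; exact: truncnS_gt.
  have hM' : `|M| + L < P%:R * L by move: hM; rewrite -(ltr_pM2r L0) mulrDl mul1r divfK ?gt_eqF.
  have eP : (P%:Z)%:~R = P%:R :> R by rewrite -pmulrn.
  have h1 : index_of x < P%:Z.
    rewrite -(ltr_int R); apply: le_lt_trans (floor_le_tmp _) _; rewrite ltr_pdivrMr//.
    have := ler_norm (co j x - c); have := ler_norm M; rewrite eP; move: L0; clear -hM' hx; lra.
  have h2 : - P%:Z <= index_of x.
    rewrite floor_ge_int_tmp ler_pdivlMr// rmorphN/= mulNr eP.
    have := ler_norm (- (co j x - c)); have := ler_norm M; rewrite normrN; move: L0; clear -hM' hx; lra.
  have [n nE] : exists n : nat, index_of x + P%:Z = n%:Z.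
    by exists (absz (index_of x + P%:Z)); rewrite gez0_abs// -lerBlDr sub0r.
  have nP : (n < P + P)%N by rewrite -ltz_nat -nE PoszD ltrD2r.
  by exists (Ordinal nP); rewrite /= -nE addrK.
pose z (i : nat) : int := i%:Z - P%:Z.
exists (fun k x => \sum_(i < P + P) mt (ev j ((z i)%:~R * L)) w k x).
exists (fun i' k x => \sum_(i < P + P) mtg (ev j ((z i)%:~R * L)) w g i' k x).
split; first exact: (@H1loc_sum R (P + P) (fun i => mt (ev j ((z i)%:~R * L)) w)
  (fun i => mtg (ev j ((z i)%:~R * L)) w g) (fun i => H1loc_mt _ wg)).
  move=> k x /hP[i0 hi0]; rewrite (bigD1 i0)//= big1 ?addr0 /ext -?hi0// => i ii.
  apply: mt_strip => //; rewrite -hi0 /z; apply: contra ii => /eqP/addIr[] h.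
  exact/eqP/val_inj.
move=> i' k x /hP[i0 hi0]; rewrite (bigD1 i0)//= big1 ?addr0 /extg -?hi0// => i ii.
apply: mtg_strip => //; rewrite -hi0 /z; apply: contra ii => /eqP/addIr[] h.
exact/eqP/val_inj.
Qed.

Lemma ext_periodic w k x : mt (ev j L) (ext w) k x = ext w k x.
Proof.
have e : index_of (shift2 (opp2 (ev j L)) x) = index_of x - 1.
  rewrite /index_of (_ : _ / L = (co j x - c + L / 2) / L + (-1)%:~R); last first.
    by rewrite /co /shift2 /opp2 /ev; case: (j) => /=; field; rewrite gt_eqF.
  by rewrite floorDrz ?intr_int// intrKfloor.
transitivity (mt (ev j L) (mt (ev j ((index_of x - 1)%:~R * L)) w) k x).
  by rewrite {1}/mt /ext e.
by rewrite mt_parallel /ext rmorphB/= mulrBl mul1r addrC subrK.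
Qed.

Lemma ext_commute (K : R) w k x : cos (L * K) = 1 -> (forall k x, mt (ev (~~ j) K) w k x = w k x) ->
  mt (ev (~~ j) K) (ext w) k x = ext w k x.
Proof.
move=> L1 hw; have e : index_of (shift2 (opp2 (ev (~~ j) K)) x) = index_of x.
  by rewrite /index_of /co /shift2 /opp2 /ev; case: (j) => /=; rewrite subr0.
transitivity (mt (ev (~~ j) K) (mt (ev j ((index_of x)%:~R * L)) w) k x).
  by rewrite {1}/mt /ext e.
rewrite mt_commute// /ext; congr (mt _ _ _ _).
by apply/funext => k'; apply/funext => y; exact: hw.
Qed.

Lemma ext_id w g x : c - L / 2 < co j x < c + L / 2 ->
  (forall k, ext w k x = w k x) /\ forall i k, extg w g i k x = g i k x.
Proof.
move=> /andP[x1 x2]; have e : index_of x = 0.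
  apply: index_ofP; rewrite mul0r (_ : shift2 _ _ = x) ?x2 ?(ltW x1)//.
  by case: x {x1 x2} => y1 y2; rewrite /shift2 /opp2 /ev; case: (j) => /=; rewrite !oppr0 !addr0.
have h u k : mt (ev j 0) u k x = u k x.
  rewrite /mt (_ : ph _ _ = 0) ?cos0 ?sin0; last by rewrite /ph /ev; case: (j) => /=; field.
  rewrite (_ : shift2 _ _ = x); first by case: k; ring.
  by case: x {x1 x2 e} => y1 y2; rewrite /shift2 /opp2 /ev; case: (j) => /=; rewrite !oppr0 !addr0.
split=> [k|i k]; rewrite /ext /extg e mul0r ?h// /mtg !h (_ : A0 i _ = 0) ?mul0r ?addr0//.
by rewrite /A0 /ev; case: (j); case: i => /=; field.
Qed.

Lemma ext_strip (P : R * R -> Prop) w k x : (forall t, P (shift2 (opp2 (ev j t)) x)) ->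
  (forall k x, P x -> w k x = 0) -> ext w k x = 0.
Proof. by move=> Px w0; rewrite /ext /mt !w0 ?mulr0 ?subr0 ?addr0; [case: k|exact: Px..]. Qed.

End one_direction.

(** Continuation in the first direction, then in the second; the first invariance survives because
    the flux [L * L] is quantised. *)
Lemma magnetic_extension (L : R) w g : 0 < L -> cos (L * L) = 1 -> H1loc_grad w g ->
  (forall x, ~ KR L x -> (forall k, w k x = 0) /\ forall i k, g i k x = 0) ->
  exists v h, [/\ H1loc_grad v h, in_ER L v &
    forall x, KR L x -> (forall k, v k x = w k x) /\ forall i k, h i k x = g i k x].
Proof.
move=> L0 L1 wg supp.
have K j x : ~~ (0 - L / 2 <= co j x < 0 + L / 2) -> ~ KR L x.
  rewrite sub0r add0r; move=> /negP h [/=]; rewrite !in_itv/= => /andP[a1 a2] /andP[b1 b2]; apply: h.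
  by rewrite /co; case: j; rewrite (ltW a1, ltW b1) (a2, b2) ?ltW.
have sw j : in_strip 0 L j w by move=> k x /K/supp[].
have sg j i : in_strip 0 L j (g i) by move=> k x /K/supp[].
pose v1 := ext 0 L false w; pose g1 := extg 0 L false w g.
have h1 : H1loc_grad v1 g1 by apply: H1loc_ext.
have s1 : in_strip 0 L true v1.
  move=> k x hx; apply: (@ext_strip 0 L false (fun x => ~~ (0 - L / 2 <= co true x < 0 + L / 2))) => //.
    by move=> t; rewrite /co /shift2 /opp2 /ev /= subr0.
  by move=> k' y hy; exact: sw hy.
have sg1 i : in_strip 0 L true (g1 i).
  move=> k x hx; rewrite /g1 /extg /mtg.
  have P t : ~~ (0 - L / 2 <= co true (shift2 (opp2 (ev false t)) x) < 0 + L / 2).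
    by rewrite /co /shift2 /opp2 /ev /= subr0.
  have m0 u k' : in_strip 0 L true u -> mt (ev false ((index_of 0 L false x)%:~R * L)) u k' x = 0.
    by move=> su; rewrite /mt !su ?P// !mulr0 subr0 addr0; case: k'.
  by rewrite !m0//; case: k; rewrite ?oppr0 mulr0 addr0.
exists (ext 0 L true v1), (extg 0 L true v1 g1); split.
- exact: H1loc_ext.
- apply/in_ERP => -[] k x; first exact: ext_periodic.
  by apply: (@ext_commute 0 L true L) => // k' y; exact: ext_periodic.
- move=> x [/=]; rewrite !in_itv/= => a1 a2.
  have {}a1 : 0 - L / 2 < x.1 < 0 + L / 2 by rewrite sub0r add0r.
  have {}a2 : 0 - L / 2 < x.2 < 0 + L / 2 by rewrite sub0r add0r.
  have [e1 e2] := @ext_id 0 L true L0 v1 g1 x a2; have [e3 e4] := @ext_id 0 L false L0 w g x a1.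
  by split=> [k|i k]; rewrite ?e1 ?e2 /v1 /g1 ?e3 ?e4.
Qed.

End periodic_extension.

(** * Cutoff functions with bounded slope *)

Section cutoff.
Variable R : realType.

(** A step from 0 to 1 on [[0, 1]] made of two parabolas, of slope at most 2. *)
Let stp (t : R) := 2 * sqp t - 4 * sqp (t - 1 / 2) + 2 * sqp (t - 1).
Let stp' (t : R) := 2 * sqp' t - 4 * sqp' (t - 1 / 2) + 2 * sqp' (t - 1).

Let is_derive_affine (h h' : R -> R) (c k t : R) : (forall t, is_derive t (1 : R) h (h' t)) ->
  is_derive t (1 : R) (fun t => h (k * t + c)) (k * h' (k * t + c)).
Proof.
move=> hh; have h3 : is_derive t (1 : R) (fun t => k * t + c) k.
  by apply: is_derive_eq; rewrite /GRing.scale/= mulr1 addr0.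
by rewrite mulrC; exact: (@is_derive1_comp R h (fun t => k * t + c) t _ _ (hh _) h3).
Qed.

Let is_derive_stp t : is_derive t (1 : R) stp (stp' t).
Proof.
have h (c : R) s : is_derive s (1 : R) (fun t => sqp (t - c)) (sqp' (s - c)).
  have := @is_derive_affine _ _ (- c) 1 s (@is_derive_sqp R); rewrite !mul1r.
  by under eq_fun do rewrite mul1r.
have d1 := is_derive_eq (is_deriveM (is_derive_cst (2 : R) t (1 : R)) (is_derive_sqp t)) erefl.
have d2 := is_derive_eq (is_deriveM (is_derive_cst (4 : R) t (1 : R)) (h (1 / 2) t)) erefl.
have d3 := is_derive_eq (is_deriveM (is_derive_cst (2 : R) t (1 : R)) (h 1 t)) erefl.
apply: is_derive_eq (is_deriveD (is_deriveB d1 d2) d3) _.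
by rewrite /GRing.scale/= /stp'; ring.
Qed.

Let continuous_stp' : continuous stp'.
Proof.
have h (c : R) : continuous (fun t : R => sqp' (t - c)).
  move=> t; apply: (@continuous_comp _ _ _ (fun t => t - c) (@sqp' R)); last exact: continuous_sqp'.
  by apply: cvgB; [exact: cvg_id|exact: cvg_cst].
move=> t; rewrite /stp'; apply: cvgD; [apply: cvgB|]; apply: cvgM; try exact: cvg_cst; try exact: h.
exact: continuous_sqp'.
Qed.

Let sqpE (t : R) : sqp t = if 0 <= t then t ^+ 2 else 0.
Proof. by rewrite /sqp; case: ifP => h; [rewrite ger0_norm//; field|rewrite ltr0_norm ?ltNge ?h//; field]. Qed.
Let sqp'E (t : R) : sqp' t = if 0 <= t then 2 * t else 0.
Proof. by rewrite /sqp'; case: ifP => h; [rewrite ger0_norm//; ring|rewrite ltr0_norm ?ltNge ?h//; ring]. Qed.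

Let stp0 t : t <= 0 -> stp t = 0 /\ stp' t = 0.
Proof.
move=> h; rewrite /stp /stp' !sqpE !sqp'E.
have -> : (0 <= t - 1 / 2) = false by apply/negbTE; rewrite -ltNge; lra.
have -> : (0 <= t - 1) = false by apply/negbTE; rewrite -ltNge; lra.
by case: ifP => h'; [have -> : t = 0 by apply/eqP; rewrite eq_le h h'|]; split; ring.
Qed.

Let stp1 t : 1 <= t -> stp t = 1 /\ stp' t = 0.
Proof.
move=> h; rewrite /stp /stp' !sqpE !sqp'E.
have -> : (0 <= t - 1 / 2) = true by lra.
have -> : (0 <= t - 1) = true by lra.
have -> : (0 <= t) = true by lra.
by split; field.
Qed.

Let stp01 t : 0 <= stp t <= 1 /\ 0 <= stp' t <= 2.
Proof.
have [h|h0] := leP t 0; first by have [-> ->] := stp0 h; rewrite lexx ler01 ler0n.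
have [h|h1] := leP 1 t; first by have [-> ->] := stp1 h; rewrite ?lexx ?ler01 ?ler0n.
rewrite /stp /stp' !sqpE !sqp'E (ltW h0).
have -> : (0 <= t - 1) = false by apply/negbTE; rewrite -ltNge; lra.
case: ifP => h2.
  by split; apply/andP; split; nra.
have h3 : t < 1 / 2 by move/negbT: h2; rewrite -ltNge; lra.
by split; apply/andP; split; nra.
Qed.

Lemma cutoff1 (r : R) : 0 <= r -> exists al al' : R -> R, [/\ C1_bump al al',
  forall t, 0 <= al t <= 1 /\ `|al' t| <= 4, forall t, `|t| <= r -> al t = 1 /\ al' t = 0 &
  forall t, r + 1 <= `|t| -> al t = 0 /\ al' t = 0].
Proof.
move=> r0; pose f t := stp (1 * t + (r + 1)); pose f' t := 1 * stp' (1 * t + (r + 1)).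
pose k t := stp (-1 * t + (r + 1)); pose k' t := -1 * stp' (-1 * t + (r + 1)).
have df t : is_derive t (1 : R) f (f' t) by exact: is_derive_affine.
have dk t : is_derive t (1 : R) k (k' t) by exact: is_derive_affine.
have cont (h' : R -> R) (c d : R) : continuous h' -> continuous (fun t => c * h' (c * t + d)).
  move=> ch t; apply: cvgM; first exact: cvg_cst.
  apply: (@continuous_comp _ _ _ (fun t => c * t + d) h'); last exact: ch.
  by apply: cvgD; [apply: cvgM; [exact: cvg_cst|exact: cvg_id]|exact: cvg_cst].
have cf := continuous_of_is_derive df; have ck := continuous_of_is_derive dk.
have cf' : continuous f' by exact: cont.
have ck' : continuous k' by exact: cont.
have z t : r + 1 <= `|t| -> f t * k t = 0 /\ f t * k' t + f' t * k t = 0.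
  rewrite ler_normr /f /f' /k /k' => /orP[h|h].
    by have [-> ->] : _ /\ _ := @stp0 (-1 * t + (r + 1)) ltac:(lra); split; ring.
  by have [-> ->] : _ /\ _ := @stp0 (1 * t + (r + 1)) ltac:(lra); split; ring.
exists (fun t => f t * k t), (fun t => f t * k' t + f' t * k t); split=> //.
- split.
  + by move=> t; apply: cvgD; apply: cvgM; [exact: cf|exact: ck'|exact: cf'|exact: ck].
  + by move=> t; apply: is_derive_eq (is_deriveM (df t) (dk t)) _; rewrite /GRing.scale/=; ring.
  + by exists (r + 1) => t /ltW/z[].
- move=> t; rewrite /f /f' /k /k' mul1r mulN1r.
  have [/andP[a1 a2] /andP[a3 a4]] := stp01 (1 * t + (r + 1)).
  have [/andP[b1 b2] /andP[b3 b4]] := stp01 (-1 * t + (r + 1)).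
  move: a1 a2 a3 a4 b1 b2 b3 b4; rewrite mul1r mulN1r.
  move: (stp _) (stp' _) (stp _) (stp' _) => x y z' w *; split.
    by rewrite mulr_ge0//= mulr_ile1.
  by rewrite ler_norml; apply/andP; split; nra.
- move=> t; rewrite ler_norml => /andP[h1 h2]; rewrite /f /f' /k /k'.
  have [-> ->] : _ /\ _ := @stp1 (-1 * t + (r + 1)) ltac:(lra).
  by have [-> ->] : _ /\ _ := @stp1 (1 * t + (r + 1)) ltac:(lra); split; ring.
Qed.

Lemma cutoff (r : R) : 0 <= r -> exists c (d : bool -> R * R -> R), [/\ C1 c d,
  forall x, 0 <= c x <= 1 /\ forall j, `|d j x| <= 4,
  forall x, `|x.1| <= r -> `|x.2| <= r -> c x = 1 /\ forall j, d j x = 0 &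
  forall x, r + 1 <= `|x.1| \/ r + 1 <= `|x.2| -> c x = 0 /\ forall j, d j x = 0].
Proof.
move=> r0; have [al [al' [ba h1 h2 h3]]] := cutoff1 r0.
exists (fun x => al x.1 * al x.2), (fun j x => if j then al x.1 * al' x.2 else al' x.1 * al x.2); split.
- by have [] := C1_bump_prod ba ba.
- move=> x; have [/andP[a1 a2] a3] := h1 x.1; have [/andP[b1 b2] b3] := h1 x.2; split.
    by rewrite mulr_ge0//= mulr_ile1.
  by case; rewrite normrM; [rewrite (ger0_norm a1) -[4]mul1r|rewrite (ger0_norm b1) -[4]mulr1]; exact: ler_pM.
- by move=> x /h2[-> ->] /h2[-> ->]; rewrite !mulr1; split=> // -[]; rewrite ?mulr0 ?mul0r.
- by move=> x [/h3[-> ->]|/h3[-> ->]]; rewrite ?mul0r ?mulr0; split=> // -[]; rewrite ?mulr0 ?mul0r.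
Qed.

End cutoff.

(** * Integrals of periodic densities over blocks of cells *)

Section block_integrals.
Variable R : realType.
Local Notation mu2 := (@leb2 R).
Local Notation mu1 := (@lebesgue_measure R).
Local Notation T1 := (measurableTypeR R).
Local Notation T2 := (T1 * T1)%type.

Lemma integral_indicM2 (f : R * R -> R) (D : set T2) :
  (\int[mu2]_(x in D) (f x)%:E = \int[mu2]_x (\1_D x * f x)%:E)%E.
Proof.
rewrite integral_mkcond; apply: eq_integral => x _; rewrite patchE indicE.
by case: ifP => _; rewrite ?mul1r ?mul0r.
Qed.

Lemma ae_shift2 (P : T2 -> Prop) a : {ae mu2, forall x : T2, P x} -> {ae mu2, forall x : T2, P (shift2 a x)}.
Proof.
move=> [N [mN N0 PN]]; exists (shift2 a @^-1` N); split.
- by rewrite -[X in measurable X]setTI; exact: measurable_shift2.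
- by have := leb2_shift a mN; rewrite /pushforward N0.
- by move=> x /= nP; apply: PN.
Qed.

(** Makes the difference between half-open blocks and the open cell [KR] negligible. *)
Lemma ae_line_neq (c : R) : {ae mu2, forall x : T2, x.1 != c /\ x.2 != c}.
Proof.
have m1 : measurable ([set c] : set T1) by exact: measurable_set1.
have z : (@leb2 R ([set c] `*` setT) = 0 /\ @leb2 R (setT `*` [set c]) = 0)%E.
  have e : lebesgue_measure ([set c] : set R) = 0%E := lebesgue_measure_set1 c.
  split; rewrite /leb2 product_measure1E//.
    by transitivity (0 * mu1 [set: T1])%E; [congr (_ * _)%E; exact: e|rewrite mul0e].
  by transitivity (mu1 [set: T1] * 0)%E; [congr (_ * _)%E; exact: e|rewrite mule0].
have [z1 z2] := z.
have n1 : mu2.-negligible ([set c] `*` setT : set T2) by exists ([set c] `*` setT); split=> //; exact: measurableX.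
have n2 : mu2.-negligible (setT `*` [set c] : set T2) by exists (setT `*` [set c]); split=> //; exact: measurableX.
apply: negligibleS (negligibleU n1 n2) => x /= /not_andP[/negP|/negP]; rewrite negbK => /eqP e; [by left|by right].
Qed.

Variables (l : R) (h : R * R -> R).
Hypothesis l0 : 0 < l.
Hypothesis mh : measurable_fun [set: T2] h.
Hypothesis h0 : forall x, 0 <= h x.
Hypothesis per : forall j, {ae mu2, forall x : T2, h (shift2 (opp2 (ev j l)) x) = h x}.

Let pers a := {ae mu2, forall x : T2, h (shift2 a x) = h x}.

Let shift2D a b (x : R * R) : shift2 a (shift2 b x) = shift2 (b.1 + a.1, b.2 + a.2) x.
Proof. by rewrite /shift2 /= !addrA. Qed.

Let persD a b : pers a -> pers b -> pers (b.1 + a.1, b.2 + a.2).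
Proof.
move=> pa pb; apply: filterS2 (ae_shift2 b pa) pb => x h1 h2.
by rewrite -shift2D h1.
Qed.

Let persN a : pers a -> pers (opp2 a).
Proof.
move=> pa; have := ae_shift2 (opp2 a) pa; apply: filterS => x.
by rewrite shift2K => ->.
Qed.

Let pers0 : pers (0, 0).
Proof. by apply: aeW => x; rewrite /shift2 !addr0; case: x. Qed.

Let persM a n : pers a -> pers (n%:R * a.1, n%:R * a.2).
Proof.
move=> pa; elim: n => [|n IH]; first by rewrite !mul0r; exact: pers0.
have := persD IH pa; rewrite /= -natr1; congr pers; congr (_, _); ring.
Qed.

Let per_lattice (i j p : nat) : pers (i%:R * l - p%:R * l, j%:R * l - p%:R * l).
Proof.
have p1 : pers (l, 0) by have := persN (per false); rewrite /opp2 /= ?opprK ?oppr0.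
have p2 : pers (0, l) by have := persN (per true); rewrite /opp2 /= ?opprK ?oppr0.
have := persD (persD (persM i p1) (persM j p2)) (persN (persD (persM p p1) (persM p p2))).
by rewrite /opp2 /=; congr pers; congr (_, _); ring.
Qed.

(** An odd number of periods centres the block with [KR l] as its middle cell, up to a null set, so
    that all shifts are lattice vectors. *)
Lemma integral_block_periodic (p : nat) (k := p.*2.+1) :
  (\int[mu2]_x (\1_(block l (- (k%:R * l / 2), - (k%:R * l / 2)) k k) x * h x)%:E =
   (k%:R ^+ 2)%:E * \int[mu2]_(x in KR l) (h x)%:E)%E.
Proof.
pose c := - (l / 2); have kE : k%:R = 2 * p%:R + 1 :> R by rewrite /k -natr1 -muln2 natrM; ring.
have mcell : measurable (cell l : set T2) by apply: measurableX; exact: measurable_itv.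
have mi (A : set T2) : measurable A -> measurable_fun [set: T2] (\1_A : T2 -> R) by move=> mA; exact: measurable_indic.
have msh a : measurable_fun setT (fun s : T2 => h (shift2 a s)).
  by apply: (measurableT_comp mh); exact: measurable_shift2.
have i0 (A : set T2) x : 0 <= \1_A x :> R by rewrite indicE.
have mK := measurable_KR l.
transitivity ((k%:R ^+ 2)%:E * \int[mu2]_s (\1_(cell l) s * h (shift2 (c, c) s))%:E)%E.
  rewrite -integral_cells// -ge0_integralZl//; last 2 first.
  - by apply/measurable_EFinP; apply: measurable_funM => //; exact: mi.
  - by move=> s _; rewrite lee_fin mulr_ge0.
  apply: ge0_ae_eq_integral => //.
  - apply/measurable_EFinP; apply: measurable_funM; first exact: mi.
    by apply: measurable_sum => i; apply: measurable_sum => j; exact: msh.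
  - by apply: emeasurable_funM => //; apply/measurable_EFinP; apply: measurable_funM => //; exact: mi.
  - by move=> s _; rewrite lee_fin mulr_ge0//; apply: sumr_ge0 => i _; exact: sumr_ge0.
  - by move=> s _; rewrite -EFinM lee_fin mulr_ge0 ?sqr_ge0// mulr_ge0.
  have := ae_foralln (fun i => ae_foralln (fun j => ae_shift2 (c, c) (per_lattice i j p))).
  apply: filterS => s hs _; rewrite -EFinM mulrCA; congr (_ * _)%:E.
  rewrite (eq_bigr (fun=> k%:R * h (shift2 (c, c) s))); last first.
    move=> i _; rewrite (eq_bigr (fun=> h (shift2 (c, c) s))); last first.
      move=> j _; rewrite -(hs i j) shift2D /node; congr (h (shift2 (_, _) s)) => /=;
        by rewrite /c kE; field.
    by rewrite sumr_const card_ord mulr_natl.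
  by rewrite sumr_const card_ord -[(_ * _) *+ _]mulr_natl mulrA -expr2.
congr (_ * _)%E.
transitivity (\int[mu2]_x (\1_(block l (c, c) 1 1) x * h x)%:E)%E.
  rewrite -integral_cells//; apply: eq_integral => s _; rewrite !big_ord1; congr (_ * h (shift2 _ _))%:E.
  by rewrite /node /= !mul0r !addr0.
rewrite integral_indicM2; apply: ge0_ae_eq_integral => //.
- by apply/measurable_EFinP; apply: measurable_funM => //; apply: mi; exact: measurable_block.
- by apply/measurable_EFinP; apply: measurable_funM => //; exact: mi.
- by move=> s _; rewrite lee_fin mulr_ge0.
- by move=> s _; rewrite lee_fin mulr_ge0.
have := ae_line_neq c; apply: filterS => -[x1 x2] /= [n1 n2] _; congr (_ * _)%:E.
rewrite !indicE; congr ((_ : bool)%:R); apply/idP/idP => /set_mem[/=];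
  rewrite /c !in_itv/= => a1 a2; apply/mem_set; rewrite /KR /block /= !in_itv/=.
  have m1 : - (l / 2) < x1 by rewrite lt_neqAle eq_sym n1; case/andP: a1.
  have m2 : - (l / 2) < x2 by rewrite lt_neqAle eq_sym n2; case/andP: a2.
  by rewrite m1 m2; case/andP: a1 => _ a1; case/andP: a2 => _ a2; split; rewrite /=; lra.
case/andP: a1 => a1 a1'; case/andP: a2 => a2 a2'.
by rewrite /c (ltW a1) (ltW a2); split; rewrite /=; lra.
Qed.

End block_integrals.

(** * Comparison of the minimal energies of two cells *)

Section subadditivity.
Variable R : realType.
Local Notation mu2 := (@leb2 R).
Local Notation mu1 := (@lebesgue_measure R).
Local Notation T1 := (measurableTypeR R).
Local Notation T2 := (T1 * T1)%type.

Lemma measurable_GL_density (b : R) u g : H1loc_grad u g -> measurable_fun [set: T2] (GL_density b u g).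
Proof.
move=> ug; have [hu _] := ug; have mu k : measurable_fun [set: T2] (u k) := proj1 (hu k).
rewrite (_ : GL_density b u g = fun x => b * cov2 u g true x + (b * cov2 u g false x +
  2^-1 * (1 - (u false x ^+ 2 + u true x ^+ 2)) ^+ 2)); last by apply/funext => x; rewrite GL_density_cov2.
apply: measurable_funD; first by apply: measurable_funM => //; exact: measurable_cov2.
apply: measurable_funD; first by apply: measurable_funM => //; exact: measurable_cov2.
apply: measurable_funM => //; apply: measurable_funX; apply: measurable_funB => //.
by apply: measurable_funD; exact: measurable_funX.
Qed.

Lemma integral_KR_cst (L c : R) : 0 < L -> 0 <= c -> (\int[mu2]_(x in KR L) c%:E = (c * L ^+ 2)%:E)%E.
Proof.
move=> L0 c0; rewrite integral_cst; last exact: measurable_KR.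
have e : lebesgue_measure (`]- (L / 2), L / 2[ : set R) = L%:E.
  rewrite lebesgue_measure_itv/= lte_fin ifT; last by lra.
  by rewrite -EFinB; congr (_%:E); field.
have E : mu2 (KR L) = (L ^+ 2)%:E.
  rewrite /leb2 /KR product_measure1E; [|exact: measurable_itv|exact: measurable_itv].
  by transitivity (L%:E * L%:E)%E; [congr (_ * _)%E; exact: e|rewrite -EFinM expr2].
by transitivity (c%:E * mu2 (KR L))%E; [|rewrite E -EFinM].
Qed.

Lemma ep_ge0 (b L : R) : 0 <= b -> (0 <= ep b L)%E.
Proof.
move=> b0; apply: le_ereal_inf_tmp => _ [u [g [_ [_ ->]]]].
by apply: integral_ge0 => x _; rewrite lee_fin GL_density_ge0.
Qed.

Lemma ep_le (b L : R) u g : H1loc_grad u g -> in_ER L u -> (ep b L <= FKR b L u g)%E.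
Proof. by move=> h1 h2; apply: ereal_inf_lbound; exists u, g. Qed.

(** The zero function is admissible, which makes the infimum finite. *)
Lemma ep_le_area (b L : R) : 0 < L -> (ep b L <= (2^-1 * L ^+ 2)%:E)%E.
Proof.
move=> L0; apply: le_trans (ep_le b (@H1loc0 R) _) _.
  by apply/in_ERP => j k x; rewrite /mt; case: k; ring.
rewrite /FKR (eq_integral (fun _ : T2 => (2^-1)%:E)); last first.
  by move=> x _; rewrite GL_density_cov2 /cov2; congr (_%:E); ring.
by rewrite integral_KR_cst ?invr_ge0.
Qed.

Let cutoff_arith (b m X1 X2 Y1 Y2 Z : R) : 0 <= b -> b <= 1 -> 0 <= m ->
  X1 <= 2 * Y1 + 32 * m -> X2 <= 2 * Y2 + 32 * m -> Z <= 2 + 2 * m ^+ 2 -> 0 <= Y1 -> 0 <= Y2 ->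
  b * X1 + (b * X2 + 2^-1 * Z) <= 200 * (1 + (b * Y1 + (b * Y2 + 2^-1 * (1 - m) ^+ 2))).
Proof.
move=> b0 b1 m0 K1 K2 W y1 y2.
have B1 := ler_wpM2l b0 K1; have B2 := ler_wpM2l b0 K2.
have Y10 : 0 <= b * Y1 by rewrite mulr_ge0.
have Y20 : 0 <= b * Y2 by rewrite mulr_ge0.
have bm : b * m <= m by rewrite -[leRHS]mul1r ler_wpM2r.
have W' : m <= 2 + (1 - m) ^+ 2 by have := sqr_ge0 (m - 3 / 2); lra.
have W'' : m ^+ 2 <= 2 + 2 * (1 - m) ^+ 2 by have := sqr_ge0 (m - 2); lra.
have := sqr_ge0 (1 - m); lra.
Qed.

(** The slope of the cutoff adds a multiple of [|u|^2] to the kinetic part, and the potential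
    controls it by [m <= 2 + (1 - m) ^+ 2]. *)
Lemma GL_density_cutoff (b : R) u g (c : R) (d : bool -> R) x : 0 <= b <= 1 ->
  0 <= c <= 1 -> (forall j, `|d j| <= 4) ->
  GL_density b (fun k x => c * u k x) (fun j k x => c * g j k x + d j * u k x) x <=
  200 * (1 + GL_density b u g x).
Proof.
move=> /andP[b0 b1] /andP[c0 c1] hd.
rewrite !GL_density_cov2 /cov2.
have c2 : 0 <= c ^+ 2 <= 1 by rewrite sqr_ge0 expr_le1.
have d2 j : (d j) ^+ 2 <= 16.
  by rewrite -real_normK ?num_real// (_ : 16 = 4 ^+ 2 :> R); [rewrite lerXn2r ?nnegrE|ring].
set p := u false x; set q := u true x; set m := p ^+ 2 + q ^+ 2.
have m0 : 0 <= m by rewrite addr_ge0 ?sqr_ge0.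
have key j (A : R) (gp gq : R) : (c * gp + d j * p + A * (c * q)) ^+ 2 + (c * gq + d j * q - A * (c * p)) ^+ 2 <=
    2 * ((gp + A * q) ^+ 2 + (gq - A * p) ^+ 2) + 32 * m.
  set e1 := gp + A * q; set e2 := gq - A * p.
  have -> : c * gp + d j * p + A * (c * q) = c * e1 + d j * p by rewrite /e1; ring.
  have -> : c * gq + d j * q - A * (c * p) = c * e2 + d j * q by rewrite /e2; ring.
  have h (s t : R) : (c * s + d j * t) ^+ 2 <= 2 * s ^+ 2 + 32 * t ^+ 2.
    have h1 : c ^+ 2 * s ^+ 2 <= s ^+ 2 by rewrite -[leRHS]mul1r ler_wpM2r ?sqr_ge0//; case/andP: c2.
    have h2 : d j ^+ 2 * t ^+ 2 <= 16 * t ^+ 2 by rewrite ler_wpM2r ?sqr_ge0.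
    have : 0 <= (c * s - d j * t) ^+ 2 by exact: sqr_ge0.
    by rewrite sqrrB sqrrD !exprMn; lra.
  by have := h e1 p; have := h e2 q; rewrite /m; lra.
have K1 := key true (A0 true x) (g true false x) (g true true x).
have K2 := key false (A0 false x) (g false false x) (g false true x).
have W : (1 - ((c * p) ^+ 2 + (c * q) ^+ 2)) ^+ 2 <= 2 + 2 * m ^+ 2.
  have -> : (c * p) ^+ 2 + (c * q) ^+ 2 = c ^+ 2 * m by rewrite /m; ring.
  have h : 0 <= c ^+ 2 * m <= m.
    by rewrite mulr_ge0 ?(andP c2).1//= -[leRHS]mul1r ler_wpM2r//; case/andP: c2.
  by move: h => /andP[h1 h2]; nra.
exact: (cutoff_arith b0 b1 m0 K1 K2 W (addr_ge0 (sqr_ge0 _) (sqr_ge0 _)) (addr_ge0 (sqr_ge0 _) (sqr_ge0 _))).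
Qed.

Section comparison.
Variables (b l L F : R) (p : nat) (u : bool -> R * R -> R) (g : bool -> bool -> R * R -> R).
Hypothesis b01 : 0 <= b <= 1.
Hypothesis l1 : 1 <= l.
Hypothesis L1 : cos (L * L) = 1.
Local Notation k := p.*2.+1.
Local Notation k2 := p.+1.*2.+1.
Hypothesis klL : k%:R * l + 2 <= L.
Hypothesis ug : H1loc_grad u g.
Hypothesis uE : in_ER l u.
Hypothesis uF : FKR b l u g = F%:E.

Let l0 : 0 < l. Proof. exact: lt_le_trans l1. Qed.
Let L0 : 0 < L.
Proof. by apply: lt_le_trans klL; rewrite ltr_wpDl// mulr_ge0// ltW. Qed.
Let h := GL_density b u g.
Let mh : measurable_fun [set: T2] h. Proof. exact: measurable_GL_density. Qed.
Let h0 x : 0 <= h x. Proof. by apply: GL_density_ge0; case/andP: b01. Qed.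
Let B (n : nat) : set T2 := block l (- (n%:R * l / 2), - (n%:R * l / 2)) n n.
Let mi (A : set T2) : measurable A -> measurable_fun [set: T2] (\1_A : T2 -> R).
Proof. by move=> mA; exact: measurable_indic. Qed.
Let i0 (A : set T2) x : 0 <= \1_A x :> R. Proof. by rewrite indicE. Qed.

Let block_h n : (\int[mu2]_x (\1_(B n.*2.+1) x * h x)%:E = (n.*2.+1%:R ^+ 2 * F)%:E)%E.
Proof.
rewrite integral_block_periodic//; last by move=> j; exact: GL_density_periodic.
by rewrite [RHS]EFinM -uF /FKR.
Qed.

Let block_1 n : (\int[mu2]_x (\1_(B n.*2.+1) x * 1)%:E = (n.*2.+1%:R ^+ 2 * l ^+ 2)%:E)%E.
Proof.
rewrite (@integral_block_periodic _ _ (fun=> 1))//; last by move=> j; apply: aeW.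
by rewrite integral_KR_cst// mul1r EFinM.
Qed.

(** [u] is cut off outside [k] periods and continued with period [L]. Both sides of the pointwise
    comparison consist of nonnegative terms, so that it can be integrated. On the inner block it is
    an equality, with [401 / 2 = 200 + 1 / 2]. *)
Let extension : exists v gv, [/\ H1loc_grad v gv, in_ER L v & forall x : T2,
  \1_(KR L : set T2) x * GL_density b v gv x + (199 * (\1_(B k) x * h x) + (401 / 2) * (\1_(B k) x * 1)) <=
  200 * (\1_(B k2) x * 1) + (200 * (\1_(B k2) x * h x) + 2^-1 * (\1_(KR L : set T2) x * 1))].
Proof.
have r0 : 0 <= k%:R * l / 2 by rewrite mulr_ge0// mulr_ge0// ltW.
have [c [d [cd bd c1 c0]]] := cutoff r0; have [cc cdd _ _] := cd.
have [hu [hg wd]] := ug.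
pose w (i : bool) x := c x * u i x; pose gw (j i : bool) x := c x * g j i x + d j x * u i x.
have wg : H1loc_grad w gw.
  split; first by move=> i; exact: L2locM.
  split=> j i; first by apply: L2locD; exact: L2locM.
  by apply: weak_derivM => //; exact: L2loc_L1loc.
have [x|v [gv [vg vE vw]]] := magnetic_extension L0 L1 wg.
  move=> nK; have [e1 e2] : c x = 0 /\ forall j, d j x = 0.
    apply: c0; apply: contrapT => /not_orP[/negP h1 /negP h2]; apply: nK.
    move: h1 h2; rewrite -!ltNge !ltr_norml => /andP[a1 a2] /andP[a3 a4].
    by rewrite /KR /= !in_itv/=; move: klL; split; lra.
  by split=> *; rewrite /w /gw e1 ?e2 !mul0r ?addr0.
exists v, gv; split=> // x.
have Bk2 : B k2 x <-> (- (k%:R * l / 2) - l <= x.1 < k%:R * l / 2 + l) /\ (- (k%:R * l / 2) - l <= x.2 < k%:R * l / 2 + l).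
  have e : k2%:R = k%:R + 2 :> R by rewrite doubleS -natrD addn2.
  rewrite /B /block /= !in_itv/= e.
  have e1 : - ((k%:R + 2) * l / 2) = - (k%:R * l / 2) - l by field.
  have e2 : - ((k%:R + 2) * l / 2) + (k%:R + 2) * l = k%:R * l / 2 + l by field.
  by rewrite e2 e1.
have Bk : B k x <-> (- (k%:R * l / 2) <= x.1 < k%:R * l / 2) /\ (- (k%:R * l / 2) <= x.2 < k%:R * l / 2).
  rewrite /B /block /= !in_itv/=.
  by have -> : - (k%:R * l / 2) + k%:R * l = k%:R * l / 2 by field.
have [KL|nK] := pselect (KR L x); last first.
  rewrite [\1_(KR L) x]indicE memNset// !mul0r mulr0 add0r addr0.
  have nB : ~ B k x.
    move=> /Bk[/andP[a1 a2] /andP[a3 a4]]; apply: nK; rewrite /KR /= !in_itv/=.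
    by move: klL; split; lra.
  rewrite [\1_(B k) x]indicE memNset// !mul0r !mulr0 addr0.
  by apply: addr_ge0; apply: mulr_ge0; rewrite ?ler0n ?mulr_ge0.
have [e1 e2] := vw _ KL.
rewrite [\1_(KR L) x]indicE mem_set// !mul1r.
have -> : GL_density b v gv x = GL_density b w gw x by rewrite !GL_density_cov2 /cov2 !e1 !e2.
have dens : GL_density b w gw x <= 200 * (1 + h x).
  by have [h1 h2] := bd x; exact: (@GL_density_cutoff b u g (c x) (fun j => d j x) x b01 h1 h2).
have [b2|nb2] := pselect (B k2 x); last first.
  have nB : ~ B k x.
    by move=> /Bk[/andP[a1 a2] /andP[a3 a4]]; apply: nb2; apply/Bk2; move: l1; split; lra.
  have [e3 e4] : c x = 0 /\ forall j, d j x = 0.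
    apply: c0; apply: contrapT => /not_orP[/negP h1 /negP h2]; apply: nb2; apply/Bk2.
    move: h1 h2; rewrite -!ltNge !ltr_norml => /andP[a1 a2] /andP[a3 a4].
    by move: l1; split; lra.
  rewrite [\1_(B k) x]indicE memNset// [\1_(B k2) x]indicE memNset//.
  rewrite !mul0r !mulr0 !add0r !addr0 mulr1.
  rewrite GL_density_cov2 /cov2 /w /gw e3 !e4 le_eqVlt; apply/orP; left; apply/eqP; ring.
rewrite [\1_(B k2) x]indicE mem_set// !mul1r.
have [bk|nbk] := pselect (B k x); last first.
  by rewrite [\1_(B k) x]indicE memNset// !mul0r; move: dens (h0 x); lra.
have [e3 e4] : c x = 1 /\ forall j, d j x = 0.
  by move: bk => /Bk[/andP[a1 a2] /andP[a3 a4]]; apply: c1; rewrite ler_norml; apply/andP; split; rewrite ?(ltW a2) ?(ltW a4).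
rewrite [\1_(B k) x]indicE mem_set// !mul1r.
have -> : GL_density b w gw x = h x.
  by rewrite /h !GL_density_cov2 /cov2 /w /gw e3 !e4; ring.
by have := h0 x; lra.
Qed.

Let integral_comb (f1 f2 f3 : T2 -> R) (a1 a2 a3 : R) :
  measurable_fun setT f1 -> measurable_fun setT f2 -> measurable_fun setT f3 ->
  (forall x, 0 <= f1 x) -> (forall x, 0 <= f2 x) -> (forall x, 0 <= f3 x) -> 0 <= a1 -> 0 <= a2 -> 0 <= a3 ->
  (\int[mu2]_x (a1 * f1 x + (a2 * f2 x + a3 * f3 x))%:E = a1%:E * \int[mu2]_x (f1 x)%:E +
   (a2%:E * \int[mu2]_x (f2 x)%:E + a3%:E * \int[mu2]_x (f3 x)%:E))%E.
Proof.
move=> m1 m2 m3 p1 p2 p3 q1 q2 q3.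
have mE (f : T2 -> R) : measurable_fun setT f -> measurable_fun setT (fun x => (f x)%:E) by move=> ?; exact/measurable_EFinP.
rewrite -!ge0_integralZl//; try by [exact: mE|move=> x _; rewrite lee_fin].
have mZ a (f : T2 -> R) : measurable_fun setT f -> measurable_fun setT (fun x => (a%:E * (f x)%:E)%E).
  by move=> mf; apply: emeasurable_funM => //; exact: mE.
have pZ a (f : T2 -> R) : 0 <= a -> (forall x, 0 <= f x) -> forall x, (0 <= a%:E * (f x)%:E)%E.
  by move=> a0 f0 x; rewrite mule_ge0 ?lee_fin.
rewrite -[X in (_ + X)%E]ge0_integralD//; try by [exact: mZ|move=> x _; exact: pZ].
rewrite -ge0_integralD//; try by [exact: mZ|move=> x _; exact: pZ|apply: emeasurable_funD; exact: mZ|move=> x _; rewrite adde_ge0 ?pZ].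
Qed.

(** The three terms are the energy of [u] on the block, the cutoff in a layer one period wide on
    each side, and the density [2^-1] of the zero function elsewhere. *)
Lemma ep_compare : (ep b L <= (k%:R ^+ 2 * F + 200 * (k2%:R ^+ 2 - k%:R ^+ 2) * (l ^+ 2 + F) +
  2^-1 * (L ^+ 2 - k%:R ^+ 2 * l ^+ 2))%:E)%E.
Proof.
have [v [gv [vg vE hv]]] := extension.
have mB n : measurable (B n) by exact: measurable_block.
have mK := measurable_KR L.
have mBh n : measurable_fun setT (fun x : T2 => \1_(B n) x * h x) by apply: measurable_funM => //; exact: mi.
have mB1 n : measurable_fun setT (fun x : T2 => \1_(B n) x * 1 : R) by apply: measurable_funM => //; exact: mi.
have mK1 : measurable_fun setT (fun x : T2 => \1_(KR L) x * 1 : R) by apply: measurable_funM => //; exact: mi.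
have mKv : measurable_fun setT (fun x : T2 => \1_(KR L) x * GL_density b v gv x).
  by apply: measurable_funM; [exact: mi|exact: measurable_GL_density].
have v0 x : 0 <= GL_density b v gv x by apply: GL_density_ge0; case/andP: b01.
have pKv x : 0 <= \1_(KR L : set T2) x * GL_density b v gv x by exact: mulr_ge0.
have pBh n x : 0 <= \1_(B n) x * h x by exact: mulr_ge0.
have pB1 n (x : T2) : (0 : R) <= \1_(B n) x * 1 by exact: mulr_ge0.
have pK1 (x : T2) : (0 : R) <= \1_(KR L : set T2) x * 1 by exact: mulr_ge0.
have c401 : 0 <= 401 / 2 :> R by exact: divr_ge0 (ler0n _ _) (ler0n _ _).
have c2 : 0 <= 2^-1 :> R by rewrite invr_ge0 ler0n.
have : (\int[mu2]_x (1 * (\1_(KR L) x * GL_density b v gv x) + (199 * (\1_(B k) x * h x) + (401 / 2) * (\1_(B k) x * 1)))%:E <=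
   \int[mu2]_x (200 * (\1_(B k2) x * 1) + (200 * (\1_(B k2) x * h x) + 2^-1 * (\1_(KR L) x * 1)))%:E)%E.
  have q (f1 f2 f3 : T2 -> R) (a1 a2 a3 : R) :
      measurable_fun setT f1 -> measurable_fun setT f2 -> measurable_fun setT f3 ->
      measurable_fun setT (fun x => (a1 * f1 x + (a2 * f2 x + a3 * f3 x))%:E).
    move=> *; apply/measurable_EFinP; apply: measurable_funD; first exact: measurable_funM.
    by apply: measurable_funD; exact: measurable_funM.
  apply: ge0_le_integral.
  - exact: measurableT.
  - by move=> x _; rewrite lee_fin; exact: (addr_ge0 (mulr_ge0 ler01 (pKv x))
      (addr_ge0 (mulr_ge0 (ler0n _ 199) (pBh k x)) (mulr_ge0 c401 (pB1 k x)))).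
  - exact: (q _ _ _ 1 199 (401 / 2) mKv (mBh k) (mB1 k)).
  - exact: (q _ _ _ 200 200 2^-1 (mB1 k2) (mBh k2) mK1).
  - by move=> x _; rewrite lee_fin mul1r.
rewrite (integral_comb mKv (mBh k) (mB1 k) pKv (pBh k) (pB1 k) ler01 (ler0n _ 199) c401).
rewrite (integral_comb (mB1 k2) (mBh k2) mK1 (pB1 k2) (pBh k2) pK1 (ler0n _ 200) (ler0n _ 200) c2).
rewrite (block_h p) (block_1 p) (block_h p.+1) (block_1 p.+1).
rewrite -(integral_indicM2 (GL_density b v gv)) -(integral_indicM2 (fun=> 1)) (integral_KR_cst L0 ler01) -/(FKR b L v gv).
rewrite [(1%:E * FKR b L v gv)%E]mul1e [1 * L ^+ 2]mul1r -!EFinM -!EFinD.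
move=> H; apply: le_trans (ep_le b vg vE) _.
rewrite -leeBrDr// in H; apply: le_trans H _; rewrite -EFinB lee_fin; lra.
Qed.

End comparison.
End subadditivity.

(** * Existence of the energy per area along the admissible periods *)

Section limit.
Variable R : realType.

(** The limit is the infimum over positive indices; 0 is left out because the period [Rn 0]
    vanishes. *)
Lemma cvg_almost_monotone (a : nat -> R) : (forall n, 0 <= a n) ->
  (forall m, (0 < m)%N -> forall e, 0 < e -> \forall n \near \oo, a n <= a m + e) ->
  exists2 l, a @ \oo --> l & l <= a 1%N.
Proof.
move=> a0 am; pose S := [set a n | n in [set n | (0 < n)%N]].
have hS : has_inf S by split; [exists (a 1%N), 1%N|exists 0 => _ [n _ <-]].
have lbS n : (0 < n)%N -> inf S <= a n by move=> n0; apply: ge_inf; [exact: hS.2|exists n].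
exists (inf S); last exact: lbS.
apply/cvgrPdist_le => e e0; have e2 : 0 < e / 2 by rewrite divr_gt0.
have [_ [m m0 <-] hm] := inf_adherent e2 hS.
have := am m m0 _ e2; near_simpl => H; near=> n.
have h1 : a n <= a m + e / 2 by near: n.
have h2 : inf S <= a n by apply: lbS; near: n; exact: nbhs_infty_gt.
by rewrite ler_distl; apply/andP; split; lra.
Unshelve. all: by end_near. Qed.

Lemma Rn_sqr n : Rn R n ^+ 2 = 2 * pi * n%:R.
Proof. by rewrite sqr_sqrtr// !mulr_ge0// pi_ge0. Qed.

Lemma Rn_ge (A : R) n : A ^+ 2 <= n%:R -> A <= Rn R n.
Proof.
move=> h; apply: le_trans (ler_norm A) _; rewrite -sqrtr_sqr; apply: ler_wsqrtr.
apply: le_trans h _; rewrite -[X in X <= _]mul1r ler_wpM2r//; have := pi_ge2 R; lra.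
Qed.

Lemma Rn_ge1 n : (0 < n)%N -> 1 <= Rn R n.
Proof. by move=> n0; apply: Rn_ge; rewrite expr1n ler1n. Qed.

Lemma cos_Rn_sqr n : cos (Rn R n ^+ 2) = 1.
Proof.
rewrite Rn_sqr mulrC.
have c : cos (2 * pi) = 1 :> R by rewrite mulr_natl cos2pi.
by have [] := cos_sin_mulz n%:Z c.
Qed.

Lemma ep_fin (b L : R) : 0 <= b -> 0 < L -> ep b L \is a fin_num.
Proof.
move=> b0 L0; rewrite ge0_fin_numE ?ep_ge0//.
by apply: le_lt_trans (ep_le_area b L0) _; rewrite ltry.
Qed.

Let arith (k l L F : R) : 0 <= F -> 1 <= l -> 1 <= k -> k * l <= L -> L <= k * l + 2 * l + 2 ->
  k ^+ 2 * F + 200 * ((k + 2) ^+ 2 - k ^+ 2) * (l ^+ 2 + F) + 2^-1 * (L ^+ 2 - k ^+ 2 * l ^+ 2) <=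
  F / l ^+ 2 * L ^+ 2 + (1600 * (l ^+ 2 + F) + (2 * l + 2)) * L.
Proof.
move=> F0 l1 k1 h1 h2; have l0 : 0 < l by exact: lt_le_trans l1.
have k0 : 0 <= k by exact: le_trans k1.
have L0 : 0 <= L by apply: le_trans h1; rewrite mulr_ge0// ltW.
have kL : k <= L by apply: le_trans h1; rewrite ler_peMr.
have A : k ^+ 2 * F <= F / l ^+ 2 * L ^+ 2.
  rewrite mulrC -mulrA ler_wpM2l// mulrC ler_pdivlMr ?exprn_gt0// -exprMn.
  by rewrite lerXn2r ?nnegrE// mulr_ge0// ltW.
have B : ((k + 2) ^+ 2 - k ^+ 2) * (l ^+ 2 + F) <= 8 * (l ^+ 2 + F) * L.
  rewrite mulrAC ler_wpM2r ?addr_ge0 ?sqr_ge0//.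
  have -> : (k + 2) ^+ 2 - k ^+ 2 = 4 * k + 4 by ring.
  lra.
have C : 2^-1 * (L ^+ 2 - k ^+ 2 * l ^+ 2) <= (2 * l + 2) * L.
  rewrite -exprMn subr_sqr.
  have kl0 : 0 <= k * l by rewrite mulr_ge0// ltW.
  have c1 : 0 <= L - k * l by lra.
  have c2 : L - k * l <= 2 * l + 2 by lra.
  have c3 : 0 <= L + k * l by lra.
  have c4 : L + k * l <= 2 * L by lra.
  by have := ler_pM c1 c3 c2 c4; lra.
by lra.
Qed.

Let arith_limit (e l L F G H C : R) : 0 < e -> 1 <= l -> 0 < L -> F <= G + e / 2 ->
  H <= F / l ^+ 2 * L ^+ 2 + C * L -> C / (e / 2) <= L -> H / L ^+ 2 <= G / l ^+ 2 + e.
Proof.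
move=> e0 l1 L0 Fle h CLe; have e2 : 0 < e / 2 by rewrite divr_gt0.
have l0 : 0 < l by exact: lt_le_trans l1.
rewrite ler_pdivrMr ?exprn_gt0// mulrDl.
have CL : C * L <= e / 2 * L ^+ 2.
  by rewrite expr2 mulrA ler_wpM2r ?(ltW L0)// mulrC -ler_pdivrMr.
have FL : F / l ^+ 2 * L ^+ 2 <= G / l ^+ 2 * L ^+ 2 + e / 2 * L ^+ 2.
  rewrite -mulrDl ler_wpM2r ?sqr_ge0//.
  rewrite ler_pdivrMr ?exprn_gt0// mulrDl divfK ?gt_eqF ?exprn_gt0//.
  by apply: le_trans Fle _; rewrite lerD2l ler_peMr ?(ltW e2)// exprn_ege1.
have -> : e * L ^+ 2 = e / 2 * L ^+ 2 + e / 2 * L ^+ 2 by field.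
by rewrite addrA; apply: le_trans h _; apply: lerD.
Qed.

(** A large cell is filled with copies of a nearly optimal cell of fixed size, up to a layer of
    relative size [1 / L]; the energy per area is therefore almost decreasing. The comparison with
    the first term reduces the upper bound to a single cell. *)
Lemma ep_limit (b : R) : 0 < b <= 1 ->
  exists2 l, (fun n => fine (ep b (Rn R n)) / Rn R n ^+ 2) @ \oo --> l & l <= fine (ep b (Rn R 1)) / Rn R 1 ^+ 2.
Proof.
move=> /andP[b0 b1]; have bb : 0 <= b <= 1 by rewrite (ltW b0).
apply: cvg_almost_monotone => [n|m m0 e e0].
  by rewrite divr_ge0 ?sqr_ge0// fine_ge0// ep_ge0// ltW.
set l := Rn R m; have l1 : 1 <= l := Rn_ge1 m0; have l0 : 0 < l by exact: lt_le_trans l1.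
have e2 : 0 < e / 2 by rewrite divr_gt0.
have fin := ep_fin (ltW b0) l0.
have [_ [u [g [ug [uE ->]]]] hF'] := lb_ereal_inf_adherent e2 fin.
have hF : (FKR b l u g < ep b l + (e / 2)%:E)%E := hF'.
have F0 : (0 <= FKR b l u g)%E by apply: integral_ge0 => x _; rewrite lee_fin GL_density_ge0// ltW.
have finF : FKR b l u g \is a fin_num.
  by rewrite ge0_fin_numE//; apply: lt_trans hF _; rewrite -(fineK fin) -EFinD ltry.
pose F := fine (FKR b l u g); have uF : FKR b l u g = F%:E by rewrite fineK.
have Fge : 0 <= F by rewrite fine_ge0.
have Fle : F <= fine (ep b l) + e / 2.
  by rewrite -lee_fin -uF EFinD fineK// ltW.
pose C := 1600 * (l ^+ 2 + F) + (2 * l + 2).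
have C0 : 0 <= C.
  apply: addr_ge0; first by apply: mulr_ge0; [exact: ler0n|apply: addr_ge0 => //; exact: sqr_ge0].
  by apply: addr_ge0; [apply: mulr_ge0; [exact: ler0n|exact: ltW]|exact: ler0n].
pose A := l + 2 + C / (e / 2).
have A0 : 0 <= C / (e / 2) by rewrite divr_ge0// ltW.
have : \forall n \near \oo, A ^+ 2 <= n%:R by exact: nbhs_infty_ger.
apply: filterS => n /Rn_ge; set L := Rn R n; rewrite /A => AL.
have L0 : 0 < L by move: l0; lra.
(* Then [p.*2.+1] is the largest odd number of periods that leaves a margin of 1 on each side. *)
pose t := (L - 2 - l) / (2 * l).
have t0 : 0 <= t by rewrite divr_ge0 ?mulr_ge0 ?(ltW l0)//; lra.
pose p := Num.trunc t; have /andP[p1 p2] := truncn_itv t0; rewrite -/p in p1 p2.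
have kE : p.*2.+1%:R = 2 * p%:R + 1 :> R by rewrite -natr1 -muln2 natrM; ring.
have k2E : p.+1.*2.+1%:R = p.*2.+1%:R + 2 :> R by rewrite doubleS -natrD addn2.
have l20 : 0 < 2 * l by rewrite mulr_gt0.
have q1 : p.*2.+1%:R * l + 2 <= L.
  by move: p1; rewrite ler_pdivlMr// kE mulrDl mul1r; lra.
have q2 : L <= p.*2.+1%:R * l + 2 * l + 2.
  by move: p2; rewrite ltr_pdivrMr// -natr1 kE !mulrDl !mul1r; lra.
have H := ep_compare bb l1 (cos_Rn_sqr n : cos (_ * _) = 1) q1 ug uE uF.
have finL := ep_fin (ltW b0) L0.
rewrite -(fineK finL) lee_fin k2E in H.
have k1 : 1 <= p.*2.+1%:R :> R by rewrite ler1n.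
have q1' : p.*2.+1%:R * l <= L by apply: le_trans q1; rewrite lerDl ler0n.
have {}H := le_trans H (arith Fge l1 k1 q1' q2).
have CL : C / (e / 2) <= L by apply: le_trans AL; rewrite lerDr addr_ge0 ?ler0n// ltW.
exact: (arith_limit e0 l1 L0 Fle H CL).
Qed.

End limit.

(** * Continuously differentiable functions have weak gradients *)

Section constants.
Variable R : realType.
Local Notation mu2 := (@leb2 R).
Local Notation mu1 := (@lebesgue_measure R).
Local Notation T1 := (measurableTypeR R).
Local Notation T2 := (T1 * T1)%type.
Implicit Types (c phi : R * R -> R) (d : bool -> R * R -> R).

Lemma L2loc_continuous (c : R * R -> R) : continuous c -> L2loc c.
Proof.
have L1 : L2loc (fun=> 1 : R).
  split=> // M; rewrite (eq_integral (fun _ : T2 => 1%E)); last by move=> x _; rewrite expr1n.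
  by rewrite integral_cst ?mul1e ?leb2_box//; exact: measurable_box.
move=> cc; have := L2locM cc L1; congr L2loc.
by apply/funext => x; rewrite mulr1.
Qed.

(** The constant 1 is its own sweep over a unit segment. Moved onto the derivative, the sweep
    produces [phi] minus a translate, whose integral is 0 by invariance. *)
Lemma J_partial0 j phi d : C1 phi d -> compact_support phi -> J (d j) = 0 :> R.
Proof.
move=> hphi sp; have [cp cd d1 d2] := hphi; have sd := C1_support j hphi sp.
have l1 : L1loc (fun=> 1 : R) by apply: L2loc_L1loc; apply: L2loc_continuous; exact: cst_continuous.
pose psi x := phi x + -1 * phi (shift2 (ev j (-1)) x).
have cps : continuous (fun x => phi (shift2 (ev j (-1)) x)).
  by move=> x; apply: continuous_comp; [exact: continuous_shift2|exact: cp].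
have cpsi : continuous psi.
  move=> x; apply: cvgD; first exact: cp.
  by apply: cvgM; [exact: cvg_cst|exact: cps].
have sps := compact_support_shift (ev j (-1)) sp.
have spsi : compact_support psi.
  have [M hM] := sp; have [N hN] := sps; exists (Num.max M N) => x hx.
  have a k : Num.max M N < k -> M < k /\ N < k by rewrite gt_max => /andP[].
  by rewrite /psi hM ?hN; [ring|case: hx => /a[]; [left|right]|case: hx => /a[]; [left|right]].
have cline x : continuous (fun t => d j (shift2 (ev j (- t)) x)).
  move=> t; apply: (@continuous_comp _ _ _ (fun t => shift2 (ev j (- t)) x) (d j)); last exact: cd.
  have cN : (fun t : R => - t) @ t --> - t by apply: cvgN; exact: cvg_id.
  have h1 : (fun s : R => x.1 + (ev j (- s)).1) @ t --> x.1 + (ev j (- t)).1.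
    by apply: cvgD; [exact: cvg_cst|rewrite /ev; case: (j) => /=; [exact: cvg_cst|exact: cN]].
  have h2 : (fun s : R => x.2 + (ev j (- s)).2) @ t --> x.2 + (ev j (- t)).2.
    by apply: cvgD; [exact: cvg_cst|rewrite /ev; case: (j) => /=; [exact: cN|exact: cvg_cst]].
  exact: (cvg_pair h1 h2).
have := @J_sweep R 1 ltr01 j (fun=> 1) l1 (d j) psi (cd j) sd cpsi spsi (fun x => integrable_itv _ _ (cline x)).
have swe x : sweep 1 j (fun=> 1) x = 1 :> R.
  rewrite /sweep /Rintegral (eq_integral (fun t : T1 => (1 * \1_(`[0, 1] : set R) t)%:E)); last by [].
  rewrite -integral_indicM.
  by rewrite (@integral_is_derive R id (fun=> 1) 0 1 ltr01 (@cst_continuous _ _ _) (fun t => is_derive_id _ _))/= subr0.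
move=> H; have -> : J (d j) = J (fun x => sweep 1 j (fun=> 1) x * d j x) by apply: eq_J => x; rewrite swe mul1r.
rewrite H => [|x].
  have ip := integ_test l1 cp sp; have ips := integ_test l1 cps sps.
  rewrite (@eq_J _ _ (fun x => 1 * phi x + -1 * (1 * phi (shift2 (ev j (-1)) x)))); last by move=> x; rewrite /psi; ring.
  rewrite JD//; last by rewrite /integ /=; have := integrableZl measurableT (-1) ips; under eq_fun do rewrite -EFinM.
  rewrite (JZ (-1) ips) (@eq_J _ (fun x => 1 * phi (shift2 (ev j (-1)) x)) (fun x => phi (shift2 (ev j (-1)) x))); last by move=> x; rewrite mul1r.
  rewrite J_shift; last exact: continuous_measurable2.
  by rewrite (@eq_J _ (fun x => 1 * phi x) phi) ?mulN1r ?subrr// => x; rewrite mul1r.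
rewrite -integral_indicM.
have dF t : is_derive t (1 : R) (fun t => - phi (shift2 (ev j (- t)) x)) (d j (shift2 (ev j (- t)) x)).
  have hN : is_derive t (1 : R) (fun t => (if j then x.2 else x.1) - t) (-1).
    by apply: is_derive_eq (is_deriveB (is_derive_cst (if j then x.2 else x.1) t (1 : R)) (is_derive_id t (1 : R))) _; rewrite sub0r.
  have hp : is_derive ((if j then x.2 else x.1) - t) (1 : R)
      (fun s => phi (if j then (x.1, s) else (s, x.2))) (d j (shift2 (ev j (- t)) x)).
    have := d1 (x.1 - t, x.2); have := d2 (x.1, x.2 - t); rewrite /shift2 /ev /=.
    by case: (j) => /=; rewrite addr0.
  have := is_deriveN (@is_derive1_comp R _ _ t _ _ hp hN); rewrite mulrN1 opprK.
  congr is_derive; apply/funext => s; rewrite /= fctE; congr (- phi _).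
  by rewrite /shift2 /ev; case: (j) => /=; rewrite addr0.
rewrite (integral_is_derive ltr01 (cline x) dF) oppr0 /psi; congr (_%:E).
have -> : shift2 (ev j 0) x = x by rewrite /shift2 /ev; case: (j) => /=; rewrite !addr0 -surjective_pairing.
by ring.
Qed.

Lemma C1_weak_deriv j c d : C1 c d -> weak_deriv j c (d j).
Proof.
move=> hc; have [cc cd _ _] := hc.
have L1c (f : R * R -> R) : continuous f -> L1loc f by move=> cf; apply: L2loc_L1loc; exact: L2loc_continuous.
apply/weak_derivP => [||phi e hphi sp]; try exact: L1c.
have [cp ce _ _] := hphi; have se := C1_support j hphi sp.
have := J_partial0 j (C1M hc hphi) (compact_supportMl c sp) => /=.
by rewrite JD ?addr_eq0; [move/eqP; rewrite addr_eq0 => /eqP|exact: integ_test (L1c _ cc) (ce j) se|exact: integ_test (L1c _ (cd j)) cp sp].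
Qed.

Lemma C1_H1loc (u : bool -> R * R -> R) (g : bool -> bool -> R * R -> R) :
  (forall k, C1 (u k) (fun j => g j k)) -> H1loc_grad u g.
Proof.
move=> h; split; first by move=> k; apply: L2loc_continuous; have [] := h k.
split=> j k; first by apply: L2loc_continuous; have [_ cd _ _] := h k.
exact: (C1_weak_deriv j (h k)).
Qed.

(** Smoothness of [h] is asked only at the values of [c], as the inverse square root requires. *)
Lemma C1_comp_at (h h' : R -> R) c d : (forall x, is_derive (c x) (1 : R) h (h' (c x))) ->
  (forall x, {for c x, continuous h'}) ->
  C1 c d -> C1 (fun x => h (c x)) (fun j x => h' (c x) * d j x).
Proof.
move=> hh ch' [a1 a2 a3 a4].
have ch x : {for c x, continuous h}.
  by apply: differentiable_continuous; apply/derivable1_diffP; have [] := hh x.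
split.
- by move=> x; apply: continuous_comp; [exact: a1|exact: ch].
- move=> j x; apply: cvgM; last exact: a2.
  by apply: continuous_comp; [exact: a1|exact: ch'].
- move=> x; have h2 : is_derive (c (x.1, x.2)) (1 : R) h (h' (c x)) by rewrite -surjective_pairing.
  exact: (@is_derive1_comp R h (fun t => c (t, x.2)) x.1 _ _ h2 (a3 x)).
- move=> x; have h2 : is_derive (c (x.1, x.2)) (1 : R) h (h' (c x)) by rewrite -surjective_pairing.
  exact: (@is_derive1_comp R h (fun t => c (x.1, t)) x.2 _ _ h2 (a4 x)).
Qed.

End constants.

(** * A function with one zero per cell of flux [2 * pi], and its normalisation *)

Section trial_state.
Variable R : realType.
Implicit Types (u : bool -> R * R -> R) (g : bool -> bool -> R * R -> R) (a : R * R).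

(** Real and imaginary part of [(d_j - i A_j) u]. *)
Definition cv u g (j k : bool) (x : R * R) : R :=
  if k then g j true x - A0 j x * u false x else g j false x + A0 j x * u true x.

Lemma mt_cv a u g j k x : cv (mt a u) (mtg a u g) j k x = mt a (cv u g j) k x.
Proof. by rewrite /cv /mtg /mt /shift2 /opp2 /A0; case: k; case: j => /=; ring. Qed.

Lemma mtD a u u' k x : mt a (fun k x => u k x + u' k x) k x = mt a u k x + mt a u' k x.
Proof. by rewrite /mt; case: k; ring. Qed.

Section fixed.
Variables (L b : R).
Hypothesis L1 : 1 <= L.
Hypothesis LL : L ^+ 2 = 2 * pi.
Hypothesis b0 : 0 < b.

Let L0 : 0 < L. Proof. exact: lt_le_trans L1. Qed.

(** The square of [cos (L / 4 * (x.2 + L / 2))] on its central arch, 0 elsewhere: [sqp] squares the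
    positive part and [be] removes the other arches. On the cell this profile and its translate by
    [L] add up to 1, since the sine changes sign. *)
Let strip_profile : exists al da, [/\ @C1 R al da, forall x, da false x = 0,
  forall x, `|x.2 + L / 2| <= L -> al x = (1 - sin (L * x.2 / 2)) / 2 /\ da true x = - (L / 4 * cos (L * x.2 / 2)),
  forall x, L <= `|x.2 + L / 2| -> al x = 0 /\ forall j, da j x = 0 &
  forall x y : R * R, x.2 = y.2 -> al x = al y].
Proof.
have [be [be' [[cbe' dbe _] _ be1 be0]]] := cutoff1 (ltW L0).
pose ta (x : R * R) := x.2 + L / 2; pose s x := cos (L / 4 * ta x).
have Cta : C1 ta (fun j _ => (j == true)%:R).
  by apply: C1_ext (C1D (C1_proj R true) (C1_cst (L / 2))) _ => j x; rewrite addr0.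
have csin (t : R) : {for t, continuous (fun t => - sin t)} by apply: cvgN; exact: continuous_sin.
have Cs : C1 s (fun j x => - sin (L / 4 * ta x) * (L / 4 * (j == true)%:R)).
  have := @C1_comp R cos (fun t => - sin t) _ _ (@is_derive_cos R) csin (C1M (C1_cst (L / 4)) Cta).
  by move=> /C1_ext; apply => j x /=; ring.
have Cal := C1M (C1_comp dbe cbe' Cta) (C1_comp (@is_derive_sqp R) (@continuous_sqp' R) Cs).
have sgn (x : R * R) : `|L / 4 * ta x| = L / 4 * `|ta x| by rewrite normrM (ger0_norm (divr_ge0 (ltW L0) (ler0n _ _))).
have cosn (t : R) : cos `|t| = cos t by have [h|h] := leP 0 t; [rewrite ger0_norm|rewrite ltr0_norm// cosN].
have L4 : L / 4 * L = pi / 2 by rewrite mulrAC -expr2 LL; field.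
eexists; eexists; split; first exact: Cal.
- by move=> x /=; rewrite !mulr0 mul0r addr0.
- move=> x hx /=; have [-> ->] := be1 _ hx.
  have s0 : 0 <= s x.
    rewrite /s -cosn sgn; apply: cos_ge0_pihalf; have := pi_ge0 R.
    have h : L / 4 * `|ta x| <= pi / 2 by rewrite -L4 ler_wpM2l// divr_ge0// ltW.
    by move=> p0; apply/andP; split=> //; apply: le_trans (_ : 0 <= _); rewrite ?oppr_le0 ?divr_ge0// mulr_ge0// divr_ge0// ltW.
  rewrite /sqp /sqp' (ger0_norm s0) /s.
  set z := L / 4 * ta x; have zE : L * x.2 / 2 = z + z - pi / 2.
    by rewrite /z /ta mulrDr (_ : L / 4 * (L / 2) = pi / 4); [field|rewrite mulrA L4; field].
  rewrite zE sinB cosB sin_pihalf cos_pihalf cosD sinD.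
  have CS : cos z ^+ 2 + sin z ^+ 2 = 1 := cos2Dsin2 z.
  split; last by rewrite /=; field.
  have -> : sin z * sin z = 1 - cos z ^+ 2 by rewrite -CS; ring.
  by field.
(* Between [L] and [2 * L] the cosine is nonpositive; from [2 * L] on the cutoff, which ends at
   [L + 1], vanishes. *)
- move=> x hx /=; have [h|h] := leP (2 * L) `|ta x|.
    have [-> ->] : _ /\ _ := be0 (ta x) ltac:(move: L1; lra).
    by split=> [|j]; rewrite !mul0r ?add0r.
  have s0 : s x <= 0.
    rewrite /s -cosn sgn -[_ * _](subrK pi) cosDpi oppr_le0.
    have h1 : pi / 2 <= L / 4 * `|ta x| by rewrite -L4 ler_wpM2l// divr_ge0// ltW.
    have h2 : L / 4 * `|ta x| <= pi.
      have -> : pi = L / 4 * (2 * L) by rewrite mulrCA L4; field.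
      by rewrite ler_wpM2l ?(ltW h)// divr_ge0// ltW.
    by apply: cos_ge0_pihalf; apply/andP; split; lra.
  rewrite /sqp /sqp' (ler0_norm s0).
  by split=> [|j]; field.
- by move=> x y xy; rewrite /s /ta xy.
Qed.

Let X (x : R * R) := L * x.1 / 2.
Let Y (x : R * R) := L * x.2 / 2.
Let Th (x : R * R) := Y x + x.1 * x.2 / 2 - X x.
(** The squared modulus of the quasi-periodic function below; in the cell it vanishes only at the
    origin. *)
Let q x := 1 - cos (X x) ^+ 2 * cos (Y x) ^+ 2.

(** A sum of strips with phases, like a theta function. One strip, invariant in the first direction,
    is continued with period [2 * L] in the second; adding its translate by [L] gives period [L]. In
    the cell two strips overlap, with sum [- sin Y cos X + i sin X] times [e^(i Th)]. *)
Let quasi_periodic : exists v gv, [/\ H1loc_grad v gv, in_ER L v,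
  forall x, KR L x -> v false x = - (sin (Y x) * cos (X x) * cos (Th x)) - sin (X x) * sin (Th x) /\
    v true x = sin (X x) * cos (Th x) - sin (Y x) * cos (X x) * sin (Th x),
  forall x, KR L x ->
    let t := L / 2 * (1 + sin (Y x)) in let p := cos (X x) * (t - x.2 * sin (Y x)) in
    let d := sin (X x) * (x.2 - t) in
    cv v gv false false x = - (d * cos (Th x)) - p * sin (Th x) /\
    cv v gv false true x = - (d * sin (Th x)) + p * cos (Th x) &
  forall x, KR L x ->
    let m := - (L / 2 * (cos (Y x) * cos (X x) + sin (X x))) in let n := - (L / 2 * (sin (Y x) * cos (X x))) in
    cv v gv true false x = m * cos (Th x) - n * sin (Th x) /\
    cv v gv true true x = m * sin (Th x) + n * cos (Th x)].
Proof.
have [al [da [Cal da1 alin alout aly]]] := strip_profile.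
(* With this phase [w] is invariant under the magnetic translation by [L] in the first direction. *)
pose Ps (x : R * R) := L / 2 * x.2 + 2^-1 * (x.1 * x.2).
pose dPs (j : bool) (x : R * R) := if j then L / 2 + x.1 / 2 else x.2 / 2.
have CPs : C1 Ps dPs.
  have := C1D (C1M (C1_cst (L / 2)) (C1_proj R true)) (C1M (C1_cst 2^-1) (C1M (C1_proj R false) (C1_proj R true))).
  by move=> /C1_ext; apply; rewrite /dPs => -[] x /=; field.
pose tr (k : bool) t : R := if k then sin t else cos t.
pose tr' (k : bool) t : R := if k then cos t else - sin t.
have Ctr k : C1 (fun x => tr k (Ps x)) (fun j x => tr' k (Ps x) * dPs j x).
  case: k; first exact: (@C1_comp R sin cos _ _ (@is_derive_sin R) (@continuous_cos R) CPs).
  have csin (t : R) : {for t, continuous (fun t => - sin t)} by apply: cvgN; exact: continuous_sin.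
  exact: (@C1_comp R cos (fun t => - sin t) _ _ (@is_derive_cos R) csin CPs).
pose w k x := al x * tr k (Ps x).
pose gw j k x := al x * (tr' k (Ps x) * dPs j x) + da j x * tr k (Ps x).
have wg : H1loc_grad w gw by apply: C1_H1loc => k; exact: (C1M Cal (Ctr k)).
pose c0 := - (L / 2); pose L2 := 2 * L; have L20 : 0 < L2 by rewrite mulr_gt0.
have out x : ~~ (c0 - L2 / 2 <= co true x < c0 + L2 / 2) -> L <= `|x.2 + L / 2|.
  rewrite /c0 /L2 /co negb_and -!ltNge ler_normr -leNgt => /orP[h|h]; apply/orP; [right|left]; lra.
have sw : in_strip c0 L2 true w by move=> k x /out/alout[e _]; rewrite /w e mul0r.
have sg j : in_strip c0 L2 true (gw j).
  by move=> k x /out/alout[e e']; rewrite /gw e e' !mul0r addr0.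
pose v0 := ext c0 L2 true w; pose g0 := extg c0 L2 true w gw.
have vg0 : H1loc_grad v0 g0 by exact: H1loc_ext.
have LL1 : cos (L * L) = 1 by rewrite -expr2 LL mulr_natl cos2pi.
have LL2 : cos (L2 * L) = 1.
  have [+ _] := @cos_sin_mulz R (L * L) 2 LL1; rewrite /L2 -mulrA; congr (cos (_ * _) = _).
have w1 k x : mt (ev (~~ true) L) w k x = w k x.
  have alE : al (shift2 (opp2 (ev false L)) x) = al x by apply: aly; rewrite /shift2 /opp2 /ev /= subr0.
  have PsE : Ps x = ph (ev false L) x + Ps (shift2 (opp2 (ev false L)) x).
    by rewrite /Ps /ph /shift2 /opp2 /ev /=; field.
  by rewrite /mt /w /tr PsE /= alE cosD sinD; case: k; ring.
have v01 k x : mt (ev (~~ true) L) v0 k x = v0 k x by exact: ext_commute.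
pose v k x := v0 k x + mt (ev true L) v0 k x.
pose gv j k x := g0 j k x + mtg (ev true L) v0 g0 j k x.
have cvE j k x : cv v gv j k x = cv v0 g0 j k x + mt (ev true L) (cv v0 g0 j) k x.
  by rewrite -mt_cv /v /gv /cv; case: k; ring.
have v0K x : - (3 / 2 * L) < x.2 < L / 2 -> (forall k, v0 k x = w k x) /\ forall j k, g0 j k x = gw j k x.
  move=> /andP[h1 h2]; apply: ext_id => //; rewrite /c0 /L2 /co; apply/andP; split; lra.
have cwE (j k : bool) x : `|x.2 + L / 2| <= L -> cv w gw j k x =
    if j then (if k then - (L / 4 * cos (Y x)) * sin (Ps x) + (1 - sin (Y x)) / 2 * (L / 2) * cos (Ps x)
               else - (L / 4 * cos (Y x)) * cos (Ps x) - (1 - sin (Y x)) / 2 * (L / 2) * sin (Ps x))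
    else (1 - sin (Y x)) / 2 * x.2 * (if k then cos (Ps x) else - sin (Ps x)).
  move=> hx; have [e1 e2] := alin _ hx; rewrite /cv /gw /w /tr /tr' /dPs /A0.
  by case: k; case: j => /=; rewrite ?da1 ?e2 e1 -/(Y x); field.
pose y x := shift2 (opp2 (ev true L)) x.
(* As [L ^+ 2 = 2 * pi], a translation by [L] moves [Y] by [pi]; this gives the sign changes. *)
have yE x : [/\ (y x).1 = x.1, (y x).2 = x.2 - L, ph (ev true L) x + Ps (y x) = Ps x - 2 * X x - pi,
    sin (Y (y x)) = - sin (Y x) & cos (Y (y x)) = - cos (Y x)].
  rewrite /y /shift2 /opp2 /ev /Y /=.
  have e : L * (x.2 - L) / 2 = L * x.2 / 2 - pi by rewrite mulrBr -expr2 LL; field.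
  rewrite e sinB cosB sinpi cospi; split; [by rewrite subr0|by []| |by ring|by ring].
  have -> : pi = L ^+ 2 / 2 by rewrite LL; field.
  by rewrite /ph /Ps /X /=; field.
have PsT x : Ps x = Th x + X x by rewrite /Th /Y /X /Ps; field.
have inK x : KR L x -> [/\ `|x.2 + L / 2| <= L, `|(y x).2 + L / 2| <= L,
    - (3 / 2 * L) < x.2 < L / 2 & - (3 / 2 * L) < (y x).2 < L / 2].
  move=> Kx; have /andP[h1 h2] : - (L / 2) < x.2 < L / 2 by case: Kx => _; rewrite /= in_itv.
  have [_ -> _ _ _] := yE x.
  by split; rewrite ?ler_norml; apply/andP; split; move: L0 h1 h2; lra.
have mtE (f : bool -> R * R -> R) (A B : R) x : (forall k, f k (y x) = A * tr k (Ps (y x)) + B * tr' k (Ps (y x))) ->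
    forall k, mt (ev true L) f k x = - (A * tr k (Th x - X x) + B * tr' k (Th x - X x)).
  move=> fE k; have [_ _ e _ _] := yE x.
  have h (s t : R) : s + t = Th x - X x - pi ->
      cos s * cos t - sin s * sin t = - cos (Th x - X x) /\ sin s * cos t + cos s * sin t = - sin (Th x - X x).
    by move=> st; rewrite -cosD -sinD st sinB cosB sinpi cospi; split; ring.
  have e' : ph (ev true L) x + Ps (y x) = Th x - X x - pi by rewrite e PsT; ring.
  have [h1 h2] := h _ _ e'.
  rewrite /mt -/(y x) !fE /tr /tr'; move: h1 h2; set s := ph _ _; set t := Ps _ => h1 h2.
  case: k.
    transitivity (A * (sin s * cos t + cos s * sin t) + B * (cos s * cos t - sin s * sin t)); first by ring.
    by rewrite h1 h2; ring.
  transitivity (A * (cos s * cos t - sin s * sin t) - B * (sin s * cos t + cos s * sin t)); first by ring.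
  by rewrite h1 h2; ring.
exists v, gv; split.
- exact: H1locD vg0 (H1loc_mt _ vg0).
- apply/in_ERP => -[] k x.
    rewrite /v mtD mt_parallel addrC; congr (_ + _).
    by rewrite (_ : L + L = L2); [exact: ext_periodic|rewrite /L2; ring].
  rewrite /v mtD v01; congr (_ + _).
  have := @mt_commute R L L 1 true v0 k x LL1; rewrite mul1r => ->.
  by congr (mt _ _ _ _); apply/funext => k'; apply/funext => x'; exact: v01.
- move=> x Kx; have [h1 h2 h3 h4] := inK x Kx; have [e1 e2] := v0K x h3; have [e3 e4] := v0K _ h4.
  have [a1 _] := alin _ h1; have [a2 _] := alin _ h2; have [_ _ _ s1 s2] := yE x.
  have hy k : v0 k (y x) = (1 + sin (Y x)) / 2 * tr k (Ps (y x)) + 0 * tr' k (Ps (y x)).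
    by rewrite e3 /w a2 -/(Y (y x)) s1; ring.
  rewrite /v !e1 !(mtE _ _ _ _ hy).
  rewrite /w a1 -/(Y x) /tr /tr' PsT; move: (Th x) (X x) (Y x) => T X1 Y1; rewrite ![cos (T - _)]cosB ![sin (T - _)]sinB ![cos (T + _)]cosD ![sin (T + _)]sinD.
  by split; field.
- move=> x Kx t p d; have [h1 h2 h3 h4] := inK x Kx; have [e1 e2] := v0K x h3; have [e3 e4] := v0K _ h4.
  have [_ ys _ s1 s2] := yE x.
  have hy k : cv v0 g0 false k (y x) = 0 * tr k (Ps (y x)) + (1 + sin (Y x)) / 2 * (x.2 - L) * tr' k (Ps (y x)).
    rewrite (_ : cv v0 g0 false k (y x) = cv w gw false k (y x)); last by rewrite /cv !e3 !e4.
    by rewrite cwE// s1 ys /tr'; case: k; ring.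
  have cE k : cv v0 g0 false k x = cv w gw false k x by rewrite /cv !e1 !e2.
  rewrite !cvE !(mtE _ _ _ _ hy) !cE !cwE// /tr /tr' PsT /p /d /t; move: (Th x) (X x) (Y x) => T X1 Y1; rewrite ![cos (T - _)]cosB ![sin (T - _)]sinB ![cos (T + _)]cosD ![sin (T + _)]sinD.
  by split; field.
- move=> x Kx m n; have [h1 h2 h3 h4] := inK x Kx; have [e1 e2] := v0K x h3; have [e3 e4] := v0K _ h4.
  have [_ ys _ s1 s2] := yE x.
  have hy k : cv v0 g0 true k (y x) = L / 4 * cos (Y x) * tr k (Ps (y x)) + (1 + sin (Y x)) / 2 * (L / 2) * tr' k (Ps (y x)).
    rewrite (_ : cv v0 g0 true k (y x) = cv w gw true k (y x)); last by rewrite /cv !e3 !e4.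
    by rewrite cwE// s1 s2 /tr /tr'; case: k; ring.
  have cE k : cv v0 g0 true k x = cv w gw true k x by rewrite /cv !e1 !e2.
  rewrite !cvE !(mtE _ _ _ _ hy) !cE !cwE// /tr /tr' PsT /m /n; move: (Th x) (X x) (Y x) => T X1 Y1; rewrite ![cos (T - _)]cosB ![sin (T - _)]sinB ![cos (T + _)]cosD ![sin (T + _)]sinD.
  by split; field.
Qed.


(** [k] is the normalising factor, [p] the magnetic derivative of [v], and [dr] the derivative of
    [|v|^2]. The subtracted term is the variation of the modulus that the division removes. *)
Let normalization (k Q r vF vT pF pT dr : R) : k ^+ 2 * Q = 1 -> 0 < Q -> r <= Q ->
  vF ^+ 2 + vT ^+ 2 = r -> vF * pF + vT * pT = dr / 2 ->
  (k * pF + - (k ^+ 3 / 2) * dr * vF) ^+ 2 + (k * pT + - (k ^+ 3 / 2) * dr * vT) ^+ 2 <=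
  (pF ^+ 2 + pT ^+ 2) / Q - dr ^+ 2 / (4 * Q ^+ 2).
Proof.
move=> kQ Q0 rQ vv vp.
have k2 : k ^+ 2 = Q^-1 by rewrite -[RHS]mul1r -kQ mulfK ?gt_eqF.
have -> : (k * pF + - (k ^+ 3 / 2) * dr * vF) ^+ 2 + (k * pT + - (k ^+ 3 / 2) * dr * vT) ^+ 2 =
   k ^+ 2 * (pF ^+ 2 + pT ^+ 2) - (k ^+ 2) ^+ 2 * dr * (vF * pF + vT * pT) +
   (k ^+ 2) ^+ 3 / 4 * dr ^+ 2 * (vF ^+ 2 + vT ^+ 2) by field.
rewrite k2 vv vp.
have h : Q^-1 ^+ 3 / 4 * dr ^+ 2 * r <= Q^-1 ^+ 2 / 4 * dr ^+ 2.
  have -> : Q^-1 ^+ 2 / 4 * dr ^+ 2 = Q^-1 ^+ 3 / 4 * dr ^+ 2 * Q by field; rewrite gt_eqF.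
  by rewrite ler_wpM2l// mulr_ge0 ?sqr_ge0// divr_ge0// exprn_ge0// invr_ge0 ltW.
have -> : (pF ^+ 2 + pT ^+ 2) / Q - dr ^+ 2 / (4 * Q ^+ 2) =
  Q^-1 * (pF ^+ 2 + pT ^+ 2) - Q^-1 ^+ 2 * dr * (dr / 2) + Q^-1 ^+ 2 / 4 * dr ^+ 2.
  by field; rewrite gt_eqF.
by rewrite lerD2l.
Qed.

(** [r] is the modulus of the function. To leading order each of the two derivatives contributes
    [pi / 2]; the remaining terms carry a factor [|S|] or [|s * C|], both at most [r]. *)
Let kinetic (S C s c y r t : R) : C ^+ 2 + S ^+ 2 = 1 -> c ^+ 2 + s ^+ 2 = 1 -> 0 <= C -> `|y| <= L / 2 ->
  0 <= r -> r ^+ 2 = 1 - C ^+ 2 * c ^+ 2 ->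
  t = L / 2 * (1 + s) ->
  (C * (t - y * s)) ^+ 2 + (S * (y - t)) ^+ 2 +
  ((L / 2 * (c * C + S)) ^+ 2 + (L / 2 * (s * C)) ^+ 2) <= pi / 2 * (2 + 6 * r + 8 * r ^+ 2).
Proof.
move=> CS cs C0 yL r0 rE tE.
have rE' : r ^+ 2 = S ^+ 2 + s ^+ 2 * C ^+ 2.
  by rewrite rE -CS; transitivity (S ^+ 2 + C ^+ 2 * (1 - c ^+ 2)); [ring|rewrite -cs; ring].
have le1 (A B : R) : A ^+ 2 + B ^+ 2 = 1 -> `|A| <= 1.
  by move=> AB; rewrite -[leRHS]normr1 -ler_sqr ?nnegrE// !real_normK ?num_real// expr1n; have := sqr_ge0 B; lra.
have C1 : C <= 1 by apply: le_trans (ler_norm _) (le1 _ _ CS).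
have s1 : `|s| <= 1 by apply: (le1 s c); rewrite addrC.
have c1 : `|c| <= 1 by exact: (le1 c s).
have le_r (A : R) : A ^+ 2 <= r ^+ 2 -> `|A| <= r.
  by move=> h; rewrite -ler_sqr ?nnegrE// real_normK ?num_real.
have Sr : `|S| <= r by apply: le_r; rewrite rE' lerDl mulr_ge0 ?sqr_ge0.
have sCr : `|s * C| <= r by apply: le_r; rewrite rE' exprMn lerDr sqr_ge0.
have [z yE z1] : exists2 z, y = L / 2 * z & `|z| <= 1.
  exists (y / (L / 2)); first by rewrite mulrCA divff ?mulr1// gt_eqF// divr_gt0.
  by rewrite normrM normfV (ger0_norm (divr_ge0 (ltW L0) (ler0n _ _))) ler_pdivrMr ?mul1r// divr_gt0.
have L24 : pi / 2 = L / 2 * (L / 2) by rewrite mulrACA -expr2 LL; field.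
have -> : (C * (t - y * s)) ^+ 2 + (S * (y - t)) ^+ 2 + ((L / 2 * (c * C + S)) ^+ 2 + (L / 2 * (s * C)) ^+ 2) =
  pi / 2 * (C ^+ 2 * (1 + s * (1 - z)) ^+ 2 + S ^+ 2 * (z - 1 - s) ^+ 2 + ((c * C + S) ^+ 2 + s ^+ 2 * C ^+ 2)).
  by rewrite L24 tE yE; ring.
rewrite ler_wpM2l ?divr_ge0 ?pi_ge0//.
have D2 : (c * C + S) ^+ 2 + s ^+ 2 * C ^+ 2 <= 1 + 2 * r.
  have -> : (c * C + S) ^+ 2 + s ^+ 2 * C ^+ 2 = C ^+ 2 * (c ^+ 2 + s ^+ 2) + S ^+ 2 + 2 * (c * C * S) by ring.
  rewrite cs mulr1 CS lerD2l ler_wpM2l//; apply: le_trans (ler_norm _) _.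
  rewrite !normrM (ger0_norm C0) -[leRHS]mul1r ler_pM ?mulr_ge0//.
  by rewrite -[leRHS]mul1r ler_pM.
have D1 : C ^+ 2 * (1 + s * (1 - z)) ^+ 2 + S ^+ 2 * (z - 1 - s) ^+ 2 <= 1 + 4 * r + 8 * r ^+ 2.
  have h1 : (1 + s * (1 - z)) ^+ 2 <= (1 + 2 * `|s|) ^+ 2.
    rewrite -[leLHS]real_normK ?num_real// lerXn2r ?nnegrE ?addr_ge0 ?mulr_ge0//.
    apply: le_trans (ler_normD _ _) _; rewrite normr1 lerD2l normrM mulrC ler_wpM2r//.
    by apply: le_trans (ler_normB _ _) _; rewrite normr1; lra.
  have h2 : (z - 1 - s) ^+ 2 <= 9.
    have -> : 9 = 3 ^+ 2 :> R by ring.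
    rewrite -[leLHS]real_normK ?num_real// lerXn2r ?nnegrE//.
    apply: le_trans (ler_normB _ _) _; apply: le_trans (lerD (ler_normB _ _) (lexx _)) _.
    by rewrite normr1; lra.
  have {}h1 := ler_wpM2l (sqr_ge0 C) h1; have {}h2 := ler_wpM2l (sqr_ge0 S) h2.
  have e : C ^+ 2 * (1 + 2 * `|s|) ^+ 2 = C ^+ 2 + 4 * (C * (`|s| * C)) + 4 * (`|s| ^+ 2 * C ^+ 2) by ring.
  rewrite e (real_normK (num_real s)) in h1.
  have h3 : C * (`|s| * C) <= r.
    by move: sCr; rewrite normrM (ger0_norm C0) => h; rewrite -[leRHS]mul1r ler_pM ?mulr_ge0.
  have h4 : C ^+ 2 = 1 - S ^+ 2 by rewrite -CS; ring.
  have h5 : 0 <= s ^+ 2 * C ^+ 2 by rewrite mulr_ge0 ?sqr_ge0.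
  by rewrite rE'; move: h1 h2 h3 h4 h5; lra.
by lra.
Qed.

(** In units of [pi / 2] the kinetic part is about [2 / Q] and the gain of the normalisation about
    [1 / Q], so one [1 / Q] remains. Young's inequality splits [6 * r / Q] into [e / Q] and a
    constant depending on [e]. *)
Let energy_arith (r Q e D G : R) : 0 <= r -> Q = r ^+ 2 + b -> 0 < e ->
  D <= pi / 2 * (2 + 6 * r + 8 * r ^+ 2) -> pi / 2 * (r ^+ 2 * (1 - r ^+ 2) ^+ 2) <= G ->
  b * (D / Q - G / Q ^+ 2) + 2^-1 * (b / Q) ^+ 2 <=
  b * (pi / 2) * ((1 + e) / Q + 2 * (b / Q ^+ 2) + (9 / e + 10)).
Proof.
move=> r0 QE e0 hD hG.
have Q0 : 0 < Q by rewrite QE ltr_wpDl ?sqr_ge0.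
have q1 : r ^+ 2 / Q <= 1 by rewrite ler_pdivrMr// mul1r QE lerDl ltW.
have q0 : 0 <= r ^+ 2 / Q by rewrite divr_ge0 ?sqr_ge0// ltW.
have p2 : 0 < pi / 2 :> R by rewrite divr_gt0// pi_gt0.
have h6 : 6 * r / Q <= e / Q + 9 / e.
  have : 6 * r <= e + 9 / e * r ^+ 2.
    have : 0 <= (e - 3 * r) ^+ 2 / e by rewrite divr_ge0 ?sqr_ge0// ltW.
    have -> : (e - 3 * r) ^+ 2 / e = e - 6 * r + 9 / e * r ^+ 2 by field; rewrite gt_eqF.
    by lra.
  move=> h; apply: le_trans (_ : (e + 9 / e * r ^+ 2) / Q <= _); first by rewrite ler_wpM2r// invr_ge0 ltW.
  have -> : (e + 9 / e * r ^+ 2) / Q = e / Q + 9 / e * (r ^+ 2 / Q) by field; rewrite !gt_eqF.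
  by rewrite lerD2l ler_piMr// divr_ge0 ?ler0n// ltW.
have a1 : D / Q <= pi / 2 * (2 / Q + (e / Q + 9 / e) + 8).
  apply: le_trans (_ : pi / 2 * (2 + 6 * r + 8 * r ^+ 2) / Q <= _); first by rewrite ler_wpM2r// invr_ge0 ltW.
  rewrite -mulrA ler_wpM2l ?(ltW p2)//.
  have -> : (2 + 6 * r + 8 * r ^+ 2) / Q = 2 / Q + 6 * r / Q + 8 * (r ^+ 2 / Q) by field; rewrite gt_eqF.
  by move: h6 q1; lra.
have a2 : pi / 2 * (1 / Q - b / Q ^+ 2 - 2) <= G / Q ^+ 2.
  apply: le_trans (_ : pi / 2 * (r ^+ 2 * (1 - r ^+ 2) ^+ 2) / Q ^+ 2 <= _); last first.
    by rewrite ler_wpM2r// invr_ge0 sqr_ge0.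
  rewrite -[X in _ <= X]mulrA ler_wpM2l ?(ltW p2)//.
  have -> : 1 / Q - b / Q ^+ 2 = r ^+ 2 / Q ^+ 2.
    have -> : r ^+ 2 = Q - b by rewrite QE; ring.
    by field; rewrite gt_eqF.
  have -> : r ^+ 2 * (1 - r ^+ 2) ^+ 2 / Q ^+ 2 = r ^+ 2 / Q ^+ 2 - 2 * (r ^+ 2 / Q) ^+ 2 + r ^+ 2 / Q ^+ 2 * (r ^+ 2) ^+ 2.
    by field; rewrite gt_eqF.
  have : 0 <= r ^+ 2 / Q ^+ 2 * (r ^+ 2) ^+ 2 by rewrite mulr_ge0 ?sqr_ge0// divr_ge0 ?sqr_ge0.
  have : (r ^+ 2 / Q) ^+ 2 <= 1 by rewrite expr_le1.
  by lra.
have p1 : 1 <= pi :> R by have := pi_ge2 R; lra.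
have a3 : 2^-1 * (b / Q) ^+ 2 <= b * (pi / 2) * (b / Q ^+ 2).
  have -> : b * (pi / 2) * (b / Q ^+ 2) = pi * (2^-1 * (b / Q) ^+ 2) by field; rewrite gt_eqF.
  by rewrite ler_peMl// mulr_ge0 ?invr_ge0 ?sqr_ge0.
have a4 : b * (D / Q - G / Q ^+ 2) <= b * (pi / 2 * (2 / Q + (e / Q + 9 / e) + 8) - pi / 2 * (1 / Q - b / Q ^+ 2 - 2)).
  by rewrite ler_wpM2l ?(ltW b0)//; lra.
apply: le_trans (lerD a4 a3) _; rewrite le_eqVlt; apply/orP; left; apply/eqP; field.
by rewrite !gt_eqF.
Qed.

(** [1 / Q] will produce the logarithm; [b / Q ^+ 2] is the core, at distances of order sqrt b from
    the zero; the remaining term is constant. *)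
Lemma trial_state : exists u gu, [/\ H1loc_grad u gu, in_ER L u &
  forall x e Q, KR L x -> 0 < e -> Q = 1 - cos (L * x.1 / 2) ^+ 2 * cos (L * x.2 / 2) ^+ 2 + b ->
    GL_density b u gu x <= b * (pi / 2) * ((1 + e) / Q + 2 * (b / Q ^+ 2) + (9 / e + 10))].
Proof.
have [v [gv [vg vE v_ d1 d2]]] := quasi_periodic.
have CX : C1 X (fun j _ => L / 2 * (j == false)%:R).
  have -> : X = fun x => L / 2 * x.1 by apply/funext => x; rewrite /X; field.
  by apply: C1_ext (C1M (C1_cst (L / 2)) (C1_proj R false)) _ => j x /=; ring.
have CY : C1 Y (fun j _ => L / 2 * (j == true)%:R).
  have -> : Y = fun x => L / 2 * x.2 by apply/funext => x; rewrite /Y; field.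
  by apply: C1_ext (C1M (C1_cst (L / 2)) (C1_proj R true)) _ => j x /=; ring.
have csin (t : R) : {for t, continuous (fun t => - sin t)} by apply: cvgN; exact: continuous_sin.
have CcX := C1_comp (@is_derive_cos R) csin CX; have CcY := C1_comp (@is_derive_cos R) csin CY.
pose dq (j : bool) x := if j then L * cos (X x) ^+ 2 * cos (Y x) * sin (Y x)
  else L * cos (X x) * sin (X x) * cos (Y x) ^+ 2.
have Cq : C1 q dq.
  have -> : q = fun x => 1 + -1 * ((cos (X x) * cos (X x)) * (cos (Y x) * cos (Y x))).
    by apply/funext => x; rewrite /q; ring.
  have := C1D (C1_cst 1) (C1M (C1_cst (-1)) (C1M (C1M CcX CcX) (C1M CcY CcY))).
  by move=> /C1_ext; apply; rewrite /dq => -[] x /=; field.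
have q0 x : 0 <= q x.
  by rewrite subr_ge0 mulr_ile1 ?sqr_ge0// -(cos2Dsin2 (X x), cos2Dsin2 (Y x)).1 ?lerDl ?sqr_ge0// -(cos2Dsin2 (Y x)) lerDl sqr_ge0.
have qb x : 0 < q x + b by rewrite ltr_wpDl.
pose h (t : R) := (Num.sqrt (t + b))^-1; pose h' (t : R) := - (h t ^+ 3 / 2).
have hsq x : h (q x) ^+ 2 * (q x + b) = 1.
  by rewrite /h exprVn sqr_sqrtr ?(ltW (qb _))// mulVf ?gt_eqF.
have dh x : is_derive (q x) (1 : R) h (h' (q x)).
  have h3 : is_derive (q x) (1 : R) (fun t => t + b) 1.
    by apply: is_derive_eq (is_deriveD (is_derive_id (q x) (1 : R)) (is_derive_cst b (q x) (1 : R))) _; rewrite addr0.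
  have h4 := @is_derive1_comp R (@Num.sqrt R) (fun t => t + b) (q x) _ _ (is_derive1_sqrt (qb x)) h3.
  have sq0 : Num.sqrt (q x + b) != 0 by rewrite gt_eqF// sqrtr_gt0.
  have h5 : is_derive (q x) (1 : R) h _ := @is_deriveV R (fun t => Num.sqrt (t + b)) (q x) _ _ sq0 h4.
  apply: is_derive_eq h5 _.
  by rewrite /GRing.scale/= /h' /h; field.
have ch x : {for q x, continuous h}.
  by apply: differentiable_continuous; apply/derivable1_diffP; have [] := dh x.
have ch' x : {for q x, continuous h'}.
  rewrite /h'; apply: cvgN; apply: cvgM; last exact: cvg_cst.
  have c2 : (fun t => h t * h t) @ q x --> h (q x) * h (q x) by apply: cvgM; exact: ch.
  have -> : (fun t => h t ^+ 3) = (fun t => h t * (h t * h t)) by apply/funext => t; ring.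
  have -> : h (q x) ^+ 3 = h (q x) * (h (q x) * h (q x)) by ring.
  by apply: cvgM => //; exact: ch.
have Ck := C1_comp_at dh ch' Cq; have [ck cdk _ _] := Ck; have [hv [hg wd]] := vg.
pose u (k : bool) x := h (q x) * v k x.
pose gu (j k : bool) x := h (q x) * gv j k x + h' (q x) * dq j x * v k x.
exists u, gu; split.
- split; first by move=> k; exact: L2locM.
  split=> j k; first by apply: L2locD; [exact: L2locM|exact: (L2locM (cdk j))].
  by apply: (weak_derivM Ck); [exact: L2loc_L1loc..|exact: wd].
- have /in_ERP vP := vE; apply/in_ERP => j k x; rewrite /u -(vP j k x).
  have qE : q (shift2 (opp2 (ev j L)) x) = q x.
    have e t : cos (L * (t - L) / 2) ^+ 2 = cos (L * t / 2) ^+ 2.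
      have -> : L * (t - L) / 2 = L * t / 2 - pi by rewrite mulrBr -expr2 LL; field.
      by rewrite cosB sinpi cospi; ring.
    by rewrite /q /X /Y /shift2 /opp2 /ev; case: (j) => /=; rewrite ?oppr0 ?addr0 e.
  by rewrite /mt /= qE; case: k; ring.
move=> x e Q Kx e0 QE0; have QE : Q = q x + b by [].
have Q0 : 0 < Q by rewrite QE.
pose C := cos (X x); pose S := sin (X x); pose c := cos (Y x); pose s := sin (Y x).
pose E := cos (Th x); pose G := sin (Th x).
have CS : C ^+ 2 + S ^+ 2 = 1 := cos2Dsin2 _.
have cs : c ^+ 2 + s ^+ 2 = 1 := cos2Dsin2 _.
have EG : E ^+ 2 + G ^+ 2 = 1 := cos2Dsin2 _.
have sqE (A B : R) : (E ^+ 2 + G ^+ 2) * (A ^+ 2 + B ^+ 2) = A ^+ 2 + B ^+ 2 by rewrite EG mul1r.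
have qE : q x = S ^+ 2 + s ^+ 2 * C ^+ 2.
  rewrite /q -/C -/c -CS; transitivity (S ^+ 2 + C ^+ 2 * (1 - c ^+ 2)); first by ring.
  by rewrite -cs; ring.
have [v1 v2] := v_ x Kx.
have vv : v false x ^+ 2 + v true x ^+ 2 = q x.
  rewrite v1 v2 qE -/C -/S -/s -/E -/G; transitivity ((E ^+ 2 + G ^+ 2) * (S ^+ 2 + s ^+ 2 * C ^+ 2)); first by ring.
  by rewrite EG mul1r.
have [a1 a2] := d1 x Kx; have [a3 a4] := d2 x Kx.
set t := L / 2 * (1 + s).
pose P := C * (t - x.2 * s); pose D := S * (x.2 - t).
pose m := - (L / 2 * (c * C + S)); pose n := - (L / 2 * (s * C)).
have p1 : cv v gv false false x ^+ 2 + cv v gv false true x ^+ 2 = P ^+ 2 + D ^+ 2.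
  by rewrite a1 a2 -/C -/S -/s -/E -/G -/t -/P -/D -[RHS]sqE; ring.
have p2 : cv v gv true false x ^+ 2 + cv v gv true true x ^+ 2 = m ^+ 2 + n ^+ 2.
  by rewrite a3 a4 -/C -/S -/s -/c -/E -/G -/m -/n -[RHS]sqE; ring.
have i1 : v false x * cv v gv false false x + v true x * cv v gv false true x = dq false x / 2.
  rewrite a1 a2 v1 v2 /dq -/C -/S -/s -/c -/E -/G -/t -/P -/D.
  transitivity ((E ^+ 2 + G ^+ 2) * (s * C * D + S * P)); first by ring.
  rewrite EG mul1r /P /D /t; transitivity (L / 2 * (S * C * (1 - s ^+ 2))); first by field.
  have s2 : 1 - s ^+ 2 = c ^+ 2 by rewrite -cs; ring.
  by rewrite s2; field.
have i2 : v false x * cv v gv true false x + v true x * cv v gv true true x = dq true x / 2.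
  rewrite a3 a4 v1 v2 /dq -/C -/S -/s -/c -/E -/G -/m -/n.
  transitivity ((E ^+ 2 + G ^+ 2) * (S * n - s * C * m)); first by ring.
  by rewrite EG mul1r /m /n; field.
have qQ : q x <= Q by rewrite QE lerDl ltW.
have hQ : h (q x) ^+ 2 * Q = 1 by rewrite QE.
have k1 : cov2 u gu false x <= (P ^+ 2 + D ^+ 2) / Q - dq false x ^+ 2 / (4 * Q ^+ 2).
  rewrite -p1; apply: le_trans (normalization hQ Q0 qQ vv i1); rewrite le_eqVlt; apply/orP; left; apply/eqP.
  by rewrite /cov2 /u /gu /cv /h'; ring.
have k2 : cov2 u gu true x <= (m ^+ 2 + n ^+ 2) / Q - dq true x ^+ 2 / (4 * Q ^+ 2).
  rewrite -p2; apply: le_trans (normalization hQ Q0 qQ vv i2); rewrite le_eqVlt; apply/orP; left; apply/eqP.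
  by rewrite /cov2 /u /gu /cv /h'; ring.
pose r := Num.sqrt (q x).
have r2 : r ^+ 2 = q x by rewrite sqr_sqrtr.
have piL : L / 2 * (L / 2) = pi / 2 by rewrite mulrACA -expr2 LL; field.
have [b1 b2] := Kx; move: b1 b2; rewrite /= !in_itv/= => /andP[b1 b1'] /andP[b2 b2'].
(* In the cell [|X|] is at most [L ^+ 2 / 4 = pi / 2]. *)
have C0 : 0 <= C.
  have e1 : pi / 2 = L / 2 * (L / 2) by rewrite piL.
  have L20 : 0 < L / 2 by rewrite divr_gt0.
  apply: cos_ge0_pihalf; rewrite /X e1 (_ : L * x.1 / 2 = L / 2 * x.1); last by field.
  apply/andP; split.
    by rewrite -mulrN ler_wpM2l ?(ltW L20)// ltW.
  by rewrite ler_wpM2l ?(ltW L20)// ltW.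
have yL : `|x.2| <= L / 2 by rewrite ler_norml (ltW b2) (ltW b2').
have K := kinetic CS cs C0 yL (sqrtr_ge0 _) r2 (erefl t).
(* The gain: near the zero a quarter of the squared gradient of [q] is close to [pi / 2 * q]. *)
have W : pi / 2 * (r ^+ 2 * (1 - r ^+ 2) ^+ 2) <= (dq false x ^+ 2 + dq true x ^+ 2) / 4.
  have -> : (dq false x ^+ 2 + dq true x ^+ 2) / 4 = pi / 2 * (C ^+ 2 * c ^+ 2 * (S ^+ 2 * c ^+ 2 + C ^+ 2 * s ^+ 2)).
    by rewrite -piL /dq -/C -/S -/s -/c; field.
  have cc : 0 <= C ^+ 2 * c ^+ 2 by rewrite mulr_ge0 ?sqr_ge0.
  have -> : r ^+ 2 * (1 - r ^+ 2) ^+ 2 = C ^+ 2 * c ^+ 2 * (C ^+ 2 * c ^+ 2 * r ^+ 2).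
    by rewrite (_ : 1 - r ^+ 2 = C ^+ 2 * c ^+ 2) ?r2 /q -/C -/c; ring.
  rewrite ler_wpM2l ?divr_ge0 ?pi_ge0// ler_wpM2l// r2 qE mulrDr.
  have C2 : C ^+ 2 <= 1 by rewrite -CS lerDl sqr_ge0.
  have c2 : c ^+ 2 <= 1 by rewrite -cs lerDl sqr_ge0.
  apply: lerD.
    by rewrite mulrC ler_wpM2l ?sqr_ge0// -[leRHS]mul1r ler_wpM2r ?sqr_ge0.
  rewrite [C ^+ 2 * s ^+ 2]mulrC; apply: ler_piMl; first by rewrite mulr_ge0 ?sqr_ge0.
  exact: mulr_ile1 (sqr_ge0 _) (sqr_ge0 _) C2 c2.
have QE' : Q = r ^+ 2 + b by rewrite r2.
have := energy_arith (sqrtr_ge0 _) QE' e0 K W; apply: le_trans.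
rewrite GL_density_cov2.
have uu : 1 - (u false x ^+ 2 + u true x ^+ 2) = b / Q.
  have -> : u false x ^+ 2 + u true x ^+ 2 = h (q x) ^+ 2 * (v false x ^+ 2 + v true x ^+ 2) by rewrite /u; ring.
  rewrite vv; have -> : h (q x) ^+ 2 = Q^-1 by rewrite -[RHS]mul1r -hQ mulfK ?gt_eqF.
  have -> : q x = Q - b by rewrite QE; ring.
  by field; rewrite gt_eqF.
rewrite uu addrA lerD2r -mulrDr ler_wpM2l ?(ltW b0)//.
apply: le_trans (lerD k2 k1) _; rewrite le_eqVlt; apply/orP; left; apply/eqP.
by rewrite /m /n /P /D; field; rewrite gt_eqF.
Qed.

End fixed.
End trial_state.

(** * The energy of the trial function on one cell *)

Section upper_bound.
Variable R : realType.
Local Notation mu2 := (@leb2 R).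
Local Notation mu1 := (@lebesgue_measure R).
Local Notation T1 := (measurableTypeR R).
Local Notation T2 := (T1 * T1)%type.

(** For moduli up to 2 the cubic bound leaves a third of the linear term, hence the 9. *)
Lemma sin_sqr_bounds (x : R) : `|x| <= 2 ->
  [/\ x ^+ 2 / 9 <= sin x ^+ 2, sin x ^+ 2 <= x ^+ 2 & x ^+ 2 - x ^+ 4 / 3 <= sin x ^+ 2].
Proof.
move=> x2.
have sE : sin x ^+ 2 = sin `|x| ^+ 2 by have [h|h] := leP 0 x; [rewrite ger0_norm|rewrite ltr0_norm// sinN sqrrN].
have e2 : x ^+ 2 = `|x| ^+ 2 by rewrite real_normK ?num_real.
have e4 : x ^+ 4 = (`|x| ^+ 2) ^+ 2 by rewrite -e2; ring.
rewrite sE e2 e4; move: (normr_ge0 x) x2; move: `|x| => z z0 z2.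
have h1 := sin_ge_cubic z0; have h2 := sin_le_id z0.
have z4 : z ^+ 2 <= 4 by rewrite (_ : 4 = 2 ^+ 2 :> R); [rewrite lerXn2r ?nnegrE|ring].
have c0 : 0 <= 1 - z ^+ 2 / 6 by lra.
have c1 : z * (1 - z ^+ 2 / 6) <= sin z by apply: le_trans h1; rewrite le_eqVlt; apply/orP; left; apply/eqP; field.
have zc0 : 0 <= z * (1 - z ^+ 2 / 6) by rewrite mulr_ge0.
have s0 : 0 <= sin z by exact: le_trans c1.
have c2 : (z * (1 - z ^+ 2 / 6)) ^+ 2 <= sin z ^+ 2 by rewrite lerXn2r ?nnegrE.
have zz : 0 <= z ^+ 2 := sqr_ge0 z.
split; last 2 first.
- by rewrite lerXn2r ?nnegrE.
- apply: le_trans c2; have -> : (z * (1 - z ^+ 2 / 6)) ^+ 2 = z ^+ 2 - (z ^+ 2) ^+ 2 / 3 + z ^+ 2 * ((z ^+ 2) / 6) ^+ 2 by field.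
  by rewrite lerDl mulr_ge0 ?sqr_ge0.
apply: le_trans c2; rewrite exprMn ler_wpM2l//.
have -> : 9^-1 = (1 / 3) ^+ 2 :> R by field.
by rewrite lerXn2r ?nnegrE ?divr_ge0//; lra.
Qed.

(** [q] is comparable with [X ^+ 2 + Y ^+ 2] and agrees with it up to fourth order; therefore the
    inverses of both, shifted by [b], differ by a bounded amount. *)
Lemma vortex_profile (X Y : R) : `|X| <= 2 -> `|Y| <= 2 ->
  let q := 1 - cos X ^+ 2 * cos Y ^+ 2 in
  ((X ^+ 2 + Y ^+ 2) / 18 <= q) /\ (X ^+ 2 + Y ^+ 2 - q <= (X ^+ 2 + Y ^+ 2) ^+ 2).
Proof.
move=> hX hY q.
have [a1 a2 a3] := sin_sqr_bounds hX; have [b1 b2 b3] := sin_sqr_bounds hY.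
have qE : q = sin X ^+ 2 + sin Y ^+ 2 - sin X ^+ 2 * sin Y ^+ 2.
  have eX : cos X ^+ 2 = 1 - sin X ^+ 2 by rewrite -(cos2Dsin2 X); ring.
  have eY : cos Y ^+ 2 = 1 - sin Y ^+ 2 by rewrite -(cos2Dsin2 Y); ring.
  by rewrite /q eX eY; ring.
have s1 : sin X ^+ 2 <= 1 by rewrite -(cos2Dsin2 X) lerDr sqr_ge0.
have t1 : sin Y ^+ 2 <= 1 by rewrite -(cos2Dsin2 Y) lerDr sqr_ge0.
rewrite qE; move: a1 a2 a3 b1 b2 b3 s1 t1 (sqr_ge0 (sin X)) (sqr_ge0 (sin Y)) (sqr_ge0 X) (sqr_ge0 Y).
have -> : X ^+ 4 = (X ^+ 2) ^+ 2 by ring.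
have -> : Y ^+ 4 = (Y ^+ 2) ^+ 2 by ring.
move: (sin X ^+ 2) (sin Y ^+ 2) (X ^+ 2) (Y ^+ 2) => s t x y a1 a2 a3 b1 b2 b3 s1 t1 s0 t0 x0 y0.
have st : s * t <= s by rewrite ler_piMr.
have st' : s * t <= t by rewrite ler_piMl.
have xy : s * t <= x * y by apply: ler_pM.
split; first by lra.
have : 0 <= x * y by rewrite mulr_ge0.
have := sqr_ge0 x; have := sqr_ge0 y; have -> : (x + y) ^+ 2 = x ^+ 2 + y ^+ 2 + 2 * (x * y) by ring.
by lra.
Qed.

Let seg (h : R) : set R := `[- h, h].

Let mseg (h : R) : measurable (seg h : set T1). Proof. exact: measurable_itv. Qed.

Lemma integral_atan (k A h : R) : 0 < k -> 0 < A -> 0 < h ->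
  (\int[mu1]_(t in seg h) ((k ^+ 2 * t ^+ 2 + A ^+ 2)^-1)%:E <= (pi / (k * A))%:E)%E.
Proof.
move=> k0 A0 h0.
have D0 (t : R) : 0 < k ^+ 2 * t ^+ 2 + A ^+ 2 by rewrite ltr_wpDl ?exprn_gt0// mulr_ge0 ?sqr_ge0.
have dF (t : R) : is_derive t (1 : R) (fun t => (k * A)^-1 * atan (k / A * t)) ((k ^+ 2 * t ^+ 2 + A ^+ 2)^-1).
  have h3 : is_derive t (1 : R) (fun t => k / A * t) (k / A).
    apply: is_derive_eq (is_deriveM (is_derive_cst (k / A) t (1 : R)) (is_derive_id t (1 : R))) _.
    by rewrite /GRing.scale/= mulr0 addr0 mulr1.
  have h4 := @is_derive1_comp R (@atan R) (fun t => k / A * t) t _ _ (is_derive1_atan _) h3.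
  apply: is_derive_eq (is_deriveM (is_derive_cst ((k * A)^-1) t (1 : R)) h4) _.
  rewrite /GRing.scale/= mulr0 addr0.
  have e : 1 + (k / A * t) ^+ 2 = (k ^+ 2 * t ^+ 2 + A ^+ 2) / A ^+ 2 by field; rewrite gt_eqF.
  rewrite e; move: (D0 t); move: (_ + A ^+ 2) => d d0.
  by field; rewrite (gt_eqF k0) (gt_eqF A0) (gt_eqF d0).
have cf : continuous (fun t : R => (k ^+ 2 * t ^+ 2 + A ^+ 2)^-1).
  move=> t; apply: cvgV; first by rewrite gt_eqF.
  apply: cvgD; last exact: cvg_cst.
  by apply: cvgM; [exact: cvg_cst|apply: exprn_continuous].
rewrite (integral_is_derive _ cf dF); last by lra.
rewrite lee_fin -mulrBr mulrC ler_wpM2r ?invr_ge0 ?mulr_ge0 ?(ltW k0) ?(ltW A0)//.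
by have := atan_ltpi2 (k / A * h); have := atan_gtNpi2 (k / A * - h); lra.
Qed.

(** The primitive is the logarithmic form of the inverse hyperbolic sine; as [s] is even, the
    quotient of its end values is a square. *)
Lemma integral_asinh (k A h : R) : 0 < k -> 0 < A -> 0 < h ->
  (\int[mu1]_(t in seg h) ((Num.sqrt (k ^+ 2 * t ^+ 2 + A ^+ 2))^-1)%:E =
   (2 / k * ln ((k * h + Num.sqrt (k ^+ 2 * h ^+ 2 + A ^+ 2)) / A))%:E)%E.
Proof.
move=> k0 A0 h0; pose D (t : R) := k ^+ 2 * t ^+ 2 + A ^+ 2; pose s t := Num.sqrt (D t).
have D0 t : 0 < D t by rewrite ltr_wpDl ?exprn_gt0// mulr_ge0 ?sqr_ge0.
have s0 t : 0 < s t by rewrite sqrtr_gt0.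
have s2 t : s t ^+ 2 = D t by rewrite sqr_sqrtr ?(ltW (D0 t)).
have ks t : 0 < k * t + s t.
  have : `|k * t| < s t.
    rewrite -ltr_sqr ?nnegrE ?(ltW (s0 t))// real_normK ?num_real// s2 /D exprMn ltrDl exprn_gt0//.
  by rewrite ltr_norml => /andP[]; lra.
have dD t : is_derive t (1 : R) D (k ^+ 2 * (2 * t)).
  have d2 := is_deriveX 2 (is_derive_id t (1 : R)).
  have d3 := is_deriveM (is_derive_cst (k ^+ 2) t (1 : R)) d2.
  apply: is_derive_eq (is_deriveD d3 (is_derive_cst (A ^+ 2) t (1 : R))) _.
  by rewrite /GRing.scale/= mulr0 !addr0 expr1 mulr1.
have ds t : is_derive t (1 : R) s (k ^+ 2 * t / s t).
  apply: is_derive_eq (@is_derive1_comp R (@Num.sqrt R) D t _ _ (is_derive1_sqrt (D0 t)) (dD t)) _.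
  by rewrite -/(s t); field; rewrite gt_eqF.
have dF (t : R) : is_derive t (1 : R) (fun t => k^-1 * ln (k * t + s t)) (s t)^-1.
  have h3 : is_derive t (1 : R) (fun t => k * t) k.
    apply: is_derive_eq (is_deriveM (is_derive_cst k t (1 : R)) (is_derive_id t (1 : R))) _.
    by rewrite /GRing.scale/= mulr0 addr0 mulr1.
  have h4 := is_deriveD h3 (ds t).
  have h5 := @is_derive1_comp R (@ln R) (fun t => k * t + s t) t _ _ (is_derive1_ln (ks t)) h4.
  apply: is_derive_eq (is_deriveM (is_derive_cst (k^-1) t (1 : R)) h5) _.
  rewrite /GRing.scale/= mulr0 addr0.
  have e : k + k ^+ 2 * t / s t = k * (k * t + s t) / s t by field; rewrite gt_eqF.
  by rewrite e; field; rewrite !gt_eqF.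
have cs : continuous s := continuous_of_is_derive ds.
have cf : continuous (fun t : R => (s t)^-1).
  by move=> t; apply: cvgV; [rewrite gt_eqF|exact: cs].
rewrite (integral_is_derive _ cf dF); last by lra.
congr (_%:E); have sN : s (- h) = s h by rewrite /s /D sqrrN.
rewrite sN -mulrBr -ln_div ?posrE//; last by rewrite -sN.
have e : (k * h + s h) / (k * - h + s h) = ((k * h + s h) / A) ^+ 2.
  have p1 := ks (- h); rewrite sN in p1.
  have E : (k * - h + s h) * (k * h + s h) = A ^+ 2.
    by transitivity (s h ^+ 2 - k ^+ 2 * h ^+ 2); [ring|rewrite s2 /D; ring].
  by rewrite exprMn exprVn -E; field; rewrite !gt_eqF ?ks.
rewrite e lnXn ?divr_gt0// -[ln _ *+ 2]mulr_natl mulrA; congr (_ * _).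
by rewrite mulrC.
Qed.

Lemma KR_iterated (L : R) (F : R * R -> R) (G : R -> R) (B : R) : 0 < L ->
  measurable_fun [set: T2] F -> (forall x, 0 <= F x) -> continuous G -> (forall s, 0 <= G s) ->
  (forall s, (\int[mu1]_(t in seg (L / 2)) (F (s, t))%:E <= (G s)%:E)%E) ->
  (\int[mu1]_(s in seg (L / 2)) (G s)%:E <= B%:E)%E ->
  (\int[mu2]_(x in KR L) (F x)%:E <= B%:E)%E.
Proof.
move=> L0 mF F0 cG G0 inner outer.
have mi (D : set T1) : measurable D -> measurable_fun [set: T1] (\1_D : T1 -> R) by move=> mD; exact: measurable_indic.
have mI : measurable (seg (L / 2) : set T1) by exact: measurable_itv.
have mK := measurable_KR L.
have i0 (D : set R) t : 0 <= \1_D t :> R by rewrite indicE.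
rewrite integral_indicM2 leb2_tonelli; last 2 first.
- by apply/measurable_EFinP; apply: measurable_funM => //; exact: measurable_indic.
- by move=> p; rewrite lee_fin mulr_ge0// indicE.
apply: le_trans outer; rewrite integral_indicM.
have mFs s : measurable_fun [set: T1] (fun t => F (s, t)) by exact: (measurableT_comp mF (measurable_pair1 s)).
have K1 s t : \1_(KR L) (s, t) <= \1_(seg (L / 2)) s * \1_(seg (L / 2)) t :> R.
  rewrite [\1_(KR L) _]indicE; case: (boolP ((s, t) \in KR L)) => [|_]; last by rewrite mulr_ge0.
  rewrite inE => -[/=]; rewrite !in_itv/= => /andP[a1 a2] /andP[a3 a4].
  by rewrite !indicE !mem_set /seg /= ?in_itv/= ?mulr1// ?(ltW a1) ?(ltW a2) ?(ltW a3) ?(ltW a4).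
apply: ge0_le_integral => //.
- by move=> s _; apply: integral_ge0 => t _; rewrite lee_fin mulr_ge0// indicE.
- apply: (@measurable_fun_fubini_tonelli_F _ _ T1 T1 R mu1 (fun x => (\1_(KR L) x * F x)%:E)).
    by apply/measurable_EFinP; apply: measurable_funM => //; exact: measurable_indic.
  by move=> p; rewrite lee_fin mulr_ge0// indicE.
- apply/measurable_EFinP; apply: measurable_funM; last exact: mi.
  exact: continuous_measurable_fun.
- move=> s _; apply: le_trans (_ : (\1_(seg (L / 2)) s)%:E * (\int[mu1]_(t in seg (L / 2)) (F (s, t))%:E) <= _)%E; last first.
    by rewrite [G s * _]mulrC EFinM; apply: lee_wpmul2l; rewrite ?lee_fin.
  rewrite integral_indicM -ge0_integralZl//;
    try by [apply/measurable_EFinP; apply: measurable_funM => //; exact: mi|move=> t _; rewrite lee_fin mulr_ge0|rewrite lee_fin].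
  apply: ge0_le_integral => //.
  + by move=> t _; rewrite lee_fin mulr_ge0// indicE.
  + apply/measurable_EFinP; apply: measurable_funM => //.
    have mK1 : measurable_fun [set: T2] (\1_(KR L) : T2 -> R) by exact: measurable_indic.
    exact: (measurableT_comp mK1 (measurable_pair1 s)).
  + by apply: emeasurable_funM => //; apply/measurable_EFinP; apply: measurable_funM => //; exact: mi.
  + move=> t _; rewrite -EFinM lee_fin mulrCA mulrC ler_wpM2l//.
Qed.

Section fixed.
Variables (L b : R).
Hypothesis L1 : 1 <= L.
Hypothesis LL : L ^+ 2 = 2 * pi.
Hypothesis b0 : 0 < b.
Hypothesis b1 : b <= 1.

Let L0 : 0 < L. Proof. exact: lt_le_trans L1. Qed.
Let k := L / 2.
Let k0 : 0 < k. Proof. by rewrite divr_gt0. Qed.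
Let kk : k ^+ 2 = pi / 2. Proof. by rewrite /k exprMn LL; field. Qed.
Let sb0 : 0 < Num.sqrt b. Proof. by rewrite sqrtr_gt0. Qed.
Let sb2 : Num.sqrt b ^+ 2 = b. Proof. by rewrite sqr_sqrtr// ltW. Qed.
Let Q (x : R * R) := 1 - cos (L * x.1 / 2) ^+ 2 * cos (L * x.2 / 2) ^+ 2 + b.
(** One factor of a product that dominates the core density; its integral is bounded independently
    of [b]. *)
Let gb (t : R) := Num.sqrt b / 2 * ((k / 5) ^+ 2 * t ^+ 2 + (Num.sqrt b / 2) ^+ 2)^-1.

Let den0 (m A : R) (t : R) : 0 < A -> 0 < m ^+ 2 * t ^+ 2 + A ^+ 2.
Proof. by move=> A0; rewrite ltr_wpDl ?exprn_gt0// mulr_ge0 ?sqr_ge0. Qed.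

Let continuous_den (m A : R) : 0 < A -> continuous (fun t : R => (m ^+ 2 * t ^+ 2 + A ^+ 2)^-1).
Proof.
move=> A0 t; apply: cvgV; first by rewrite gt_eqF// den0.
apply: cvgD; last exact: cvg_cst.
by apply: cvgM; [exact: cvg_cst|apply: exprn_continuous].
Qed.

(** The variables of the core density are separated by [4 * (A * B) <= (A + B) ^+ 2] with
    [A + B <= Q x]; the [k / 5] is chosen since [1 / 25] is below [1 / 18]. *)
Let Q_bounds x : KR L x -> (Q x)^-1 <= (k ^+ 2 * x.2 ^+ 2 + (k ^+ 2 * x.1 ^+ 2 + b))^-1 + 18 /\
  b / Q x ^+ 2 <= gb x.1 * gb x.2.
Proof.
move=> [/=]; rewrite !in_itv/= -/k => h1 h2.
have k2 : k * k <= 2 by rewrite -expr2 kk; have := @pihalf_02_cos_pihalf R => -[/andP[]].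
have le2 t : - k < t < k -> `|L * t / 2| <= 2.
  move=> /andP[t1 t2]; have -> : L * t / 2 = k * t by rewrite /k; field.
  rewrite normrM (gtr0_norm k0); apply: le_trans k2; rewrite ler_wpM2l ?(ltW k0)//.
  by rewrite ler_norml (ltW t1) (ltW t2).
have [q1 q2] := vortex_profile (le2 _ h1) (le2 _ h2).
have e t : (L * t / 2) ^+ 2 = k ^+ 2 * t ^+ 2 by rewrite /k; field.
rewrite !e in q1 q2; set q := 1 - _ in q1 q2.
have QE : Q x = q + b by [].
set r := k ^+ 2 * x.1 ^+ 2 + k ^+ 2 * x.2 ^+ 2 in q1 q2.
have r0 : 0 <= r by rewrite addr_ge0// mulr_ge0 ?sqr_ge0.
have Q0 : 0 < Q x by rewrite QE ltr_wpDl// (le_trans _ q1)// divr_ge0.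
have rb : 0 < r + b by rewrite ltr_wpDl.
split.
  have -> : k ^+ 2 * x.2 ^+ 2 + (k ^+ 2 * x.1 ^+ 2 + b) = r + b by rewrite /r; ring.
  rewrite -[X in X <= _]mul1r ler_pdivrMr// mulrDl.
  have : Q x * (r + b) >= r ^+ 2 / 18.
    have -> : r ^+ 2 / 18 = r / 18 * r by ring.
    apply: ler_pM; [by rewrite divr_ge0|exact: r0|rewrite QE; move: q1 b0; lra|move: b0; lra].
  move=> h; have -> : (r + b)^-1 * Q x = Q x / (r + b) by rewrite mulrC.
  rewrite -(ler_pM2r rb) mul1r mulrDl divfK ?gt_eqF// -mulrA QE.
  by rewrite QE in h; move: h q2; lra.
set A := (k / 5) ^+ 2 * x.1 ^+ 2 + (Num.sqrt b / 2) ^+ 2.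
set B := (k / 5) ^+ 2 * x.2 ^+ 2 + (Num.sqrt b / 2) ^+ 2.
have sb20 : 0 < Num.sqrt b / 2 by rewrite divr_gt0.
have A0 : 0 < A by exact: den0. have B0 : 0 < B by exact: den0.
have AB : A + B <= Q x.
  have -> : A + B = r / 25 + Num.sqrt b ^+ 2 / 2 by rewrite /A /B /r; field.
  by rewrite sb2 QE; move: b0 q1 r0; lra.
have -> : gb x.1 * gb x.2 = b / (4 * (A * B)).
  by rewrite /gb -/A -/B -[X in _ = X / _]sb2; field; rewrite !gt_eqF.
rewrite ler_wpM2l ?(ltW b0)// lef_pV2 ?posrE ?mulr_gt0 ?exprn_gt0//.
apply: le_trans (_ : (A + B) ^+ 2 <= _); last by rewrite lerXn2r ?nnegrE ?(ltW Q0)// addr_ge0// ltW.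
have -> : (A + B) ^+ 2 = (A - B) ^+ 2 + 4 * (A * B) by ring.
by rewrite lerDr sqr_ge0.
Qed.

(** For [b <= 1] a bound for the argument of the logarithm in [integral_asinh], freed of its
    denominator sqrt b; note that [k ^+ 2 = pi / 2]. *)
Let c0 := pi / 2 + Num.sqrt ((pi / 2) ^+ 2 + 1) : R.

Let c0_gt0 : 0 < c0.
Proof. by rewrite ltr_wpDr ?sqrtr_ge0// divr_gt0// pi_gt0. Qed.

Let f1 (x : R * R) := (k ^+ 2 * x.2 ^+ 2 + (k ^+ 2 * x.1 ^+ 2 + b))^-1.

Let f1_den x : 0 < k ^+ 2 * x.2 ^+ 2 + (k ^+ 2 * x.1 ^+ 2 + b).
Proof. by apply: ltr_wpDl; [rewrite mulr_ge0 ?sqr_ge0|rewrite -sb2 den0]. Qed.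

Let mf1 : measurable_fun [set: T2] f1.
Proof.
apply: continuous_measurable2 => x; apply: cvgV; first by rewrite gt_eqF// f1_den.
have sq (p : R * R -> R) : continuous p -> (fun x => k ^+ 2 * p x ^+ 2) @ x --> k ^+ 2 * p x ^+ 2.
  move=> cp; apply: cvgM; first exact: cvg_cst.
  by apply: (@continuous_comp _ _ _ p (fun t => t ^+ 2)); [exact: cp|exact: exprn_continuous].
apply: cvgD; first by apply: sq => y; exact: cvg_snd.
by apply: cvgD; [apply: sq => y; exact: cvg_fst|exact: cvg_cst].
Qed.

Let gb_ge0 t : 0 <= gb t.
Proof. by rewrite mulr_ge0 ?divr_ge0 ?(ltW sb0)// invr_ge0 ltW// den0// divr_gt0. Qed.

Let continuous_gb : continuous gb.
Proof. by move=> t; apply: cvgM; [exact: cvg_cst|apply: continuous_den; rewrite divr_gt0]. Qed.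

Let mf2 : measurable_fun [set: T2] (fun x : T2 => gb x.1 * gb x.2).
Proof.
have mg := continuous_measurable_fun continuous_gb.
apply: measurable_funM; first by apply: (measurableT_comp mg); exact: measurable_fst.
by apply: (measurableT_comp mg); exact: measurable_snd.
Qed.

(** The inner integral is at most [pi / k] times an inverse square root, the outer one an inverse
    hyperbolic sine; [pi / k * (2 / k) = 4] is the coefficient of the logarithm. *)
Let int_log : (\int[mu2]_(x in KR L) ((k ^+ 2 * x.2 ^+ 2 + (k ^+ 2 * x.1 ^+ 2 + b))^-1)%:E <=
  (4 * (ln (Num.sqrt b)^-1 + ln c0))%:E)%E.
Proof.
pose A (s : R) := Num.sqrt (k ^+ 2 * s ^+ 2 + b).
have A0 s : 0 < A s by rewrite sqrtr_gt0 -sb2 den0.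
have A2 s : A s ^+ 2 = k ^+ 2 * s ^+ 2 + b by rewrite sqr_sqrtr// -sb2 ltW// den0.
have cA0 : continuous A.
  move=> s; apply: (@continuous_comp R R R (fun s => k ^+ 2 * s ^+ 2 + b) (@Num.sqrt R) s); last exact: sqrt_continuous.
  by apply: cvgD; [apply: cvgM; [exact: cvg_cst|exact: exprn_continuous]|exact: cvg_cst].
have cA : continuous (fun s => (A s)^-1) by move=> s; apply: cvgV; [rewrite gt_eqF|exact: cA0].
have mk := mseg k.
apply: (@KR_iterated L _ (fun s => pi / k * (A s)^-1)) => //.
- by move=> x; rewrite invr_ge0 -A2 ltW// den0.
- by move=> s; apply: cvgM; [exact: cvg_cst|exact: cA].
- by move=> s; apply: mulr_ge0; [exact: divr_ge0 (pi_ge0 R) (ltW k0)|rewrite invr_ge0 ltW].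
- move=> s /=; have := integral_atan k0 (A0 s) k0; rewrite -/k A2.
  by rewrite (_ : pi / (k * A s) = pi / k * (A s)^-1)//; field; rewrite !gt_eqF.
rewrite -/k (eq_integral (fun s : T1 => (pi / k)%:E * ((Num.sqrt (k ^+ 2 * s ^+ 2 + Num.sqrt b ^+ 2))^-1)%:E)%E); last first.
  by move=> s _; rewrite sb2 -EFinM.
have pk0 : 0 <= pi / k by rewrite divr_ge0 ?pi_ge0// ltW.
rewrite ge0_integralZl//; try by [apply: measurable_funTS; apply/measurable_EFinP; apply: continuous_measurable_fun; rewrite sb2; exact: cA|move=> s _; rewrite lee_fin invr_ge0 sqrtr_ge0].
rewrite integral_asinh// -EFinM lee_fin mulrA.
have -> : pi / k * (2 / k) = 4.
  have -> : pi = k ^+ 2 * 2 by rewrite kk; field.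
  by field; rewrite gt_eqF.
rewrite ler_wpM2l// ln_div ?posrE//; last by rewrite ltr_wpDr ?sqrtr_ge0// mulr_gt0.
rewrite lnV ?posrE// addrC lerD2l ler_ln ?posrE//; last by rewrite ltr_wpDr ?sqrtr_ge0// mulr_gt0.
rewrite /c0 -exprMn -!expr2 kk lerD2l ler_wsqrtr// lerD2l sb2//.
Qed.

Let int_core : (\int[mu2]_(x in KR L) (gb x.1 * gb x.2)%:E <= (50 * pi)%:E)%E.
Proof.
have mk := mseg k.
have sb20 : 0 < Num.sqrt b / 2 by rewrite divr_gt0.
have k5 : 0 < k / 5 by rewrite divr_gt0.
have g0 := gb_ge0; have cg := continuous_gb.
have mgE : measurable_fun [set: T1] (fun t => (gb t)%:E) by apply/measurable_EFinP; exact: continuous_measurable_fun.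
have int_g : (\int[mu1]_(t in seg k) (gb t)%:E <= (5 * pi / k)%:E)%E.
  rewrite (eq_integral (fun t : T1 => (Num.sqrt b / 2)%:E * (((k / 5) ^+ 2 * t ^+ 2 + (Num.sqrt b / 2) ^+ 2)^-1)%:E)%E); last first.
    by move=> t _; rewrite -EFinM.
  rewrite ge0_integralZl//; try by [apply: measurable_funTS; apply/measurable_EFinP; apply: continuous_measurable_fun; exact: continuous_den|move=> t _; rewrite lee_fin invr_ge0 ltW// den0|rewrite lee_fin ltW].
  apply: le_trans (lee_wpmul2l _ (integral_atan k5 sb20 k0)) _; first by rewrite lee_fin ltW.
  by rewrite -EFinM lee_fin le_eqVlt; apply/orP; left; apply/eqP; field; rewrite !gt_eqF.
have p5 : 0 <= 5 * pi / k by rewrite divr_ge0 ?mulr_ge0 ?pi_ge0// ltW.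
apply: (@KR_iterated L _ (fun s => gb s * (5 * pi / k))) => //.
- by move=> x; exact: mulr_ge0.
- by move=> s; apply: cvgM; [exact: cg|exact: cvg_cst].
- by move=> s; exact: mulr_ge0.
- move=> s /=; rewrite -/k; under eq_integral do rewrite EFinM.
  rewrite ge0_integralZl ?lee_fin//; last 2 first.
  + exact: measurable_funTS.
  + by move=> t _; rewrite lee_fin.
  by rewrite [leRHS]EFinM; apply: lee_wpmul2l; rewrite ?lee_fin.
rewrite -/k; under eq_integral do rewrite EFinM muleC.
rewrite ge0_integralZl ?lee_fin//; last 2 first.
- exact: measurable_funTS.
- by move=> t _; rewrite lee_fin.
apply: le_trans (lee_wpmul2l _ int_g) _; first by rewrite lee_fin.
rewrite -EFinM lee_fin le_eqVlt; apply/orP; left; apply/eqP.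
have -> : pi = k ^+ 2 * 2 by rewrite kk; field.
by field; rewrite gt_eqF.
Qed.

Lemma ep_upper e : 0 < e ->
  (ep b L <= (b * (pi / 2) * ((1 + e) * (4 * (ln (Num.sqrt b)^-1 + ln c0)) +
     (2 * (50 * pi) + ((1 + e) * 18 + (9 / e + 10)) * (2 * pi))))%:E)%E.
Proof.
move=> e0; have [u [gu [ug uE dens]]] := trial_state L1 LL b0.
apply: le_trans (ep_le b ug uE) _; rewrite /FKR.
have mK := measurable_KR L; set K := (1 + e) * 18 + _.
have e1 : 0 <= 1 + e by rewrite addr_ge0// ltW.
have K0 : 0 <= K by rewrite /K !addr_ge0 ?mulr_ge0 ?invr_ge0// ltW.
have bp0 : 0 <= b * (pi / 2) by rewrite mulr_ge0 ?divr_ge0 ?pi_ge0// ltW.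
have f10 x : 0 <= f1 x by rewrite invr_ge0 ltW// f1_den.
have f20 x : 0 <= gb x.1 * gb x.2 by rewrite mulr_ge0 ?gb_ge0.
have mr (f : T2 -> R) : measurable_fun setT f -> measurable_fun (KR L : set T2) (fun x => (f x)%:E).
  by move=> mf; apply: measurable_funTS; exact/measurable_EFinP.
have mZ (a : R) (f : T2 -> R) : measurable_fun setT f -> measurable_fun (KR L : set T2) (fun x => (a%:E * (f x)%:E)%E).
  by move=> mf; apply: emeasurable_funM => //; exact: mr.
have pZ (a : R) (f : T2 -> R) x : 0 <= a -> 0 <= f x -> (0 <= a%:E * (f x)%:E)%E.
  by move=> *; rewrite mule_ge0 ?lee_fin.
apply: (@le_trans _ _ (\int[mu2]_(x in KR L) ((b * (pi / 2))%:E *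
    ((1 + e)%:E * (f1 x)%:E + (2%:E * (gb x.1 * gb x.2)%:E + K%:E))))%E).
  apply: ge0_le_integral => //.
  - by move=> x _; rewrite lee_fin GL_density_ge0// ltW.
  - exact: mr (measurable_GL_density b ug).
  - apply: emeasurable_funM => //; apply: emeasurable_funD; first exact: (mZ _ f1 mf1).
    by apply: emeasurable_funD => //; exact: (mZ _ _ mf2).
  - move=> x Kx.
    change ((GL_density b u gu x)%:E <= (b * (pi / 2) * ((1 + e) * f1 x + (2 * (gb x.1 * gb x.2) + K)))%:E)%E.
    rewrite lee_fin.
    have [q1 q2] := Q_bounds Kx.
    apply: le_trans (dens x e (Q x) Kx e0 erefl) _; rewrite ler_wpM2l//.
    have := ler_wpM2l e1 q1; rewrite -/(f1 x) mulrDr /K; move: q2; lra.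
have mA : measurable_fun (KR L : set T2) (fun x : T2 => (2%:E * (gb x.1 * gb x.2)%:E + K%:E)%E).
  by apply: emeasurable_funD => //; exact: (mZ _ _ mf2).
have pA (x : T2) : (0 <= 2%:E * (gb x.1 * gb x.2)%:E + K%:E)%E.
  by apply: adde_ge0; [apply: (pZ 2 (fun y => gb y.1 * gb y.2))|rewrite lee_fin].
rewrite ge0_integralZl//; try by [apply: emeasurable_funD => //; exact: (mZ _ f1 mf1)|
  move=> x _; rewrite adde_ge0 ?pZ ?pA].
rewrite (EFinM (b * (pi / 2))); apply: lee_wpmul2l; first by rewrite lee_fin.
rewrite ge0_integralD//; try by [exact: (mZ _ f1 mf1)|move=> x _; rewrite ?pZ ?pA].
rewrite [leRHS]EFinD; apply: leeD.
  rewrite ge0_integralZl//; try by [exact: mr|move=> x _; rewrite lee_fin].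
  by rewrite [leRHS]EFinM; apply: lee_wpmul2l; [rewrite lee_fin|exact: int_log].
rewrite ge0_integralD//; try by [exact: (mZ _ _ mf2)|move=> x _; apply: (pZ 2 (fun y => gb y.1 * gb y.2))|move=> x _; rewrite lee_fin].
rewrite [leRHS]EFinD; apply: leeD.
  rewrite ge0_integralZl//; try by [exact: mr|move=> x _; rewrite lee_fin].
  by rewrite [leRHS]EFinM; apply: lee_wpmul2l; [rewrite lee_fin|exact: int_core].
by rewrite integral_KR_cst// LL.
Qed.

End fixed.
End upper_bound.

(** * Choice of the parameters and the asymptotics for small b *)

Section asymptotics.
Variable R : realType.

(** The factor lost to the background flux; the parameters must bring it close to 1. *)
Let den (delta beta : R) (Q : nat) : R :=
  1 + 2 * delta ^+ 2 * (2000 * (1 + ln Q%:R) * Q%:R ^+ 2 / beta ^+ 2) * 600.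

Let den_ge1 (delta beta : R) (Q : nat) : (1 < Q)%N -> 1 <= den delta beta Q.
Proof.
move=> Q1; have lnQ : 0 <= ln (Q%:R : R) by rewrite ln_ge0// ler1n ltnW.
rewrite /den lerDl; apply: mulr_ge0; last exact: ler0n.
apply: mulr_ge0; first by apply: mulr_ge0; [exact: ler0n|exact: sqr_ge0].
apply: mulr_ge0; last by rewrite invr_ge0 sqr_ge0.
apply: mulr_ge0; last exact: sqr_ge0.
by apply: mulr_ge0; [exact: ler0n|exact: (addr_ge0 ler01 lnQ)].
Qed.

Section fixed.
Variables (b delta eta beta : R) (Q : nat).
Hypothesis b0 : 0 < b.
Hypothesis delta0 : 0 < delta.
Hypothesis delta1 : delta <= 1.
Hypothesis eta01 : 0 < eta <= 1 / 4.
Hypothesis kapeta : 1 <= delta ^+ 2 / (8 * b) * eta ^+ 2.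
Hypothesis beta01 : 0 < beta <= 1.
Hypothesis betaeta : beta ^+ 2 <= eta / 300.
Hypothesis Q1 : (1 < Q)%N.

Let D := den delta beta Q.
Let m := (1 - 2 * eta) * (expR (- (beta / 4)) * ln (Q%:R : R)).
Let B := 200 * (1 + ln (Q%:R : R)) ^+ 2.

Let m0 : 0 <= m.
Proof.
have lnQ : 0 <= ln (Q%:R : R) by rewrite ln_ge0// ler1n ltnW.
by rewrite mulr_ge0 ?mulr_ge0 ?expR_ge0//; case/andP: eta01 => _ h; lra.
Qed.

Let B0 : 0 <= B. Proof. by apply: mulr_ge0; [exact: ler0n|exact: sqr_ge0]. Qed.
Let D1 : 1 <= D. Proof. exact: den_ge1. Qed.
Let D0 : 0 < D. Proof. exact: lt_le_trans D1. Qed.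

Let ep_ge (L : R) (N : nat) : N.+1%:R * delta < L ->
  m * (N%:R ^+ 2 * delta ^+ 2) - B * N.+2%:R <= D / b * fine (ep b L).
Proof.
move=> NL; have L0 : 0 < L by apply: le_lt_trans NL; rewrite mulr_ge0// ltW.
have fin := ep_fin (ltW b0) L0; have Db : 0 < D / b by rewrite divr_gt0.
rewrite -ler_pdivrMl// -lee_fin fineK//; apply: le_ereal_inf_tmp => _ [u [g [ug [_ ->]]]].
have H := FKR_ge ug b0 delta0 NL eta01 kapeta beta01 betaeta delta1 Q1.
by rewrite EFinM lee_pdivrMl.
Qed.

Let arith (L N : R) : 1 <= L -> 0 <= N -> (N + 1) * delta < L -> L <= (N + 3) * delta ->
  m - (6 * m + B * (delta^-1 + 2)) / L <= (m * (N ^+ 2 * delta ^+ 2) - B * (N + 2)) / L ^+ 2.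
Proof.
move=> L1 N0 h1 h2; have L0 : 0 < L by exact: lt_le_trans L1.
have L2 : 0 < L ^+ 2 by rewrite exprn_gt0.
rewrite ler_pdivlMr// mulrBl.
have -> : (6 * m + B * (delta^-1 + 2)) / L * L ^+ 2 = (6 * m + B * (delta^-1 + 2)) * L by rewrite expr2 mulrA divfK// gt_eqF.
have Nd : L ^+ 2 - 6 * L <= N ^+ 2 * delta ^+ 2.
  rewrite -exprMn.
  have a1 : L - 3 <= N * delta by move: delta1; lra.
  have [h|h] := leP L 3.
    apply: le_trans (sqr_ge0 _); rewrite expr2 -mulrBl mulr_le0_ge0 ?(ltW L0)//; lra.
  have a2 : (L - 3) ^+ 2 <= (N * delta) ^+ 2 by rewrite lerXn2r ?nnegrE//; lra.
  by apply: le_trans a2; rewrite sqrrB; lra.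
have N2 : N + 2 <= (delta^-1 + 2) * L.
  have : N <= L / delta by rewrite ler_pdivlMr//; move: delta0; lra.
  have : 2 * 1 <= 2 * L by rewrite ler_wpM2l.
  by rewrite mulrDl mulrC; lra.
have {}Nd := ler_wpM2l m0 Nd; have {}N2 := ler_wpM2l B0 N2.
by move: Nd N2; rewrite mulrBr !mulrDl; lra.
Qed.

(** With mesh, kernel and tolerances fixed, the boundary terms grow like [L] against [L ^+ 2] and
    disappear in the limit. *)
Lemma limit_ge l : (fun n => fine (ep b (Rn R n)) / Rn R n ^+ 2) @ \oo --> l ->
  b * m / D <= l.
Proof.
move=> al; pose C := 6 * m + B * (delta^-1 + 2).
have C0 : 0 <= C.
  apply: addr_ge0; first by apply: mulr_ge0; [exact: ler0n|exact: m0].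
  by apply: mulr_ge0; [exact: B0|rewrite addr_ge0// invr_ge0 ltW].
suff H (e : R) : 0 < e -> b / D * (m - e) <= l.
  have bD : 0 < b / D by rewrite divr_gt0.
  rewrite mulrAC; apply/ler_addgt0Pr => e e0.
  have E : b / D * (e / (b / D)) = e by rewrite mulrC divfK// gt_eqF.
  by have := H (e / (b / D)) ltac:(by rewrite divr_gt0); rewrite mulrBr E; lra.
move=> e0; rewrite -(cvg_lim _ al)//; apply: limr_ge; first by apply/cvg_ex; exists l.
pose A := Num.max (Num.max 1 (3 * delta)) (C / e).
have : \forall n \near \oo, A ^+ 2 <= n%:R by exact: nbhs_infty_ger.
apply: filterS => n /Rn_ge; set L := Rn R n; rewrite !ge_max => /andP[/andP[L1 L3] LC].
have L0 : 0 < L by exact: lt_le_trans L1.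
pose t := L / delta - 2; have t0 : 0 <= t by rewrite subr_ge0 ler_pdivlMr//; move: delta0; lra.
pose N := Num.trunc t; have /andP[p1 p2] := truncn_itv t0; rewrite -/N in p1 p2.
have h1 : (N%:R + 1) * delta < L.
  by move: p1; rewrite -ltr_pdivlMr// /t; lra.
have h2 : L <= (N%:R + 3) * delta.
  by move: p2; rewrite -ler_pdivrMr// /t -natr1; lra.
have NL : N.+1%:R * delta < L by rewrite -natr1.
have := ep_ge NL; rewrite (_ : N.+2%:R = N%:R + 2); last by rewrite -addn2 natrD.
have := arith L1 (ler0n _ N) h1 h2; rewrite -/C.
have CL : C / L <= e by rewrite ler_pdivrMr// mulrC -ler_pdivrMr.
set X := _ - B * _ => g1 g2.
have g3 : m - e <= X / L ^+ 2 by lra.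
have bD0 : 0 <= b / D by rewrite divr_ge0 ?ltW.
apply: le_trans (ler_wpM2l bD0 g3) _.
rewrite mulrA ler_wpM2r ?invr_ge0 ?sqr_ge0//.
have := ler_wpM2l bD0 g2; rewrite mulrA.
by rewrite (_ : b / D * (D / b) = 1) ?mul1r// mulrA divfK ?gt_eqF// divff// gt_eqF.
Qed.

End fixed.

(** [La] stands for [ln (Num.sqrt b)^-1], so [expR (- (2 * La))] is [b]. [Q] is about b to the power
    [- (1 - rho) / 2]: its logarithm is nearly [La], while in [b * ln Q * Q ^+ 2] a factor b to the
    power [rho] is left to beat the logarithm. *)
Let pick_Q (La rho : R) : 0 < rho < 1 -> 2 <= La -> 4 <= rho * La -> exists2 Q : nat, (1 < Q)%N &
  (1 - rho) * La <= ln (Q%:R : R) /\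
  expR (- (2 * La)) * ((1 + ln (Q%:R : R)) * Q%:R ^+ 2) <= 16 / (rho ^+ 2 * La).
Proof.
move=> /andP[r0 r1] La2 rLa; have La0 : 0 < La by lra.
pose E := expR ((1 - rho) * La); have E0 : 0 < E := expR_gt0 _.
have E1 : 1 <= E by rewrite -expR0 ler_expR mulr_ge0 ?(ltW La0)//; lra.
pose Q := (Num.trunc E).+1; have /andP[q1 q2] := truncn_itv (ltW E0).
have Q2 : Q%:R <= 2 * E by rewrite /Q -natr1; lra.
have Q0 : 0 < Q%:R :> R by rewrite ltr0n.
have Q1 : (1 < Q)%N by rewrite -(ltr_nat R); apply: le_lt_trans E1 _.
exists Q => //; split.
  by rewrite -[X in X <= _]expRK ler_ln ?posrE ?ltW.
have lnQ : ln (Q%:R : R) <= La.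
  rewrite -[leRHS]expRK ler_ln ?posrE ?expR_gt0//; apply: le_trans Q2 _.
  have -> : La = rho * La + (1 - rho) * La by ring.
  by rewrite expRD (ler_wpM2r (ltW E0))//; apply: le_trans (expR_ge1Dx _); lra.
have lnQ0 : 0 <= ln (Q%:R : R) by rewrite ln_ge0// ler1n ltnW.
have QQ : (1 + ln (Q%:R : R)) * Q%:R ^+ 2 <= 2 * La * (2 * E) ^+ 2.
  apply: ler_pM; [lra|exact: sqr_ge0|lra|].
  by rewrite lerXn2r ?nnegrE ?(ltW Q0)// mulr_ge0// ltW.
apply: le_trans (ler_wpM2l (expR_ge0 _) QQ) _.
have -> : expR (- (2 * La)) * (2 * La * (2 * E) ^+ 2) = 8 * La * (expR (- (2 * La)) * E ^+ 2) by ring.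
have -> : expR (- (2 * La)) * E ^+ 2 = (expR (rho * La) ^+ 2)^-1.
  rewrite /E expr2 -!expRD [in RHS]expr2 -expRD -expRN; congr expR; ring.
rewrite ler_pdivlMr ?mulr_gt0 ?exprn_gt0//.
have h : rho * La <= expR (rho * La) by apply: le_trans (expR_ge1Dx _); lra.
have h2 : (rho * La) ^+ 2 <= expR (rho * La) ^+ 2 by rewrite lerXn2r ?nnegrE ?expR_ge0//; lra.
have e0 : 0 < expR (rho * La) ^+ 2 by rewrite exprn_gt0// expR_gt0.
have rL0 : 0 < (rho * La) ^+ 2 by rewrite exprn_gt0// mulr_gt0.
have h3 : (expR (rho * La) ^+ 2)^-1 <= ((rho * La) ^+ 2)^-1 by rewrite lef_pV2 ?posrE.
have L8 : 0 <= 8 * La by rewrite mulr_ge0// ltW.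
apply: le_trans (_ : 8 * La * ((rho * La) ^+ 2)^-1 * (rho ^+ 2 * La) <= _).
  by apply: ler_wpM2r; [rewrite mulr_ge0 ?sqr_ge0 ?(ltW La0)|exact: ler_wpM2l].
have -> : 8 * La * ((rho * La) ^+ 2)^-1 * (rho ^+ 2 * La) = 8 by field; rewrite !gt_eqF.
by rewrite ler_nat.
Qed.

(** Repeated use of [(1 - p) * (1 - q) >= 1 - (p + q)]: the relative losses simply add up. *)
Let lower_arith (b La m D l eta beta rho x e : R) : 0 < b -> 0 < La -> 0 < D -> D <= 1 + x -> 0 <= x <= 1 ->
  0 <= eta <= 1 / 4 -> 0 <= beta <= 1 -> 0 <= rho <= 1 ->
  (1 - 2 * eta) * ((1 - beta / 4) * ((1 - rho) * La)) <= m -> b * m / D <= l ->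
  2 * eta + beta / 4 + rho + x <= e -> 1 - e <= l / (b * La).
Proof.
move=> b0 La0 D0 Dx /andP[x0 x1] /andP[h0 h1] /andP[be0 be1] /andP[r0 r1] hm hl he.
have w (p q : R) : 0 <= p <= 1 -> 0 <= q <= 1 -> 1 - (p + q) <= (1 - p) * (1 - q) /\ 0 <= (1 - p) * (1 - q) <= 1.
  move=> /andP[p0 p1] /andP[q0 q1].
  have pq : 0 <= p * q by rewrite mulr_ge0.
  by split; [nra|rewrite mulr_ge0 ?mulr_ile1 ?subr_ge0//=; lra].
have Dinv : 1 - x <= D^-1.
  rewrite -[X in _ <= X]mul1r ler_pdivlMr//.
  apply: le_trans (_ : (1 - x) * (1 + x) <= _); first by rewrite ler_wpM2l// subr_ge0.
  by have := sqr_ge0 x; nra.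
have [a1 a2] := w (2 * eta) (beta / 4) ltac:(lra) ltac:(lra).
have a3 : 0 <= 1 - (1 - 2 * eta) * (1 - beta / 4) <= 1 by move: a2; lra.
have [b1 b2] := w _ rho a3 ltac:(lra); rewrite opprB addrCA subrr addr0 in b1 b2.
have b3 : 0 <= 1 - (1 - 2 * eta) * (1 - beta / 4) * (1 - rho) <= 1 by move: b2; lra.
have [c1 _] := w _ x b3 ltac:(lra); rewrite opprB addrCA subrr addr0 in c1.
set P := (1 - 2 * eta) * (1 - beta / 4) * (1 - rho) in b1 b2 c1.
have P0 : 0 <= P by case/andP: b2.
have mP : P * La <= m by apply: le_trans hm; rewrite /P !mulrA.
have bL : 0 < b * La by rewrite mulr_gt0.
rewrite ler_pdivlMr//; apply: le_trans hl.
apply: le_trans (_ : b * (P * La) * (1 - x) <= _); last first.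
  apply: ler_pM; [by rewrite mulr_ge0 ?(ltW b0)// mulr_ge0// ltW|by rewrite subr_ge0|by rewrite ler_wpM2l ?(ltW b0)|exact: Dinv].
have -> : b * (P * La) * (1 - x) = P * (1 - x) * (b * La) by ring.
rewrite ler_wpM2r ?(ltW bL)//; move: a1 b1 c1; lra.
Qed.

(** [beta ^+ 2] is [eta ^+ 2 / 400], below [eta / 300], and the four losses take about 1/8, 1/1280,
    1/4 and 1/2 of [e]. *)
Let parameters (e eta beta rho x : R) : 0 < e <= 1 -> eta = e / 16 -> beta = eta / 20 -> rho = e / 4 -> x <= e / 2 ->
  [/\ 0 < eta <= 1 / 4, 0 < beta <= 1, beta ^+ 2 <= eta / 300, 0 < rho < 1 &
      [/\ 0 <= 1 - 2 * eta, 0 <= 1 - beta / 4, x <= 1 & 2 * eta + beta / 4 + rho + x <= e]].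
Proof.
move=> /andP[e0 e1] -> -> -> x1; split; [lra|lra| |lra|split; lra].
by rewrite expr2; nra.
Qed.

Let limit_bounds e : 0 < e <= 1 -> exists A, forall b l : R, 0 < b -> A <= ln (Num.sqrt b)^-1 ->
  (fun n => fine (ep b (Rn R n)) / Rn R n ^+ 2) @ \oo --> l -> l <= fine (ep b (Rn R 1)) / Rn R 1 ^+ 2 ->
  `|1 - l / (b * ln (Num.sqrt b)^-1)| <= e.
Proof.
move=> e01; have [e0 e1] := andP e01.
pose eta := e / 16; pose beta := eta / 20; pose rho := e / 4.
have eta0 : 0 < eta by rewrite divr_gt0.
have beta0 : 0 < beta by rewrite divr_gt0.
have rho0 : 0 < rho by rewrite divr_gt0.
pose G := 2 * 2000 * 600 * (8 / (eta ^+ 2 * beta ^+ 2)).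
have G0 : 0 <= G.
  apply: mulr_ge0; first by rewrite mulr_ge0 ?mulr_ge0 ?ler0n.
  by apply: divr_ge0; [exact: ler0n|rewrite mulr_ge0 ?sqr_ge0].
pose H := G * (16 / rho ^+ 2).
have H0 : 0 <= H by rewrite mulr_ge0// divr_ge0 ?ler0n ?sqr_ge0.
pose lc : R := ln (pi / 2 + Num.sqrt ((pi / 2) ^+ 2 + 1)).
pose K : R := 2 * (50 * pi) + ((1 + e / 2) * 18 + (9 / (e / 2) + 10)) * (2 * pi).
pose K2 := (1 + e / 2) * lc + K / 4.
(* The entries serve, in order: the two hypotheses of [pick_Q], a mesh of at most 1, a flux loss of
   at most [e / 2], and the bounded terms of the upper bound. *)
pose A := Num.max (Num.max 2 (4 / rho)) (Num.max (Num.max (8 / eta ^+ 2) (2 * H / e)) (K2 / (e / 2))).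
exists A => b l b0; set La := ln _; rewrite !ge_max => /andP[/andP[A1 A2] /andP[/andP[A3 A4] A5]] al l1.
have La0 : 0 < La by apply: lt_le_trans A1.
have sb0 : 0 < Num.sqrt b by rewrite sqrtr_gt0.
have bE : b = expR (- (2 * La)).
  by rewrite /La lnV ?posrE// mulrN opprK expRM_natl lnK ?posrE// sqr_sqrtr// ltW.
have b8 : 8 * b <= eta ^+ 2.
  rewrite bE expRN ler_pdivrMr ?expR_gt0// mulrC -ler_pdivrMr ?exprn_gt0//.
  by apply: le_trans A3 _; apply: le_trans (expR_ge1Dx _); lra.
have [eta01 beta01 betaeta rho1 [c2 be4 _ _]] := parameters e01 (erefl eta) (erefl beta) (erefl rho) (lexx _).
have eta1 : eta <= 1 by case/andP: eta01 => _ h; apply: le_trans h _; rewrite ler_pdivrMr ?mul1r// ler1n.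
have b1 : b <= 1.
  apply: le_trans (_ : 8 * b <= _); first by rewrite ler_peMl ?(ltW b0)// ler1n.
  by apply: le_trans b8 _; rewrite expr_le1// ltW.
have bLa : 0 < b * La by rewrite mulr_gt0.
rewrite ler_distl; apply/andP; split; last first.
  rewrite -lerBlDr.
  (* The smallest mesh allowed by [kapeta], which becomes an equality. *)
  pose delta := Num.sqrt (8 * b) / eta.
  have b80 : 0 < 8 * b by rewrite mulr_gt0.
  have d2 : delta ^+ 2 = 8 * b / eta ^+ 2 by rewrite exprMn exprVn sqr_sqrtr// ltW.
  have delta0 : 0 < delta by rewrite divr_gt0// sqrtr_gt0.
  have delta1 : delta <= 1.
    by rewrite -(expr_le1 (n := 2))// ?(ltW delta0)// d2 ler_pdivrMr ?exprn_gt0// mul1r.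
  have kap : 1 <= delta ^+ 2 / (8 * b) * eta ^+ 2.
    by rewrite d2 le_eqVlt; apply/orP; left; apply/eqP; field; rewrite !gt_eqF.
  have rLa : 4 <= rho * La by rewrite mulrC -ler_pdivrMr.
  have [Q Q1 [q1 q2]] := pick_Q rho1 A1 rLa; rewrite -bE in q2.
  have low := limit_ge b0 delta0 delta1 eta01 kap beta01 betaeta Q1 al.
  have D0 := lt_le_trans ltr01 (den_ge1 delta beta Q1).
  have DE : den delta beta Q <= 1 + H / La.
    rewrite /den lerD2l d2.
    have -> : 2 * (8 * b / eta ^+ 2) * (2000 * (1 + ln Q%:R) * Q%:R ^+ 2 / beta ^+ 2) * 600 =
      G * (b * ((1 + ln Q%:R) * Q%:R ^+ 2)) by rewrite /G; field; rewrite !gt_eqF.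
    have -> : H / La = G * (16 / (rho ^+ 2 * La)) by rewrite /H; field; rewrite !gt_eqF.
    by rewrite ler_wpM2l.
  have x01 : 0 <= H / La <= e / 2.
    rewrite divr_ge0 ?(ltW La0)//= ler_pdivrMr// mulrC -ler_pdivrMr ?divr_gt0//.
    by apply: le_trans A4; rewrite le_eqVlt; apply/orP; left; apply/eqP; field; rewrite gt_eqF.
  have [x0 x1] := andP x01.
  have [_ _ _ _ [_ _ xle1 sum_le]] := parameters e01 (erefl eta) (erefl beta) (erefl rho) x1.
  have exb : 1 - beta / 4 <= expR (- (beta / 4)) by exact: expR_ge1Dx.
  apply: (@lower_arith b La _ _ l eta beta rho (H / La) e b0 La0 D0 DE _ _ _ _ _ low).
  - by rewrite x0.
  - by rewrite (ltW eta0); case/andP: eta01.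
  - by rewrite (ltW beta0); case/andP: beta01.
  - by rewrite (ltW rho0) ltW//; case/andP: rho1.
  - rewrite ler_wpM2l//.
    have r4 : 0 <= (1 - rho) * La by rewrite mulr_ge0 ?(ltW La0)// subr_ge0 ltW//; case/andP: rho1.
    by apply: ler_pM.
  - exact: sum_le.
rewrite lerBlDr.
have R1 : 1 <= Rn R 1 by exact: Rn_ge1.
have R2 : Rn R 1 ^+ 2 = 2 * pi by rewrite Rn_sqr mulr1.
have e20 : 0 < e / 2 by rewrite divr_gt0.
have up := ep_upper R1 R2 b0 b1 e20.
rewrite -/La -/lc -/K -(fineK (ep_fin (ltW b0) (lt_le_trans ltr01 R1))) lee_fin in up.
have p0 : 0 < 2 * pi :> R by rewrite mulr_gt0// pi_gt0.
rewrite ler_pdivrMr//; apply: le_trans l1 _; rewrite R2 ler_pdivrMr//; apply: le_trans up _.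
have K2La : K2 <= e / 2 * La by rewrite mulrC -ler_pdivrMr.
have -> : b * (pi / 2) * ((1 + e / 2) * (4 * (La + lc)) + K) = 2 * pi * b * ((1 + e / 2) * La + K2).
  by rewrite /K2; field.
have -> : (1 + e) * (b * La) * (2 * pi) = 2 * pi * b * ((1 + e / 2) * La + e / 2 * La) by field.
by rewrite ler_wpM2l ?mulr_ge0 ?(ltW b0) ?pi_ge0// lerD2l.
Qed.

Lemma fGL_equivalent :
  (fun b : R => fGL b / (b / 2 * ln (Num.sqrt b)^-1)) @ 0^'+ --> (1 : R).
Proof.
apply/cvgrPdist_le => e e0; pose e' := Num.min e 1.
have e'01 : 0 < e' <= 1 by rewrite lt_min e0 ltr01 ge_min lexx orbT.
have [A hA] := limit_bounds e'01; near=> b.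
have b0 : 0 < b by near: b; exact: nbhs_right_gt.
have b1 : b <= 1 by near: b; apply: nbhs_right_le; exact: ltr01.
have bA : b <= expR (- (2 * A)) by near: b; apply: nbhs_right_le; exact: expR_gt0.
have sb0 : 0 < Num.sqrt b by rewrite sqrtr_gt0.
have LaA : A <= ln (Num.sqrt b)^-1.
  rewrite lnV ?posrE// lerNr -ler_expR lnK ?posrE// -ler_sqr ?nnegrE ?(ltW sb0) ?expR_ge0//.
  by rewrite sqr_sqrtr ?(ltW b0)// -expRM_natl mulrN.
have [|l al l1] := ep_limit (b := b); first by rewrite b0.
have := hA b l b0 LaA al l1; rewrite /fGL (cvg_lim _ al)//.
have -> : 2^-1 * l / (b / 2 * ln (Num.sqrt b)^-1) = l / (b * ln (Num.sqrt b)^-1).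
  by rewrite (mulrAC b) [2^-1 * l]mulrC -mulf_div divff ?mulr1// invr_neq0// pnatr_eq0.
by move=> h; apply: le_trans h _; rewrite ge_min lexx.
Unshelve. all: by end_near. Qed.

End asymptotics.

Theorem theorem2p4 (R : realType) :
  (fun b : R => fGL b / (b / 2 * ln (Num.sqrt b)^-1)) @ 0^'+ --> (1 : R).
Proof. exact: fGL_equivalent. Qed.
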